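(* Under the $N$-soliton condensate scattering data assumption (recalled in the context), for every compact set $\mathfrak K\subset\mathbb R^2$ there are $N_0$ and a constant $c_0$ such that for all $N>N_0$ and all $(x,t)\in\mathfrak K$, $$\left|\psi_N(x,t)-\psi_{SG}(x,t;N)\right|\le\frac{c_0}{N}.$$
   Context: **Data ($N$-soliton condensate scattering data assumption).** Fix $a,b>0$ and put $A=a+ib$. Let $\eta_1$ be the segment from $A$ to $-\overline A=-a+ib$ (oriented right to left) and $\eta_2$ the segment from $-A=-a-ib$ to $\overline A=a-ib$ (oriented left to right). Let $\mathcal U$ be a neighborhood of the closed region bounded by $\eta_1$ and the arc in the upper half-plane of the circle $|z|=|A|$ joining $A$ to $-\overline A$. The function $\rho$ is analytic in $\mathcal U$ and in its complex conjugate $\overline{\mathcal U}$, with $\rho(s+ib)>0$ for $s\in(-a,a)$, $\int_{-a}^a\rho(s+ib)\,ds=1$, $\rho(\overline z)=\overline{\rho(z)}$. The eigenvalues $\lambda_1,\dots,\lambda_N\in\eta_1$ satisfy $\int_{-a}^{\operatorname{Re}\lambda_j}\rho(s+ib)\,ds=\frac{2j-1}{2N}$, $\operatorname{Im}\lambda_j=b$. The function $h$ is analytic in $\mathcal U$ and $\overline{\mathcal U}$, $h(\overline z)=\overline{h(z)}$, $h\neq0$ on $\eta_1\cup\eta_2$, and the norming constants are $c_j=h(\lambda_j)$. $\Gamma_1\subset\mathbb C_+$ is a simple closed analytic curve encircling $\eta_1$, $\Gamma_2\subset\mathbb C_-$ is its complex conjugate; both are oriented clockwise. **Conventions.** $\theta(z)=\theta(z;x,t)=zx+z^2t$.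 On $\Gamma_1,\Gamma_2$ subscripts $+$ and $-$ denote boundary values from the exterior and the interior respectively. **$\psi_N$.** Let $A_N(z)=A_N(z;x,t)$ be the unique $2\times2$ matrix function analytic in $\mathbb C\setminus(\Gamma_1\cup\Gamma_2)$, $A_N(z)=I+\mathcal O(1/z)$ as $z\to\infty$, with $A_{N,+}=A_{N,-}J_{A_N}$, $$J_{A_N}(z)=\begin{pmatrix}1&0\\ \sum_{j=1}^N\frac{c_j}{z-\lambda_j}e^{2i\theta(\lambda_j)}&1\end{pmatrix}\ (z\in\Gamma_1),\qquad J_{A_N}(z)=\begin{pmatrix}1&-\sum_{j=1}^N\frac{\overline{c_j}}{z-\overline{\lambda_j}}e^{-2i\theta(\overline{\lambda_j})}\\0&1\end{pmatrix}\ (z\in\Gamma_2).$$ $\psi_N(x,t)=\lim_{z\to\infty}2iz\,(A_N)_{12}(z)$ is the $N$-soliton solution of the focusing NLS equation $i\partial_t\psi=-\frac12\partial_x^2\psi-|\psi|^2\psi$ with reflection coefficient $0$, eigenvalues $\lambda_j$ and norming constants $c_j$. **$\psi_{SG}$.** Let $\tilde A(z)=\tilde A(z;x,t,N)$ be the unique $2\times2$ matrix function analytic in $\mathbb C\setminus(\Gamma_1\cup\Gamma_2)$, $\tilde A(z)=I+\mathcal O(1/z)$ as $z\to\infty$, with $\tilde A_+=\tilde A_-J_{\tilde A}$, $$J_{\tilde A}(z)=\begin{pmatrix}1&0\\ N\int_{\eta_1}\frac{h(\lambda)\rho(\lambda)e^{2i\theta(\lambda)}}{\lambda-z}d\lambda&1\end{pmatrix}\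 (z\in\Gamma_1),\qquad J_{\tilde A}(z)=\begin{pmatrix}1&N\int_{\eta_2}\frac{h(\lambda)\rho(\lambda)e^{-2i\theta(\lambda)}}{\lambda-z}d\lambda\\0&1\end{pmatrix}\ (z\in\Gamma_2).$$ Then $\psi_{SG}(x,t;N)=\lim_{z\to\infty}2iz\,\tilde A_{12}(z)$. *)

(* Defs.v *)
From Stdlib Require Import Reals List.
From Coquelicot Require Import Coquelicot.

Open Scope R_scope.
Open Scope C_scope.

Definition Cexp (z : C) : C :=
  (exp (Re z) * cos (Im z), exp (Re z) * sin (Im z))%R.

Definition holomorphic_on (D : C -> Prop) (f : C -> C) : Prop :=
  forall z : C, D z -> ex_derive (K := C_AbsRing) (V := C_NormedModule) f z.

Definition conj_set (D : C -> Prop) : C -> Prop := fun z => D (Cconj z).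

Definition C_infty : (C -> Prop) -> Prop :=
  fun P => exists M : R, forall z : C, (M < Cmod z)%R -> P z.

Definition compact_set {T : UniformSpace} (K : T -> Prop) : Prop :=
  forall (I : Type) (O : I -> T -> Prop),
    (forall i, open (O i)) ->
    (forall x, K x -> exists i, O i x) ->
    exists l : list I, forall x, K x -> exists i, In i l /\ O i x.

Definition segment_path (p q : C) (s : R) : C := p + s * (q - p).

Definition on_segment (p q z : C) : Prop :=
  exists s : R, (0 <= s <= 1)%R /\ z = segment_path p q s.

Definition segment_integral (f : C -> C) (p q : C) : C :=
  RInt (V := C_R_CompleteNormedModule)
    (fun s : R => f (segment_path p q s) * (q - p)) 0 1.

(* Closed curves are 1-periodic maps R -> C.  "Analytic curve" has its usual
   meaning of a regular (nonvanishing velocity) real-analytic parametrization,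
   real-analyticity being extendability to a complex neighbourhood of R. *)
Definition curve_image (gamma : R -> C) : C -> Prop :=
  fun z => exists s : R, z = gamma s.

Definition simple_closed_analytic_curve (gamma : R -> C) : Prop :=
  (forall s : R, gamma (s + 1)%R = gamma s) /\
  (forall s s' : R, (0 <= s < 1)%R -> (0 <= s' < 1)%R ->
     gamma s = gamma s' -> s = s') /\
  (exists (V : C -> Prop) (g : C -> C),
     open (T := C_UniformSpace) V /\ (forall s : R, V (RtoC s)) /\
     holomorphic_on V g /\
     forall s : R, g (RtoC s) = gamma s /\ C_derive g (RtoC s) <> 0).

(* Conjugation reverses orientation, so the parameter is reversed in order
   that the conjugate of a clockwise curve is again clockwise. *)
Definition conj_curve (gamma : R -> C) : R -> C :=
  fun s => Cconj (gamma (- s)%R).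

Definition joined_in (D : C -> Prop) (z w : C) : Prop :=
  exists p : R -> C,
    (forall s : R, continuous (U := C_UniformSpace) p s) /\
    p 0%R = z /\ p 1%R = w /\
    forall s : R, (0 <= s <= 1)%R -> D (p s).

(* The bounded and the unbounded components of the complement of a closed
   curve with image G; components of an open set are path components. *)
Definition component_bounded (G : C -> Prop) (z : C) : Prop :=
  exists M : R, forall w : C,
    joined_in (fun u => ~ G u) z w -> (Cmod w <= M)%R.

Definition interior_of (G : C -> Prop) : C -> Prop :=
  fun z => ~ G z /\ component_bounded G z.

Definition exterior_of (G : C -> Prop) : C -> Prop :=
  fun z => ~ G z /\ ~ component_bounded G z.

Definition curve_velocity (gamma : R -> C) (s : R) : C :=
  (Derive (fun u => Re (gamma u)) s, Derive (fun u => Im (gamma u)) s).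

Definition winding_number (gamma : R -> C) (z : C) : C :=
  / (2 * PI * Ci) *
  RInt (V := C_R_CompleteNormedModule)
    (fun s : R => curve_velocity gamma s / (gamma s - z)) 0 1.

Definition clockwise (gamma : R -> C) : Prop :=
  forall z : C, interior_of (curve_image gamma) z ->
    winding_number gamma z = - 1.

(* Matrix entries are indexed from 0: the (1,2) entry of the text is
   [entry A 0 1]. *)
Definition M2 : Type := @matrix C 2 2.

Definition entry (A : M2) (i j : nat) : C := coeff_mat (RtoC 0) A i j.

Definition lower_unipotent (u : C) : M2 :=
  mk_matrix 2 2 (fun i j =>
    match i, j with
    | 0%nat, 0%nat => RtoC 1 | 0%nat, _ => RtoC 0
    | _, 0%nat => u          | _, _ => RtoC 1
    end).

Definition upper_unipotent (u : C) : M2 :=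
  mk_matrix 2 2 (fun i j =>
    match i, j with
    | 0%nat, 0%nat => RtoC 1 | 0%nat, _ => u
    | _, 0%nat => RtoC 0     | _, _ => RtoC 1
    end).

(* B is the limit of A at z from within D. *)
Definition boundary_value (A : C -> M2) (D : C -> Prop) (z : C) (B : M2)
    : Prop :=
  forall i j : nat, (i < 2)%nat -> (j < 2)%nat ->
    filterlim (fun w => entry (A w) i j)
      (within D (locally (T := C_UniformSpace) z))
      (locally (T := C_UniformSpace) (entry B i j)).

(* A_+ = A_- J on G, with + from the exterior and - from the interior. *)
Definition jump_on (G : C -> Prop) (J A : C -> M2) : Prop :=
  forall z : C, G z ->
    exists Aplus Aminus : M2,
      boundary_value A (exterior_of G) z Aplus /\
      boundary_value A (interior_of G) z Aminus /\
      Aplus = Mmult (T := C_Ring) Aminus (J z).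

Definition RHP_solution (G1 G2 : C -> Prop) (J1 J2 A : C -> M2) : Prop :=
  (forall i j : nat, (i < 2)%nat -> (j < 2)%nat ->
     holomorphic_on (fun z => ~ G1 z /\ ~ G2 z) (fun z => entry (A z) i j)) /\
  (exists M R0 : R, forall z : C, (R0 < Cmod z)%R ->
     forall i j : nat, (i < 2)%nat -> (j < 2)%nat ->
       (Cmod (entry (A z) i j - entry (Mone (T := C_Ring)) i j)
          <= M / Cmod z)%R) /\
  jump_on G1 J1 A /\ jump_on G2 J2 A.

(* psi = lim_{z -> oo} 2 i z A_12(z) for the solution A of the problem. *)
Definition RHP_potential (G1 G2 : C -> Prop) (J1 J2 : C -> M2) (psi : C)
    : Prop :=
  exists A : C -> M2,
    RHP_solution G1 G2 J1 J2 A /\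
    filterlim (fun z : C => 2 * Ci * z * entry (A z) 0 1)
      C_infty (locally (T := C_UniformSpace) psi).

Definition theta (z : C) (x t : R) : C := z * x + z * z * t.

Definition vertexA (a b : R) : C := (a, b).

Definition eta1 (a b : R) : C -> Prop :=
  on_segment (vertexA a b) (- Cconj (vertexA a b)).

Definition eta2 (a b : R) : C -> Prop :=
  on_segment (- vertexA a b) (Cconj (vertexA a b)).

(* The closed region between the chord eta1 and the arc above it of the
   circle |z| = |A|: a circular segment. *)
Definition cap_region (a b : R) : C -> Prop :=
  fun z => (b <= Im z)%R /\ (Cmod z <= Cmod (vertexA a b))%R.

(* [lambda N j] and [c N j], for 1 <= j <= N, are the eigenvalues and the
   norming constants of the N-soliton. *)
Record condensate_data (a b : R) (U : C -> Prop) (rho h : C -> C)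
    (lambda c : nat -> nat -> C) (gamma1 : R -> C) : Prop := {
  cd_a : (0 < a)%R;
  cd_b : (0 < b)%R;

  cd_U_open : open (T := C_UniformSpace) U;
  cd_U_nbhd : forall z, cap_region a b z -> U z;

  cd_rho_an : holomorphic_on U rho;
  cd_rho_an_conj : holomorphic_on (conj_set U) rho;
  cd_rho_pos : forall s : R, (- a < s < a)%R ->
    Im (rho (s, b)) = 0%R /\ (0 < Re (rho (s, b)))%R;
  cd_rho_int :
    RInt (V := C_R_CompleteNormedModule) (fun s : R => rho (s, b)) (- a)%R a
    = RtoC 1;
  cd_rho_conj : forall z, U z -> rho (Cconj z) = Cconj (rho z);

  cd_lambda_seg : forall N j : nat, (1 <= j <= N)%nat ->
    eta1 a b (lambda N j) /\ Im (lambda N j) = b;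
  cd_lambda_quantile : forall N j : nat, (1 <= j <= N)%nat ->
    RInt (V := C_R_CompleteNormedModule) (fun s : R => rho (s, b))
      (- a)%R (Re (lambda N j))
    = RtoC ((2 * INR j - 1) / (2 * INR N))%R;

  cd_h_an : holomorphic_on U h;
  cd_h_an_conj : holomorphic_on (conj_set U) h;
  cd_h_conj : forall z, U z -> h (Cconj z) = Cconj (h z);
  cd_h_nz : forall z, eta1 a b z \/ eta2 a b z -> h z <> 0;
  cd_c : forall N j : nat, (1 <= j <= N)%nat -> c N j = h (lambda N j);

  cd_gamma_curve : simple_closed_analytic_curve gamma1;
  cd_gamma_upper : forall s : R, (0 < Im (gamma1 s))%R;
  cd_gamma_encircles : forall z, eta1 a b z ->
    interior_of (curve_image gamma1) z;
  cd_gamma_clockwise : clockwise gamma1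
}.

Definition JN1 (lambda c : nat -> nat -> C) (N : nat) (x t : R) (z : C) : M2 :=
  lower_unipotent
    (sum_n_m (G := C_AbelianMonoid)
      (fun j => c N j / (z - lambda N j)
                * Cexp (2 * Ci * theta (lambda N j) x t)) 1 N).

Definition JN2 (lambda c : nat -> nat -> C) (N : nat) (x t : R) (z : C) : M2 :=
  upper_unipotent
    (- sum_n_m (G := C_AbelianMonoid)
      (fun j => Cconj (c N j) / (z - Cconj (lambda N j))
                * Cexp (- (2 * Ci * theta (Cconj (lambda N j)) x t))) 1 N).

Definition JSG1 (a b : R) (rho h : C -> C) (N : nat) (x t : R) (z : C) : M2 :=
  lower_unipotent
    (INR N * segment_integral
      (fun l => h l * rho l * Cexp (2 * Ci * theta l x t) / (l - z))
      (vertexA a b) (- Cconj (vertexA a b))).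

Definition JSG2 (a b : R) (rho h : C -> C) (N : nat) (x t : R) (z : C) : M2 :=
  upper_unipotent
    (INR N * segment_integral
      (fun l => h l * rho l * Cexp (- (2 * Ci * theta l x t)) / (l - z))
      (- vertexA a b) (Cconj (vertexA a b))).

Definition is_psiN (lambda c : nat -> nat -> C) (gamma1 : R -> C)
    (N : nat) (x t : R) (psi : C) : Prop :=
  RHP_potential (curve_image gamma1) (curve_image (conj_curve gamma1))
    (JN1 lambda c N x t) (JN2 lambda c N x t) psi.

Definition is_psiSG (a b : R) (rho h : C -> C) (gamma1 : R -> C)
    (N : nat) (x t : R) (psi : C) : Prop :=
  RHP_potential (curve_image gamma1) (curve_image (conj_curve gamma1))
    (JSG1 a b rho h N x t) (JSG2 a b rho h N x t) psi.

(* Main.v *)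
(* Both problems are reduced to rows (p, q) of their solutions. By the Schwarz symmetry |p|^2 + |q|^2 = 1 on the
   real line, hence |q| <= 1 in the upper half-plane, and a bilinear identity expresses psi_N - psi_SG
   through the quadrature errors, for the midpoint quantiles of rho, of h exp(2i theta) q_N q_S and of a conjugate analogue.
   As rho may vanish at the ends of the chord, the midpoint rule has error O(1/N) only if the product is small there.
   The Cauchy integral of h rho exp(2i theta) q over the chord is O(1/N) on the real line. Deforming the chord to the arc
   |z| = |A|, along which the reflection z -> |A|^2 / conj z exchanges the two sides, the maximum principle gives
   q = O(N^(-1/2)) on the arc up to a power of a Blaschke product, and a two-constants argument in a disc about each end,
   slit along the arc, turns this into q = O(N^(-1/2 + eps)) near the ends. *)
Require Import Defs.
From Stdlib Require Import Reals Lra Lia Ranalysis5 List ClassicalEpsilon FunctionalExtensionality PropExtensionality.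
From Coquelicot Require Import Coquelicot.

Open Scope R_scope.
Open Scope C_scope.

(** The jumps grow like N, and all bounds uniform in N come from the unitarity of a row on the real
    line. It makes the integrands of both quadrature errors bounded analytic functions, so their
    derivatives on the chord are bounded too. It also yields the O(1/N) on the real line: N times
    the Cauchy integral is, up to a bounded quadrature error, an entry of the row minus its value at
    infinity. The midpoint rule in the quantile variable involves the derivative of G' / rho, hence
    rho^(-2), which is eta^(-2 k) at distance eta from an end where rho vanishes to order k. With a
    product of entries of size N^(-1 + 2 eps) near the ends and eta = N^(-2 eps), the zone within
    eta of the ends contributes N^(-1 + 2 eps) eta = 1/N, and the rest is harmless if 4 eps k <= 1 -
    2 eps. As k is arbitrary, exponents arbitrarily close to 1/2 are required for q. The exponent
    1/2 comes from the arc: off finitely many points the continued integral phi jumps there by a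
    nonzero multiple of q, so the larger one-sided value of phi dominates q, while the maximum
    principle bounds a product of two such quantities by O(1/N). *)

Notation dec := excluded_middle_informative.

(** * Complex differentiability *)

Lemma Cmod_sub_sym (x y : C) : Cmod (x - y) = Cmod (y - x).
Proof. rewrite <- Cmod_opp; f_equal; ring. Qed.

Lemma Cmod_sub_diag (z : C) : Cmod (z - z) = 0%R.
Proof. replace (z - z) with (RtoC 0) by ring. apply Cmod_0. Qed.

Lemma pos_min4 x y z w : 0 < x -> 0 < y -> 0 < z -> 0 < w -> exists d, 0 < d /\ d <= x /\ d <= y /\ d <= z /\ d <= w.
Proof.
 exists (Rmin (Rmin x y) (Rmin z w)). split; [repeat apply Rmin_glb_lt; auto|]. assert (A := Rmin_l x y). assert (B := Rmin_r x y).
 assert (E := Rmin_l z w). assert (F := Rmin_r z w). assert (G := Rmin_l (Rmin x y) (Rmin z w)). assert (K := Rmin_r (Rmin x y) (Rmin z w)). lra.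
Qed.

Lemma Cmod_tri3 (x y z : C) : Cmod (x - z) <= Cmod (x - y) + Cmod (y - z).
Proof. replace (x - z) with ((x - y) + (y - z)) by ring; apply Cmod_triangle. Qed.

Lemma Cmod_tri_inv (x y : C) : Cmod x - Cmod y <= Cmod (x - y).
Proof. assert (H := Cmod_triangle (x - y) y). replace (x - y + y) with x in H by ring. lra. Qed.

Lemma Cmod_eq (z : C) : Cmod z = sqrt (Re z ^ 2 + Im z ^ 2).
Proof. reflexivity. Qed.

Lemma Cmod_sqr (z : C) : (Cmod z * Cmod z = Re z * Re z + Im z * Im z)%R.
Proof. rewrite Cmod_eq, sqrt_sqrt; [ring|nra]. Qed.

Lemma Rabs_Re_le (z : C) : Rabs (Re z) <= Cmod z.
Proof. apply Rsqr_incr_0_var; [|apply Cmod_ge_0]. unfold Rsqr; rewrite Cmod_sqr, <- Rabs_mult, Rabs_pos_eq; nra. Qed.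

Lemma Rabs_Im_le (z : C) : Rabs (Im z) <= Cmod z.
Proof. apply Rsqr_incr_0_var; [|apply Cmod_ge_0]. unfold Rsqr; rewrite Cmod_sqr, <- Rabs_mult, Rabs_pos_eq; nra. Qed.

Lemma Im_close z w : Im w - Cmod (z - w) <= Im z <= Im w + Cmod (z - w).
Proof.
 assert (A := Rabs_Im_le (z - w)). change (Im (z - w)) with (Im z - Im w)%R in A. assert (B := Rle_abs (Im z - Im w)).
 assert (B2 := Rle_abs (- (Im z - Im w))). rewrite Rabs_Ropp in B2. lra.
Qed.

Lemma Re_close z w : Re w - Cmod (z - w) <= Re z <= Re w + Cmod (z - w).
Proof.
 assert (A := Rabs_Re_le (z - w)). change (Re (z - w)) with (Re z - Re w)%R in A. assert (B := Rle_abs (Re z - Re w)).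
 assert (B2 := Rle_abs (- (Re z - Re w))). rewrite Rabs_Ropp in B2. lra.
Qed.

Lemma Cmod_le_Re_Im (z : C) : Cmod z <= Rabs (Re z) + Rabs (Im z).
Proof.
 apply Rsqr_incr_0_var; [|pose proof (Rabs_pos (Re z)); pose proof (Rabs_pos (Im z)); lra]. unfold Rsqr; rewrite Cmod_sqr.
 rewrite <- (Rabs_pos_eq (Re z * Re z)), <- (Rabs_pos_eq (Im z * Im z)), !Rabs_mult by nra.
 pose proof (Rabs_pos (Re z)); pose proof (Rabs_pos (Im z)); nra.
Qed.

Lemma Cmod_R (x : R) : Cmod (RtoC x) = Rabs x.
Proof. apply Cmod_R. Qed.

Lemma ball_C_iff (z w : C) (e : R) :
  ball (M := C_UniformSpace) z e w <->
  (Rabs (Re (w - z)) < e /\ Rabs (Im (w - z)) < e).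
Proof. split; intros [H1 H2]; split; assumption. Qed.

(** Balls of [C_UniformSpace] are open squares in the two coordinates, hence the factor 2 here and
    the separate converse inclusion. *)
Lemma ball_C_Cmod (z w : C) (e : R) :
  ball (M := C_UniformSpace) z e w -> Cmod (w - z) < 2 * e.
Proof. rewrite ball_C_iff; intros [H1 H2]. eapply Rle_lt_trans; [apply Cmod_le_Re_Im|lra]. Qed.

Lemma Cmod_ball_C (z w : C) (e : R) :
  (Cmod (w - z) < e) -> ball (M := C_UniformSpace) z e w.
Proof. intros H. apply ball_C_iff. assert (H1 := Rabs_Re_le (w - z)). assert (H2 := Rabs_Im_le (w - z)). lra. Qed.

Lemma locally_C (z : C) (P : C -> Prop) :
  locally (T := C_UniformSpace) z P <->
  exists d : R, 0 < d /\ forall w, Cmod (w - z) < d -> P w.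
Proof.
 split.
 - intros [d Hd]. exists d; split; [apply cond_pos|]. intros w Hw. apply Hd, Cmod_ball_C, Hw.
 - intros (d & Hd & H). exists (mkposreal (d/2) ltac:(lra)). intros w Hw. apply H. apply ball_C_Cmod in Hw. simpl in Hw. lra.
Qed.

Definition openC (D : C -> Prop) : Prop :=
  forall z, D z -> exists d : R, 0 < d /\ forall w, Cmod (w - z) < d -> D w.

Lemma open_openC (D : C -> Prop) : open (T := C_UniformSpace) D <-> openC D.
Proof. split; intros H z Hz; apply locally_C, H, Hz. Qed.

Definition ccont (f : C -> C) (z : C) : Prop :=
  forall e : R, 0 < e -> exists d : R, 0 < d /\
    forall w, Cmod (w - z) < d -> Cmod (f w - f z) < e.

(** The difference quotient is cleared of its denominator, so that w = z is allowed and the calculus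
    rules involve no division. *)
Definition cder (f : C -> C) (z l : C) : Prop :=
  forall e : R, 0 < e -> exists d : R, 0 < d /\
    forall w, Cmod (w - z) < d ->
      (Cmod (f w - f z - l * (w - z)) <= e * Cmod (w - z)).

Definition hol (D : C -> Prop) (f : C -> C) : Prop :=
  forall z, D z -> exists l, cder f z l.

Lemma is_derive_cder (f : C -> C) (z l : C) :
  is_derive (K := C_AbsRing) (V := C_NormedModule) f z l <-> cder f z l.
Proof.
 split.
 - intros [_ H] e He. destruct (H z (fun P HP => HP) (mkposreal e He)) as [d Hd]. exists d; split; [apply cond_pos|]. intros w Hw.
  rewrite (Cmult_comm l). auto.
 - split; [apply is_linear_scal_l|]. intros x Hx. assert (x = z) as ->.
  { symmetry. apply (is_filter_lim_locally_unique (V := AbsRing_NormedModule C_AbsRing)). exact Hx. }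
  intros e. destruct (H e (cond_pos e)) as (d & Hd & H'). exists (mkposreal d Hd). intros w Hw. specialize (H' w Hw). rewrite (Cmult_comm l) in H'.
  exact H'.
Qed.

Lemma is_derive_cder_ring (f : C -> C) (z l : C) :
  is_derive (K := C_AbsRing) (V := AbsRing_NormedModule C_AbsRing) f z l <-> cder f z l.
Proof. rewrite <- is_derive_cder. split; (intros [H1 H2]; split; [apply is_linear_scal_l|exact H2]). Qed.

(** One modulus of continuity for the product, shared by all the product rules for continuity and
    for limits. *)
Lemma mult_eps (a b : C) e : 0 < e -> exists e', 0 < e' /\
  forall u v, Cmod (u - a) < e' -> Cmod (v - b) < e' -> Cmod (u * v - a * b) < e.
Proof.
 pose proof (Cmod_ge_0 a). pose proof (Cmod_ge_0 b). set (M := (Cmod a + Cmod b + 1)%R). assert (HM : 0 < M) by (unfold M; lra).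
 exists (Rmin 1 (e / (2 * M))). assert (He' : 0 < Rmin 1 (e / (2 * M))) by (apply Rmin_glb_lt; [lra|apply Rdiv_lt_0_compat; lra]). split; auto.
 intros u v Hu Hv. assert (E1 := Rmin_l 1 (e / (2 * M))). assert (E2 := Rmin_r 1 (e / (2 * M))). set (e' := Rmin 1 (e / (2 * M))) in *.
 apply (Rle_div_r e') in E2; [|lra]. replace (u * v - a * b) with ((u - a) * (v - b) + ((u - a) * b + a * (v - b))) by ring.
 pose proof (Cmod_triangle ((u - a) * (v - b)) ((u - a) * b + a * (v - b))). pose proof (Cmod_triangle ((u - a) * b) (a * (v - b))).
 rewrite !Cmod_mult in *. pose proof (Cmod_ge_0 (u - a)). unfold M in E2. nra.
Qed.

Lemma ccont_const (k z : C) : ccont (fun _ => k) z.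
Proof. intros e He; exists 1%R; split; [lra|]. intros w _. rewrite Cmod_sub_diag; lra. Qed.

Lemma ccont_id (z : C) : ccont (fun w => w) z.
Proof. intros e He; exists e; auto. Qed.

Lemma ccont_plus f g z : ccont f z -> ccont g z -> ccont (fun w => f w + g w) z.
Proof.
 intros Hf Hg e He. destruct (Hf (e/2)%R) as (d1 & Hd1 & H1); [lra|]. destruct (Hg (e/2)%R) as (d2 & Hd2 & H2); [lra|].
 exists (Rmin d1 d2); split; [apply Rmin_glb_lt; lra|]. intros w Hw. specialize (H1 w (proj1 (Rmin_Rgt_l _ _ _ Hw))).
 specialize (H2 w (proj2 (Rmin_Rgt_l _ _ _ Hw))). replace (f w + g w - (f z + g z)) with ((f w - f z) + (g w - g z)) by ring.
 eapply Rle_lt_trans; [apply Cmod_triangle|lra].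
Qed.

Lemma ccont_mult f g z : ccont f z -> ccont g z -> ccont (fun w => f w * g w) z.
Proof.
 intros Hf Hg e He. destruct (mult_eps (f z) (g z) e He) as (e' & He' & K). destruct (Hf e' He') as (d1 & Hd1 & H1).
 destruct (Hg e' He') as (d2 & Hd2 & H2). exists (Rmin d1 d2); split; [apply Rmin_glb_lt; lra|]. intros w Hw. apply Rmin_Rgt_l in Hw.
 apply K; [apply H1|apply H2]; apply Hw.
Qed.

Lemma ccont_ext_loc (f g : C -> C) z d :
  (0 < d) -> (forall w, Cmod (w - z) < d -> f w = g w) -> ccont f z -> ccont g z.
Proof.
 intros Hd E Hf e He. destruct (Hf e He) as (d' & Hd' & H). exists (Rmin d d'); split; [apply Rmin_glb_lt; lra|]. intros w Hw.
 rewrite <- (E w), <- (E z).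
 - apply H, (proj2 (Rmin_Rgt_l _ _ _ Hw)).
 - rewrite Cmod_sub_diag; lra.
 - apply (proj1 (Rmin_Rgt_l _ _ _ Hw)).
Qed.

Lemma cder_ext_loc (f g : C -> C) z l d :
  (0 < d) -> (forall w, Cmod (w - z) < d -> f w = g w) -> cder f z l -> cder g z l.
Proof.
 intros Hd E Hf e He. destruct (Hf e He) as (d' & Hd' & H). exists (Rmin d d'); split; [apply Rmin_glb_lt; lra|]. intros w Hw.
 rewrite <- (E w), <- (E z).
 - apply H, (proj2 (Rmin_Rgt_l _ _ _ Hw)).
 - rewrite Cmod_sub_diag; lra.
 - apply (proj1 (Rmin_Rgt_l _ _ _ Hw)).
Qed.

Lemma cder_ext f g z l : (forall w, f w = g w) -> cder f z l -> cder g z l.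
Proof. intros E. apply cder_ext_loc with 1%R; [lra|auto]. Qed.

Lemma cder_cont f z l : cder f z l -> ccont f z.
Proof.
 intros H e He. destruct (H 1%R) as (d & Hd & H1); [lra|]. pose proof (Cmod_ge_0 l) as Hl. exists (Rmin d (e / (Cmod l + 2))); split.
 { apply Rmin_glb_lt; [lra|apply Rdiv_lt_0_compat; lra]. }
 intros w Hw. specialize (H1 w (proj1 (Rmin_Rgt_l _ _ _ Hw))). assert (H2 := Rlt_le_trans _ _ _ Hw (Rmin_r _ _)).
 replace (f w - f z) with ((f w - f z - l * (w - z)) + l * (w - z)) by ring. eapply Rle_lt_trans; [apply Cmod_triangle|]. rewrite Cmod_mult.
 apply Rle_lt_trans with ((Cmod l + 1) * (e / (Cmod l + 2)))%R.
 { nra. }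
 apply (Rmult_lt_reg_r (Cmod l + 2)); [lra|]. field_simplify; [nra|lra].
Qed.

Lemma cder_const (k z : C) : cder (fun _ => k) z 0.
Proof. apply is_derive_cder_ring, @is_derive_const. Qed.

Lemma cder_id (z : C) : cder (fun w => w) z 1.
Proof. apply is_derive_cder_ring, @is_derive_id. Qed.

Lemma cder_plus f g z l m :
  cder f z l -> cder g z m -> cder (fun w => f w + g w) z (l + m).
Proof. rewrite <- !is_derive_cder_ring. apply @is_derive_plus. Qed.

Lemma cder_opp f z l : cder f z l -> cder (fun w => - f w) z (- l).
Proof. rewrite <- !is_derive_cder_ring. apply @is_derive_opp. Qed.

Lemma cder_minus f g z l m :
  cder f z l -> cder g z m -> cder (fun w => f w - g w) z (l - m).
Proof. rewrite <- !is_derive_cder_ring. apply @is_derive_minus. Qed.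

Lemma cder_mult f g z l m :
  cder f z l -> cder g z m -> cder (fun w => f w * g w) z (l * g z + f z * m).
Proof. rewrite <- !is_derive_cder_ring. intros Hf Hg. apply (is_derive_mult (K := C_AbsRing)); auto. apply Cmult_comm. Qed.

Lemma cder_scal k f z l : cder f z l -> cder (fun w => k * f w) z (k * l).
Proof. intros H. replace (k * l) with (0 * f z + k * l) by ring. apply cder_mult; [apply cder_const|exact H]. Qed.

Lemma cder_comp f g z l m :
  cder f z l -> cder g (f z) m -> cder (fun w => g (f w)) z (m * l).
Proof.
 rewrite <- !is_derive_cder_ring, Cmult_comm. intros Hf Hg.
 apply (is_derive_comp (K := C_AbsRing) (V := AbsRing_NormedModule C_AbsRing) g f z m l); auto.
Qed.

Lemma cder_inv (z : C) : z <> 0 -> cder Cinv z (- / (z * z)).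
Proof.
 (* Within [d] one has |w| >= |z|/2, and the remainder (w - z)^2 / (z^2 w) is at most e |w - z|. *)
 intros Hz e He. assert (Hm : 0 < Cmod z) by (apply Cmod_gt_0; auto). set (d := Rmin (Cmod z / 2) (e * (Cmod z * Cmod z * Cmod z) / 2)).
 assert (0 < Cmod z * Cmod z * Cmod z) by (repeat apply Rmult_lt_0_compat; lra). exists d; split.
 { apply Rmin_glb_lt; [lra|]. nra. }
 intros w Hw. destruct (Rmin_Rgt_l _ _ _ Hw) as [W1 W2]. assert (W3 : Cmod z / 2 <= Cmod w).
 { assert (T := Cmod_tri_inv z w). rewrite (Cmod_sub_sym z w) in T. lra. }
 assert (Hw0 : w <> 0).
 { intros ->. rewrite Cmod_0 in W3. lra. }
 replace (/ w - / z - - / (z * z) * (w - z)) with ((w - z) * (w - z) * / (z * z * w)).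
 2:{ field. auto. }
 rewrite !Cmod_mult, Cmod_inv, !Cmod_mult by (repeat apply Cmult_neq_0; auto). pose proof (Cmod_ge_0 (w - z)).
 apply (Rmult_le_reg_r (Cmod z * Cmod z * Cmod w)).
 { nra. }
 rewrite Rmult_assoc, Rinv_l.
 2:{ nra. }
 assert (Cmod z * Cmod z * (Cmod z/2) <= Cmod z * Cmod z * Cmod w).
 { nra. }
 apply Rle_trans with (e * Cmod (w - z) * (Cmod z * Cmod z * (Cmod z / 2)))%R.
 2:{ apply Rmult_le_compat_l; [nra|lra]. }
 nra.
Qed.

Lemma cder_unique f z l m : cder f z l -> cder f z m -> l = m.
Proof. rewrite <- !is_derive_cder. intros H1 H2. rewrite <- (is_C_derive_unique _ _ _ H1). apply is_C_derive_unique, H2. Qed.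

Lemma Cconj_mod (z : C) : Cmod (Cconj z) = Cmod z.
Proof. apply Cmod_conj. Qed.

Lemma cder_conj f z l :
  cder f (Cconj z) l -> cder (fun w => Cconj (f (Cconj w))) z (Cconj l).
Proof.
 intros H e He. destruct (H e He) as (d & Hd & K). exists d; split; auto. intros w Hw.
 assert (E : Cconj w - Cconj z = Cconj (w - z)) by (rewrite Cminus_conj; auto). specialize (K (Cconj w)). rewrite E, Cconj_mod in K. specialize (K Hw).
 rewrite <- Cconj_mod, Cminus_conj, Cminus_conj, !Cconj_conj, Cmult_conj, Cconj_conj. exact K.
Qed.

Lemma cder_div f g z l m : cder f z l -> cder g z m -> g z <> 0 ->
  exists k, cder (fun w => f w / g w) z k.
Proof. intros Hf Hg N. eexists. apply cder_mult; [exact Hf|]. eapply cder_comp; [exact Hg|]. apply cder_inv, N. Qed.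

Lemma ccont_inv f z : ccont f z -> f z <> 0 -> ccont (fun w => / f w) z.
Proof.
 intros Hf N e He. assert (I := cder_cont _ _ _ (cder_inv _ N)). destruct (I e He) as (d & Hd & H). destruct (Hf d Hd) as (d' & Hd' & H').
 exists d'; auto.
Qed.

Lemma ccont_opp f z : ccont f z -> ccont (fun w => - f w) z.
Proof.
 intros H e He. destruct (H e He) as (d & Hd & K). exists d; split; auto. intros w Hw. replace (- f w - - f z) with (- (f w - f z)) by ring.
 rewrite Cmod_opp; auto.
Qed.

Lemma ccont_minus f g z : ccont f z -> ccont g z -> ccont (fun w => f w - g w) z.
Proof. intros; apply ccont_plus; [|apply ccont_opp]; assumption. Qed.

Lemma Cexp_plus (z w : C) : Cexp (z + w) = Cexp z * Cexp w.
Proof. unfold Cexp, Cmult, Cplus, Re, Im; cbn -[exp cos sin]. rewrite exp_plus, cos_plus, sin_plus. f_equal; ring. Qed.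

Lemma Cexp_0 : Cexp 0 = 1.
Proof. unfold Cexp, Re, Im; cbn -[exp cos sin]. rewrite exp_0, cos_0, sin_0. unfold RtoC; f_equal; ring. Qed.

Lemma Cmod_Cexp (z : C) : Cmod (Cexp z) = exp (Re z).
Proof.
 rewrite Cmod_eq. unfold Cexp, Re, Im; cbn [fst snd].
 replace ((exp (fst z) * cos (snd z)) ^ 2 + (exp (fst z) * sin (snd z)) ^ 2)%R with (Rsqr (exp (fst z)) * (Rsqr (sin (snd z)) + Rsqr (cos (snd z))))%R by (unfold Rsqr; ring).
 rewrite sin2_cos2, Rmult_1_r, sqrt_Rsqr; auto. left; apply exp_pos.
Qed.

Lemma Cexp_conj (z : C) : Cexp (Cconj z) = Cconj (Cexp z).
Proof. unfold Cexp, Cconj, Re, Im; cbn -[exp cos sin]. rewrite cos_neg, sin_neg; f_equal; ring. Qed.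

Lemma derive_eps (f : R -> R) (x l : R) : derivable_pt_lim f x l ->
  forall e, 0 < e -> exists d, 0 < d /\ forall h, Rabs h < d ->
   (Rabs (f (x + h) - f x - l * h) <= e * Rabs h)%R.
Proof.
 intros H e He. destruct (H e He) as [d Hd]. exists d; split; [apply cond_pos|]. intros h Hh. destruct (Req_dec h 0) as [->|N].
 { rewrite Rplus_0_r, Rmult_0_r, Rminus_0_r, Rminus_diag, Rabs_R0. lra. }
 specialize (Hd h N Hh). replace (f (x + h) - f x - l * h)%R with (((f (x + h) - f x) / h - l) * h)%R by (field; auto). rewrite Rabs_mult.
 apply Rmult_le_compat_r; [apply Rabs_pos|lra].
Qed.

(** The derivative at 0 comes from the first-order expansions of [exp], [cos] and [sin]; [Cexp_plus]
    carries it to every point. *)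
Lemma cder_Cexp (z : C) : cder Cexp z (Cexp z).
Proof.
 assert (H0 : cder Cexp 0 1).
 { intros e He. assert (X1 := derivable_pt_lim_exp 0). assert (X2 := derivable_pt_lim_cos 0). assert (X3 := derivable_pt_lim_sin 0).
  rewrite sin_0, Ropp_0 in X2. rewrite cos_0 in X3. assert (E4 : 0 < e / 20) by lra. destruct (derive_eps _ _ _ X1 _ E4) as (d1 & Hd1 & K1).
  destruct (derive_eps _ _ _ X2 _ E4) as (d2 & Hd2 & K2). destruct (derive_eps _ _ _ X3 _ E4) as (d3 & Hd3 & K3). set (d4 := Rmin 1 (e/20)).
  exists (Rmin (Rmin d1 d2) (Rmin d3 d4)); split; [repeat apply Rmin_glb_lt; lra|]. intros w Hw. replace (w - 0) with w in * by ring. rewrite Cexp_0.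
  assert (Rx := Rabs_Re_le w). assert (Ry := Rabs_Im_le w). assert (L1 := Rmin_l (Rmin d1 d2) (Rmin d3 d4)).
  assert (L2 := Rmin_r (Rmin d1 d2) (Rmin d3 d4)). assert (L3 := Rmin_l d1 d2). assert (L4 := Rmin_r d1 d2). assert (L5 := Rmin_l d3 d4).
  assert (L6 := Rmin_r d3 d4). assert (L7 := Rmin_l 1 (e/20)). assert (L8 := Rmin_r 1 (e/20)). fold d4 in L7, L8. specialize (K1 (Re w) ltac:(lra)).
  specialize (K2 (Im w) ltac:(lra)). specialize (K3 (Im w) ltac:(lra)). rewrite Rplus_0_l, exp_0 in K1. rewrite Rplus_0_l, cos_0 in K2.
  rewrite Rplus_0_l, sin_0 in K3. assert (EX : exp (Re w) <= 3).
  { apply Rle_trans with (exp 1); [|apply exp_le_3]. left; apply exp_increasing. assert (Re w <= Rabs (Re w)) by apply RRle_abs. lra. }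
  assert (EP := exp_pos (Re w)). eapply Rle_trans; [apply Cmod_le_Re_Im|]. unfold Cexp. set (x := Re w) in *. set (y := Im w) in *.
  replace (Re (((exp x * cos y)%R, (exp x * sin y)%R) - 1 - 1 * w)) with ((exp x - 1 - x) + exp x * (cos y - 1))%R.
  2:{ unfold x, y, Re, Im, Cminus, Cplus, Copp, Cmult, RtoC; cbn -[exp cos sin]. ring. }
  replace (Im (((exp x * cos y)%R, (exp x * sin y)%R) - 1 - 1 * w)) with (exp x * (sin y - y) + (exp x - 1) * y)%R.
  2:{ unfold x, y, Re, Im, Cminus, Cplus, Copp, Cmult, RtoC; cbn -[exp cos sin]. ring. }
  assert (Q1 : Rabs (exp x - 1) <= 2 * e/20 + e/20*1).
  { replace (exp x - 1)%R with ((exp x - 1 - 1 * x) + x)%R by ring. eapply Rle_trans; [apply Rabs_triang|]. nra. }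
  rewrite Rmult_0_l, Rminus_0_r in K2. assert (Q2 : Rabs (exp x * (cos y - 1)) <= 3 * (e/20 * Rabs y)).
  { rewrite Rabs_mult, (Rabs_pos_eq (exp x)) by lra. apply Rmult_le_compat; try lra; apply Rabs_pos. }
  replace (sin y - 0 - 1 * y)%R with (sin y - y)%R in K3 by ring. assert (Q3 : Rabs (exp x * (sin y - y)) <= 3 * (e/20 * Rabs y)).
  { rewrite Rabs_mult, (Rabs_pos_eq (exp x)) by lra. apply Rmult_le_compat; try lra; apply Rabs_pos. }
  assert (Q4 : Rabs ((exp x - 1) * y) <= (2 * e/20 + e/20*1) * Rabs y).
  { rewrite Rabs_mult. apply Rmult_le_compat_r; [apply Rabs_pos|lra]. }
  assert (T1 := Rabs_triang (exp x - 1 - x) (exp x * (cos y - 1))). assert (T2 := Rabs_triang (exp x * (sin y - y)) ((exp x - 1) * y)).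
  replace (exp x - 1 - 1 * x)%R with (exp x - 1 - x)%R in K1 by ring. pose proof (Rabs_pos y). nra. }
 assert (H1 : cder (fun w => w - z) z (1 - 0)) by (apply cder_minus; [apply cder_id|apply cder_const]).
 assert (H2 : cder (fun w => Cexp (w - z)) z (1 * (1 - 0))).
 { apply cder_comp; [exact H1|]. replace (z - z) with (RtoC 0) by ring. exact H0. }
 apply (cder_scal (Cexp z)) in H2. replace (Cexp z * (1 * (1 - 0))) with (Cexp z) in H2 by ring. revert H2. apply cder_ext. intros w.
 rewrite <- Cexp_plus. f_equal; ring.
Qed.

Lemma hol_sub (D D' : C -> Prop) f : (forall z, D z -> D' z) -> hol D' f -> hol D f.
Proof. intros S H z Hz. auto. Qed.

Lemma hol_cont D f z : hol D f -> D z -> ccont f z.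
Proof. intros H Hz. destruct (H z Hz) as [l Hl]. apply (cder_cont _ _ _ Hl). Qed.

Lemma hol_const D k : hol D (fun _ => k).
Proof. intros z _; eexists; apply cder_const. Qed.

Lemma hol_id D : hol D (fun z => z).
Proof. intros z _; eexists; apply cder_id. Qed.

Lemma hol_plus D f g : hol D f -> hol D g -> hol D (fun z => f z + g z).
Proof. intros Hf Hg z Hz. destruct (Hf z Hz), (Hg z Hz). eexists; apply cder_plus; eassumption. Qed.

Lemma hol_minus D f g : hol D f -> hol D g -> hol D (fun z => f z - g z).
Proof. intros Hf Hg z Hz. destruct (Hf z Hz), (Hg z Hz). eexists; apply cder_minus; eassumption. Qed.

Lemma hol_opp D f : hol D f -> hol D (fun z => - f z).
Proof. intros Hf z Hz. destruct (Hf z Hz). eexists; apply cder_opp; eassumption. Qed.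

Lemma hol_mult D f g : hol D f -> hol D g -> hol D (fun z => f z * g z).
Proof. intros Hf Hg z Hz. destruct (Hf z Hz), (Hg z Hz). eexists; apply cder_mult; eassumption. Qed.

Lemma hol_div D f g : hol D f -> hol D g -> (forall z, D z -> g z <> 0) -> hol D (fun z => f z / g z).
Proof. intros Hf Hg N z Hz. destruct (Hf z Hz), (Hg z Hz). eapply cder_div; eauto. Qed.

Lemma hol_comp (D D' : C -> Prop) f g : hol D f -> hol D' g -> (forall z, D z -> D' (f z)) ->
  hol D (fun z => g (f z)).
Proof. intros Hf Hg S z Hz. destruct (Hf z Hz) as [l Hl], (Hg _ (S z Hz)) as [m Hm]. eexists; eapply cder_comp; eassumption. Qed.

Lemma hol_Cexp D f : hol D f -> hol D (fun z => Cexp (f z)).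
Proof. intros H. apply (hol_comp D (fun _ => True)); auto. intros z _; eexists; apply cder_Cexp. Qed.

Lemma hol_conj D f : hol D f -> hol (fun z => D (Cconj z)) (fun z => Cconj (f (Cconj z))).
Proof. intros H z Hz. destruct (H _ Hz) as [l Hl]. eexists; apply cder_conj; exact Hl. Qed.

Lemma hol_pow D f n : hol D f -> hol D (fun z => Cpow (f z) n).
Proof.
 intros H. induction n as [|n IH].
 - exact (hol_const D 1).
 - exact (hol_mult D f (fun z => Cpow (f z) n) H IH).
Qed.

(** * Contour integrals over segments and rectangles *)

Definition CI (f : R -> C) (a b : R) : C := RInt (V := C_R_CompleteNormedModule) f a b.

Definition rcont (f : R -> C) (s : R) : Prop :=
  forall e : R, 0 < e -> exists d : R, 0 < d /\
    forall s', Rabs (s' - s) < d -> Cmod (f s' - f s) < e.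

Lemma rcont_continuous f s : rcont f s -> continuous (U := C_R_CompleteNormedModule) f s.
Proof.
 intros H. apply (filterlim_locally (U := C_UniformSpace)). intros e. destruct (H e (cond_pos e)) as (d & Hd & K). exists (mkposreal d Hd).
 intros s' Hs'. apply Cmod_ball_C, K, Hs'.
Qed.

Lemma continuous_rcont f s : continuous (U := C_UniformSpace) f s -> rcont f s.
Proof.
 intros H e He. assert (K := proj1 (filterlim_locally (U := C_UniformSpace) _ _) H (mkposreal (e/2) ltac:(lra))). destruct K as [d Hd].
 exists d; split; [apply cond_pos|]. intros s' Hs'. specialize (Hd s' Hs'). apply ball_C_Cmod in Hd. simpl in Hd. lra.
Qed.

Definition rcont_on (f : R -> C) (a b : R) : Prop := forall s, a <= s <= b -> rcont f s.

Lemma CI_ex f a b : a <= b -> rcont_on f a b -> ex_RInt (V := C_R_CompleteNormedModule) f a b.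
Proof. intros Hab H. apply ex_RInt_continuous. intros s Hs. rewrite Rmin_left, Rmax_right in Hs by lra. apply rcont_continuous, H, Hs. Qed.

Lemma rcont_comp (f : C -> C) (g : R -> C) s : rcont g s -> ccont f (g s) -> rcont (fun t => f (g t)) s.
Proof. intros Hg Hf e He. destruct (Hf e He) as (d & Hd & H). destruct (Hg d Hd) as (d' & Hd' & H'). exists d'; auto. Qed.

Lemma rcont_const k s : rcont (fun _ => k) s.
Proof. intros e He; exists 1%R; split; [lra|]. intros t _. rewrite Cmod_sub_diag; lra. Qed.

Lemma rcont_plus f g s : rcont f s -> rcont g s -> rcont (fun w => f w + g w) s.
Proof.
 intros Hf Hg e He. destruct (Hf (e/2)%R) as (d1 & Hd1 & H1); [lra|]. destruct (Hg (e/2)%R) as (d2 & Hd2 & H2); [lra|].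
 exists (Rmin d1 d2); split; [apply Rmin_glb_lt; lra|]. intros w Hw. specialize (H1 w (proj1 (Rmin_Rgt_l _ _ _ Hw))).
 specialize (H2 w (proj2 (Rmin_Rgt_l _ _ _ Hw))). replace (f w + g w - (f s + g s)) with ((f w - f s) + (g w - g s)) by ring.
 eapply Rle_lt_trans; [apply Cmod_triangle|lra].
Qed.

Lemma rcont_scal k f s : rcont f s -> rcont (fun w => k * f w) s.
Proof. intros H. apply (rcont_comp (fun z => k * z)); auto. apply ccont_mult; [apply ccont_const|apply ccont_id]. Qed.

Lemma rcont_opp f s : rcont f s -> rcont (fun w => - f w) s.
Proof. intros H. apply (rcont_comp (fun z => - z)); auto. apply ccont_opp, ccont_id. Qed.

Lemma rcont_minus f g s : rcont f s -> rcont g s -> rcont (fun w => f w - g w) s.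
Proof. intros; apply rcont_plus; [|apply rcont_opp]; assumption. Qed.

Lemma rcont_mult f g s : rcont f s -> rcont g s -> rcont (fun w => f w * g w) s.
Proof.
 intros Hf Hg e He. destruct (mult_eps (f s) (g s) e He) as (e' & He' & K). destruct (Hf e' He') as (d1 & Hd1 & H1).
 destruct (Hg e' He') as (d2 & Hd2 & H2). exists (Rmin d1 d2); split; [apply Rmin_glb_lt; lra|]. intros w Hw. apply Rmin_Rgt_l in Hw.
 apply K; [apply H1|apply H2]; apply Hw.
Qed.

Lemma rcont_affine (p q : C) s : rcont (fun t => p + RtoC t * q) s.
Proof.
 intros e He. pose proof (Cmod_ge_0 q). exists (e / (Cmod q + 1))%R; split; [apply Rdiv_lt_0_compat; lra|]. intros t Ht.
 replace (p + t * q - (p + s * q)) with (RtoC (t - s) * q).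
 2:{ rewrite RtoC_minus. ring. }
 rewrite Cmod_mult, Cmod_R. apply Rle_lt_trans with (Rabs (t - s) * (Cmod q + 1))%R.
 { apply Rmult_le_compat_l; [apply Rabs_pos|lra]. }
 apply Rlt_le_trans with (e / (Cmod q + 1) * (Cmod q + 1))%R.
 { nra. }
 right; field; lra.
Qed.

Lemma rcont_ext f g s : (forall t, f t = g t) -> rcont f s -> rcont g s.
Proof. intros E H e He. destruct (H e He) as (d & Hd & K). exists d; split; auto. intros t Ht. rewrite <- !E; auto. Qed.

Lemma rcont_hor (x y : R) s : rcont (fun t => ((x + t)%R, y) : C) s.
Proof. apply rcont_ext with (fun t => (x, y) + RtoC t * 1); [|apply rcont_affine]. intros t. unfold RtoC, Cplus, Cmult; simpl. f_equal; ring. Qed.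

Lemma rcont_ver (x y : R) s : rcont (fun t => (x, (y + t)%R) : C) s.
Proof. apply rcont_ext with (fun t => (x, y) + RtoC t * Ci); [|apply rcont_affine]. intros t. unfold RtoC, Ci, Cplus, Cmult; simpl. f_equal; ring. Qed.

Section Integrals.

Lemma CI_is f a b : a <= b -> rcont_on f a b -> is_RInt (V := C_R_CompleteNormedModule) f a b (CI f a b).
Proof. intros; apply (RInt_correct (V := C_R_CompleteNormedModule)), CI_ex; auto. Qed.

Lemma CI_unique f a b l : is_RInt (V := C_R_CompleteNormedModule) f a b l -> CI f a b = l.
Proof. apply (is_RInt_unique (V := C_R_CompleteNormedModule)). Qed.

Lemma CI_ext f g a b : a <= b -> (forall s, a < s < b -> f s = g s) -> CI f a b = CI g a b.
Proof. intros Hab E. apply (RInt_ext (V := C_R_CompleteNormedModule)). intros s Hs. rewrite Rmin_left, Rmax_right in Hs by lra. auto. Qed.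

Lemma CI_plus f g a b : a <= b -> rcont_on f a b -> rcont_on g a b ->
  CI (fun s => f s + g s) a b = CI f a b + CI g a b.
Proof. intros. apply CI_unique, (is_RInt_plus (V := C_R_CompleteNormedModule)); apply CI_is; auto. Qed.

Lemma CI_minus f g a b : a <= b -> rcont_on f a b -> rcont_on g a b ->
  CI (fun s => f s - g s) a b = CI f a b - CI g a b.
Proof. intros. apply CI_unique, (is_RInt_minus (V := C_R_CompleteNormedModule)); apply CI_is; auto. Qed.

Lemma CI_pair f a b : a <= b -> rcont_on f a b ->
  CI f a b = (RInt (fun s => Re (f s)) a b, RInt (fun s => Im (f s)) a b).
Proof.
 intros Hab H. assert (K := CI_is f a b Hab H). assert (K1 := is_RInt_fct_extend_fst (U := R_NormedModule) (V := R_NormedModule) _ _ _ _ K).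
 assert (K2 := is_RInt_fct_extend_snd (U := R_NormedModule) (V := R_NormedModule) _ _ _ _ K).
 apply (is_RInt_unique (V := R_CompleteNormedModule)) in K1. apply (is_RInt_unique (V := R_CompleteNormedModule)) in K2.
 transitivity (fst (CI f a b), snd (CI f a b)); [auto|]. apply f_equal2; symmetry; [exact K1|exact K2].
Qed.

Lemma is_CI_Re_Im f a b l : is_RInt (fun s => Re (f s)) a b (Re l) -> is_RInt (fun s => Im (f s)) a b (Im l) ->
  CI f a b = l.
Proof.
 intros H1 H2. apply CI_unique. destruct l as [l1 l2].
 apply (is_RInt_fct_extend_pair (U := R_NormedModule) (V := R_NormedModule) f a b l1 l2); assumption.
Qed.

(** The integral lives in a real normed space, where multiplication by a complex number mixes the
    two components; each is treated separately. *)
Lemma CI_scal k f a b : a <= b -> rcont_on f a b ->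
  CI (fun s => k * f s) a b = k * CI f a b.
Proof.
 intros Hab H. assert (K := CI_is f a b Hab H). assert (K1 := is_RInt_fct_extend_fst (U := R_NormedModule) (V := R_NormedModule) _ _ _ _ K).
 assert (K2 := is_RInt_fct_extend_snd (U := R_NormedModule) (V := R_NormedModule) _ _ _ _ K). apply is_CI_Re_Im.
 - apply (is_RInt_minus (V := R_NormedModule)); apply (is_RInt_scal (V := R_NormedModule)); assumption.
 - apply (is_RInt_plus (V := R_NormedModule)); apply (is_RInt_scal (V := R_NormedModule)); assumption.
Qed.

Lemma CI_chasles f a b c : a <= b -> b <= c -> rcont_on f a c -> CI f a b + CI f b c = CI f a c.
Proof. intros Hab Hbc H. symmetry. apply CI_unique, (is_RInt_Chasles (V := C_R_CompleteNormedModule)) with b; apply CI_is; auto; intros s Hs; apply H; lra. Qed.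

Lemma CI_const k a b : CI (fun _ => k) a b = RtoC (b - a) * k.
Proof.
 apply CI_unique. assert (H := is_RInt_const (V := C_R_NormedModule) a b k).
 replace (RtoC (b - a) * k) with (scal (V := C_R_NormedModule) (b - a)%R k); auto. unfold scal, RtoC, Cmult; simpl. unfold prod_scal, scal; simpl.
 unfold mult; simpl. f_equal; ring.
Qed.

Lemma CI_bound f a b M : a <= b -> rcont_on f a b -> (forall s, a <= s <= b -> Cmod (f s) <= M) ->
  (Cmod (CI f a b) <= (b - a) * M)%R.
Proof.
 intros Hab H B. rewrite Cmod_norm. apply (norm_RInt_le (V := C_R_NormedModule) f (fun _ => M) a b (CI f a b) ((b - a) * M)%R); auto.
 - intros s Hs. rewrite <- Cmod_norm. auto.
 - apply CI_is; auto.
 - apply (is_RInt_const (V := R_NormedModule)).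
Qed.

Lemma CI_shift f a b c : a <= b -> rcont_on f (a + c) (b + c) ->
  CI (fun t => f (t + c)%R) a b = CI f (a + c) (b + c).
Proof.
 intros Hab H. assert (K : is_RInt (V := C_R_NormedModule) f (1 * a + c) (1 * b + c) (CI f (a + c) (b + c))).
 { rewrite !Rmult_1_l. apply CI_is; auto; lra. }
 assert (K1 := is_RInt_comp_lin (V := C_R_NormedModule) _ _ _ _ _ _ K). apply CI_unique. revert K1. apply is_RInt_ext. intros t _. rewrite Rmult_1_l.
 apply (scal_one (V := C_R_NormedModule)).
Qed.

Lemma CI_lin f u v a b : a <= b -> 0 < u -> rcont_on f (u * a + v) (u * b + v) ->
  CI (fun t => RtoC u * f (u * t + v)%R) a b = CI f (u * a + v) (u * b + v).
Proof.
 intros Hab Hu H. assert (K : is_RInt (V := C_R_NormedModule) f (u * a + v) (u * b + v) (CI f (u * a + v) (u * b + v))).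
 { apply CI_is; auto; nra. }
 assert (K1 := is_RInt_comp_lin (V := C_R_NormedModule) _ _ _ _ _ _ K). apply CI_unique. revert K1. apply is_RInt_ext. intros t _.
 unfold scal, RtoC, Cmult; simpl. unfold prod_scal, scal; simpl. unfold mult; simpl. f_equal; ring.
Qed.

Lemma CI_zero_len f a : CI f a a = 0.
Proof. apply CI_unique. apply (is_RInt_point (V := C_R_NormedModule)). Qed.

End Integrals.

(** * Integrals around rectangles and Goursat's theorem *)

Definition crect (x y a b : R) (z : C) : Prop :=
  (x <= Re z <= x + a /\ y <= Im z <= y + b).

(** The boundary is run through counterclockwise; top and left side are parametrised backwards,
    hence their signs. *)
Definition RI (f : C -> C) (x y a b : R) : C :=
  CI (fun t => f ((x + t)%R, y)) 0 a + Ci * CI (fun t => f ((x + a)%R, (y + t)%R)) 0 b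
  - CI (fun t => f ((x + t)%R, (y + b)%R)) 0 a - Ci * CI (fun t => f (x, (y + t)%R)) 0 b.

Definition cont_rect f x y a b : Prop := forall z, crect x y a b z -> ccont f z.

Lemma cont_rect_hor f x y a b y' : y <= y' <= y + b -> cont_rect f x y a b ->
  rcont_on (fun t => f ((x + t)%R, y')) 0 a.
Proof. intros Hy H s Hs. apply (rcont_comp f (fun t => ((x + t)%R, y'))); [apply rcont_hor|]. apply H. unfold crect, Re, Im; simpl. lra. Qed.

Lemma cont_rect_ver f x y a b x' : x <= x' <= x + a -> cont_rect f x y a b ->
  rcont_on (fun t => f (x', (y + t)%R)) 0 b.
Proof. intros Hy H s Hs. apply (rcont_comp f (fun t => (x', (y + t)%R))); [apply rcont_ver|]. apply H. unfold crect, Re, Im; simpl. lra. Qed.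

Definition brect (x y a b : R) (z : C) : Prop :=
  crect x y a b z /\ (Re z = x \/ Re z = x + a \/ Im z = y \/ Im z = y + b)%R.

Definition cont_brect f x y a b : Prop := forall z, brect x y a b z -> ccont f z.

Lemma cont_rect_b f x y a b : cont_rect f x y a b -> cont_brect f x y a b.
Proof. intros H z [Hz _]; auto. Qed.

Lemma cont_brect_hor f x y a b y' : 0 <= b -> (y' = y \/ y' = y + b)%R -> cont_brect f x y a b ->
  rcont_on (fun t => f ((x + t)%R, y')) 0 a.
Proof. intros Hb Hy H s Hs. apply (rcont_comp f (fun t => ((x + t)%R, y'))); [apply rcont_hor|]. apply H. unfold brect, crect, Re, Im; simpl. lra. Qed.

Lemma cont_brect_ver f x y a b x' : 0 <= a -> (x' = x \/ x' = x + a)%R -> cont_brect f x y a b ->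
  rcont_on (fun t => f (x', (y + t)%R)) 0 b.
Proof. intros Ha Hy H s Hs. apply (rcont_comp f (fun t => (x', (y + t)%R))); [apply rcont_ver|]. apply H. unfold brect, crect, Re, Im; simpl. lra. Qed.

Lemma CI_shift0 (f : R -> C) a1 a2 : 0 <= a1 -> 0 <= a2 -> rcont_on f 0 (a1 + a2) ->
  CI f 0 (a1 + a2) = CI f 0 a1 + CI (fun t => f (a1 + t)%R) 0 a2.
Proof.
 intros H1 H2 H. rewrite <- (CI_chasles f 0 a1 (a1 + a2)) by (auto; lra). f_equal.
 rewrite (CI_ext (fun t => f (a1 + t)%R) (fun t => f (t + a1)%R)) by (auto; intros; f_equal; ring). rewrite CI_shift; [f_equal; ring|lra|].
 intros s Hs; apply H; lra.
Qed.

Lemma RI_split_h f x y a1 a2 b : 0 <= a1 -> 0 <= a2 -> 0 <= b ->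
  cont_rect f x y (a1 + a2) b ->
  RI f x y (a1 + a2) b = RI f x y a1 b + RI f (x + a1) y a2 b.
Proof.
 intros H1 H2 Hb H. unfold RI.
 rewrite (CI_shift0 (fun t => f ((x + t)%R, y))), (CI_shift0 (fun t => f ((x + t)%R, (y + b)%R))); auto; try (eapply cont_rect_hor; [|exact H]; lra).
 assert (E : forall y' t, f ((x + (a1 + t))%R, y') = f ((x + a1 + t)%R, y')) by (intros; do 2 f_equal; ring).
 rewrite (CI_ext (fun t => f ((x + (a1 + t))%R, y)) (fun t => f ((x + a1 + t)%R, y))) by auto.
 rewrite (CI_ext (fun t => f ((x + (a1 + t))%R, (y + b)%R)) (fun t => f ((x + a1 + t)%R, (y+b)%R))) by auto. rewrite <- Rplus_assoc. ring.
Qed.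

Lemma RI_split_v f x y a b1 b2 : 0 <= a -> 0 <= b1 -> 0 <= b2 ->
  cont_rect f x y a (b1 + b2) ->
  RI f x y a (b1 + b2) = RI f x y a b1 + RI f x (y + b1) a b2.
Proof.
 intros H1 H2 Hb H. unfold RI.
 rewrite (CI_shift0 (fun t => f ((x + a)%R, (y + t)%R))), (CI_shift0 (fun t => f (x, (y + t)%R))); auto; try (eapply cont_rect_ver; [|exact H]; lra).
 assert (E : forall x' t, f (x', (y + (b1 + t))%R) = f (x', (y + b1 + t)%R)) by (intros; do 2 f_equal; ring).
 rewrite (CI_ext (fun t => f ((x+a)%R, (y + (b1 + t))%R)) (fun t => f ((x+a)%R, (y + b1 + t)%R))) by auto.
 rewrite (CI_ext (fun t => f (x, (y + (b1 + t))%R)) (fun t => f (x, (y + b1 + t)%R))) by auto. rewrite <- Rplus_assoc. ring.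
Qed.

Lemma RI_plus f g x y a b : 0 <= a -> 0 <= b -> cont_brect f x y a b -> cont_brect g x y a b ->
  RI (fun z => f z + g z) x y a b = RI f x y a b + RI g x y a b.
Proof.
 intros Ha Hb Hf Hg. unfold RI.
 rewrite (CI_plus (fun t => f ((x + t)%R, y))), (CI_plus (fun t => f ((x + t)%R, (y + b)%R))), (CI_plus (fun t => f ((x + a)%R, (y + t)%R))), (CI_plus (fun t => f (x, (y + t)%R))); try ring; auto; try (eapply cont_brect_hor; [| |eassumption]; [lra|tauto]); try (eapply cont_brect_ver; [| |eassumption]; [lra|tauto]).
Qed.

Lemma RI_scal k f x y a b : 0 <= a -> 0 <= b -> cont_brect f x y a b ->
  RI (fun z => k * f z) x y a b = k * RI f x y a b.
Proof.
 intros Ha Hb Hf. unfold RI.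
 rewrite (CI_scal k (fun t => f ((x + t)%R, y))), (CI_scal k (fun t => f ((x + t)%R, (y + b)%R))), (CI_scal k (fun t => f ((x + a)%R, (y + t)%R))), (CI_scal k (fun t => f (x, (y + t)%R))); try ring; auto; try (eapply cont_brect_hor; [| |eassumption]; [lra|tauto]); try (eapply cont_brect_ver; [| |eassumption]; [lra|tauto]).
Qed.

Lemma RI_ext f g x y a b : 0 <= a -> 0 <= b -> (forall z, brect x y a b z -> f z = g z) ->
  RI f x y a b = RI g x y a b.
Proof.
 intros Ha Hb E. unfold RI.
 rewrite (CI_ext (fun t => f ((x + t)%R, y)) (fun t => g ((x + t)%R, y))), (CI_ext (fun t => f ((x + t)%R, (y+b)%R)) (fun t => g ((x + t)%R, (y+b)%R))), (CI_ext (fun t => f ((x + a)%R, (y+t)%R)) (fun t => g ((x + a)%R, (y+t)%R))), (CI_ext (fun t => f (x, (y+t)%R)) (fun t => g (x, (y+t)%R))); auto; intros; apply E; unfold brect, crect, Re, Im; simpl; lra.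
Qed.

Lemma RI_bound f x y a b M : 0 <= a -> 0 <= b -> cont_brect f x y a b ->
  (forall z, brect x y a b z -> Cmod (f z) <= M) ->
  (Cmod (RI f x y a b) <= 2 * (a + b) * M).
Proof.
 intros Ha Hb Hf B. unfold RI. set (I1 := CI (fun t => f ((x + t)%R, y)) 0 a). set (I2 := CI (fun t => f ((x + a)%R, (y + t)%R)) 0 b).
 set (I3 := CI (fun t => f ((x + t)%R, (y + b)%R)) 0 a). set (I4 := CI (fun t => f (x, (y + t)%R)) 0 b). assert (B1 : Cmod I1 <= (a - 0) * M).
 { apply CI_bound; auto; [eapply cont_brect_hor; [| |eassumption]; [lra|tauto]|]. intros s Hs; apply B; unfold brect, crect, Re, Im; simpl; lra. }
 assert (B2 : Cmod I2 <= (b - 0) * M).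
 { apply CI_bound; auto; [eapply cont_brect_ver; [| |eassumption]; [lra|tauto]|]. intros s Hs; apply B; unfold brect, crect, Re, Im; simpl; lra. }
 assert (B3 : Cmod I3 <= (a - 0) * M).
 { apply CI_bound; auto; [eapply cont_brect_hor; [| |eassumption]; [lra|tauto]|]. intros s Hs; apply B; unfold brect, crect, Re, Im; simpl; lra. }
 assert (B4 : Cmod I4 <= (b - 0) * M).
 { apply CI_bound; auto; [eapply cont_brect_ver; [| |eassumption]; [lra|tauto]|]. intros s Hs; apply B; unfold brect, crect, Re, Im; simpl; lra. }
 assert (HC : Cmod Ci = 1%R) by (rewrite Cmod_eq; unfold Ci, Re, Im; simpl; rewrite Rmult_0_l, Rplus_0_l, !Rmult_1_r; apply sqrt_1).
 replace (I1 + Ci * I2 - I3 - Ci * I4) with ((I1 + Ci * I2) + (- I3 + - (Ci * I4))) by ring.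
 pose proof (Cmod_triangle (I1 + Ci * I2) (- I3 + - (Ci * I4))). pose proof (Cmod_triangle I1 (Ci * I2)).
 pose proof (Cmod_triangle (- I3) (- (Ci * I4))). rewrite !Cmod_opp, !Cmod_mult, HC in *. lra.
Qed.

Lemma Cpair (x y : R) : (x, y) = RtoC x + Ci * RtoC y.
Proof. unfold RtoC, Ci, Cplus, Cmult; simpl; f_equal; ring. Qed.

Lemma CI_t a : 0 <= a -> CI (fun t => RtoC t) 0 a = RtoC (a * a / 2).
Proof.
 intros Ha. apply is_CI_Re_Im.
 - replace (a * a / 2)%R with (minus (a * a / 2)%R (0 * 0 / 2)%R) by (unfold minus, plus, opp; simpl; field).
  apply (is_RInt_derive (V := R_CompleteNormedModule) (fun t => t * t / 2)%R (fun t => t)).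
  + intros t _. auto_derive; auto; field.
  + intros t _. apply continuous_id.
 - unfold RtoC. replace 0%R with (scal (a - 0)%R 0%R) at 2 by (unfold scal; simpl; unfold mult; simpl; ring).
  apply (is_RInt_const (V := R_NormedModule)).
Qed.

Lemma RI_affine x y a b (p q : C) : 0 <= a -> 0 <= b -> RI (fun z => p + q * z) x y a b = 0.
Proof.
 intros Ha Hb. assert (L : forall (u v : C) c, 0 <= c -> CI (fun t => p + q * (u + RtoC t * v)) 0 c = RtoC c * (p + q * u) + q * v * RtoC (c * c / 2)).
 { intros u v c Hc. rewrite (CI_ext _ (fun t => (p + q * u) + q * v * RtoC t)) by (auto; intros; ring). rewrite CI_plus; auto.
  - rewrite CI_const, CI_scal, CI_t; auto.
   + rewrite Rminus_0_r. reflexivity.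
   + intros s _. apply rcont_ext with (fun t => 0 + RtoC t * 1); [intros; ring|apply rcont_affine].
  - intros s _. apply rcont_const.
  - intros s _. apply rcont_scal, rcont_ext with (fun t => 0 + RtoC t * 1); [intros; ring|apply rcont_affine]. }
 unfold RI. rewrite (CI_ext (fun t => p + q * ((x + t)%R, y)) (fun t => p + q * ((x, y) + RtoC t * 1))); auto.
 2:{ intros; rewrite !Cpair, RtoC_plus; ring. }
 rewrite (CI_ext (fun t => p + q * ((x + t)%R, (y+b)%R)) (fun t => p + q * ((x, (y+b)%R) + RtoC t * 1))); auto.
 2:{ intros; rewrite !Cpair, RtoC_plus; ring. }
 rewrite (CI_ext (fun t => p + q * ((x + a)%R, (y+t)%R)) (fun t => p + q * (((x+a)%R, y) + RtoC t * Ci))); auto.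
 2:{ intros; rewrite !Cpair, !RtoC_plus; ring. }
 rewrite (CI_ext (fun t => p + q * (x, (y+t)%R)) (fun t => p + q * ((x, y) + RtoC t * Ci))); auto.
 2:{ intros; rewrite !Cpair, !RtoC_plus; ring. }
 rewrite !L by auto. rewrite !Cpair, !RtoC_plus. ring.
Qed.

(** Produces the nested rectangles of Goursat's theorem; the invariant [I] may depend on the
    stage. *)
Lemma dependent_choice {A : Type} (I : nat -> A -> Prop) (Q : nat -> A -> A -> Prop) (a0 : A) :
  I 0%nat a0 -> (forall n a, I n a -> exists a', I (S n) a' /\ Q n a a') ->
  exists u : nat -> A, u 0%nat = a0 /\ forall n, I n (u n) /\ Q n (u n) (u (S n)).
Proof.
 intros H0 HS. assert (step : forall n (p : {a | I n a}), {a' : {a | I (S n) a} | Q n (proj1_sig p) (proj1_sig a')}).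
 { intros n [a Ha]. apply constructive_indefinite_description. destruct (HS n a Ha) as (a' & H1 & H2). exists (exist _ a' H1). exact H2. }
 set (F := fix F n : {a | I n a} := match n with O => exist _ a0 H0 | S m => proj1_sig (step m (F m)) end). exists (fun n => proj1_sig (F n)).
 split; [reflexivity|]. split; [apply (proj2_sig (F n))|]. exact (proj2_sig (step n (F n))).
Qed.

Lemma nested_limit (u : nat -> R) (l : nat -> R) :
  (forall n, u n <= u (S n) /\ u (S n) + l (S n) <= u n + l n /\ 0 <= l n)%R ->
  exists x, forall n, u n <= x <= u n + l n.
Proof.
 intros H. assert (M1 : forall n m, (n <= m)%nat -> u n <= u m).
 { induction 1; [lra|]. specialize (H m). lra. }
 assert (M2 : forall n m, (n <= m)%nat -> u m + l m <= u n + l n).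
 { induction 1; [lra|]. specialize (H m). lra. }
 assert (U : forall n m, u n <= u m + l m).
 { intros n m. destruct (Nat.le_ge_cases n m) as [L|L].
  - specialize (M1 _ _ L). specialize (H m). lra.
  - specialize (M2 _ _ L). specialize (H n). lra. }
 destruct (completeness (fun r => exists n, r = u n)) as [x [X1 X2]].
 - exists (u 0%nat + l 0%nat)%R. intros r [n ->]. apply U.
 - exists (u 0%nat); exists 0%nat; reflexivity.
 - exists x. split; [apply X1; exists n; reflexivity|]. apply X2. intros r [m ->]. apply U.
Qed.

Lemma hol_cont_rect f x y a b : (forall z, crect x y a b z -> exists l, cder f z l) -> cont_rect f x y a b.
Proof. intros H z Hz. destruct (H z Hz) as [l Hl]. apply (cder_cont _ _ _ Hl). Qed.

Lemma RI_quarter f x y a b : 0 <= a -> 0 <= b -> cont_rect f x y a b ->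
  exists x' y', (x' = x \/ x' = x + a/2)%R /\ (y' = y \/ y' = y + b/2)%R /\
   (Cmod (RI f x y a b) <= 4 * Cmod (RI f x' y' (a/2) (b/2)))%R.
Proof.
 intros Ha Hb H.
 assert (E : RI f x y a b = (RI f x y (a/2) (b/2) + RI f (x+a/2) y (a/2) (b/2)) + (RI f x (y+b/2) (a/2) (b/2) + RI f (x+a/2) (y+b/2) (a/2) (b/2))).
 { replace a with (a/2 + a/2)%R at 1 by field. replace b with (b/2+b/2)%R at 1 by field.
  rewrite RI_split_v by (try lra; intros z Hz; apply H; unfold crect in *; lra).
  rewrite !RI_split_h by (try lra; intros z Hz; apply H; unfold crect in *; lra). reflexivity. }
 set (e := Cmod (RI f x y a b)) in *. destruct (Rle_dec e (4 * Cmod (RI f x y (a/2) (b/2)))) as [L1|L1].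
 { exists x, y; auto. }
 destruct (Rle_dec e (4 * Cmod (RI f (x+a/2) y (a/2) (b/2)))) as [L2|L2].
 { exists (x+a/2)%R, y; auto. }
 destruct (Rle_dec e (4 * Cmod (RI f x (y+b/2) (a/2) (b/2)))) as [L3|L3].
 { exists x, (y+b/2)%R; auto. }
 exists (x+a/2)%R, (y+b/2)%R; repeat split; auto. unfold e in *. rewrite E in *.
 match goal with |- (Cmod (?A + ?B + (?C + ?D)) <= _) => pose proof (Cmod_triangle (A + B) (C + D)); pose proof (Cmod_triangle A B); pose proof (Cmod_triangle C D) end.
 lra.
Qed.

Theorem goursat f x y a b : 0 <= a -> 0 <= b ->
  (forall z, crect x y a b z -> exists l, cder f z l) -> RI f x y a b = 0.
Proof.
 intros Ha Hb H.
 (* [I] describes a rectangle of generation n that carries at least the fraction 4^(-n) of the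
    integral, [Q] the nesting of consecutive generations. *)
 set (I := fun n (p : R * R) => (x <= fst p /\ fst p + a / 2^n <= x + a /\ y <= snd p /\ snd p + b/2^n <= y + b) /\ Cmod (RI f x y a b) <= 4^n * Cmod (RI f (fst p) (snd p) (a/2^n) (b/2^n))).
 set (Q := fun n (p p' : R * R) => (fst p <= fst p' /\ fst p' + a/2^(S n) <= fst p + a/2^n /\ snd p <= snd p' /\ snd p' + b/2^(S n) <= snd p + b/2^n)).
 assert (P2 : forall n, 0 < 2^n) by (intros; apply pow_lt; lra). assert (AP : forall n c, (0 <= c -> 0 <= c/2^n)%R).
 { intros n c Hc. apply Rmult_le_pos; auto. left; apply Rinv_0_lt_compat, P2. }
 destruct (dependent_choice I Q (x,y)) as (u & U0 & U).
 - unfold I; simpl. rewrite !Rdiv_1_r. lra.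
 - intros n [x1 y1] [Hin Hle]. simpl in Hin, Hle. assert (A1 := AP n a Ha). assert (B1 := AP n b Hb).
  assert (Ea : (a / 2^(S n) = a/2^n/2)%R) by (simpl; field; apply pow_nonzero; lra).
  assert (Eb : (b / 2^(S n) = b/2^n/2)%R) by (simpl; field; apply pow_nonzero; lra).
  destruct (RI_quarter f x1 y1 (a/2^n) (b/2^n)) as (x' & y' & Hx & Hy & L); auto.
  { apply hol_cont_rect. intros z Hz; apply H. unfold crect in *; lra. }
  exists (x', y'). unfold I, Q. cbn [fst snd]. rewrite Ea, Eb. simpl pow. assert (P4 : 0 < 4^n) by (apply pow_lt; lra). nra.
 - destruct (nested_limit (fun n => fst (u n)) (fun n => (a/2^n)%R)) as [xs Hxs].
  { intros n. destruct (U n) as [_ V]. unfold Q in V. repeat split; try lra. auto. }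
  destruct (nested_limit (fun n => snd (u n)) (fun n => (b/2^n)%R)) as [ys Hys].
  { intros n. destruct (U n) as [_ V]. unfold Q in V. repeat split; try lra. auto. }
  destruct (H (xs, ys)) as [l Hl].
  { specialize (Hxs 0%nat). specialize (Hys 0%nat). rewrite U0 in Hxs, Hys. simpl in *. unfold crect, Re, Im; simpl. lra. }
  set (e0 := Cmod (RI f x y a b)). destruct (Req_dec e0 0) as [E|N]; [apply Cmod_eq_0; exact E|exfalso].
  assert (e0pos : 0 < e0) by (pose proof (Cmod_ge_0 (RI f x y a b)); unfold e0 in *; lra). set (L := (a + b + 1)%R).
  (* With this [eps] the final bound 2 (a + b) eps L for the whole integral is at most e0 / 2. *)
  set (eps := (e0 / (4 * (L * L)))%R). assert (LP : 0 < L) by (unfold L; lra). assert (epos : 0 < eps).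
  { apply Rdiv_lt_0_compat; auto. nra. }
  destruct (Hl eps epos) as (d & Hd & K). destruct (pow_lt_1_zero (1/2)%R) with (y := (d / L)%R) as [n Hn].
  { rewrite Rabs_pos_eq; lra. }
  { apply Rdiv_lt_0_compat; lra. }
  specialize (Hn n (le_n n)). rewrite Rabs_pos_eq in Hn by (apply pow_le; lra). destruct (U n) as [[Uin Ule] _]. specialize (Hxs n).
  specialize (Hys n). set (x1 := fst (u n)) in *. set (y1 := snd (u n)) in *. set (an := (a/2^n)%R) in *. set (bn := (b/2^n)%R) in *.
  assert (An : 0 <= an) by lra. assert (Bn : 0 <= bn) by lra. set (t := ((1/2)^n)%R) in *. assert (Et : (t = / 2^n)%R).
  { unfold t. replace (1/2)%R with (/2)%R by field. apply pow_inv. }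
  assert (Ean : an = (a * t)%R) by (unfold an, Rdiv; rewrite Et; reflexivity).
  assert (Ebn : bn = (b * t)%R) by (unfold bn, Rdiv; rewrite Et; reflexivity). assert (tpos : 0 < t) by (unfold t; apply pow_lt; lra).
  assert (tL : L * t < d).
  { apply Rlt_le_trans with (L * (d/L))%R; [nra|right; field; lra]. }
  assert (clos : forall z, crect x1 y1 an bn z -> Cmod (z - (xs, ys)) <= L * t).
  { intros z Hz. eapply Rle_trans; [apply Cmod_le_Re_Im|]. replace (Re (z - (xs,ys))) with (Re z - xs)%R by reflexivity.
   replace (Im (z - (xs,ys))) with (Im z - ys)%R by reflexivity. unfold crect in Hz. assert (Rabs (Re z - xs) <= an) by (apply Rabs_le; lra).
   assert (Rabs (Im z - ys) <= bn) by (apply Rabs_le; lra). unfold L. nra. }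
  assert (CR : cont_rect f x1 y1 an bn).
  { apply hol_cont_rect. intros z Hz; apply H. unfold crect in *; lra. }
  (* Subtracting the first-order expansion of [f] at the common point leaves the integral unchanged,
     by [RI_affine], and makes the integrand small. *)
  set (g := fun z => f z + (- (f (xs,ys) - l * (xs,ys)) + (- l) * z)).
  assert (CRa : cont_rect (fun z => - (f (xs,ys) - l * (xs,ys)) + (- l) * z) x1 y1 an bn).
  { intros z _. apply ccont_plus; [apply ccont_const|apply ccont_mult; [apply ccont_const|apply ccont_id]]. }
  assert (E : RI f x1 y1 an bn = RI g x1 y1 an bn).
  { unfold g. rewrite RI_plus, RI_affine by (auto using cont_rect_b). ring. }
  assert (B : Cmod (RI g x1 y1 an bn) <= 2 * (an + bn) * (eps * (L * t))).
  { apply RI_bound; auto.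
   - intros z [Hz _]. apply ccont_plus; auto.
   - intros z [Hz _]. assert (Q1 := clos z Hz). assert (Q2 := K z ltac:(lra)).
    replace (g z) with (f z - f (xs,ys) - l * (z - (xs,ys))) by (unfold g; ring). nra. }
  rewrite E in Ule. fold e0 in Ule. assert (T4 : (4^n * (t * t) = 1)%R).
  { rewrite Et, <- Rinv_mult, <- pow_add, <- (Rmult_1_r 4). replace (n + n)%nat with (2 * n)%nat by lia. rewrite pow_mult.
   replace (2^2)%R with (4*1)%R by ring. apply Rinv_r, pow_nonzero; lra. }
  assert (P4 : 0 < 4^n) by nra. assert (F1 : e0 <= 4^n * (2 * (an + bn) * (eps * (L * t)))).
  { nra. }
  assert (F2 : (4^n * (2 * (an + bn) * (eps * (L * t))) = 2 * (a+b) * eps * L * (4^n * (t*t)))%R).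
  { nra. }
  rewrite F2, T4 in F1. assert (F3 : 2 * (a + b) * eps * L <= 2 * L * eps * L).
  { apply Rmult_le_compat_r; [lra|]. unfold L; lra. }
  assert (F4 : (2 * L * eps * L = e0/2)%R).
  { unfold eps; field; lra. }
  lra.
Qed.

(** * Thin sets: counting the cells met by a curve *)

Fixpoint rsum (f : nat -> R) (n : nat) : R :=
  match n with O => 0%R | S m => (rsum f m + f m)%R end.

Lemma rsum_le f g n : (forall i, (i < n)%nat -> f i <= g i) -> (rsum f n <= rsum g n)%R.
Proof. induction n as [|n IH]; intros H; simpl; [lra|]. assert (f n <= g n) by auto. assert (rsum f n <= rsum g n)%R by auto. lra. Qed.

Lemma rsum_plus f g n : rsum (fun i => f i + g i)%R n = (rsum f n + rsum g n)%R.
Proof. induction n as [|n IH]; simpl; [ring|lra]. Qed.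

Lemma rsum_scal c f n : rsum (fun i => c * f i)%R n = (c * rsum f n)%R.
Proof. induction n as [|n IH]; simpl; [ring|lra]. Qed.

Lemma rsum_const c n : rsum (fun _ => c) n = (INR n * c)%R.
Proof. induction n as [|n IH]; [simpl; ring|]. rewrite S_INR; simpl; rewrite IH; ring. Qed.

Lemma rsum_ext f g n : (forall i, (i < n)%nat -> f i = g i) -> rsum f n = rsum g n.
Proof. induction n as [|n IH]; intros H; simpl; auto. rewrite IH, H; auto. Qed.

Lemma rsum_swap (f : nat -> nat -> R) n m :
  rsum (fun i => rsum (fun j => f i j) m) n = rsum (fun j => rsum (fun i => f i j) n) m.
Proof.
 induction n as [|n IH]; simpl.
 - rewrite rsum_const; ring.
 - rewrite IH, <- rsum_plus. reflexivity.
Qed.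

Lemma rsum_pos f n : (forall i, (i < n)%nat -> 0 <= f i) -> (0 <= rsum f n)%R.
Proof. intros H. rewrite <- (Rmult_0_r (INR n)), <- rsum_const. apply rsum_le; auto. Qed.

Definition indic (P : Prop) : R := if dec P then 1%R else 0%R.

Lemma indic_true P : P -> indic P = 1%R.
Proof. unfold indic; destruct (dec P); tauto. Qed.
Lemma indic_false P : ~ P -> indic P = 0%R.
Proof. unfold indic; destruct (dec P); tauto. Qed.
Lemma indic_bounds P : 0 <= indic P <= 1.
Proof. unfold indic; destruct (dec P); lra. Qed.
Lemma indic_le (P Q : Prop) : (P -> Q) -> indic P <= indic Q.
Proof. unfold indic; destruct (dec P), (dec Q); try lra; tauto. Qed.

Lemma RI_grid_row f x y a b n : 0 <= a -> 0 <= b -> cont_rect f x y (INR n * a) b ->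
  (Cmod (RI f x y (INR n * a) b) <= rsum (fun i => Cmod (RI f (x + INR i * a) y a b)) n)%R.
Proof.
 intros Ha Hb. induction n as [|n IH]; intros H.
 - rewrite Rmult_0_l. simpl. unfold RI. rewrite Rplus_0_r, !CI_zero_len.
  replace (0 + Ci * CI (fun t => f (x, (y + t)%R)) 0 b - 0 - Ci * CI (fun t => f (x, (y + t)%R)) 0 b) with (RtoC 0) by ring. rewrite Cmod_0; lra.
 - assert (Hn := pos_INR n). rewrite S_INR, Rmult_plus_distr_r, Rmult_1_l in *. rewrite RI_split_h; auto; [|nra].
  eapply Rle_trans; [apply Cmod_triangle|]. simpl. assert (Cmod (RI f x y (INR n * a) b) <= rsum (fun i => Cmod (RI f (x + INR i * a) y a b)) n)%R.
  { apply IH. intros z Hz; apply H. unfold crect in *. lra. }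
  lra.
Qed.

Lemma RI_grid f x y a b n : 0 <= a -> 0 <= b -> cont_rect f x y (INR n * a) (INR n * b) ->
  (Cmod (RI f x y (INR n * a) (INR n * b)) <=
   rsum (fun j => rsum (fun i => Cmod (RI f (x + INR i * a) (y + INR j * b) a b)) n) n)%R.
Proof.
 intros Ha Hb H.
 assert (G : forall m, (m <= n)%nat -> (Cmod (RI f x y (INR n * a) (INR m * b)) <= rsum (fun j => rsum (fun i => Cmod (RI f (x + INR i * a) (y + INR j * b) a b)) n) m)%R).
 { induction m as [|m IH]; intros Hm.
  - rewrite Rmult_0_l. simpl. unfold RI. rewrite Rplus_0_r, !CI_zero_len. match goal with |- (Cmod ?X <= _) => replace X with (RtoC 0) by ring end.
   rewrite Cmod_0; lra.
  - assert (Hn := pos_INR m). assert (Hn' := pos_INR n). assert (Hmn : INR (S m) <= INR n) by (apply le_INR; auto).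
   assert (S1 : INR (S m) * b <= INR n * b) by nra. assert (S2 : 0 <= INR m * b) by nra. assert (S3 : 0 <= INR n * a) by nra.
   rewrite S_INR, Rmult_plus_distr_r, Rmult_1_l in *. rewrite RI_split_v; auto; [|intros z Hz; apply H; unfold crect in *; lra].
   eapply Rle_trans; [apply Cmod_triangle|]. simpl.
   assert (Cmod (RI f x (y + INR m * b) (INR n * a) b) <= rsum (fun i => Cmod (RI f (x + INR i * a) (y + INR m * b) a b)) n)%R.
   { apply RI_grid_row; auto. intros z Hz; apply H; unfold crect in *; lra. }
   assert (IH' := IH ltac:(lia)). lra. }
 apply G; lia.
Qed.

Definition hits (E : C -> Prop) (x y s : R) (i j : nat) : Prop :=
  exists z, E z /\ crect (x + INR i * s) (y + INR j * s) s s z.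

(* [E] meets only O(n) of the n^2 cells of a subdivision of any square: the
   property of a rectifiable curve that makes it removable for continuous functions. *)
Definition thin (E : C -> Prop) : Prop :=
  forall x y L : R, 0 < L -> exists K : R, forall n : nat, (0 < n)%nat ->
    (rsum (fun j => rsum (fun i => indic (hits E x y (L / INR n) i j)) n) n <= K * INR n)%R.

Lemma thin_sub E E' : (forall z, E z -> E' z) -> thin E' -> thin E.
Proof.
 intros S H x y L HL. destruct (H x y L HL) as [K HK]. exists K. intros n Hn. eapply Rle_trans; [|auto].
 apply rsum_le; intros j _; apply rsum_le; intros i _. apply indic_le. intros (z & Hz & Hz'); exists z; auto.
Qed.

Lemma thin_union E E' : thin E -> thin E' -> thin (fun z => E z \/ E' z).
Proof.
 intros H H' x y L HL. destruct (H x y L HL) as [K HK], (H' x y L HL) as [K' HK']. exists (K + K')%R. intros n Hn. specialize (HK n Hn).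
 specialize (HK' n Hn). rewrite Rmult_plus_distr_r. eapply Rle_trans; [|apply Rplus_le_compat; eassumption]. rewrite <- rsum_plus.
 apply rsum_le; intros j _. rewrite <- rsum_plus. apply rsum_le; intros i _. set (A := hits E x y (L / INR n) i j).
 set (B := hits E' x y (L / INR n) i j). destruct (classic A) as [a|a]; [|destruct (classic B) as [b|b]].
 - rewrite (indic_true A) by auto. pose proof (indic_bounds B). pose proof (indic_bounds (hits (fun z => E z \/ E' z) x y (L / INR n) i j)). lra.
 - rewrite (indic_true B) by auto. pose proof (indic_bounds A). pose proof (indic_bounds (hits (fun z => E z \/ E' z) x y (L / INR n) i j)). lra.
 - rewrite indic_false.
  { pose proof (indic_bounds A); pose proof (indic_bounds B); lra. }
  intros (z & [Hz|Hz] & Hz'); [apply a|apply b]; exists z; auto.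
Qed.

Lemma count_close (X c : R) n : 0 <= c -> (rsum (fun i => indic (Rabs (INR i - X) <= c)) n <= 2 * c + 1)%R.
Proof.
 (* The induction needs the window truncated at n - 1, so that a step adds 1 only when the new
    integer lies in it. *)
 intros Hc. assert (G : (rsum (fun i => indic (Rabs (INR i - X) <= c)) n <= Rmax 0 (Rmin (INR n - 1) (X + c) - (X - c) + 1))%R).
 { induction n as [|n IH]; [apply Rmax_l|]. simpl rsum. rewrite S_INR. destruct (classic (Rabs (INR n - X) <= c)) as [H|H].
  - rewrite indic_true by auto. apply Rabs_le_between in H. unfold Rmax, Rmin in *.
   destruct (Rle_dec (INR n - 1) (X + c)); repeat match goal with |- context [Rle_dec ?a ?b] => destruct (Rle_dec a b) end; repeat match goal with H : context [Rle_dec ?a ?b] |- _ => destruct (Rle_dec a b) end; lra.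
  - rewrite indic_false by auto. rewrite Rplus_0_r. eapply Rle_trans; [exact IH|]. apply Rle_max_compat_l.
   assert (Rmin (INR n - 1) (X+c) <= Rmin (INR n + 1 - 1) (X+c)).
   { apply Rle_min_compat_r. lra. }
   lra. }
 eapply Rle_trans; [exact G|]. apply Rmax_lub; [lra|]. assert (Rmin (INR n - 1) (X+c) <= X + c) by apply Rmin_r. lra.
Qed.

(** Sample the curve at n points: a cell met by the curve is within [c] cells of some sample in both
    coordinates, and each sample is that close to at most (2 c + 1)^2 cells. *)
Lemma thin_lipschitz (g : R -> C) (A B M : R) (E : C -> Prop) : A < B -> 0 <= M ->
  (forall s t, A <= s <= B -> A <= t <= B -> Cmod (g s - g t) <= M * Rabs (s - t)) ->
  (forall z, E z -> exists s, A <= s <= B /\ z = g s) -> thin E.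
Proof.
 intros HAB HM Lip HE x y L HL. set (c := (1 + M * (B - A) / L)%R). assert (Hc : 0 <= c).
 { unfold c. assert (0 <= M * (B - A) / L); [|lra]. apply Rmult_le_pos; [nra|left; apply Rinv_0_lt_compat; lra]. }
 exists ((2 * c + 1) * (2 * c + 1))%R. intros n Hn. assert (Pn : 0 < INR n) by (apply lt_0_INR; auto). set (s := (L / INR n)%R).
 assert (Ps : 0 < s) by (apply Rdiv_lt_0_compat; auto). set (tk := fun k : nat => (A + INR k * ((B - A) / INR n))%R).
 set (X := fun k => ((Re (g (tk k)) - x) / s)%R). set (Y := fun k => ((Im (g (tk k)) - y) / s)%R).
 assert (Ptk : forall k, (k < n)%nat -> A <= tk k <= B).
 { intros k Hk. unfold tk. assert (INR k <= INR n) by (apply le_INR; lia). pose proof (pos_INR k).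
  assert (INR n * ((B-A)/INR n) = B - A)%R by (field; lra). nra. }
 assert (CV : forall i j, hits E x y s i j -> exists k, (k < n)%nat /\ Rabs (INR i - X k) <= c /\ Rabs (INR j - Y k) <= c).
 { intros i j (z & Hz & Hr). destruct (HE z Hz) as (t & Ht & ->). assert (Hk : exists k, (k < n)%nat /\ tk k <= t <= tk k + (B-A)/INR n).
  { set (h := ((B - A)/INR n)%R).
   assert (G : forall m, (m <= n)%nat -> (0 < m)%nat -> t <= A + INR m * h -> exists k, (k < m)%nat /\ A + INR k * h <= t <= A + INR k * h + h).
   { induction m as [|m IH]; intros Hm Pm Hle; [lia|]. destruct (Rle_dec (A + INR m * h) t) as [Q|Q].
    - exists m; split; [lia|]. rewrite S_INR in Hle. split; lra.
    - destruct m as [|m]; [simpl in Q; lra|]. destruct IH as (k & Hk & Hk'); [lia|lia|lra|]. exists k; split; [lia|auto]. }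
   destruct (G n (le_n n) Hn) as (k & Hk & Hk').
   { replace (A + INR n * h)%R with B; [lra|unfold h; field; lra]. }
   exists k; auto. }
  destruct Hk as (k & Hk & Hkt). exists k; split; auto. assert (D : Cmod (g t - g (tk k)) <= M * ((B-A)/INR n)).
  { eapply Rle_trans; [auto|]. apply Rmult_le_compat_l; auto. apply Rabs_le; lra. }
  assert (Dx := Rabs_Re_le (g t - g (tk k))). assert (Dy := Rabs_Im_le (g t - g (tk k))).
  replace (Re (g t - g (tk k))) with (Re (g t) - Re (g (tk k)))%R in Dx by reflexivity.
  replace (Im (g t - g (tk k))) with (Im (g t) - Im (g (tk k)))%R in Dy by reflexivity. unfold crect in Hr.
  assert (Ec : (c * s = s + M * ((B-A)/INR n))%R) by (unfold c, s; field; lra).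
  assert (DD := Rabs_le_between (Re (g t) - Re (g (tk k))) (M * ((B - A) / INR n))).
  assert (DD' := Rabs_le_between (Im (g t) - Im (g (tk k))) (M * ((B - A) / INR n))). split.
  - apply (Rmult_le_reg_r s); auto. rewrite <- (Rabs_pos_eq s) at 1 by lra. rewrite <- Rabs_mult.
   replace ((INR i - X k) * s)%R with (INR i * s + x - Re (g (tk k)))%R by (unfold X; field; lra). apply Rabs_le; lra.
  - apply (Rmult_le_reg_r s); auto. rewrite <- (Rabs_pos_eq s) at 1 by lra. rewrite <- Rabs_mult.
   replace ((INR j - Y k) * s)%R with (INR j * s + y - Im (g (tk k)))%R by (unfold Y; field; lra). apply Rabs_le; lra. }
 apply Rle_trans with (rsum (fun j => rsum (fun i => rsum (fun k => indic (Rabs (INR i - X k) <= c) * indic (Rabs (INR j - Y k) <= c))%R n) n) n).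
 { apply rsum_le; intros j _; apply rsum_le; intros i _. destruct (classic (hits E x y s i j)) as [h|h].
  - destruct (CV i j h) as (k & Hk & H1 & H2). assert (T : forall f m, (forall q, 0 <= f q) -> (k < m)%nat -> (f k <= rsum f m)%R).
   { intros f m Pf. induction m as [|m IH]; intros Hkm; [lia|]. simpl. destruct (Nat.eq_dec k m) as [->|Ne].
    - assert (0 <= rsum f m)%R by (apply rsum_pos; auto). lra.
    - assert (f k <= rsum f m)%R by (apply IH; lia). specialize (Pf m). lra. }
   eapply Rle_trans; [|apply (T (fun k => indic (Rabs (INR i - X k) <= c) * indic (Rabs (INR j - Y k) <= c))%R)]; auto.
   + rewrite !indic_true by auto. lra.
   + intros q. apply Rmult_le_pos; apply indic_bounds.
  - rewrite indic_false by auto. apply rsum_pos; intros q _. apply Rmult_le_pos; apply indic_bounds. }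
 rewrite (rsum_ext _ (fun j => rsum (fun k => rsum (fun i => indic (Rabs (INR i - X k) <= c) * indic (Rabs (INR j - Y k) <= c))%R n) n)).
 2:{ intros j _. apply rsum_swap. }
 rewrite rsum_swap. apply Rle_trans with (rsum (fun _ => (2 * c + 1) * (2 * c + 1))%R n); [|rewrite rsum_const; lra]. apply rsum_le; intros k _.
 apply Rle_trans with (rsum (fun j => (2 * c + 1) * indic (Rabs (INR j - Y k) <= c))%R n).
 { apply rsum_le; intros j _.
  rewrite (rsum_ext _ (fun i => indic (Rabs (INR j - Y k) <= c) * indic (Rabs (INR i - X k) <= c))%R) by (intros; ring).
  rewrite rsum_scal, Rmult_comm. apply Rmult_le_compat_r; [apply indic_bounds|apply count_close; auto]. }
 rewrite rsum_scal. apply Rmult_le_compat_l; [lra|apply count_close; auto].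
Qed.

Lemma thin_point p : thin (fun z => z = p).
Proof.
 apply (thin_lipschitz (fun _ => p) 0 1 0); try lra.
 - intros. rewrite Cmod_sub_diag; lra.
 - exists 0%R; split; [lra|auto].
Qed.

Lemma thin_empty : thin (fun _ => False).
Proof. apply thin_sub with (fun z : C => z = RtoC 0); [tauto|apply thin_point]. Qed.

Lemma thin_segment p q : thin (on_segment p q).
Proof.
 apply (thin_lipschitz (fun s => segment_path p q s) 0 1 (Cmod (q - p))); try lra.
 - apply Cmod_ge_0.
 - intros s t _ _. unfold segment_path. replace (p + s * (q - p) - (p + t * (q - p))) with (RtoC (s - t) * (q - p)).
  + rewrite Cmod_mult, Cmod_R. lra.
  + rewrite RtoC_minus. ring.
 - auto.
Qed.

(** If [E] contained a disc, all n^2 cells of a square inside it would be met, against the bound K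
    n. *)
Lemma thin_dense E : thin E -> forall z d, 0 < d -> exists w, Cmod (w - z) < d /\ ~ E w.
Proof.
 intros H z d Hd. apply NNPP. intros N. assert (A : forall w, Cmod (w - z) < d -> E w).
 { intros w Hw. apply NNPP. intros Q. apply N. exists w; auto. }
 destruct (H (Re z) (Im z) (d/2)%R) as [K HK]; [lra|]. destruct (nfloor_ex (Rmax K 1)) as [m Hm].
 { apply Rle_trans with 1%R; [lra|apply Rmax_r]. }
 set (n := S (S m)). specialize (HK n ltac:(unfold n; lia)). assert (Pn : 0 < INR n) by (apply lt_0_INR; unfold n; lia).
 assert (Kn : K < INR n).
 { unfold n. rewrite S_INR, S_INR. pose proof (Rmax_l K 1). lra. }
 rewrite (rsum_ext _ (fun _ => INR n)) in HK.
 2:{ intros j Hj. rewrite (rsum_ext _ (fun _ => 1%R)).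
  - rewrite rsum_const; ring.
  - intros i Hi. apply indic_true. set (s := (d/2/INR n)%R). assert (Ps : 0 < s) by (apply Rdiv_lt_0_compat; lra).
   exists ((Re z + INR i * s)%R, (Im z + INR j * s)%R). split.
   + apply A. eapply Rle_lt_trans; [apply Cmod_le_Re_Im|].
    replace (Re (((Re z + INR i * s)%R, (Im z + INR j * s)%R) - z)) with (INR i * s)%R by (unfold Re, Cminus, Cplus, Copp; simpl; ring).
    replace (Im (((Re z + INR i * s)%R, (Im z + INR j * s)%R) - z)) with (INR j * s)%R by (unfold Im, Cminus, Cplus, Copp; simpl; ring).
    pose proof (pos_INR i); pose proof (pos_INR j). rewrite !Rabs_pos_eq by nra. assert (INR i < INR n) by (apply lt_INR; auto).
    assert (INR j < INR n) by (apply lt_INR; auto). assert (INR n * s = d/2)%R by (unfold s; field; lra). nra.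
   + unfold crect, Re, Im; simpl. lra. }
 rewrite rsum_const in HK. nra.
Qed.

(** * Cauchy's theorem with thin exceptional sets *)

Lemma unif_cont_rect f x y a b : cont_rect f x y a b -> forall e, 0 < e -> exists d, 0 < d /\
  forall z w, crect x y a b z -> crect x y a b w -> Cmod (z - w) < d -> Cmod (f z - f w) < e.
Proof.
 intros H e He.
 assert (D : forall u v : R, {d : posreal | crect x y a b (u, v) -> forall w, Cmod (w - (u,v)) < 3 * d -> (Cmod (f w - f (u,v)) < e/2)}).
 { intros u v. apply constructive_indefinite_description. destruct (classic (crect x y a b (u,v))) as [Q|Q].
  - destruct (H _ Q (e/2)%R) as (d & Hd & K); [lra|]. exists (mkposreal (d/3) ltac:(lra)). intros _ w Hw. apply K. simpl in Hw. lra.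
  - exists (mkposreal 1 Rlt_0_1). tauto. }
 destruct (compactness_value_2d x (x + a) y (y + b) (fun u v => proj1_sig (D u v))) as [d Hd]. exists d; split; [apply cond_pos|].
 intros z w Hz Hw Hzw. apply NNPP. intros N. apply (Hd (Re z) (Im z)); [apply Hz|apply Hz|]. intros (u & v & Hu & Hv & H1 & H2 & H3). apply N.
 destruct (D u v) as [d' Hd']. cbn [proj1_sig] in *. specialize (Hd' ltac:(split; assumption)). assert (C1 : Cmod (z - (u,v)) < 2 * d').
 { eapply Rle_lt_trans; [apply Cmod_le_Re_Im|]. replace (Re (z - (u,v))) with (Re z - u)%R by reflexivity.
  replace (Im (z - (u,v))) with (Im z - v)%R by reflexivity. lra. }
 assert (C2 : Cmod (w - (u,v)) < 3 * d').
 { eapply Rle_lt_trans; [apply (Cmod_tri3 _ z)|]. rewrite (Cmod_sub_sym w z). lra. }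
 assert (Pd := cond_pos d'). eapply Rle_lt_trans; [apply (Cmod_tri3 _ (f (u,v)))|]. rewrite (Cmod_sub_sym (f (u,v)) (f w)).
 assert (K1 := Hd' z ltac:(lra)). assert (K2 := Hd' w C2). lra.
Qed.

(** Cells that avoid [E] contribute nothing, by Goursat. The others number at most K n, and each
    contributes at most its perimeter 4 L / n times the oscillation of [f], which tends to 0. *)
Theorem painleve_goursat f E x y L : 0 < L -> thin E -> cont_rect f x y L L ->
  (forall z, crect x y L L z -> ~ E z -> exists l, cder f z l) -> RI f x y L L = 0.
Proof.
 intros HL HE HC HD. destruct (HE x y L HL) as [K HK]. assert (K0 : 0 <= K).
 { specialize (HK 1%nat ltac:(lia)). simpl in HK. pose proof (indic_bounds (hits E x y (L/1) 0 0)). lra. }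
 apply Cmod_eq_0. apply Rle_antisym; [|apply Cmod_ge_0]. apply Rnot_lt_le. intros P. set (e0 := Cmod (RI f x y L L)) in *.
 set (e := (e0 / (8 * (L * (K + 1))))%R). assert (He : 0 < e).
 { apply Rdiv_lt_0_compat; auto. nra. }
 destruct (unif_cont_rect f x y L L HC e He) as (d & Hd & UC). destruct (nfloor_ex (2 * L / d)%R) as [m Hm].
 { apply Rmult_le_pos; [lra|left; apply Rinv_0_lt_compat; lra]. }
 set (n := S m). assert (Pn : 0 < INR n) by (apply lt_0_INR; unfold n; lia). set (s := (L / INR n)%R).
 assert (Ps : 0 < s) by (apply Rdiv_lt_0_compat; auto). assert (Es : (INR n * s = L)%R) by (unfold s; field; lra). assert (sd : 2 * s < d).
 { apply (Rmult_lt_reg_l (INR n)); auto. replace (INR n * (2 * s))%R with (2 * L)%R by lra.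
  apply Rle_lt_trans with ((2 * L / d) * d)%R; [right; field; lra|]. apply Rmult_lt_compat_r; auto. unfold n; rewrite S_INR; lra. }
 assert (G := RI_grid f x y s s n ltac:(lra) ltac:(lra)). rewrite Es in G. specialize (G HC).
 assert (B : (e0 <= rsum (fun j => rsum (fun i => 4 * s * e * indic (hits E x y (L/INR n) i j))%R n) n)%R).
 { eapply Rle_trans; [exact G|]. apply rsum_le; intros j Hj; apply rsum_le; intros i Hi.
  assert (Ii : INR i + 1 <= INR n) by (rewrite <- S_INR; apply le_INR; lia).
  assert (Ij : INR j + 1 <= INR n) by (rewrite <- S_INR; apply le_INR; lia). pose proof (pos_INR i); pose proof (pos_INR j).
  assert (0 <= INR i * s) by nra. assert (0 <= INR j * s) by nra. assert ((INR i + 1) * s <= L) by nra. assert ((INR j + 1) * s <= L) by nra.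
  assert (Sub : forall z, crect (x + INR i * s) (y + INR j * s) s s z -> crect x y L L z).
  { intros z Hz. unfold crect in *. lra. }
  destruct (classic (hits E x y (L / INR n) i j)) as [h|h].
  - rewrite indic_true, Rmult_1_r by auto. set (p := ((x + INR i * s)%R, (y + INR j * s)%R) : C).
   assert (Hp : crect (x + INR i * s) (y + INR j * s) s s p) by (unfold crect, p, Re, Im; simpl; lra).
   assert (C1 : cont_rect f (x + INR i * s) (y + INR j * s) s s) by (intros z Hz; apply HC; auto).
   assert (EQ : RI f (x + INR i * s) (y + INR j * s) s s = RI (fun z => f z + (- f p + 0 * z)) (x + INR i * s) (y + INR j * s) s s).
   { rewrite RI_plus, RI_affine; try lra; [ring|apply cont_rect_b; auto|]. intros z _.
    apply ccont_plus; [apply ccont_const|apply ccont_mult; [apply ccont_const|apply ccont_id]]. }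
   rewrite EQ. replace (4 * s * e)%R with (2 * (s + s) * e)%R by ring. apply RI_bound; try lra.
   + intros z [Hz _]. apply ccont_plus; [auto|]. apply ccont_plus; [apply ccont_const|apply ccont_mult; [apply ccont_const|apply ccont_id]].
   + intros z [Hz _]. replace (f z + (- f p + 0 * z)) with (f z - f p) by ring. left. apply UC; auto. eapply Rle_lt_trans; [apply Cmod_le_Re_Im|].
    replace (Re (z - p)) with (Re z - (x + INR i * s))%R by reflexivity. replace (Im (z - p)) with (Im z - (y + INR j * s))%R by reflexivity.
    unfold crect in Hz. rewrite !Rabs_pos_eq by lra. lra.
  - rewrite goursat; try lra.
   + rewrite Cmod_0, indic_false by auto. lra.
   + intros z Hz. apply HD; auto. intros Ez. apply h. exists z; auto. }
 rewrite (rsum_ext _ (fun j => 4 * s * e * rsum (fun i => indic (hits E x y (L/INR n) i j)) n)%R) in B by (intros; apply rsum_scal).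
 rewrite rsum_scal in B. specialize (HK n ltac:(unfold n; lia)). assert (B2 : e0 <= 4 * s * e * (K * INR n)).
 { eapply Rle_trans; [exact B|]. apply Rmult_le_compat_l; auto. nra. }
 replace (4 * s * e * (K * INR n))%R with (4 * (INR n * s) * e * K)%R in B2 by ring. rewrite Es in B2.
 assert (4 * L * e * K <= 4 * L * e * (K+1)) by nra. assert (4 * L * e * (K + 1) = e0/2)%R by (unfold e; field; lra). lra.
Qed.

(** * Cauchy's formula and its consequences *)

Lemma is_RInt_FTC (F f : R -> R) a b :
  (forall t, is_derive F t (f t)) -> (forall t, continuous f t) -> is_RInt f a b (F b - F a)%R.
Proof. intros H1 H2. apply (is_RInt_derive (V := R_CompleteNormedModule) F f); auto. Qed.

Lemma sumsq_pos (u q : R) : (q <> 0)%R -> 0 < u * u + q * q.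
Proof. nra. Qed.

Lemma cont_rational1 (p q : R) : (q <> 0)%R -> forall t, continuous (fun t => (p + t) / ((p + t)^2 + q^2))%R t.
Proof. intros Hq t. apply (ex_derive_continuous (K := R_AbsRing) (V := R_NormedModule)). auto_derive. pose proof (sumsq_pos (p + t) q Hq). lra. Qed.

Lemma cont_rational2 (p q r : R) : (q <> 0)%R -> forall t, continuous (fun t => r / ((p + t)^2 + q^2))%R t.
Proof. intros Hq t. apply (ex_derive_continuous (K := R_AbsRing) (V := R_NormedModule)). auto_derive. pose proof (sumsq_pos (p + t) q Hq). lra. Qed.

Lemma side_h p q c : (q <> 0)%R ->
  CI (fun t => Cinv ((p + t)%R, q)) 0 c =
  ((ln ((p+c)^2+q^2) / 2 - ln ((p+0)^2+q^2) / 2)%R, (- atan ((p+c)/q) - - atan ((p+0)/q))%R).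
Proof.
 intros Hq. assert (Q := fun t => sumsq_pos (p + t) q Hq). apply is_CI_Re_Im.
 - apply (is_RInt_ext (V := R_NormedModule)) with (fun t => (p + t) / ((p+t)^2+q^2))%R; [reflexivity|].
  apply (is_RInt_FTC (fun t => ln ((p + t)^2 + q^2) / 2)%R).
  + intros t. specialize (Q t). auto_derive; [simpl; lra|]. simpl. lra.
  + apply cont_rational1; auto.
 - apply (is_RInt_ext (V := R_NormedModule)) with (fun t => - q / ((p+t)^2+q^2))%R; [reflexivity|].
  apply (is_RInt_FTC (fun t => - atan ((p + t) / q))%R).
  + intros t. specialize (Q t). auto_derive; auto. field. lra.
  + apply cont_rational2; auto.
Qed.

Lemma side_v p q c : (p <> 0)%R ->
  CI (fun t => Cinv (p, (q + t)%R)) 0 c =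
  ((atan ((q+c)/p) - atan ((q+0)/p))%R, (- (ln (p^2+(q+c)^2) / 2) - - (ln (p^2+(q+0)^2) / 2))%R).
Proof.
 intros Hp. assert (Q := fun t => sumsq_pos (q + t) p Hp). apply is_CI_Re_Im.
 - apply (is_RInt_ext (V := R_NormedModule)) with (fun t => p / ((q+t)^2+p^2))%R.
  { intros t _. specialize (Q t). unfold Re; simpl. field. lra. }
  apply (is_RInt_FTC (fun t => atan ((q + t) / p))%R).
  + intros t. specialize (Q t). auto_derive; auto. field. lra.
  + apply cont_rational2; auto.
 - apply (is_RInt_ext (V := R_NormedModule)) with (fun t => (-1) * ((q + t) / ((q+t)^2+p^2)))%R.
  { intros t _. specialize (Q t). unfold Im; simpl. field. lra. }
  apply (is_RInt_FTC (fun t => - (ln (p^2 + (q + t)^2) / 2))%R).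
  + intros t. specialize (Q t). auto_derive; [simpl; lra|]. field. lra.
  + intros t. apply (continuous_scal_r (V := R_NormedModule) (-1)%R). apply cont_rational1; auto.
Qed.

Lemma atan_quot (u v : R) : 0 < u -> 0 < v -> (atan (u / v) + atan (v / u) = PI / 2)%R.
Proof. intros Hu Hv. replace (u / v)%R with (/ (v / u))%R by (field; lra). rewrite atan_inv; [lra|apply Rdiv_lt_0_compat; auto]. Qed.

Definition orect (x y a b : R) (z : C) : Prop :=
  (x < Re z < x + a /\ y < Im z < y + b).

Definition twopii : C := RtoC (2 * PI) * Ci.

Lemma twopii_neq_0 : twopii <> 0.
Proof.
 apply Cmult_neq_0.
 - intros E. apply RtoC_inj in E. pose proof PI_RGT_0. lra.
 - intros E. apply (f_equal Im) in E. unfold Im, Ci, RtoC in E; simpl in E. lra.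
Qed.

(** The sides are integrated by explicit logarithms and arctangents. The logarithms cancel, and each
    corner contributes atan (u / v) + atan (v / u) = PI / 2. *)
Lemma RI_inv x y a b z0 : orect x y a b z0 -> RI (fun z => / (z - z0)) x y a b = twopii.
Proof.
 intros [[H1 H2] [H3 H4]]. destruct z0 as [x0 y0]; simpl in *. unfold RI.
 assert (E : forall u v, ((u, v) : C) - (x0, y0) = ((u - x0)%R, (v - y0)%R)) by reflexivity.
 rewrite (CI_ext (fun t => / (((x + t)%R, y) - (x0, y0))) (fun t => Cinv ((x - x0 + t)%R, (y - y0)%R))) by (try lra; intros; rewrite E; apply f_equal, injective_projections; simpl; ring).
 rewrite (CI_ext (fun t => / (((x + t)%R, (y+b)%R) - (x0, y0))) (fun t => Cinv ((x - x0 + t)%R, (y + b - y0)%R))) by (try lra; intros; rewrite E; apply f_equal, injective_projections; simpl; ring).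
 rewrite (CI_ext (fun t => / (((x + a)%R, (y+t)%R) - (x0, y0))) (fun t => Cinv ((x + a - x0)%R, (y - y0 + t)%R))) by (try lra; intros; rewrite E; apply f_equal, injective_projections; simpl; ring).
 rewrite (CI_ext (fun t => / ((x, (y+t)%R) - (x0, y0))) (fun t => Cinv ((x - x0)%R, (y - y0 + t)%R))) by (try lra; intros; rewrite E; apply f_equal, injective_projections; simpl; ring).
 rewrite !side_h, !side_v by lra. rewrite !Rplus_0_r. replace (x - x0 + a)%R with (x + a - x0)%R by ring.
 replace (y - y0 + b)%R with (y + b - y0)%R by ring. set (p1 := (x0 - x)%R). set (p2 := (x + a - x0)%R). set (q1 := (y0 - y)%R).
 set (q2 := (y + b - y0)%R). replace (x - x0)%R with (- p1)%R by (unfold p1; ring). replace (y - y0)%R with (- q1)%R by (unfold q1; ring).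
 assert (P1 : 0 < p1) by (unfold p1; lra). assert (P2 : 0 < p2) by (unfold p2; lra). assert (Q1 : 0 < q1) by (unfold q1; lra).
 assert (Q2 : 0 < q2) by (unfold q2; lra). replace (p2 / - q1)%R with (- (p2 / q1))%R by (field; lra).
 replace (- p1 / - q1)%R with (p1 / q1)%R by (field; lra). replace (- q1 / p2)%R with (- (q1 / p2))%R by lra.
 replace (- p1 / q2)%R with (- (p1 / q2))%R by lra. replace (- q1 / - p1)%R with (q1 / p1)%R by (field; lra).
 replace (q2 / - p1)%R with (- (q2 / p1))%R by (field; lra). rewrite !atan_opp. assert (A1 := atan_quot p1 q1 P1 Q1).
 assert (A2 := atan_quot p2 q1 P2 Q1). assert (A3 := atan_quot p1 q2 P1 Q2). assert (A4 := atan_quot p2 q2 P2 Q2).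
 apply injective_projections; cbn -[atan ln PI pow]; lra.
Qed.

(** The difference quotient of [f] at [z0], completed by the derivative, is continuous and is
    holomorphic off [E] and [z0]; these form a thin set, so its integral vanishes. *)
Lemma cauchy_formula f E x y L z0 : 0 < L -> thin E -> cont_rect f x y L L -> orect x y L L z0 ->
  (forall z, crect x y L L z -> ~ E z -> exists l, cder f z l) -> ~ E z0 ->
  RI (fun z => f z / (z - z0)) x y L L = twopii * f z0.
Proof.
 intros HL HE HC Hz HD HN. assert (Hzc : crect x y L L z0) by (unfold orect, crect in *; lra). destruct (HD z0 Hzc HN) as [l Hl].
 set (k := fun z => if dec (z = z0) then l else (f z - f z0) / (z - z0)). assert (Kz0 : k z0 = l) by (unfold k; destruct (dec (z0 = z0)); tauto).
 assert (Kz : forall z, z <> z0 -> k z = (f z - f z0) / (z - z0)) by (intros z Nz; unfold k; destruct (dec (z = z0)); tauto).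
 assert (Nz : forall z, z <> z0 -> z - z0 <> 0).
 { intros z N Eq. apply N. replace z with (z - z0 + z0) by ring. rewrite Eq; ring. }
 assert (Loc : forall z, z <> z0 -> forall w, Cmod (w - z) < Cmod (z - z0) -> (f w - f z0) / (w - z0) = k w).
 { intros z N w Hw. symmetry. apply Kz. intros ->. rewrite Cmod_sub_sym in Hw. lra. }
 assert (I : RI k x y L L = 0).
 { apply (painleve_goursat k (fun z => E z \/ z = z0)); auto.
  - apply thin_union; auto. apply thin_point.
  - intros z Hzr. destruct (classic (z = z0)) as [->|N].
   + intros e He. destruct (Hl (e/2)%R) as (d & Hd & K); [lra|]. exists d; split; auto. intros w Hw. rewrite Kz0.
    destruct (classic (w = z0)) as [->|Nw].
    { rewrite Kz0. rewrite Cmod_sub_diag; lra. }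
    rewrite (Kz w Nw). assert (N0 := Nz w Nw). replace ((f w - f z0) / (w - z0) - l) with ((f w - f z0 - l * (w - z0)) / (w - z0)) by (field; auto).
    rewrite Cmod_div by auto. apply Cmod_gt_0 in N0. apply (Rmult_lt_reg_r (Cmod (w - z0))); auto. unfold Rdiv. rewrite Rmult_assoc, Rinv_l by lra.
    specialize (K w Hw). nra.
   + apply ccont_ext_loc with (fun w => (f w - f z0) / (w - z0)) (Cmod (z - z0)).
    { apply Cmod_gt_0; auto. }
    { apply Loc; auto. }
    apply ccont_mult.
    * apply ccont_minus; [auto|apply ccont_const].
    * apply ccont_inv; [apply ccont_minus; [apply ccont_id|apply ccont_const]|auto].
  - intros z Hzr N. destruct (HD z Hzr ltac:(tauto)) as [m Hm].
   destruct (cder_div (fun w => f w - f z0) (fun w => w - z0) z (m - 0) (1 - 0)) as [q Hq].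
   + apply cder_minus; [auto|apply cder_const].
   + apply cder_minus; [apply cder_id|apply cder_const].
   + auto.
   + exists q. apply cder_ext_loc with (2:=Loc z ltac:(tauto)); auto. apply Cmod_gt_0, Nz; tauto. }
 assert (Bz : forall z, brect x y L L z -> z <> z0).
 { intros z [_ Hb] ->. unfold orect in Hz. lra. }
 assert (Cinvc : cont_brect (fun z => / (z - z0)) x y L L).
 { intros z Hb. apply ccont_inv; [apply ccont_minus; [apply ccont_id|apply ccont_const]|apply Nz, Bz, Hb]. }
 assert (Cq : cont_brect (fun z => (f z - f z0) / (z - z0)) x y L L).
 { intros z Hb. apply ccont_mult.
  - apply ccont_minus; [apply HC, Hb|apply ccont_const].
  - auto. }
 assert (I2 : RI (fun z => (f z - f z0) / (z - z0)) x y L L = 0).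
 { rewrite <- I. apply RI_ext; try lra. intros z Hb. symmetry; apply Kz, Bz, Hb. }
 rewrite (RI_ext (fun z => f z / (z - z0)) (fun z => (f z - f z0) / (z - z0) + f z0 * / (z - z0))); try lra.
 - rewrite RI_plus, I2, RI_scal, RI_inv; auto; try lra; try ring. intros z Hb. apply ccont_mult; [apply ccont_const|auto].
 - intros z Hb. field. auto.
Qed.

(** Second-order remainders of 1 / (l - z) and 1 / (l - z)^2 as functions of z, uniform in l; they
    justify differentiation under the integral sign. *)
Lemma param_kernel_bound (l z w : C) (d : R) : 0 < d -> 2 * d <= Cmod (l - z) -> Cmod (w - z) < d ->
  (Cmod (/ (l - w) - / (l - z) - / ((l - z) * (l - z)) * (w - z)) <= Cmod (w - z) * Cmod (w - z) / (d * d * d)) /\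
  (Cmod (/ ((l - w) * (l - w)) - / ((l - z) * (l - z)) - 2 / ((l - z) * (l - z) * (l - z)) * (w - z))
      <= 6 * (Cmod (w - z) * Cmod (w - z)) / (d * d * d * d)).
Proof.
 intros Hd H1 H2. assert (H3 : d <= Cmod (l - w)).
 { assert (T := Cmod_tri3 l w z). lra. }
 set (A := l - z) in *. set (B := l - w) in *. set (h := w - z) in *. assert (EB : B = A - h) by (unfold A, B, h; ring).
 assert (NA : A <> 0) by (intros E; rewrite E, Cmod_0 in H1; lra). assert (NB : B <> 0) by (intros E; rewrite E, Cmod_0 in H3; lra). split.
 - replace (/ B - / A - / (A * A) * h) with (h * h / (A * A * B)).
  2:{ rewrite EB in *. field. auto. }
  rewrite Cmod_div by (repeat apply Cmult_neq_0; auto). rewrite !Cmod_mult. apply Rmult_le_compat_l; [nra|].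
  apply Rinv_le_contravar; [repeat apply Rmult_lt_0_compat; lra|]. apply Rmult_le_compat; try lra; [nra|]. nra.
 - replace (/ (B * B) - / (A * A) - 2 / (A * A * A) * h) with (h * h * (A + 2 * B) / (A * A * A * B * B)).
  2:{ rewrite EB in *. field. auto. }
  rewrite Cmod_div by (repeat apply Cmult_neq_0; auto). rewrite !Cmod_mult. assert (Q1 : Cmod (A + 2 * B) <= Cmod A + 2 * Cmod B).
  { eapply Rle_trans; [apply Cmod_triangle|]. rewrite Cmod_mult, Cmod_R, Rabs_pos_eq; lra. }
  assert (Q2 : Cmod A <= 2 * Cmod B).
  { assert (T := Cmod_tri_inv A h). rewrite <- EB in T. lra. }
  apply Rle_trans with (Cmod h * Cmod h * (4 * Cmod B) / (Cmod A * Cmod A * Cmod A * Cmod B * Cmod B))%R.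
  { apply Rmult_le_compat_r; [left; apply Rinv_0_lt_compat; repeat apply Rmult_lt_0_compat; lra|]. nra. }
  replace (Cmod h * Cmod h * (4 * Cmod B) / (Cmod A * Cmod A * Cmod A * Cmod B * Cmod B))%R with (Cmod h * Cmod h * (4 * / (Cmod A * Cmod A * Cmod A * Cmod B)))%R by (field; lra).
  replace (6 * (Cmod h * Cmod h) / (d * d * d * d))%R with (Cmod h * Cmod h * (6 * / (d * d * d * d)))%R by lra. apply Rmult_le_compat_l; [nra|].
  apply Rle_trans with (4 * / (d * d * d * d))%R.
  + apply Rmult_le_compat_l; [lra|]. apply Rinv_le_contravar; [repeat apply Rmult_lt_0_compat; lra|]. apply Rmult_le_compat; try lra; [nra|].
   apply Rmult_le_compat; try lra; [nra|]. nra.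
  + apply Rmult_le_compat_r; [left; apply Rinv_0_lt_compat; repeat apply Rmult_lt_0_compat; lra|lra].
Qed.

Lemma rcont_inv f s : rcont f s -> f s <> 0 -> rcont (fun t => / f t) s.
Proof. intros H N. apply (rcont_comp Cinv f); auto. apply (cder_cont _ _ _ (cder_inv _ N)). Qed.

Lemma rcont_bounded f a b : a <= b -> rcont_on f a b -> exists M, 0 <= M /\ forall s, a <= s <= b -> Cmod (f s) <= M.
Proof.
 intros Hab H. assert (D : forall t : R, {d : posreal | (a <= t <= b) -> forall s, Rabs (s - t) < d -> (Cmod (f s) <= Cmod (f t) + 1)}).
 { intros t. apply constructive_indefinite_description. destruct (classic (a <= t <= b)) as [Q|Q].
  - destruct (H t Q 1%R) as (d & Hd & K); [lra|]. exists (mkposreal d Hd). intros _ s Hs. specialize (K s Hs). assert (T := Cmod_tri_inv (f s) (f t)).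
   lra.
  - exists (mkposreal 1 Rlt_0_1). tauto. }
 apply NNPP. intros N. destruct (compactness_list 1 (a, tt) (b, tt) (fun t => proj1_sig (D (fst t)))). intros [l Hl]. apply N.
 exists (fold_right Rmax 0%R (map (fun t => Cmod (f (fst t)) + 1)%R l)). split.
 - clear. induction l as [|p l IH]; simpl; [lra|]. eapply Rle_trans; [exact IH|apply Rmax_r].
 - intros s Hs. destruct (Hl (s, tt)) as (t & Ht & Hbt & Hct); [simpl; tauto|]. destruct t as [t []]. simpl in Hbt, Hct. destruct (D t) as [d Hd].
  apply Rle_trans with (Cmod (f t) + 1)%R; [apply Hd; tauto|]. clear - Ht. induction l as [|p l IH]; [tauto|]. destruct Ht as [->|Ht].
  + apply Rmax_l.
  + eapply Rle_trans; [auto|apply Rmax_r].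
Qed.

(** The reciprocal of g - z is continuous on a compact interval, hence bounded. *)
Lemma rcont_min_dist (g : R -> C) a b z : a <= b -> rcont_on g a b -> (forall s, a <= s <= b -> g s <> z) ->
  exists d, 0 < d /\ forall s, a <= s <= b -> d <= Cmod (g s - z).
Proof.
 intros Hab H N. assert (Nz : forall s, a <= s <= b -> g s - z <> 0).
 { intros s Hs E. apply (N s Hs). replace (g s) with (g s - z + z) by ring. rewrite E; ring. }
 destruct (rcont_bounded (fun s => / (g s - z)) a b Hab) as (M & HM & K).
 - intros s Hs. apply rcont_inv; auto. apply rcont_minus; [auto|apply rcont_const].
 - exists (/ (M + 1))%R. split; [apply Rinv_0_lt_compat; lra|]. intros s Hs. specialize (K s Hs). assert (P := Nz s Hs). rewrite Cmod_inv in K by auto.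
  apply Cmod_gt_0 in P. rewrite <- (Rinv_inv (Cmod (g s - z))). apply Rinv_le_contravar; [apply Rinv_0_lt_compat; auto|lra].
Qed.

Lemma CI_kernel_der (k g : R -> C) a b z : a <= b -> rcont_on k a b -> rcont_on g a b ->
  (forall s, a <= s <= b -> g s <> z) ->
  cder (fun w => CI (fun s => k s / (g s - w)) a b) z (CI (fun s => k s / ((g s - z) * (g s - z))) a b) /\
  cder (fun w => CI (fun s => k s / ((g s - w) * (g s - w))) a b) z
       (CI (fun s => 2 * k s / ((g s - z) * (g s - z) * (g s - z))) a b).
Proof.
 intros Hab Hk Hg N. destruct (rcont_min_dist g a b z Hab Hg N) as (d2 & Hd2 & Dist). set (d := (d2/2)%R). assert (Hd : 0 < d) by (unfold d; lra).
 assert (PD3 : 0 < d * d * d) by (apply Rmult_lt_0_compat; [nra|]; exact Hd). assert (PD4 : 0 < d * d * d * d) by nra.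
 destruct (rcont_bounded k a b Hab Hk) as (M & HM & Bk). assert (NW : forall w, Cmod (w - z) < d -> forall s, a <= s <= b -> g s - w <> 0).
 { intros w Hw s Hs E. assert (T := Cmod_tri3 (g s) w z). rewrite E, Cmod_0 in T. specialize (Dist s Hs). unfold d in *; lra. }
 assert (Z0 : Cmod (z - z) < d) by (rewrite Cmod_sub_diag; auto). assert (Cw : forall w, Cmod (w - z) < d -> rcont_on (fun s => / (g s - w)) a b).
 { intros w Hw s Hs. apply rcont_inv; [apply rcont_minus; [auto|apply rcont_const]|apply (NW w Hw s Hs)]. }
 assert (C1 : forall w, Cmod (w - z) < d -> rcont_on (fun s => k s / (g s - w)) a b).
 { intros w Hw s Hs. apply rcont_mult; [auto|apply Cw; auto]. }
 assert (C0 : forall w s, a <= s <= b -> rcont (fun s => g s - w) s).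
 { intros w s Hs. apply rcont_minus; [auto|apply rcont_const]. }
 assert (C2 : forall w, Cmod (w - z) < d -> rcont_on (fun s => k s / ((g s - w) * (g s - w))) a b).
 { intros w Hw s Hs. apply rcont_mult; [auto|]. apply rcont_inv.
  - apply rcont_mult; auto.
  - apply Cmult_neq_0; apply (NW w Hw s Hs). }
 assert (C3 : rcont_on (fun s => 2 * k s / ((g s - z) * (g s - z) * (g s - z))) a b).
 { intros s Hs. apply rcont_mult; [apply rcont_scal; auto|]. apply rcont_inv.
  - repeat apply rcont_mult; auto.
  - repeat apply Cmult_neq_0; apply (NW z Z0 s Hs). }
 split.
 - intros e He. set (Q := ((b - a) * (M / (d * d * d)))%R). assert (HQ : 0 <= Q).
  { apply Rmult_le_pos; [lra|]. apply Rmult_le_pos; auto. left; apply Rinv_0_lt_compat. auto. }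
  exists (Rmin d (e / (Q + 1))). split; [apply Rmin_glb_lt; [auto|apply Rdiv_lt_0_compat; lra]|]. intros w Hw.
  destruct (Rmin_Rgt_l _ _ _ Hw) as [W1 W2].
  replace (CI (fun s => k s / ((g s - z) * (g s - z))) a b * (w - z)) with (CI (fun s => (w - z) * (k s / ((g s - z) * (g s - z)))) a b).
  2:{ rewrite CI_scal; auto. ring. }
  rewrite <- CI_minus, <- CI_minus; auto.
  2:{ intros s Hs. apply rcont_minus; [apply C1|apply C1]; auto. }
  2:{ intros s Hs. apply rcont_scal. apply C2; auto. }
  apply Rle_trans with ((b - a) * (M * (Cmod (w - z) * Cmod (w - z) / (d * d * d))))%R.
  + apply CI_bound; auto.
   * intros s Hs. apply rcont_minus; [apply rcont_minus; apply C1; auto|apply rcont_scal, C2; auto].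
   * intros s Hs.
    replace (k s / (g s - w) - k s / (g s - z) - (w - z) * (k s / ((g s - z) * (g s - z)))) with (k s * (/ (g s - w) - / (g s - z) - / ((g s - z) * (g s - z)) * (w - z))) by (unfold Cdiv; ring).
    rewrite Cmod_mult. apply Rmult_le_compat; auto using Cmod_ge_0. apply param_kernel_bound; auto. unfold d. specialize (Dist s Hs). lra.
  + replace ((b - a) * (M * (Cmod (w - z) * Cmod (w - z) / (d * d * d))))%R with (Q * Cmod (w - z) * Cmod (w - z))%R by (unfold Q; field; lra).
   apply Rmult_le_compat_r; [apply Cmod_ge_0|]. apply Rle_trans with ((Q + 1) * (e / (Q + 1)))%R; [|right; field; lra].
   apply Rmult_le_compat; auto using Cmod_ge_0; lra.
 - intros e He. set (Q := ((b - a) * (M * 6 / (d * d * d * d)))%R). assert (HQ : 0 <= Q).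
  { apply Rmult_le_pos; [lra|]. apply Rmult_le_pos; [lra|]. left; apply Rinv_0_lt_compat. auto. }
  exists (Rmin d (e / (Q + 1))). split; [apply Rmin_glb_lt; [auto|apply Rdiv_lt_0_compat; lra]|]. intros w Hw.
  destruct (Rmin_Rgt_l _ _ _ Hw) as [W1 W2].
  replace (CI (fun s => 2 * k s / ((g s - z) * (g s - z) * (g s - z))) a b * (w - z)) with (CI (fun s => (w - z) * (2 * k s / ((g s - z) * (g s - z) * (g s - z)))) a b).
  2:{ rewrite CI_scal; auto. ring. }
  rewrite <- CI_minus, <- CI_minus; auto.
  2:{ intros s Hs. apply rcont_minus; [apply C2|apply C2]; auto. }
  2:{ intros s Hs. apply rcont_scal. auto. }
  apply Rle_trans with ((b - a) * (M * (6 * (Cmod (w - z) * Cmod (w - z)) / (d * d * d * d))))%R.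
  + apply CI_bound; auto.
   * intros s Hs. apply rcont_minus; [apply rcont_minus; apply C2; auto|apply rcont_scal, C3; auto].
   * intros s Hs.
    replace (k s / ((g s - w) * (g s - w)) - k s / ((g s - z) * (g s - z)) - (w - z) * (2 * k s / ((g s - z) * (g s - z) * (g s - z)))) with (k s * (/ ((g s - w) * (g s - w)) - / ((g s - z) * (g s - z)) - 2 / ((g s - z) * (g s - z) * (g s - z)) * (w - z))) by (unfold Cdiv; ring).
    rewrite Cmod_mult. apply Rmult_le_compat; auto using Cmod_ge_0. apply param_kernel_bound; auto. unfold d. specialize (Dist s Hs). lra.
  + replace ((b - a) * (M * (6 * (Cmod (w - z) * Cmod (w - z)) / (d * d * d * d))))%R with (Q * Cmod (w - z) * Cmod (w - z))%R by (unfold Q; field; lra).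
   apply Rmult_le_compat_r; [apply Cmod_ge_0|]. apply Rle_trans with ((Q + 1) * (e / (Q + 1)))%R; [|right; field; lra].
   apply Rmult_le_compat; auto using Cmod_ge_0; lra.
Qed.

Lemma RI_kernel_der f x y a b z : 0 <= a -> 0 <= b -> cont_brect f x y a b -> ~ brect x y a b z ->
  cder (fun w => RI (fun u => f u / (u - w)) x y a b) z (RI (fun u => f u / ((u - z) * (u - z))) x y a b) /\
  cder (fun w => RI (fun u => f u / ((u - w) * (u - w))) x y a b) z
    (RI (fun u => 2 * f u / ((u - z) * (u - z) * (u - z))) x y a b).
Proof.
 intros Ha Hb Hf N. destruct (CI_kernel_der (fun t => f ((x + t)%R, y)) (fun t => ((x + t)%R, y)) 0 a z) as [A1 B1]; auto.
 { apply (cont_brect_hor f x y a b); auto. }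
 { intros s _; apply rcont_hor. }
 { intros s Hs E; apply N; rewrite <- E; unfold brect, crect, Re, Im; simpl; lra. }
 destruct (CI_kernel_der (fun t => f ((x + t)%R, (y+b)%R)) (fun t => ((x + t)%R, (y+b)%R)) 0 a z) as [A3 B3]; auto.
 { apply (cont_brect_hor f x y a b); auto. }
 { intros s _; apply rcont_hor. }
 { intros s Hs E; apply N; rewrite <- E; unfold brect, crect, Re, Im; simpl; lra. }
 destruct (CI_kernel_der (fun t => f ((x + a)%R, (y+t)%R)) (fun t => ((x + a)%R, (y+t)%R)) 0 b z) as [A2 B2]; auto.
 { apply (cont_brect_ver f x y a b); auto. }
 { intros s _; apply rcont_ver. }
 { intros s Hs E; apply N; rewrite <- E; unfold brect, crect, Re, Im; simpl; lra. }
 destruct (CI_kernel_der (fun t => f (x, (y+t)%R)) (fun t => (x, (y+t)%R)) 0 b z) as [A4 B4]; auto.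
 { apply (cont_brect_ver f x y a b); auto. }
 { intros s _; apply rcont_ver. }
 { intros s Hs E; apply N; rewrite <- E; unfold brect, crect, Re, Im; simpl; lra. }
 split.
 - apply cder_minus; [apply cder_minus; [apply cder_plus; [exact A1|apply cder_scal; exact A2]|exact A3]|apply cder_scal; exact A4].
 - apply cder_minus; [apply cder_minus; [apply cder_plus; [exact B1|apply cder_scal; exact B2]|exact B3]|apply cder_scal; exact B4].
Qed.

Definition csq (z0 : C) (s : R) : C -> Prop := crect (Re z0 - s) (Im z0 - s) (2 * s) (2 * s).
Definition bsq (z0 : C) (s : R) : C -> Prop := brect (Re z0 - s) (Im z0 - s) (2 * s) (2 * s).
Definition osq (z0 : C) (s : R) : C -> Prop := orect (Re z0 - s) (Im z0 - s) (2 * s) (2 * s).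

Lemma csq_close z0 s z : csq z0 s z -> Cmod (z - z0) <= 2 * s.
Proof.
 unfold csq, crect. intros H. eapply Rle_trans; [apply Cmod_le_Re_Im|]. replace (Re (z - z0)) with (Re z - Re z0)%R by reflexivity.
 replace (Im (z - z0)) with (Im z - Im z0)%R by reflexivity. assert (Rabs (Re z - Re z0) <= s) by (apply Rabs_le; lra).
 assert (Rabs (Im z - Im z0) <= s) by (apply Rabs_le; lra). lra.
Qed.

Lemma bsq_far z0 s z : bsq z0 s z -> s <= Cmod (z - z0).
Proof.
 unfold bsq, brect. assert (A := Rabs_Re_le (z - z0)). assert (B := Rabs_Im_le (z - z0)).
 replace (Re (z - z0)) with (Re z - Re z0)%R in A by reflexivity. replace (Im (z - z0)) with (Im z - Im z0)%R in B by reflexivity.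
 assert (E1 := Rle_abs (Re z - Re z0)). assert (E2 := Rle_abs (- (Re z - Re z0))). assert (E3 := Rle_abs (Im z - Im z0)).
 assert (E4 := Rle_abs (- (Im z - Im z0))). rewrite Rabs_Ropp in E2, E4. lra.
Qed.

Lemma close_osq z0 s z : Cmod (z - z0) < s -> osq z0 s z.
Proof. assert (A := Re_close z z0). assert (B := Im_close z z0). unfold osq, orect. lra. Qed.

Lemma osq_open z0 s z : osq z0 s z -> exists d, 0 < d /\ forall w, Cmod (w - z) < d -> osq z0 s w.
Proof.
 unfold osq, orect. intros Hz.
 destruct (pos_min4 (Re z - (Re z0 - s)) (Re z0 + s - Re z) (Im z - (Im z0 - s)) (Im z0 + s - Im z)) as (d & Hd & H); [lra..|]. exists d; split; auto.
 intros w Hw. assert (A := Re_close w z). assert (B := Im_close w z). lra.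
Qed.

Lemma osq_center z0 s : 0 < s -> osq z0 s z0.
Proof. intros; unfold osq, orect; lra. Qed.

Lemma osq_not_bsq z0 s z : osq z0 s z -> ~ bsq z0 s z.
Proof. unfold osq, orect, bsq, brect, crect; lra. Qed.

(** Both sides are continuous in z and the complement of [E] is dense, so the formula reaches the
    points of [E]. *)
Lemma Cauchy_on_square f E D z0 s : 0 < s -> thin E -> (forall z, csq z0 s z -> D z) ->
  (forall z, D z -> ccont f z) -> (forall z, D z -> ~ E z -> exists l, cder f z l) ->
  forall z, osq z0 s z ->
  RI (fun u => f u / (u - z)) (Re z0 - s) (Im z0 - s) (2 * s) (2 * s) = twopii * f z.
Proof.
 intros Hs HE HD HC HH.
 assert (G : forall z, osq z0 s z -> ~ E z -> RI (fun u => f u / (u - z)) (Re z0 - s) (Im z0 - s) (2 * s) (2 * s) = twopii * f z).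
 { intros z Hz N. apply (cauchy_formula f E); auto; try lra.
  - intros u Hu; apply HC, HD, Hu. }
 intros z Hz. assert (Dz : D z) by (apply HD; unfold csq, osq, crect, orect in *; lra).
 assert (CB : cont_brect f (Re z0 - s) (Im z0 - s) (2 * s) (2 * s)) by (intros u [Hu _]; apply HC, HD, Hu).
 destruct (RI_kernel_der f (Re z0 - s) (Im z0 - s) (2 * s) (2 * s) z) as [K _]; try lra; auto.
 { apply osq_not_bsq, Hz. }
 apply cder_cont in K. set (F := fun w => RI (fun u => f u / (u - w)) (Re z0 - s) (Im z0 - s) (2 * s) (2 * s)) in *.
 assert (C2 : ccont (fun w => F w - twopii * f w) z).
 { apply ccont_minus; [exact K|apply ccont_mult; [apply ccont_const|auto]]. }
 assert (Z : F z - twopii * f z = 0).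
 { apply Cmod_eq_0. apply Rle_antisym; [|apply Cmod_ge_0]. apply Rnot_lt_le. intros P. destruct (C2 _ P) as (d & Hd & Q).
  destruct (osq_open z0 s z Hz) as (r & Hr & Or). destruct (thin_dense E HE z (Rmin d r)) as (w & Hw & Nw); [apply Rmin_glb_lt; auto|].
  destruct (Rmin_Rgt_l _ _ _ Hw) as [W1 W2]. specialize (Q w W1). assert (O := Or w W2). unfold F in Q at 1. rewrite (G w O Nw) in Q.
  replace (twopii * f w - twopii * f w - (F z - twopii * f z)) with (- (F z - twopii * f z)) in Q by ring. rewrite Cmod_opp in Q. lra. }
 change (F z = twopii * f z). replace (F z) with (F z - twopii * f z + twopii * f z) by ring. rewrite Z; ring.
Qed.

(** A total choice of the complex derivative, meaningful where one exists. *)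
Definition cd (f : C -> C) (z : C) : C := epsilon (inhabits (RtoC 0)) (fun l => cder f z l).

Lemma cd_spec f z : (exists l, cder f z l) -> cder f z (cd f z).
Proof. intros H. exact (epsilon_spec (inhabits (RtoC 0)) (fun l => cder f z l) H). Qed.

Lemma cd_unique f z l : cder f z l -> cd f z = l.
Proof. intros H. apply (cder_unique f z); [apply cd_spec; exists l; auto|auto]. Qed.

Lemma open_csq D z0 : openC D -> D z0 -> exists s, 0 < s /\ forall z, csq z0 s z -> D z.
Proof. intros HD H0. destruct (HD z0 H0) as (d & Hd & K). exists (d/4)%R; split; [lra|]. intros z Hz. apply K. apply csq_close in Hz. lra. Qed.

Lemma painleve_local f E D z0 s : 0 < s -> thin E -> (forall z, csq z0 s z -> D z) ->
  (forall z, D z -> ccont f z) -> (forall z, D z -> ~ E z -> exists l, cder f z l) ->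
  forall z, osq z0 s z ->
  cder f z (/ twopii * RI (fun u => f u / ((u - z) * (u - z))) (Re z0 - s) (Im z0 - s) (2 * s) (2 * s)).
Proof.
 intros Hs HE HD HC HH z Hz. assert (CB : cont_brect f (Re z0 - s) (Im z0 - s) (2 * s) (2 * s)) by (intros u [Hu _]; apply HC, HD, Hu).
 destruct (RI_kernel_der f (Re z0 - s) (Im z0 - s) (2 * s) (2 * s) z) as [K _]; try lra; auto.
 { apply osq_not_bsq, Hz. }
 apply (cder_scal (/ twopii)) in K. destruct (osq_open z0 s z Hz) as (r & Hr & Or). revert K. apply cder_ext_loc with r; auto. intros w Hw.
 rewrite (Cauchy_on_square f E D z0 s Hs HE HD HC HH); [field; apply twopii_neq_0|auto].
Qed.

(** Cauchy's formula holds at the points of [E] as well and may be differentiated under the integral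
    sign. *)
Theorem painleve f E D : openC D -> thin E -> (forall z, D z -> ccont f z) ->
  (forall z, D z -> ~ E z -> exists l, cder f z l) -> hol D f.
Proof.
 intros HD HE HC HH z Hz. destruct (open_csq D z HD Hz) as (s & Hs & K). eexists. apply (painleve_local f E D z s Hs HE K HC HH). apply osq_center, Hs.
Qed.

Lemma hol_cd D f : openC D -> hol D f -> hol D (cd f).
Proof.
 intros HD Hf z Hz. destruct (open_csq D z HD Hz) as (s & Hs & K). assert (HC : forall u, D u -> ccont f u) by (intros u Hu; apply (hol_cont D); auto).
 assert (CB : cont_brect f (Re z - s) (Im z - s) (2 * s) (2 * s)) by (intros u [Hu _]; apply HC, K, Hu).
 destruct (RI_kernel_der f (Re z - s) (Im z - s) (2 * s) (2 * s) z) as [_ Q]; try lra; auto.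
 { apply osq_not_bsq, osq_center, Hs. }
 apply (cder_scal (/ twopii)) in Q. refine (ex_intro _ _ (cder_ext_loc _ _ _ _ s Hs _ Q)). symmetry. apply cd_unique.
 apply (painleve_local f (fun _ => False) D z s Hs); auto using thin_empty, close_osq.
Qed.

Lemma hol_cder D f z : hol D f -> D z -> cder f z (cd f z).
Proof. intros H Hz; apply cd_spec, H, Hz. Qed.

Lemma PI_ge_2 : 2 <= PI.
Proof. pose proof PI2_1. lra. Qed.

Lemma Cmod_Ci : Cmod Ci = 1%R.
Proof. rewrite Cmod_eq; simpl; rewrite Rmult_0_l, Rplus_0_l, !Rmult_1_r; apply sqrt_1. Qed.

Lemma Cmod_twopii : Cmod twopii = (2 * PI)%R.
Proof. unfold twopii. rewrite Cmod_mult, Cmod_R, Cmod_Ci, Rabs_pos_eq; [ring|]. pose proof PI_ge_2; lra. Qed.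

(** On the square of half side R0 / 3 the boundary integral is at most 24 M / R0; division by 2 PI
    >= 4 leaves 6 M / R0. *)
Lemma cauchy_est D f z0 R0 M : 0 < R0 -> hol D f ->
  (forall w, Cmod (w - z0) < R0 -> D w /\ Cmod (f w) <= M) -> Cmod (cd f z0) <= 8 * M / R0.
Proof.
 intros HR Hf HB. set (s := (R0/3)%R). assert (Hs : 0 < s) by (unfold s; lra). assert (In : forall z, csq z0 s z -> Cmod (z - z0) < R0).
 { intros z Hz. apply csq_close in Hz. unfold s in *. lra. }
 assert (HD : forall z, csq z0 s z -> D z) by (intros z Hz; apply HB, In, Hz).
 assert (HC : forall u, D u -> ccont f u) by (intros u Hu; apply (hol_cont D); auto).
 assert (K := painleve_local f (fun _ => False) D z0 s Hs thin_empty HD HC ltac:(auto) z0 (osq_center z0 s Hs)). apply cd_unique in K.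
 rewrite K, Cmod_mult, Cmod_inv, Cmod_twopii by apply twopii_neq_0. assert (M0 : 0 <= M).
 { eapply Rle_trans; [apply Cmod_ge_0|]. apply (HB z0). rewrite Cmod_sub_diag; lra. }
 assert (B : (Cmod (RI (fun u => f u / ((u - z0) * (u - z0)))%C (Re z0 - s) (Im z0 - s) (2 * s) (2 * s)) <= 2 * (2 * s + 2 * s) * (M / (s * s)))%R).
 { assert (NZ : forall u, bsq z0 s u -> u - z0 <> 0).
  { intros u Hu E. apply bsq_far in Hu. rewrite E, Cmod_0 in Hu. lra. }
  apply RI_bound; try lra.
  - intros u Hu. apply ccont_mult; [apply HC, HD, Hu|]. apply ccont_inv.
   + apply ccont_mult; apply ccont_minus; try apply ccont_id; apply ccont_const.
   + apply Cmult_neq_0; apply NZ, Hu.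
  - intros u Hu. rewrite Cmod_div by (apply Cmult_neq_0; apply NZ, Hu). rewrite Cmod_mult. assert (F := bsq_far _ _ _ Hu).
   apply Rmult_le_compat; [apply Cmod_ge_0| |apply HB, In, Hu|].
   + left; apply Rinv_0_lt_compat, Rmult_lt_0_compat; lra.
   + apply Rinv_le_contravar; [nra|]. nra. }
 replace (2 * (2 * s + 2 * s) * (M / (s * s)))%R with (24 * M / R0)%R in B by (unfold s; field; lra). pose proof PI_ge_2.
 apply Rle_trans with (/ 4 * (24 * M / R0))%R.
 - apply Rmult_le_compat; auto using Cmod_ge_0; [left; apply Rinv_0_lt_compat; lra|]. apply Rinv_le_contravar; lra.
 - assert (0 <= M / R0) by (apply Rmult_le_pos; [auto|left; apply Rinv_0_lt_compat; auto]). lra.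
Qed.

Lemma cauchy_center_bound D f z0 s M : 0 < s -> hol D f -> (forall z, csq z0 s z -> D z) ->
  (forall z, bsq z0 s z -> Cmod (f z) <= M) -> Cmod (f z0) <= 2 * M.
Proof.
 intros Hs Hf HD HB. assert (HC : forall u, D u -> ccont f u) by (intros u Hu; apply (hol_cont D); auto).
 assert (K := Cauchy_on_square f (fun _ => False) D z0 s Hs thin_empty HD HC ltac:(auto) z0 (osq_center z0 s Hs)).
 assert (NZ : forall u, bsq z0 s u -> u - z0 <> 0).
 { intros u Hu E. apply bsq_far in Hu. rewrite E, Cmod_0 in Hu. lra. }
 assert (M0 : 0 <= M).
 { eapply Rle_trans; [apply Cmod_ge_0|]. apply (HB ((Re z0 + s)%R, Im z0)). unfold bsq, brect, crect, Re, Im; simpl; lra. }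
 assert (B : (Cmod (RI (fun u => f u / (u - z0))%C (Re z0 - s) (Im z0 - s) (2 * s) (2 * s)) <= 2 * (2 * s + 2 * s) * (M / s))%R).
 { apply RI_bound; try lra.
  - intros u Hu. apply ccont_mult; [apply HC, HD, Hu|]. apply ccont_inv.
   + apply ccont_minus; try apply ccont_id; apply ccont_const.
   + auto.
  - intros u Hu. rewrite Cmod_div by auto. assert (F := bsq_far _ _ _ Hu). apply Rmult_le_compat; [apply Cmod_ge_0| |auto|].
   + left; apply Rinv_0_lt_compat; lra.
   + apply Rinv_le_contravar; lra. }
 rewrite K, Cmod_mult, Cmod_twopii in B. replace (2 * (2 * s + 2 * s) * (M / s))%R with (8 * M)%R in B by (field; lra). pose proof PI_ge_2. nra.
Qed.

Lemma Cmod_Cpow z n : Cmod (Cpow z n) = (Cmod z ^ n)%R.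
Proof. induction n as [|n IH]; simpl; [apply Cmod_1|]. rewrite Cmod_mult, IH. reflexivity. Qed.

(* The constant 2 of [cauchy_center_bound] disappears on applying it to the powers of [f]. *)
Lemma max_modulus_square D f z0 s M : 0 < s -> hol D f -> (forall z, csq z0 s z -> D z) ->
  (forall z, bsq z0 s z -> Cmod (f z) <= M) -> Cmod (f z0) <= M.
Proof.
 intros Hs Hf HD HB. assert (M0 : 0 <= M).
 { eapply Rle_trans; [apply Cmod_ge_0|]. apply (HB ((Re z0 + s)%R, Im z0)). unfold bsq, brect, crect, Re, Im; simpl; lra. }
 apply Rnot_lt_le. intros P. assert (G : forall n, Cmod (f z0) ^ n <= 2 * M ^ n).
 { intros n. rewrite <- Cmod_Cpow. apply (cauchy_center_bound D (fun z => Cpow (f z) n) z0 s); auto.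
  - apply hol_pow, Hf.
  - intros z Hz. rewrite Cmod_Cpow. apply pow_incr. split; [apply Cmod_ge_0|auto]. }
 set (A := Cmod (f z0)) in *. destruct (Req_dec M 0) as [->|N0].
 { specialize (G 1%nat). lra. }
 assert (Mp : 0 < M) by lra. set (x := ((A - M)/M)%R). assert (Px : 0 < x) by (apply Rdiv_lt_0_compat; lra).
 destruct (nfloor_ex (2 / x)%R) as [n Hn]; [left; apply Rdiv_lt_0_compat; lra|]. assert (Q := poly (S n) x Px). rewrite S_INR in Q.
 assert (E : (1 + x = A / M)%R) by (unfold x; field; lra). assert (Z : ((1 + x) ^ (S n) * M ^ (S n) = A ^ (S n))%R).
 { rewrite <- Rpow_mult_distr, E. f_equal. field; lra. }
 specialize (G (S n)). rewrite <- Z in G. assert (PM : 0 < M ^ (S n)) by (apply pow_lt; auto). apply Rmult_le_reg_r in G; auto.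
 assert (2 < (INR n + 1) * x).
 { apply Rle_lt_trans with (2 / x * x)%R; [right; field; lra|]. nra. }
 lra.
Qed.

Definition vanishes_at_infty (f : C -> C) : Prop :=
  forall e, 0 < e -> exists R0, forall z, R0 < Cmod z -> Cmod (f z) <= e.

(** The maximum principle on a square about z so large that |f| is at most |f z| / 2 on its
    boundary. *)
Theorem liouville0 f : hol (fun _ => True) f -> vanishes_at_infty f -> forall z, f z = 0.
Proof.
 intros Hf HV z. apply Cmod_eq_0. apply Rle_antisym; [|apply Cmod_ge_0]. apply Rnot_lt_le. intros P.
 destruct (HV (Cmod (f z) / 2)%R) as [R0 HR]; [lra|]. set (s := (Rabs R0 + Cmod z + 1)%R).
 assert (Hs : 0 < s) by (unfold s; pose proof (Rabs_pos R0); pose proof (Cmod_ge_0 z); lra). assert (B : Cmod (f z) <= Cmod (f z) / 2); [|lra].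
 apply (max_modulus_square (fun _ => True) f z s); auto. intros u Hu. apply HR. apply bsq_far in Hu. assert (Q := Cmod_triangle u (- z)).
 rewrite (Cmod_opp z) in Q. change (u + - z) with (u - z) in Q. pose proof (Rle_abs R0). unfold s in Hu. lra.
Qed.

(** The limit runs over all nearby points off [E], hence over both sides of a curve at once. *)
Definition punctured_limit (f : C -> C) (E : C -> Prop) (z l : C) : Prop :=
  forall e, 0 < e -> exists d, 0 < d /\ forall w, Cmod (w - z) < d -> ~ E w -> Cmod (f w - l) < e.

(** The limits define a continuous extension, to which [painleve] applies. *)
Theorem hol_extension f E D : openC D -> thin E ->
  (forall z, ~ E z -> exists d, 0 < d /\ forall w, Cmod (w - z) < d -> ~ E w) ->
  hol (fun z => D z /\ ~ E z) f ->
  (forall z, D z -> E z -> exists l, punctured_limit f E z l) ->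
  exists g, hol D g /\ forall z, ~ E z -> g z = f z.
Proof.
 intros HD HE Hcl Hf HL. set (g := fun z => if dec (E z) then epsilon (inhabits (RtoC 0)) (fun l => punctured_limit f E z l) else f z).
 assert (gE : forall z, D z -> E z -> punctured_limit f E z (g z)).
 { intros z Hz Ez. unfold g. destruct (dec (E z)); [|tauto]. exact (epsilon_spec (inhabits (RtoC 0)) (fun l => punctured_limit f E z l) (HL z Hz Ez)). }
 assert (gN : forall z, ~ E z -> g z = f z).
 { intros z N. unfold g. destruct (dec (E z)); tauto. }
 exists g; split; auto. assert (gL : forall z, D z -> punctured_limit f E z (g z)).
 { intros z Hz. destruct (classic (E z)) as [Ez|Nz]; auto. intros e He. rewrite gN by auto.
  destruct (hol_cont _ f z Hf (conj Hz Nz) e He) as (d & Hd & K). exists d; auto. }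
 apply (painleve g E); auto.
 - intros z Hz e He. destruct (gL z Hz (e/2)%R) as (d & Hd & K); [lra|]. destruct (HD z Hz) as (d2 & Hd2 & K2).
  exists (Rmin d d2); split; [apply Rmin_glb_lt; auto|]. intros w Hw. destruct (Rmin_Rgt_l _ _ _ Hw) as [W1 W2].
  destruct (gL w (K2 w W2) (e/2)%R) as (d3 & Hd3 & K3); [lra|].
  (* A point [v] off [E] close to [w] links the value at [w], possibly itself a limit, with the
     limit at [z]. *)
  destruct (thin_dense E HE w (Rmin d3 (d - Cmod (w - z)))) as (v & Hv & Nv); [apply Rmin_glb_lt; lra|]. destruct (Rmin_Rgt_l _ _ _ Hv) as [V1 V2].
  specialize (K3 v V1 Nv). specialize (K v). assert (T := Cmod_tri3 v w z). specialize (K ltac:(lra) Nv). assert (T2 := Cmod_tri3 (g w) (f v) (g z)).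
  rewrite (Cmod_sub_sym (g w) (f v)) in T2. lra.
 - intros z Hz N. destruct (Hf z (conj Hz N)) as [l Hl]. exists l. destruct (Hcl z N) as (d & Hd & K). apply cder_ext_loc with f d; auto. intros w Hw.
  symmetry; apply gN, K, Hw.
Qed.

Lemma cder_comp_line f (p q : C) t l : cder f (p + RtoC t * q)%C l ->
  is_derive (fun s => Re (f (p + RtoC s * q))) t (Re (l * q)%C) /\
  is_derive (fun s => Im (f (p + RtoC s * q))) t (Im (l * q)%C).
Proof.
 intros H.
 assert (G : forall e, 0 < e -> exists d, 0 < d /\ forall h, Rabs h < d -> (Cmod (f (p + RtoC (t + h)%R * q)%C - f (p + RtoC t * q)%C - RtoC h * (l * q))%C <= e * Rabs h)%R).
 { intros e He. pose proof (Cmod_ge_0 q). destruct (H (e / (Cmod q + 1))%R) as (d & Hd & K); [apply Rdiv_lt_0_compat; lra|].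
  exists (d / (Cmod q + 1))%R. split; [apply Rdiv_lt_0_compat; lra|]. intros h Hh. specialize (K (p + RtoC (t + h) * q)).
  replace (p + RtoC (t + h) * q - (p + t * q)) with (RtoC h * q) in K by (rewrite RtoC_plus; ring). rewrite Cmod_mult, Cmod_R in K.
  assert (B : Rabs h * Cmod q <= Rabs h * (Cmod q + 1)) by (apply Rmult_le_compat_l; [apply Rabs_pos|lra]).
  assert (B2 : Rabs h * (Cmod q + 1) < d).
  { apply Rlt_le_trans with (d / (Cmod q + 1) * (Cmod q + 1))%R; [nra|right; field; lra]. }
  specialize (K ltac:(lra)). replace (l * (RtoC h * q)) with (RtoC h * (l * q)) in K by ring. eapply Rle_trans; [exact K|].
  apply Rle_trans with (e / (Cmod q + 1) * (Rabs h * (Cmod q + 1)))%R.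
  - apply Rmult_le_compat_l; [nra|auto].
  - right; field; lra. }
 split; apply is_derive_Reals; intros e He; destruct (G (e/2)%R) as (d & Hd & K); try lra; exists (mkposreal d Hd); intros h Nh Hh; specialize (K h Hh); assert (Ph : 0 < Rabs h) by (apply Rabs_pos_lt; auto).
 - assert (A := Rabs_Re_le (f (p + RtoC (t + h)%R * q)%C - f (p + RtoC t * q)%C - RtoC h * (l * q))).
  assert (E0 : Re (f (p + RtoC (t + h)%R * q)%C - f (p + RtoC t * q)%C - RtoC h * (l * q)) = (Re (f (p + RtoC (t + h)%R * q)%C) - Re (f (p + RtoC t * q)%C) - h * Re (l * q)%C)%R).
  { unfold Cminus, Cplus, Copp, Cmult, Re, RtoC; simpl. ring. }
  rewrite E0 in A. apply (Rmult_lt_reg_r (Rabs h)); auto. rewrite <- Rabs_mult.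
  replace (((Re (f (p + RtoC (t + h)%R * q)%C) - Re (f (p + RtoC t * q)%C)) / h - Re (l * q)%C) * h)%R with (Re (f (p + RtoC (t + h)%R * q)%C) - Re (f (p + RtoC t * q)%C) - h * Re (l * q)%C)%R by (field; auto).
  nra.
 - assert (A := Rabs_Im_le (f (p + RtoC (t + h)%R * q)%C - f (p + RtoC t * q)%C - RtoC h * (l * q))).
  assert (E0 : Im (f (p + RtoC (t + h)%R * q)%C - f (p + RtoC t * q)%C - RtoC h * (l * q)) = (Im (f (p + RtoC (t + h)%R * q)%C) - Im (f (p + RtoC t * q)%C) - h * Im (l * q)%C)%R).
  { unfold Cminus, Cplus, Copp, Cmult, Im, RtoC; simpl. ring. }
  rewrite E0 in A. apply (Rmult_lt_reg_r (Rabs h)); auto. rewrite <- Rabs_mult.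
  replace (((Im (f (p + RtoC (t + h)%R * q)%C) - Im (f (p + RtoC t * q)%C)) / h - Im (l * q)%C) * h)%R with (Im (f (p + RtoC (t + h)%R * q)%C) - Im (f (p + RtoC t * q)%C) - h * Im (l * q)%C)%R by (field; auto).
  nra.
Qed.

Lemma rcont_Re f s : rcont f s -> continuous (fun t => Re (f t)) s.
Proof.
 intros H. apply (filterlim_locally (U := R_UniformSpace)). intros e. destruct (H e (cond_pos e)) as (d & Hd & K). exists (mkposreal d Hd).
 intros t Ht. specialize (K t Ht). assert (A := Rabs_Re_le (f t - f s)). change (Rabs (Re (f t) - Re (f s)) < e).
 change (Re (f t - f s)) with (Re (f t) - Re (f s))%R in A. lra.
Qed.

Lemma rcont_Im f s : rcont f s -> continuous (fun t => Im (f t)) s.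
Proof.
 intros H. apply (filterlim_locally (U := R_UniformSpace)). intros e. destruct (H e (cond_pos e)) as (d & Hd & K). exists (mkposreal d Hd).
 intros t Ht. specialize (K t Ht). assert (A := Rabs_Im_le (f t - f s)). change (Rabs (Im (f t) - Im (f s)) < e).
 change (Im (f t - f s)) with (Im (f t) - Im (f s))%R in A. lra.
Qed.

Lemma FTC_line D f (p q : C) a b : openC D -> hol D f -> a <= b ->
  (forall t, a <= t <= b -> D (p + RtoC t * q)%C) ->
  CI (fun t => cd f (p + RtoC t * q)%C * q) a b = f (p + RtoC b * q)%C - f (p + RtoC a * q)%C.
Proof.
 intros HD Hf Hab HL. assert (HC : rcont_on (fun t => cd f (p + RtoC t * q)%C * q) a b).
 { intros t Ht. apply rcont_mult; [|apply rcont_const]. apply (rcont_comp (cd f) (fun t => p + RtoC t * q)); [apply rcont_affine|].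
  apply (hol_cont D); [apply hol_cd; auto|auto]. }
 apply is_CI_Re_Im.
 - apply (is_RInt_derive (V := R_CompleteNormedModule) (fun t => Re (f (p + RtoC t * q)%C))).
  + intros t Ht. rewrite Rmin_left, Rmax_right in Ht by lra. apply cder_comp_line, (hol_cder D); auto.
  + intros t Ht. rewrite Rmin_left, Rmax_right in Ht by lra. apply rcont_Re, HC, Ht.
 - apply (is_RInt_derive (V := R_CompleteNormedModule) (fun t => Im (f (p + RtoC t * q)%C))).
  + intros t Ht. rewrite Rmin_left, Rmax_right in Ht by lra. apply cder_comp_line, (hol_cder D); auto.
  + intros t Ht. rewrite Rmin_left, Rmax_right in Ht by lra. apply rcont_Im, HC, Ht.
Qed.

Lemma mean_value_line D f (p q : C) a b M : openC D -> hol D f -> a <= b ->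
  (forall t, a <= t <= b -> D (p + RtoC t * q)%C /\ (Cmod (cd f (p + RtoC t * q)%C) <= M)%R) ->
  (Cmod (f (p + RtoC b * q)%C - f (p + RtoC a * q)%C) <= M * Cmod q * (b - a))%R.
Proof.
 intros HD Hf Hab HL. rewrite <- (FTC_line D) by (auto; intros t Ht; apply HL, Ht).
 replace (M * Cmod q * (b - a))%R with ((b - a) * (M * Cmod q))%R by ring. apply CI_bound; auto.
 - intros t Ht. apply rcont_mult; [|apply rcont_const]. apply (rcont_comp (cd f) (fun t => p + RtoC t * q)); [apply rcont_affine|].
  apply (hol_cont D); [apply hol_cd; auto|apply HL, Ht].
 - intros t Ht. rewrite Cmod_mult. apply Rmult_le_compat_r; [apply Cmod_ge_0|apply HL, Ht].
Qed.

Lemma mean_value D f z w M : openC D -> hol D f ->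
  (forall t, 0 <= t <= 1 -> D (w + RtoC t * (z - w))%C /\ (Cmod (cd f (w + RtoC t * (z - w))%C) <= M)%R) ->
  (Cmod (f z - f w) <= M * Cmod (z - w)).
Proof.
 intros HD Hf HL. assert (K := mean_value_line D f w (z - w) 0 1 M HD Hf ltac:(lra) HL). replace (w + 1 * (z - w)) with z in K by ring.
 replace (w + 0 * (z - w)) with w in K by ring. lra.
Qed.

(** * Maximum principles on the half-plane *)

Lemma pair_close (z : C) (u v d : R) : Rabs (Re z - u) < d -> Rabs (Im z - v) < d -> Cmod (z - (u,v)) < 2 * d.
Proof.
 intros H1 H2. eapply Rle_lt_trans; [apply Cmod_le_Re_Im|]. replace (Re (z - (u,v))) with (Re z - u)%R by reflexivity.
 replace (Im (z - (u,v))) with (Im z - v)%R by reflexivity. lra.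
Qed.

(** A Lebesgue number argument: a local property whose radius may be shrunk holds with a single
    radius on a compact rectangle. *)
Lemma compact_rect_uniform (x y a b : R) (P : C -> R -> Prop) :
  (forall z, crect x y a b z -> exists d, 0 < d /\ forall w, Cmod (w - z) < d -> P w d) ->
  (forall w d d', 0 < d' <= d -> P w d -> P w d') ->
  exists d, 0 < d /\ forall w, crect x y a b w -> P w d.
Proof.
 intros H Mon. assert (D : forall u v : R, {d : posreal | crect x y a b (u, v) -> forall w, Cmod (w - (u,v)) < 2 * d -> P w d}).
 { intros u v. apply constructive_indefinite_description. destruct (classic (crect x y a b (u,v))) as [Q|Q].
  - destruct (H _ Q) as (d & Hd & K). exists (mkposreal (d/2) ltac:(lra)). intros _ w Hw. apply Mon with d; simpl; [lra|]. apply K. simpl in Hw. lra.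
  - exists (mkposreal 1 Rlt_0_1). tauto. }
 destruct (compactness_value_2d x (x + a) y (y + b) (fun u v => proj1_sig (D u v))) as [d Hd]. exists d; split; [apply cond_pos|]. intros w Hw.
 apply NNPP. intros N. apply (Hd (Re w) (Im w)); [apply Hw|apply Hw|]. intros (u & v & Hu & Hv & H1 & H2 & H3). apply N. destruct (D u v) as [d' Hd'].
 apply Mon with d'; [split; [apply cond_pos|auto]|]. apply Hd'; [split; assumption|]. apply pair_close; auto.
Qed.

Lemma cont_rect_bounded f x y a b : cont_rect f x y a b -> exists M, 0 <= M /\ forall z, crect x y a b z -> Cmod (f z) <= M.
Proof.
 intros H. destruct (compact_rect_uniform x y a b (fun w d => (Cmod (f w) <= / d))) as (d & Hd & K).
 - intros z Hz. destruct (H z Hz 1%R) as (d & Hd & K); [lra|]. pose proof (Cmod_ge_0 (f z)). exists (Rmin d (/ (Cmod (f z) + 1))).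
  split; [apply Rmin_glb_lt; auto; apply Rinv_0_lt_compat; lra|]. intros w Hw. specialize (K w (proj1 (Rmin_Rgt_l _ _ _ Hw))).
  assert (T := Cmod_tri_inv (f w) (f z)). apply Rle_trans with (Cmod (f z) + 1)%R; [lra|]. rewrite <- (Rinv_inv (Cmod (f z) + 1)) at 1.
  apply Rinv_le_contravar; [|apply Rmin_r]. apply Rmin_glb_lt; auto; apply Rinv_0_lt_compat; lra.
 - intros w d d' [H1 H2] Q. eapply Rle_trans; [exact Q|]. apply Rinv_le_contravar; auto.
 - exists (/ d)%R. split; auto. left; apply Rinv_0_lt_compat; auto.
Qed.

(** Near-maximizers accumulate at a point of the closed rectangle, which may lie on the boundary of
    [X]. *)
Lemma sup_cluster (X : C -> Prop) (w : C -> R) (x y a b S : R) :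
  (forall z, X z -> w z <= S) ->
  (forall e, 0 < e -> exists z, X z /\ crect x y a b z /\ S - e < w z) ->
  exists z0, crect x y a b z0 /\ forall d e, 0 < d -> 0 < e -> exists z, X z /\ Cmod (z - z0) < d /\ S - e < w z.
Proof.
 intros HS HX. apply NNPP. intros N. destruct (compact_rect_uniform x y a b (fun z d => X z -> w z <= S - d)) as (d & Hd & K).
 - intros z Hz. apply NNPP. intros N2. apply N. exists z; split; auto. intros d e Hd He. apply NNPP. intros N3. apply N2. exists (Rmin d e).
  split; [apply Rmin_glb_lt; auto|]. intros u Hu Xu. apply Rnot_lt_le. intros Q. apply N3. exists u. split; [auto|]. split.
  + apply (proj1 (Rmin_Rgt_l _ _ _ Hu)).
  + assert (Rmin d e <= e) by apply Rmin_r. lra.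
 - intros u d d' Hd Q Xu. specialize (Q Xu). lra.
 - destruct (HX d Hd) as (z & Xz & Rz & L). specialize (K z Rz Xz). lra.
Qed.

Definition UHP (z : C) : Prop := (0 < Im z).

(** Its values on the half-plane lie in the unit disc, so the factor exp (K |m|^2) stays between 1
    and exp K. *)
Definition cayley (z : C) : C := (z - Ci) / (z + Ci).

Lemma cayley_den z : 0 <= Im z -> z + Ci <> 0.
Proof. intros H E. apply (f_equal Im) in E. unfold Im, Ci, RtoC, Cplus in *; simpl in *. lra. Qed.

Lemma cayley_le_1 z : 0 <= Im z -> Cmod (cayley z) <= 1.
Proof.
 intros H. unfold cayley. assert (N := cayley_den z H). rewrite Cmod_div by auto. apply Cmod_gt_0 in N. apply (Rmult_le_reg_r (Cmod (z + Ci))); auto.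
 unfold Rdiv. rewrite Rmult_assoc, Rinv_l, Rmult_1_r, Rmult_1_l by lra. apply Rsqr_incr_0_var; [|lra]. unfold Rsqr. rewrite !Cmod_sqr.
 unfold Re, Im, Ci, Cminus, Cplus, Copp in *; simpl in *. nra.
Qed.

Lemma cayley_hol : hol (fun z => 0 <= Im z)%R cayley.
Proof.
 apply hol_div.
 - apply hol_minus; [apply hol_id|apply hol_const].
 - apply hol_plus; [apply hol_id|apply hol_const].
 - apply cayley_den.
Qed.

(** K times the square of this separation is what a maximum at z has to lose on a square of half
    side s about it. *)
Lemma cayley_gap u z s : 0 <= Im u -> 0 <= Im z -> 0 < s -> bsq z s u ->
  (2 * s / ((Cmod z + 2 * s + 1) * (Cmod z + 2 * s + 1)) <= Cmod (cayley u - cayley z)).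
Proof.
 intros Hu Hz Hs B. assert (Nu := cayley_den u Hu). assert (Nz := cayley_den z Hz).
 replace (cayley u - cayley z) with (2 * Ci * (u - z) / ((u + Ci) * (z + Ci))).
 2:{ unfold cayley. field. auto. }
 rewrite Cmod_div, !Cmod_mult, Cmod_R, Cmod_Ci, Rabs_pos_eq by (try lra; apply Cmult_neq_0; auto). assert (F := bsq_far _ _ _ B).
 assert (N := csq_close z s u (proj1 B)). assert (B1 := Cmod_triangle u Ci). assert (B2 := Cmod_triangle z Ci). rewrite Cmod_Ci in B1, B2.
 assert (B3 := Cmod_tri_inv u z). apply Cmod_gt_0 in Nu. apply Cmod_gt_0 in Nz. apply Rmult_le_compat.
 - lra.
 - left; apply Rinv_0_lt_compat, Rmult_lt_0_compat; lra.
 - lra.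
 - apply Rinv_le_contravar; [nra|]. nra.
Qed.

(* Multiplying by [exp (K |m|^2)], [m] the Cayley transform, makes the maximum principle strict:
   a maximum at [z0] loses [K |m - m(z0)|^2] on a surrounding square, which pays for the factor [exp C1]. *)
Theorem master_max_principle (X : C -> Prop) (w : C -> R) (M B K : R) :
  0 <= M -> 0 < K ->
  (forall z, X z -> (0 <= Im z /\ 0 <= w z <= B)) ->
  (exists R0, forall z, X z -> R0 < Cmod z -> w z <= M) ->
  (forall z0, 0 <= Im z0 ->
     (forall e, 0 < e -> exists d, 0 < d /\ forall z, X z -> Cmod (z - z0) < d -> w z <= M + e) \/
     (exists s C1 D g, 0 < s /\ (forall u, csq z0 s u -> D u /\ 0 <= Im u) /\ hol D g /\
        (forall e, 0 < e -> exists d, 0 < d /\ forall z, X z -> Cmod (z - z0) < d -> w z <= exp C1 * Cmod (g z0) + e) /\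
        (forall u, bsq z0 s u -> X u /\ Cmod (g u) <= w u) /\
        (C1 < K * ((2 * s / ((Cmod z0 + 2 * s + 1) * (Cmod z0 + 2 * s + 1))) ^ 2)))) ->
  forall z, X z -> w z <= M * exp K.
Proof.
 intros HM HK HX [R0 HR] HL z1 Xz1. apply Rnot_lt_le. intros Bad. set (m2 := fun z => (Cmod (cayley z) * Cmod (cayley z))%R).
 assert (m2b : forall z, 0 <= Im z -> 0 <= m2 z <= 1).
 { intros z Hz. assert (A := cayley_le_1 z Hz). pose proof (Cmod_ge_0 (cayley z)). unfold m2; nra. }
 set (w1 := fun z => (w z * exp (K * m2 z))%R). assert (Eb : forall z, 0 <= Im z -> 1 <= exp (K * m2 z) <= exp K).
 { intros z Hz. specialize (m2b z Hz). split.
  - rewrite <- exp_0. destruct (Req_dec (K * m2 z) 0) as [->|N]; [lra|]. left; apply exp_increasing. nra.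
  - destruct (Req_dec (K * m2 z) K) as [->|N]; [lra|]. left; apply exp_increasing. nra. }
 assert (EK := exp_pos K). destruct (completeness (fun r => exists z, X z /\ r = w1 z)) as [S [S1 S2]].
 - exists (B * exp K)%R. intros r (z & Xz & ->). destruct (HX z Xz) as [Iz Wz]. specialize (Eb z Iz). unfold w1. nra.
 - exists (w1 z1), z1; auto.
 - assert (Sup : forall z, X z -> w1 z <= S) by (intros z Xz; apply S1; exists z; auto). assert (SM : M * exp K < S).
  { apply Rlt_le_trans with (w z1); auto. apply Rle_trans with (w1 z1); [|auto]. destruct (HX z1 Xz1) as [Iz Wz]. specialize (Eb z1 Iz). unfold w1.
   nra. }
  (* The supremum of [w1] exceeds M exp K, which bounds [w1] near infinity, so it is approached near
     a point [z0] of a bounded rectangle. *)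
  assert (Spos : 0 < S) by nra. set (R1 := (Rabs R0 + 1)%R). destruct (sup_cluster X w1 (- R1) 0 (2 * R1) (R1) S Sup) as (z0 & Hz0 & Cl).
  { intros e He. assert (Q : exists z, X z /\ (S - Rmin e (S - M * exp K) < w1 z)%R).
   { apply NNPP. intros N. assert (P : (0 < Rmin e (S - M * exp K))%R) by (apply Rmin_glb_lt; lra). assert (S <= S - Rmin e (S - M * exp K))%R; [|lra].
    apply S2. intros r (z & Xz & ->). apply Rnot_lt_le. intros L. apply N. exists z; auto. }
   destruct Q as (z & Xz & Qz). exists z. split; auto. assert (M1 := Rmin_l e (S - M * exp K)). assert (M2 := Rmin_r e (S - M * exp K)).
   destruct (HX z Xz) as [Iz Wz]. assert (Cz : Cmod z <= R0).
   { apply Rnot_lt_le. intros L. specialize (HR z Xz L). specialize (Eb z Iz). assert (w1 z <= M * exp K) by (unfold w1; apply Rmult_le_compat; lra).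
    lra. }
   assert (A1 := Rabs_Re_le z). assert (A2 := Rabs_Im_le z). pose proof (Rle_abs R0). assert (A3 := Rle_abs (Re z)). assert (A4 := Rle_abs (- Re z)).
   rewrite Rabs_Ropp in A4. assert (A5 := Rle_abs (Im z)). unfold crect, R1. lra. }
  assert (Iz0 : 0 <= Im z0) by (unfold crect in Hz0; lra). destruct (HL z0 Iz0) as [Ha|(s & C1 & D & g & Hs & HD & Hg & Hu & Hb & Gain)].
  + set (e := ((S - M * exp K) / (2 * exp K))%R). assert (He : 0 < e) by (apply Rdiv_lt_0_compat; lra). destruct (Ha e He) as (d & Hd & K1).
   destruct (Cl d ((S - M * exp K)/2)%R Hd) as (z & Xz & Dz & Wz); [lra|]. specialize (K1 z Xz Dz). destruct (HX z Xz) as [Iz Wz'].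
   specialize (Eb z Iz). assert (w1 z <= (M + e) * exp K) by (unfold w1; apply Rmult_le_compat; lra).
   assert (e * exp K = (S - M * exp K)/2)%R by (unfold e; field; lra). lra.
  (* Near [z0] the function [w1] comes arbitrarily close to S, while it is at most exp C1 |g z0| exp
     (K |m0|^2) up to small errors. *)
  + set (m0 := cayley z0). assert (Low : S <= exp C1 * Cmod (g z0) * exp (K * m2 z0)).
   { apply Rnot_lt_le. intros L. set (G := (exp C1 * Cmod (g z0))%R) in *.
    assert (PG : 0 <= G) by (apply Rmult_le_pos; [left; apply exp_pos|apply Cmod_ge_0]). set (e := (S - G * exp (K * m2 z0))%R).
    assert (He : 0 < e) by (unfold e; lra).
    assert (CE : forall e, 0 < e -> exists d, 0 < d /\ forall z, Cmod (z - z0) < d -> exp (K * m2 z) < exp (K * m2 z0) + e).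
    { intros e' He'. assert (CM : ccont cayley z0) by (apply (hol_cont (fun z => 0 <= Im z)%R); [apply cayley_hol|auto]).
     assert (CX := derivable_continuous_pt _ _ (derivable_pt_exp (K * m2 z0))). destruct (CX e' He') as (d1 & Hd1 & Q1).
     destruct (CM (Rmin 1 (d1 / (4 * K)))%R) as (d & Hd & Q); [apply Rmin_glb_lt; [lra|apply Rdiv_lt_0_compat; lra]|]. exists d; split; auto.
     intros z Dz. specialize (Q z Dz). assert (T1 := Cmod_tri_inv (cayley z) (cayley z0)). assert (T2 := Cmod_tri_inv (cayley z0) (cayley z)).
     rewrite (Cmod_sub_sym (cayley z0) (cayley z)) in T2. assert (L1 := cayley_le_1 z0 Iz0). destruct (Rmin_Rgt_l _ _ _ Q) as [Q2 Q3].
     destruct (Req_dec (K * m2 z) (K * m2 z0)) as [->|Ne]; [lra|]. assert (DD : Rabs (exp (K * m2 z) - exp (K * m2 z0)) < e').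
     { apply Q1. split; [split; [exact I|auto]|]. simpl. unfold Rdist.
      replace (K * m2 z - K * m2 z0)%R with (K * ((Cmod (cayley z) - Cmod (cayley z0)) * (Cmod (cayley z) + Cmod (cayley z0))))%R by (unfold m2; ring).
      pose proof (Cmod_ge_0 (cayley z)); pose proof (Cmod_ge_0 (cayley z0)). rewrite !Rabs_mult, (Rabs_pos_eq K), (Rabs_pos_eq (_ + _)) by lra.
      assert (Rabs (Cmod (cayley z) - Cmod (cayley z0)) < d1 / (4 * K)) by (apply Rabs_def1; lra).
      apply Rle_lt_trans with (K * (Rabs (Cmod (cayley z) - Cmod (cayley z0)) * 3))%R.
      { apply Rmult_le_compat_l; [lra|]. apply Rmult_le_compat_l; [apply Rabs_pos|lra]. }
      apply Rlt_trans with (K * (d1 / (4 * K) * 3))%R; [nra|]. replace (K * (d1 / (4 * K) * 3))%R with (d1 * (3/4))%R by (field; lra). lra. }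
     apply Rabs_def2 in DD. lra. }
    destruct (CE (e / (4 * (G + 1)))%R) as (d1 & Hd1 & Q1); [apply Rdiv_lt_0_compat; lra|].
    destruct (Hu (e / (4 * exp K))%R) as (d2 & Hd2 & Q2); [apply Rdiv_lt_0_compat; lra|].
    destruct (Cl (Rmin d1 d2) (e/4)%R) as (z & Xz & Dz & Wz); [apply Rmin_glb_lt; auto|lra|]. specialize (Q1 z (proj1 (Rmin_Rgt_l _ _ _ Dz))).
    specialize (Q2 z Xz (proj2 (Rmin_Rgt_l _ _ _ Dz))). destruct (HX z Xz) as [Iz Wz']. specialize (Eb z Iz).
    assert (A1 : w1 z <= (G + e / (4 * exp K)) * exp (K * m2 z)) by (unfold w1; apply Rmult_le_compat_r; lra).
    assert (A2 : e / (4 * exp K) * exp (K * m2 z) <= e/4).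
    { apply Rle_trans with (e / (4 * exp K) * exp K)%R; [apply Rmult_le_compat_l; [left; apply Rdiv_lt_0_compat; lra|lra]|right; field; lra]. }
    assert (A3 : G * exp (K * m2 z) <= G * exp (K * m2 z0) + e/4).
    { apply Rle_trans with (G * (exp (K * m2 z0) + e / (4 * (G + 1))))%R; [nra|]. rewrite Rmult_plus_distr_l. apply Rplus_le_compat_l.
     apply Rle_trans with ((G + 1) * (e / (4 * (G + 1))))%R; [apply Rmult_le_compat_r; [left; apply Rdiv_lt_0_compat; lra|lra]|right; field; lra]. }
    unfold e in *. lra. }
   set (C2 := (K * ((2 * s / ((Cmod z0 + 2 * s + 1) * (Cmod z0 + 2 * s + 1))) ^ 2))%R) in *.
   (* The exponent has real part K (|m|^2 - |m - m0|^2). Thus |g1| equals |g| exp (K |m|^2) at [z0]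
      but is smaller by the factor exp (- C2) on the boundary of the square. *)
   set (g1 := fun u => g u * Cexp (RtoC K * (2 * Cconj m0 * (cayley u - m0) + RtoC (m2 z0)))).
   assert (G1m : forall u, Cmod (g1 u) = (Cmod (g u) * exp (K * (m2 u - Cmod (cayley u - m0) * Cmod (cayley u - m0))))%R).
   { intros u. unfold g1. rewrite Cmod_mult, Cmod_Cexp. do 2 f_equal. unfold m2. rewrite !Cmod_sqr.
    unfold Re, Im, Cconj, Cmult, Cminus, Cplus, Copp, RtoC; simpl. ring. }
   assert (Up : Cmod (g1 z0) <= S * exp (- C2)).
   { apply (max_modulus_square (fun u => D u /\ 0 <= Im u)%R g1 z0 s); auto.
    - apply hol_mult.
     + apply (hol_sub _ D); [tauto|auto].
     + apply hol_Cexp, hol_mult; [apply hol_const|]. apply hol_plus; [|apply hol_const]. apply hol_mult; [apply hol_const|].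
      apply hol_minus; [|apply hol_const]. apply (hol_sub _ (fun z => 0 <= Im z)%R); [tauto|apply cayley_hol].
    - intros u Bu. destruct (Hb u Bu) as [Xu Gu]. rewrite G1m. destruct (HX u Xu) as [Iu Wu]. assert (Gp := cayley_gap u z0 s Iu Iz0 Hs Bu).
     fold m0 in Gp. set (gap := (2 * s / ((Cmod z0 + 2 * s + 1) * (Cmod z0 + 2 * s + 1)))%R) in *. assert (Gpos : 0 <= gap).
     { left; apply Rdiv_lt_0_compat; [lra|]. pose proof (Cmod_ge_0 z0). nra. }
     rewrite Rmult_minus_distr_l. unfold Rminus. rewrite exp_plus. rewrite <- Rmult_assoc. apply Rmult_le_compat.
     + apply Rmult_le_pos; [apply Cmod_ge_0|left; apply exp_pos].
     + left; apply exp_pos.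
     + apply Rle_trans with (w1 u); [|auto]. apply Rmult_le_compat_r; [left; apply exp_pos|auto].
     + assert (C2 <= K * (Cmod (cayley u - m0) * Cmod (cayley u - m0))).
      { apply Rmult_le_compat_l; [lra|]. nra. }
      destruct (Req_dec (- (K * (Cmod (cayley u - m0) * Cmod (cayley u - m0)))) (- C2)) as [->|Ne]; [lra|]. left; apply exp_increasing. lra. }
   rewrite G1m in Up. fold m0 in Up. replace (m0 - m0) with (RtoC 0) in Up by ring. rewrite Cmod_0, Rmult_0_l, Rminus_0_r in Up.
   assert (F : S <= exp C1 * (S * exp (- C2))).
   { eapply Rle_trans; [exact Low|]. rewrite Rmult_assoc. apply Rmult_le_compat_l; [left; apply exp_pos|auto]. }
   replace (exp C1 * (S * exp (- C2)))%R with (S * exp (C1 - C2))%R in F by (unfold Rminus; rewrite exp_plus; ring).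
   assert (exp (C1 - C2) < 1) by (rewrite <- exp_0; apply exp_increasing; lra). nra.
Qed.

(** Without local loss, that is with C1 = 0, every K > 0 is admissible in [master_max_principle];
    letting K tend to 0 removes the factor exp K. *)
Lemma le_mult_exp_small (w M : R) : 0 <= M -> (forall K, 0 < K -> w <= M * exp K) -> w <= M.
Proof.
 intros HM H. apply Rnot_lt_le. intros L. assert (CX := derivable_continuous_pt _ _ (derivable_pt_exp 0)).
 destruct (CX ((w - M) / (M + 1))%R) as (d & Hd & Q); [apply Rdiv_lt_0_compat; lra|]. specialize (H (d/2)%R ltac:(lra)).
 assert (DD : Rabs (exp (d/2) - exp 0) < (w - M) / (M + 1)).
 { apply Q. split; [split; [exact I|lra]|]. simpl. unfold Rdist. rewrite Rabs_pos_eq; lra. }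
 rewrite exp_0 in DD. apply Rabs_def2 in DD. assert (M * exp (d/2) <= M + M * ((w - M)/(M + 1))).
 { nra. }
 assert (M * ((w - M)/(M+1)) < w - M); [|lra]. replace (w - M)%R with ((M + 1) * ((w - M)/(M+1)))%R at 2 by (field; lra). lra.
Qed.

Lemma max_principle (X D : C -> Prop) (f : C -> C) (M B : R) :
  0 <= M -> (forall z, X z -> (0 <= Im z /\ Cmod (f z) <= B)) -> hol D f ->
  (exists R0, forall z, X z -> R0 < Cmod z -> Cmod (f z) <= M) ->
  (forall z0, 0 <= Im z0 ->
     (forall e, 0 < e -> exists d, 0 < d /\ forall z, X z -> Cmod (z - z0) < d -> Cmod (f z) <= M + e) \/
     (exists s, 0 < s /\ forall u, csq z0 s u -> D u /\ X u)) ->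
  forall z, X z -> Cmod (f z) <= M.
Proof.
 intros HM HX Hf HR HL z Xz. apply le_mult_exp_small; auto. intros K HK. apply (master_max_principle X (fun z => Cmod (f z)) M B K); auto.
 - intros u Xu. destruct (HX u Xu). repeat split; auto using Cmod_ge_0.
 - intros z0 Hz0. destruct (HL z0 Hz0) as [Ha|(s & Hs & Hb)]; [left; auto|right]. exists s, 0%R, D, f. split; auto.
  split; [|split; [auto|split; [|split]]].
  + intros u Hu. destruct (Hb u Hu) as [H1 H2]. split; auto. apply HX, H2.
  + rewrite exp_0. intros e He. assert (Dz : D z0) by (apply Hb; unfold csq, crect; lra). destruct (hol_cont D f z0 Hf Dz e He) as (d & Hd & Q).
   exists d; split; auto. intros u _ Hu. specialize (Q u Hu). assert (T := Cmod_tri_inv (f u) (f z0)). lra.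
  + intros u [Hu _]. split; [apply Hb, Hu|lra].
  + apply Rmult_lt_0_compat; auto. apply pow_lt. pose proof (Cmod_ge_0 z0). apply Rdiv_lt_0_compat; [lra|nra].
Qed.

Lemma half_plane_max D f M : openC D -> hol D f -> (forall z, 0 <= Im z -> D z) -> 0 <= M ->
  (forall z, Im z = 0%R -> Cmod (f z) <= M) ->
  (forall e, 0 < e -> exists R0, forall z, R0 < Cmod z -> Cmod (f z) <= M + e) ->
  forall z, 0 <= Im z -> Cmod (f z) <= M.
Proof.
 intros HD Hf HH HM HR HI z Hz. apply Rle_plus_epsilon. intros e He. destruct (HI e He) as [R0 HR0].
 destruct (cont_rect_bounded f (- Rabs R0) 0 (2 * Rabs R0) (Rabs R0)) as (B & HB & KB).
 { intros u Hu. apply (hol_cont D); auto. apply HH. unfold crect in Hu; lra. }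
 apply (max_principle (fun z => 0 <= Im z)%R D f (M + e) (Rmax B (M + e))); auto; try lra.
 - intros u Hu. split; auto. destruct (Rlt_dec R0 (Cmod u)) as [L|L].
  + eapply Rle_trans; [auto|apply Rmax_r].
  + eapply Rle_trans; [apply KB|apply Rmax_l]. assert (A1 := Rabs_Re_le u). assert (A2 := Rabs_Im_le u). pose proof (Rle_abs R0).
   assert (A3 := Rle_abs (Re u)). assert (A4 := Rle_abs (- Re u)). rewrite Rabs_Ropp in A4. assert (A5 := Rle_abs (Im u)). unfold crect. lra.
 - exists R0. auto.
 - intros z0 Hz0. destruct (Req_dec (Im z0) 0) as [E|N].
  + left. intros e' He'. destruct (hol_cont D f z0 Hf (HH z0 Hz0) e' He') as (d & Hd & Q). exists d; split; auto. intros u _ Hu. specialize (Q u Hu).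
   specialize (HR z0 E). assert (T := Cmod_tri_inv (f u) (f z0)). lra.
  + right. exists (Im z0). split; [lra|]. intros u Hu. unfold csq, crect in Hu. assert (0 <= Im u) by lra. split; auto.
Qed.

(** * Rows of the Riemann-Hilbert solutions *)

Lemma joined_in_refl_segment (D : C -> Prop) z w :
  (forall t, 0 <= t <= 1 -> D (z + RtoC t * (w - z))) -> joined_in D z w.
Proof.
 exists (fun t => z + RtoC t * (w - z)). split; [|split; [|split; auto]].
 - intros s. apply rcont_continuous, rcont_affine.
 - ring.
 - ring.
Qed.

Lemma rcont_lip (p : R -> C) (h : R -> R) (k : R) s : 0 < k -> (forall t t', Rabs (h t - h t') <= k * Rabs (t - t')) ->
  rcont p (h s) -> rcont (fun t => p (h t)) s.
Proof.
 intros Hk HL H e He. destruct (H e He) as (d & Hd & K). exists (d/k)%R. split; [apply Rdiv_lt_0_compat; auto|]. intros t Ht. apply K.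
 eapply Rle_lt_trans; [apply HL|]. apply Rlt_le_trans with (k * (d/k))%R; [nra|right; field; lra].
Qed.

Lemma joined_in_trans D z w u : joined_in D z w -> joined_in D w u -> joined_in D z u.
Proof.
 (* The two paths with clamped parameters are added and the common point is subtracted, which makes
    continuity immediate. *)
 intros (p & Cp & P0 & P1 & PD) (q & Cq & Q0 & Q1 & QD). exists (fun s => p (Rmin (2 * s) 1) + q (Rmax (2 * s - 1) 0) - w). repeat split.
 - intros s. apply rcont_continuous. apply rcont_minus; [apply rcont_plus|apply rcont_const].
  + apply (rcont_lip p (fun s => Rmin (2 * s) 1) 2); [lra| |apply continuous_rcont, Cp]. intros t t'.
   unfold Rmin; destruct (Rle_dec (2 * t) 1), (Rle_dec (2 * t') 1); unfold Rabs; repeat destruct Rcase_abs; lra.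
  + apply (rcont_lip q (fun s => Rmax (2 * s - 1) 0) 2); [lra| |apply continuous_rcont, Cq]. intros t t'.
   unfold Rmax; destruct (Rle_dec (2 * t - 1) 0), (Rle_dec (2 * t' - 1) 0); unfold Rabs; repeat destruct Rcase_abs; lra.
 - rewrite Rmult_0_r, Rmin_left, Rmax_right, P0, Q0 by lra. ring.
 - rewrite Rmult_1_r, Rmin_right, Rmax_left, P1 by lra. replace (2 - 1)%R with 1%R by ring. rewrite Q1. ring.
 - intros s Hs. destruct (Rle_dec (2 * s) 1) as [L|L].
  + rewrite Rmin_left, Rmax_right, Q0 by lra. replace (p (2 * s)%R + w - w) with (p (2 * s)%R) by ring. apply PD; lra.
  + rewrite Rmin_right, Rmax_left, P1 by lra. replace (w + q (2 * s - 1)%R - w) with (q (2 * s - 1)%R) by ring. apply QD; lra.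
Qed.

Lemma joined_in_conj D z w : joined_in D z w -> joined_in (fun u => D (Cconj u)) (Cconj z) (Cconj w).
Proof.
 intros (p & Cp & P0 & P1 & PD). exists (fun s => Cconj (p s)). repeat split.
 - intros s. apply rcont_continuous. assert (K := continuous_rcont _ _ (Cp s)). intros e He. destruct (K e He) as (d & Hd & Q). exists d; split; auto.
  intros t Ht. rewrite <- Cminus_conj, Cconj_mod. auto.
 - rewrite P0; auto.
 - rewrite P1; auto.
 - intros s Hs. rewrite Cconj_conj. auto.
Qed.

Definition Gconj (G : C -> Prop) : C -> Prop := fun z => G (Cconj z).

Lemma component_bounded_conj G z : component_bounded G z -> component_bounded (Gconj G) (Cconj z).
Proof.
 intros [M H]. exists M. intros w Hw. rewrite <- Cconj_mod. apply H. apply joined_in_conj in Hw. rewrite Cconj_conj in Hw.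
 destruct Hw as (p & Cp & P0 & P1 & PD). exists p. repeat split; auto. intros s Hs Gs. apply (PD s Hs). unfold Gconj. rewrite Cconj_conj. auto.
Qed.

Lemma Gconj_conj G : Gconj (Gconj G) = G.
Proof. apply functional_extensionality. intros z. unfold Gconj. rewrite Cconj_conj. reflexivity. Qed.

Lemma interior_conj G z : interior_of (Gconj G) z <-> interior_of G (Cconj z).
Proof.
 unfold interior_of. split; intros [H1 H2].
 - apply component_bounded_conj in H2. rewrite Gconj_conj in H2. auto.
 - apply component_bounded_conj in H2. rewrite Cconj_conj in H2. auto.
Qed.

Lemma exterior_conj G z : exterior_of (Gconj G) z <-> exterior_of G (Cconj z).
Proof.
 split; intros [H1 H2]; split; auto; intros H.
 - apply component_bounded_conj in H. rewrite Cconj_conj in H. auto.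
 - apply component_bounded_conj in H. rewrite Gconj_conj in H. auto.
Qed.

(** The properties of the curve on which the rest relies: it and its conjugate are thin, inside and
    outside are open, and the closed lower half-plane and a neighbourhood of infinity lie
    outside. *)
Record contour (G : C -> Prop) : Prop := {
  ct_loc : forall z, ~ G z -> exists d, 0 < d /\ forall w, Cmod (w - z) < d ->
     ~ G w /\ (component_bounded G w <-> component_bounded G z);
  ct_thin : thin G;
  ct_thinc : thin (Gconj G);
  ct_up : forall z, G z -> (0 < Im z);
  ct_low : forall z, Im z <= 0 -> exterior_of G z;
  ct_far : exists R0, forall z, R0 < Cmod z -> exterior_of G z
}.

Lemma component_bounded_joined G z w : joined_in (fun u => ~ G u) z w -> component_bounded G z -> component_bounded G w.
Proof. intros J [M H]. exists M. intros u Hu. apply H. apply (joined_in_trans _ z w u); auto. Qed.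

Lemma segment_in_ball z0 z w t d : 0 <= t <= 1 -> Cmod (z - z0) < d -> Cmod (w - z0) < d ->
  (Cmod (z + RtoC t * (w - z) - z0)%C < d).
Proof.
 intros Ht Hz Hw. replace (z + t * (w - z) - z0) with (RtoC (1 - t) * (z - z0) + RtoC t * (w - z0)) by (rewrite RtoC_minus; ring).
 eapply Rle_lt_trans; [apply Cmod_triangle|]. rewrite !Cmod_mult, !Cmod_R, !Rabs_pos_eq by lra. destruct (Req_dec t 0) as [->|N]; [lra|]. nra.
Qed.

(** The parametrization extends holomorphically, so its derivative is bounded on a period. *)
Lemma curve_lipschitz gamma : simple_closed_analytic_curve gamma ->
  exists M, 0 <= M /\ forall s t, 0 <= s <= 1 -> 0 <= t <= 1 -> Cmod (gamma s - gamma t) <= M * Rabs (s - t).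
Proof.
 intros (_ & _ & V & g & HV & HR & Hg & E). apply open_openC in HV.
 assert (Hh : hol V g) by (intros z Hz; destruct (Hg z Hz) as [l Hl]; exists l; apply is_derive_cder, Hl).
 assert (LN : forall t, (0 + RtoC t * 1) = RtoC t) by (intros; ring).
 destruct (rcont_bounded (fun t => cd g (0 + RtoC t * 1)) 0 1) as (M & HM & K); [lra| |].
 { intros t Ht. apply (rcont_comp (cd g) (fun t => 0 + RtoC t * 1)); [apply rcont_affine|]. apply (hol_cont V); [apply hol_cd; auto|]. rewrite LN.
  auto. }
 exists M; split; auto. assert (A : forall s t, 0 <= s <= 1 -> 0 <= t <= 1 -> s <= t -> Cmod (gamma t - gamma s) <= M * (t - s)).
 { intros s t Hs Ht Hst. assert (Q := mean_value_line V g 0 1 s t M HV Hh Hst). rewrite !LN in Q. destruct (E s) as [E1 _]. destruct (E t) as [E2 _].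
  rewrite E1, E2, Cmod_1, Rmult_1_r in Q. apply Q. split; [rewrite LN; auto|apply K; lra]. }
 intros s t Hs Ht. destruct (Rle_dec s t).
 - rewrite Cmod_sub_sym, Rabs_minus_sym, Rabs_pos_eq by lra. auto.
 - rewrite Rabs_pos_eq by lra. apply A; lra.
Qed.

Lemma curve_image_01 (gamma : R -> C) : (forall s, gamma (s + 1)%R = gamma s) -> forall s, exists t, 0 <= t <= 1 /\ gamma s = gamma t.
Proof.
 intros P. assert (PN : forall n s, gamma (s + INR n)%R = gamma s).
 { induction n as [|n IH]; intros s; [simpl; f_equal; ring|]. rewrite S_INR, <- Rplus_assoc, P. apply IH. }
 intros s. pose proof (Rabs_pos s). destruct (nfloor_ex (Rabs s + 1)%R) as [m Hm]; [lra|]. destruct (nfloor_ex (s + INR m)%R) as [n Hn].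
 { assert (T := Rle_abs (- s)). rewrite Rabs_Ropp in T. lra. }
 exists (s + INR m - INR n)%R. split; [lra|]. rewrite <- (PN n (s + INR m - INR n)%R).
 replace (s + INR m - INR n + INR n)%R with (s + INR m)%R by ring. auto.
Qed.

Lemma curve_contour gamma : simple_closed_analytic_curve gamma -> (forall s, 0 < Im (gamma s)) -> contour (curve_image gamma).
Proof.
 intros HS HU. destruct (curve_lipschitz gamma HS) as (M & HM & Lip).
 assert (Per : forall s, gamma (s + 1)%R = gamma s) by (destruct HS as [P _]; exact P). assert (I01 := curve_image_01 gamma Per).
 (* The Lipschitz bound is available on [0, 1], so the parameter is clamped to that interval. *)
 assert (Rc : rcont_on (fun s => gamma (Rmax 0 (Rmin s 1))) 0 1).
 { assert (LM : forall t t', Rabs (Rmax 0 (Rmin t 1) - Rmax 0 (Rmin t' 1)) <= 1 * Rabs (t - t')).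
  { intros t t'. unfold Rmax, Rmin. repeat destruct Rle_dec; unfold Rabs; repeat destruct Rcase_abs; lra. }
  intros s Hs e He. exists (e / (M + 1))%R. split; [apply Rdiv_lt_0_compat; lra|]. intros t Ht. eapply Rle_lt_trans.
  - apply Lip; unfold Rmax, Rmin; repeat destruct Rle_dec; lra.
  - specialize (LM t s). apply Rle_lt_trans with ((M + 1) * Rabs (t - s))%R.
   + apply Rmult_le_compat; try lra; apply Rabs_pos.
   + apply Rlt_le_trans with ((M + 1) * (e / (M + 1)))%R; [nra|right; field; lra]. }
 assert (Cl : forall z, ~ curve_image gamma z -> exists d, 0 < d /\ forall w, Cmod (w - z) < d -> ~ curve_image gamma w).
 { intros z Hz. destruct (rcont_min_dist (fun s => gamma (Rmax 0 (Rmin s 1))) 0 1 z) as (d & Hd & K); [lra|auto| |].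
  - intros s _ E. apply Hz. eexists; symmetry; exact E.
  - exists d; split; auto. intros w Hw [s E]. destruct (I01 s) as (t & Ht & Et). specialize (K t Ht). rewrite Rmin_left, Rmax_right in K by lra.
   rewrite <- Et, <- E in K. lra. }
 assert (Bd : exists B, forall z, curve_image gamma z -> Cmod z <= B).
 { exists (Cmod (gamma 0%R) + M)%R. intros z [s ->]. destruct (I01 s) as (t & Ht & ->). assert (T := Cmod_tri_inv (gamma t) (gamma 0%R)).
  assert (Q := Lip t 0%R Ht ltac:(lra)). rewrite Rabs_pos_eq in Q by lra. nra. }
 constructor.
 - intros z Hz. destruct (Cl z Hz) as (d & Hd & K). exists d; split; auto. split; [auto|].
  assert (Z0 : Cmod (z - z) < d) by (rewrite Cmod_sub_diag; auto).
  split; apply component_bounded_joined; apply joined_in_refl_segment; intros t Ht; apply K, segment_in_ball; auto.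
 - apply (thin_lipschitz gamma 0 1 M); auto; try lra. intros z [s ->]. apply I01.
 - apply (thin_lipschitz (fun s => Cconj (gamma s)) 0 1 M); try lra.
  + intros s t Hs Ht. rewrite <- Cminus_conj, Cconj_mod. auto.
  + intros z [s E]. destruct (I01 s) as (t & Ht & Et). exists t. rewrite <- Et, <- E, Cconj_conj. auto.
 - intros z [s ->]. auto.
 - split.
  + intros [s ->]. specialize (HU s). lra.
  (* From a point of the closed lower half-plane the vertical ray downwards avoids the curve and
     leaves every disc. *)
  + intros [B HB]. assert (Q := HB (z - RtoC (Rabs B + Cmod z + 1) * Ci)).
   assert (J : joined_in (fun u => ~ curve_image gamma u) z (z - RtoC (Rabs B + Cmod z + 1) * Ci)).
   { apply joined_in_refl_segment. intros t Ht [s E]. specialize (HU s). rewrite <- E in HU. pose proof (Rabs_pos B). pose proof (Cmod_ge_0 z).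
    set (k := (Rabs B + Cmod z + 1)%R) in *. assert (I : Im (z + t * (z - RtoC k * Ci - z)) = (Im z - t * k)%R).
    { unfold Im, Cplus, Cminus, Cmult, Copp, Ci, RtoC; simpl. ring. }
    assert (0 <= t * k) by (apply Rmult_le_pos; unfold k; lra). lra. }
   specialize (Q J). pose proof (Rabs_pos B). pose proof (Cmod_ge_0 z). pose proof (Rle_abs B). set (k := (Rabs B + Cmod z + 1)%R) in *.
   assert (T := Cmod_tri_inv (RtoC k * Ci) z). rewrite Cmod_mult, Cmod_R, Cmod_Ci, Rabs_pos_eq in T by (unfold k; lra).
   rewrite (Cmod_sub_sym (RtoC k * Ci) z) in T. unfold k in *; lra.
 - destruct Bd as [B HB]. exists (Rabs B). split.
  + intros Gz. specialize (HB z Gz). pose proof (Rle_abs B). lra.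
  (* Outside a disc that contains the curve, the ray pointing away from 0 does the same. *)
  + intros [B' HB']. set (k := (Rabs B' + 1)%R). pose proof (Rabs_pos B'). pose proof (Rabs_pos B). pose proof (Rle_abs B). pose proof (Rle_abs B').
   set (c := (1 + k / Cmod z)%R). assert (Pk : 0 < k / Cmod z) by (apply Rdiv_lt_0_compat; unfold k; lra). assert (Q := HB' (RtoC c * z)).
   assert (J : joined_in (fun u => ~ curve_image gamma u) z (RtoC c * z)).
   { apply joined_in_refl_segment. intros t Ht Gs. specialize (HB _ Gs).
    replace (z + t * (RtoC c * z - z)) with (RtoC (1 + t * (k / Cmod z)) * z) in HB.
    2:{ unfold c. rewrite !RtoC_plus, RtoC_mult. ring. }
    assert (0 <= t * (k / Cmod z)) by nra. rewrite Cmod_mult, Cmod_R, Rabs_pos_eq in HB by lra. nra. }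
   specialize (Q J). rewrite Cmod_mult, Cmod_R, Rabs_pos_eq in Q by (unfold c; lra). assert (c * Cmod z = Cmod z + k)%R by (unfold c; field; lra).
   unfold k in *. lra.
Qed.

Lemma conj_curve_image gamma : curve_image (conj_curve gamma) = Gconj (curve_image gamma).
Proof.
 apply functional_extensionality. intros z. unfold conj_curve. apply propositional_extensionality. split.
 - intros [s ->]. exists (- s)%R. rewrite Cconj_conj. auto.
 - intros [s E]. exists (- s)%R. rewrite Ropp_involutive, <- E, Cconj_conj. auto.
Qed.

(** The jump X_+ = X_- + u Y, with Y continuous across [G], amounts to the existence of a limit of
    this function at every point of [G]. *)
Definition glue (G : C -> Prop) (u X Y : C -> C) (z : C) : C :=
  if dec (component_bounded G z) then X z + u z * Y z else X z.

(* A row (p, q) of the solution is the pair (X, Y) = (p, q); by the Schwarz symmetry of the jumps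
   (- star q, star p), with star f (z) = conj (f (conj z)), is another pair for the same [u]. *)
Record pair_sol (G : C -> Prop) (u X Y : C -> C) (X0 : C) : Prop := {
  ps_X : hol (fun z => ~ G z) X;
  ps_Y : hol (fun z => ~ Gconj G z) Y;
  ps_lim : forall z, G z -> exists l, punctured_limit (glue G u X Y) G z l;
  ps_inf : exists M R0, 0 <= M /\ forall z, R0 < Cmod z -> (Cmod (X z - X0) <= M / Cmod z)
}.
Arguments ps_X {_ _ _ _ _}.
Arguments ps_Y {_ _ _ _ _}.
Arguments ps_lim {_ _ _ _ _}.
Arguments ps_inf {_ _ _ _ _}.

Definition star (f : C -> C) (z : C) : C := Cconj (f (Cconj z)).

Definition lim_in (D : C -> Prop) (f : C -> C) (z l : C) : Prop :=
  forall e, 0 < e -> exists d, 0 < d /\ forall w, Cmod (w - z) < d -> D w -> Cmod (f w - l) < e.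

Lemma boundary_value_lim A D z B i j : boundary_value A D z B -> (i < 2)%nat -> (j < 2)%nat ->
  lim_in D (fun w => entry (A w) i j) z (entry B i j).
Proof.
 intros H Hi Hj e He. assert (He2 : 0 < e/2) by lra.
 assert (K := proj1 (filterlim_locally (U := C_UniformSpace) _ _) (H i j Hi Hj) (mkposreal _ He2)). destruct K as [d K].
 exists d; split; [apply cond_pos|]. intros w Hw Dw. assert (Q := K w (Cmod_ball_C z w d Hw) Dw). apply ball_C_Cmod in Q. simpl in Q. lra.
Qed.

Lemma entry_lower (B : M2) (u : C) i : (i < 2)%nat ->
  entry (Mmult (T := C_Ring) B (lower_unipotent u)) i 0 = entry B i 0 + entry B i 1 * u /\
  entry (Mmult (T := C_Ring) B (lower_unipotent u)) i 1 = entry B i 1.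
Proof.
 intros Hi. unfold entry, Mmult. rewrite !coeff_mat_bij by lia. unfold lower_unipotent. change (pred 2) with 1%nat.
 rewrite !sum_Sn, !sum_O, !coeff_mat_bij by lia. unfold plus, mult; simpl. change zero with (RtoC 0). split; ring.
Qed.

Lemma entry_upper (B : M2) (u : C) i : (i < 2)%nat ->
  entry (Mmult (T := C_Ring) B (upper_unipotent u)) i 1 = entry B i 1 + entry B i 0 * u /\
  entry (Mmult (T := C_Ring) B (upper_unipotent u)) i 0 = entry B i 0.
Proof.
 intros Hi. unfold entry, Mmult. rewrite !coeff_mat_bij by lia. unfold upper_unipotent. change (pred 2) with 1%nat.
 rewrite !sum_Sn, !sum_O, !coeff_mat_bij by lia. unfold plus, mult; simpl. change zero with (RtoC 0). split; ring.
Qed.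

Lemma entry_Mone i j : (i < 2)%nat -> (j < 2)%nat ->
  entry (Mone (T := C_Ring)) i j = if Nat.eq_dec i j then 1 else 0.
Proof. destruct i as [|[|]], j as [|[|]]; try lia; reflexivity. Qed.

Lemma lim_in_ext_int (G : C -> Prop) f z l : lim_in (exterior_of G) f z l -> lim_in (interior_of G) f z l ->
  punctured_limit f G z l.
Proof.
 intros H1 H2 e He. destruct (H1 e He) as (d1 & Hd1 & K1). destruct (H2 e He) as (d2 & Hd2 & K2).
 exists (Rmin d1 d2); split; [apply Rmin_glb_lt; auto|]. intros w Hw Nw. destruct (classic (component_bounded G w)).
 - apply K2; [apply (proj2 (Rmin_Rgt_l _ _ _ Hw))|split; auto].
 - apply K1; [apply (proj1 (Rmin_Rgt_l _ _ _ Hw))|split; auto].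
Qed.

Lemma lim_in_ext_fun (D : C -> Prop) f g z l d : 0 < d -> (forall w, Cmod (w - z) < d -> D w -> f w = g w) ->
  lim_in D f z l -> lim_in D g z l.
Proof.
 intros Hd E H e He. destruct (H e He) as (d' & Hd' & K). exists (Rmin d d'); split; [apply Rmin_glb_lt; auto|]. intros w Hw Dw.
 rewrite <- E; auto; [apply K; auto|]; [apply (proj2 (Rmin_Rgt_l _ _ _ Hw))|apply (proj1 (Rmin_Rgt_l _ _ _ Hw))].
Qed.

Lemma lim_in_plus D f g z l m : lim_in D f z l -> lim_in D g z m -> lim_in D (fun w => f w + g w) z (l + m).
Proof.
 intros H1 H2 e He. destruct (H1 (e/2)%R) as (d1 & Hd1 & K1); [lra|]. destruct (H2 (e/2)%R) as (d2 & Hd2 & K2); [lra|].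
 exists (Rmin d1 d2); split; [apply Rmin_glb_lt; auto|]. intros w Hw Dw. specialize (K1 w (proj1 (Rmin_Rgt_l _ _ _ Hw)) Dw).
 specialize (K2 w (proj2 (Rmin_Rgt_l _ _ _ Hw)) Dw). replace (f w + g w - (l + m)) with ((f w - l) + (g w - m)) by ring.
 eapply Rle_lt_trans; [apply Cmod_triangle|lra].
Qed.

Lemma lim_in_mult D f g z l m : lim_in D f z l -> lim_in D g z m -> lim_in D (fun w => f w * g w) z (l * m).
Proof.
 intros Hf Hg e He. destruct (mult_eps l m e He) as (e' & He' & K). destruct (Hf e' He') as (d1 & Hd1 & H1). destruct (Hg e' He') as (d2 & Hd2 & H2).
 exists (Rmin d1 d2); split; [apply Rmin_glb_lt; lra|]. intros w Hw Dw. apply Rmin_Rgt_l in Hw. apply K; [apply H1|apply H2]; auto; apply Hw.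
Qed.

Lemma ccont_lim_in D f z : ccont f z -> lim_in D f z (f z).
Proof. intros H e He. destruct (H e He) as (d & Hd & K). exists d; auto. Qed.

Lemma lim_in_conj D f z l : lim_in D f z l -> lim_in (fun w => D (Cconj w)) (star f) (Cconj z) (Cconj l).
Proof.
 intros H e He. destruct (H e He) as (d & Hd & K). exists d; split; auto. intros w Hw Dw. unfold star. rewrite <- Cminus_conj, Cconj_mod.
 apply K; auto. rewrite <- (Cconj_conj z), <- Cminus_conj, Cconj_mod. auto.
Qed.

(** On [G] only p jumps and on the conjugate curve only q, so each extends across the other curve.
    On the conjugate curve the jump entry is minus the conjugate of u; conjugating the relation
    there transports it to [G] and yields the second pair. *)
Lemma rhp_pairs (G : C -> Prop) (u v : C -> C) (A : C -> M2) : contour G ->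
  (forall z, G z -> ccont u z) ->
  (forall z, v (Cconj z) = - Cconj (u z)) ->
  RHP_solution G (Gconj G) (fun z => lower_unipotent (u z)) (fun z => upper_unipotent (v z)) A ->
  exists p q, pair_sol G u p q 1 /\ pair_sol G u (fun z => - star q z) (star p) 0 /\
    forall z, ~ G z -> ~ Gconj G z -> q z = entry (A z) 0 1.
Proof.
 intros HG Hu Huv (HH & (M & R0 & HI) & J1 & J2). set (p0 := fun z => entry (A z) 0 0). set (q0 := fun z => entry (A z) 0 1).
 assert (Gsep : forall z, G z -> ~ Gconj G z).
 { intros z Gz Gz'. apply (ct_up G HG) in Gz. apply (ct_up G HG) in Gz'. unfold Im, Cconj in *; simpl in *. lra. }
 assert (clG : forall z, ~ G z -> exists d, 0 < d /\ forall w, Cmod (w - z) < d -> ~ G w).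
 { intros z Hz. destruct (ct_loc G HG z Hz) as (d & Hd & K). exists d; split; auto. intros w Hw; apply K, Hw. }
 assert (clGc : forall z, ~ Gconj G z -> exists d, 0 < d /\ forall w, Cmod (w - z) < d -> ~ Gconj G w).
 { intros z Hz. destruct (clG (Cconj z) Hz) as (d & Hd & K). exists d; split; auto. intros w Hw. apply K. rewrite <- Cminus_conj, Cconj_mod. auto. }
 assert (H0 : forall f, f = p0 \/ f = q0 -> hol (fun z => ~ G z /\ ~ Gconj G z) f).
 { intros f [->| ->] z Hz; [destruct (HH 0%nat 0%nat ltac:(lia) ltac:(lia) z Hz) as [l Hl]|destruct (HH 0%nat 1%nat ltac:(lia) ltac:(lia) z Hz) as [l Hl]]; exists l; apply is_derive_cder, Hl. }
 assert (K1 : forall z, G z -> exists pp pm qq, lim_in (exterior_of G) p0 z pp /\ lim_in (interior_of G) p0 z pm /\ lim_in (exterior_of G) q0 z qq /\ lim_in (interior_of G) q0 z qq /\ pp = pm + qq * u z).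
 { intros z Gz. destruct (J1 z Gz) as (Ap & Am & B1 & B2 & E). destruct (entry_lower Am (u z) 0 ltac:(lia)) as [E1 E2]. rewrite <- E in E1, E2.
  exists (entry Ap 0 0), (entry Am 0 0), (entry Am 0 1). split; [apply (boundary_value_lim A _ z Ap 0 0); auto|].
  split; [apply (boundary_value_lim A _ z Am 0 0); auto|]. split; [rewrite <- E2; apply (boundary_value_lim A _ z Ap 0 1); auto|].
  split; [apply (boundary_value_lim A _ z Am 0 1); auto|]. auto. }
 assert (K2 : forall z, Gconj G z -> exists qp qm pp, lim_in (exterior_of (Gconj G)) q0 z qp /\ lim_in (interior_of (Gconj G)) q0 z qm /\ lim_in (exterior_of (Gconj G)) p0 z pp /\ lim_in (interior_of (Gconj G)) p0 z pp /\ qp = qm + pp * v z).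
 { intros z Gz. destruct (J2 z Gz) as (Ap & Am & B1 & B2 & E). destruct (entry_upper Am (v z) 0 ltac:(lia)) as [E1 E2]. rewrite <- E in E1, E2.
  exists (entry Ap 0 1), (entry Am 0 1), (entry Am 0 0). split; [apply (boundary_value_lim A _ z Ap 0 1); auto|].
  split; [apply (boundary_value_lim A _ z Am 0 1); auto|]. split; [rewrite <- E2; apply (boundary_value_lim A _ z Ap 0 0); auto|].
  split; [apply (boundary_value_lim A _ z Am 0 0); auto|]. auto. }
 assert (opG : openC (fun z => ~ G z)) by auto. assert (opGc : openC (fun z => ~ Gconj G z)) by auto.
 destruct (hol_extension p0 (Gconj G) (fun z => ~ G z) opG (ct_thinc G HG) clGc (H0 p0 (or_introl eq_refl))) as (p & Hp & Ep).
 { intros z _ Gz. destruct (K2 z Gz) as (qp & qm & pp & _ & _ & L1 & L2 & _). exists pp. apply lim_in_ext_int; auto. }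
 destruct (hol_extension q0 G (fun z => ~ Gconj G z) opGc (ct_thin G HG) clG) as (q & Hq & Eq).
 { apply (hol_sub _ (fun z => ~ G z /\ ~ Gconj G z)); [tauto|auto]. }
 { intros z _ Gz. destruct (K1 z Gz) as (pp & pm & qq & _ & _ & L1 & L2 & _). exists qq. apply lim_in_ext_int; auto. }
 exists p, q. assert (Far : exists R1, forall z, R1 < Cmod z -> ~ G z /\ ~ Gconj G z).
 { destruct (ct_far G HG) as [R1 HR1]. exists R1. intros z Hz. split; [apply (HR1 z Hz)|]. apply (HR1 (Cconj z)). rewrite Cconj_mod; auto. }
 destruct Far as [R1 HR1]. assert (Gop : forall z, G z -> exists d, 0 < d /\ forall w, Cmod (w - z) < d -> ~ Gconj G w).
 { auto. }
 split; [|split].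
 - constructor; auto.
  + intros z Gz. destruct (K1 z Gz) as (pp & pm & qq & L1 & L2 & L3 & L4 & E). exists pp. destruct (Gop z Gz) as (d & Hd & KG). apply lim_in_ext_int.
   * apply (lim_in_ext_fun _ p0 _ _ _ d Hd); auto. intros w Hw [_ Nw]. unfold glue. destruct (dec (component_bounded G w)); [tauto|].
    symmetry; apply Ep, KG, Hw.
   * rewrite E. apply (lim_in_ext_fun _ (fun w => p0 w + q0 w * u w) _ _ _ d Hd).
    -- intros w Hw [Nw Bw]. unfold glue. destruct (dec (component_bounded G w)); [|tauto]. rewrite Ep, Eq by auto. ring.
    -- apply lim_in_plus; auto. apply lim_in_mult; auto. apply ccont_lim_in, Hu, Gz.
  + exists (Rabs M), (Rmax R0 R1). split; [apply Rabs_pos|]. intros z Hz. assert (Z1 := Rle_lt_trans _ _ _ (Rmax_l _ _) Hz).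
   assert (Z2 := Rle_lt_trans _ _ _ (Rmax_r _ _) Hz). destruct (HR1 z Z2) as [N1 N2]. rewrite Ep by auto.
   assert (Q := HI z Z1 0%nat 0%nat ltac:(lia) ltac:(lia)). eapply Rle_trans; [exact Q|]. unfold Rdiv. destruct (Req_dec (Cmod z) 0) as [Z|Z].
   * rewrite Z, Rinv_0. lra.
   * apply Rmult_le_compat_r; [left; apply Rinv_0_lt_compat; pose proof (Cmod_ge_0 z); lra|apply Rle_abs].
 - constructor.
  + apply hol_opp. apply (hol_sub _ (fun z => ~ Gconj G (Cconj z))); [|apply (hol_conj (fun z => ~ Gconj G z)); auto]. intros z Hz. unfold Gconj.
   rewrite Cconj_conj. auto.
  + apply (hol_conj (fun z => ~ G z)); auto.
  + intros z Gz. assert (Gz' : Gconj G (Cconj z)) by (unfold Gconj; rewrite Cconj_conj; auto).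
   destruct (K2 _ Gz') as (qp & qm & pp & L1 & L2 & L3 & L4 & E). exists (- Cconj qp). destruct (Gop z Gz) as (d & Hd & KG). apply lim_in_conj in L1.
   apply lim_in_conj in L2. apply lim_in_conj in L4. rewrite !Cconj_conj in *. assert (Nz : forall w, Cmod (w - z) < d -> ~ G (Cconj w)) by auto.
   apply lim_in_ext_int.
   * apply (lim_in_ext_fun _ (fun w => (-1) * star q0 w) _ _ _ d Hd).
    -- intros w Hw [_ Nw]. unfold glue. destruct (dec (component_bounded G w)); [tauto|]. unfold star. rewrite Eq; [ring|]. auto.
    -- replace (- Cconj qp) with ((-1) * Cconj qp) by ring. apply lim_in_mult.
     ++ apply (ccont_lim_in _ (fun _ => (-1))), ccont_const.
     ++ intros e He. destruct (L1 e He) as (d' & Hd' & K). exists d'; split; auto. intros w Hw Dw. apply K; auto. apply exterior_conj.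
      rewrite Cconj_conj. auto.
   * replace (- Cconj qp) with ((-1) * Cconj qm + Cconj pp * u z).
    2:{ rewrite E, Cplus_conj, Cmult_conj. rewrite Huv, <- Cconj_conj with (c := u z) at 1. replace (Cconj (- Cconj (u z))) with (- u z).
     2:{ rewrite Copp_conj, Cconj_conj. auto. }
     rewrite Cconj_conj. ring. }
    apply (lim_in_ext_fun _ (fun w => (-1) * star q0 w + star p0 w * u w) _ _ _ d Hd).
    -- intros w Hw [Nw Bw]. unfold glue. destruct (dec (component_bounded G w)); [|tauto]. unfold star. rewrite Eq by auto. rewrite Ep; [ring|].
     unfold Gconj. rewrite Cconj_conj. auto.
    -- apply lim_in_plus; apply lim_in_mult.
     ++ apply (ccont_lim_in _ (fun _ => (-1))), ccont_const.
     ++ intros e He. destruct (L2 e He) as (d' & Hd' & K). exists d'; split; auto. intros w Hw Dw. apply K; auto. apply interior_conj.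
      rewrite Cconj_conj. auto.
     ++ intros e He. destruct (L4 e He) as (d' & Hd' & K). exists d'; split; auto. intros w Hw Dw. apply K; auto. apply interior_conj.
      rewrite Cconj_conj. auto.
     ++ apply ccont_lim_in, Hu, Gz.
  + exists (Rabs M), (Rmax R0 R1). split; [apply Rabs_pos|]. intros z Hz. assert (Z1 := Rle_lt_trans _ _ _ (Rmax_l _ _) Hz).
   assert (Z2 := Rle_lt_trans _ _ _ (Rmax_r _ _) Hz). destruct (HR1 z Z2) as [N1 N2]. unfold star. rewrite Eq by auto.
   assert (Q := HI (Cconj z) ltac:(rewrite Cconj_mod; auto) 0%nat 1%nat ltac:(lia) ltac:(lia)). rewrite entry_Mone in Q by lia. simpl in Q.
   rewrite Cconj_mod in Q. replace (- Cconj (q0 (Cconj z)) - 0) with (- Cconj (q0 (Cconj z))) by ring. rewrite Cmod_opp, Cconj_mod.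
   replace (entry (A (Cconj z)) 0 1 - 0) with (q0 (Cconj z)) in Q by (unfold q0; ring). eapply Rle_trans; [exact Q|]. unfold Rdiv.
   destruct (Req_dec (Cmod z) 0) as [Z|Z].
   * rewrite Z, Rinv_0. lra.
   * apply Rmult_le_compat_r; [left; apply Rinv_0_lt_compat; pose proof (Cmod_ge_0 z); lra|apply Rle_abs].
 - auto.
Qed.

(** * Representation by Cauchy transforms *)

Lemma punctured_sub f (E E' : C -> Prop) z l : (forall w, E w -> E' w) -> punctured_limit f E z l -> punctured_limit f E' z l.
Proof. intros S H e He. destruct (H e He) as (d & Hd & K). exists d; split; auto. Qed.

Lemma punctured_ext f g E z l d : 0 < d -> (forall w, Cmod (w - z) < d -> ~ E w -> f w = g w) ->
  punctured_limit f E z l -> punctured_limit g E z l.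
Proof. apply lim_in_ext_fun. Qed.

Lemma punctured_plus f g E z l m : punctured_limit f E z l -> punctured_limit g E z m ->
  punctured_limit (fun w => f w + g w) E z (l + m).
Proof. apply lim_in_plus. Qed.

Lemma punctured_mult f g E z l m : punctured_limit f E z l -> punctured_limit g E z m ->
  punctured_limit (fun w => f w * g w) E z (l * m).
Proof. apply lim_in_mult. Qed.

Lemma punctured_cont f E z : ccont f z -> punctured_limit f E z (f z).
Proof. apply ccont_lim_in. Qed.

Lemma punctured_star f E z l : punctured_limit f E (Cconj z) l -> punctured_limit (star f) (Gconj E) z (Cconj l).
Proof. intros H. apply lim_in_conj in H. rewrite Cconj_conj in H. exact H. Qed.

Lemma star_star f : star (star f) = f.
Proof. apply functional_extensionality. intros z. unfold star. rewrite !Cconj_conj. reflexivity. Qed.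

Lemma hol_star D f : hol D f -> hol (Gconj D) (star f).
Proof. apply hol_conj. Qed.

Lemma vanish_plus f g : vanishes_at_infty f -> vanishes_at_infty g -> vanishes_at_infty (fun z => f z + g z).
Proof.
 intros Hf Hg e He. destruct (Hf (e/2)%R) as [R1 K1]; [lra|]. destruct (Hg (e/2)%R) as [R2 K2]; [lra|]. exists (Rmax R1 R2). intros z Hz.
 specialize (K1 z (Rle_lt_trans _ _ _ (Rmax_l _ _) Hz)). specialize (K2 z (Rle_lt_trans _ _ _ (Rmax_r _ _) Hz)).
 eapply Rle_trans; [apply Cmod_triangle|lra].
Qed.

Lemma vanish_mult_bounded f g B R0 : vanishes_at_infty f -> (forall z, R0 < Cmod z -> Cmod (g z) <= B) ->
  vanishes_at_infty (fun z => f z * g z).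
Proof.
 intros Hf Hg e He. assert (HB : 0 < Rabs B + 1) by (pose proof (Rabs_pos B); lra).
 destruct (Hf (e / (Rabs B + 1))%R) as [R1 K1]; [apply Rdiv_lt_0_compat; lra|]. exists (Rmax R0 R1). intros z Hz.
 specialize (Hg z (Rle_lt_trans _ _ _ (Rmax_l _ _) Hz)). specialize (K1 z (Rle_lt_trans _ _ _ (Rmax_r _ _) Hz)). rewrite Cmod_mult.
 pose proof (Rle_abs B). apply Rle_trans with (e / (Rabs B + 1) * (Rabs B + 1))%R; [|right; field; lra].
 apply Rmult_le_compat; auto using Cmod_ge_0; lra.
Qed.

Lemma vanish_ext f g R0 : (forall z, R0 < Cmod z -> f z = g z) -> vanishes_at_infty f -> vanishes_at_infty g.
Proof.
 intros E H e He. destruct (H e He) as [R1 K]. exists (Rmax R0 R1). intros z Hz. rewrite <- E by (apply (Rle_lt_trans _ _ _ (Rmax_l _ _) Hz)).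
 apply K, (Rle_lt_trans _ _ _ (Rmax_r _ _) Hz).
Qed.

Lemma vanish_star f : vanishes_at_infty f -> vanishes_at_infty (star f).
Proof. intros H e He. destruct (H e He) as [R1 K]. exists R1. intros z Hz. unfold star. rewrite Cconj_mod. apply K. rewrite Cconj_mod; auto. Qed.

Lemma vanish_O f M R0 : (forall z, R0 < Cmod z -> Cmod (f z) <= M / Cmod z) -> vanishes_at_infty f.
Proof.
 intros H e He. exists (Rmax R0 (Rmax 1 (Rabs M / e))). intros z Hz. assert (Z1 := Rle_lt_trans _ _ _ (Rmax_l _ _) Hz).
 assert (Z2 := Rle_lt_trans _ _ _ (Rmax_r _ _) Hz). assert (Z3 := Rle_lt_trans _ _ _ (Rmax_l _ _) Z2).
 assert (Z4 := Rle_lt_trans _ _ _ (Rmax_r _ _) Z2). eapply Rle_trans; [auto|]. apply (Rmult_le_reg_r (Cmod z)); [lra|]. unfold Rdiv.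
 rewrite Rmult_assoc, Rinv_l, Rmult_1_r by lra. pose proof (Rle_abs M).
 apply Rle_trans with (e * (Rabs M / e))%R; [apply Rle_trans with (Rabs M); [auto|right; field; lra]|]. nra.
Qed.

Lemma ps_vanish {G u X Y X0} : pair_sol G u X Y X0 -> vanishes_at_infty (fun z => X z - X0).
Proof. intros H. destruct (ps_inf H) as (M & R0 & _ & K). apply (vanish_O _ M R0 K). Qed.

Section Contour.

Variable G : C -> Prop.
Hypothesis HG : contour G.

Lemma ct_open : openC (fun z => ~ G z).
Proof. intros z Hz. destruct (ct_loc G HG z Hz) as (d & Hd & K). exists d; split; auto. intros w Hw; apply K, Hw. Qed.

Lemma ct_openc : openC (fun z => ~ Gconj G z).
Proof. intros z Hz. destruct (ct_open (Cconj z) Hz) as (d & Hd & K). exists d; split; auto. intros w Hw. apply K. rewrite <- Cminus_conj, Cconj_mod. auto. Qed.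

Lemma ct_sep z : G z -> ~ Gconj G z.
Proof. intros Gz Gz'. apply (ct_up G HG) in Gz. apply (ct_up G HG) in Gz'. unfold Im, Cconj in *; simpl in *. lra. Qed.

Lemma ct_closed_UHP z : 0 <= Im z -> ~ Gconj G z.
Proof. intros H Gz. apply (ct_up G HG) in Gz. unfold Im, Cconj in *; simpl in *. lra. Qed.

Lemma ct_bounded_UHP z : component_bounded G z -> 0 < Im z.
Proof. intros H. apply Rnot_le_lt. intros L. apply (ct_low G HG) in L. apply L, H. Qed.

Lemma ct_far2 : exists R0, forall z, R0 < Cmod z -> (~ G z /\ ~ component_bounded G z) /\ (~ Gconj G z /\ ~ component_bounded G (Cconj z)).
Proof. destruct (ct_far G HG) as [R1 HR1]. exists R1. intros z Hz. split; [apply (HR1 z Hz)|]. apply (HR1 (Cconj z)). rewrite Cconj_mod; auto. Qed.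

(** Limits at the conjugate curve are expressed through [star f], so that all jump computations take
    place on [G]. The function then extends to an entire one. *)
Lemma liouville_contours f : hol (fun z => ~ G z /\ ~ Gconj G z) f ->
  (forall z, G z -> exists l, punctured_limit f G z l) ->
  (forall z, G z -> exists l, punctured_limit (star f) G z l) ->
  vanishes_at_infty f -> forall z, ~ G z -> ~ Gconj G z -> f z = 0.
Proof.
 intros Hf L1 L2 HV z N1 N2. destruct (hol_extension f (fun z => G z \/ Gconj G z) (fun _ => True)) as (g & Hg & Eg).
 - exists 1%R. split; [lra|auto].
 - apply thin_union; [apply (ct_thin G HG)|apply (ct_thinc G HG)].
 - intros w Hw. destruct (ct_open w ltac:(tauto)) as (d1 & Hd1 & K1). destruct (ct_openc w ltac:(tauto)) as (d2 & Hd2 & K2).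
  exists (Rmin d1 d2); split; [apply Rmin_glb_lt; auto|]. intros v Hv [Q|Q].
  + apply (K1 v); auto. apply (proj1 (Rmin_Rgt_l _ _ _ Hv)).
  + apply (K2 v); auto. apply (proj2 (Rmin_Rgt_l _ _ _ Hv)).
 - apply (hol_sub _ (fun z => ~ G z /\ ~ Gconj G z)); [tauto|auto].
 - intros w _ [Gw|Gw].
  + destruct (L1 w Gw) as [l Hl]. exists l. apply (punctured_sub _ G); auto.
  + destruct (L2 (Cconj w) Gw) as [l Hl]. apply punctured_star in Hl. rewrite star_star in Hl. exists (Cconj l).
   apply (punctured_sub _ (Gconj G)); auto.
 - rewrite <- Eg by tauto. apply (liouville0 g); auto. destruct ct_far2 as [R0 HR0]. apply (vanish_ext f g R0); auto. intros w Hw. symmetry. apply Eg.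
  destruct (HR0 w Hw). tauto.
Qed.

(** The function p star p + q star q - 1 is entire and tends to 0. Near [G] it is the glued p times
    star p minus q times the glued second pair, minus 1, because the two terms in u cancel. On the
    real line [star] is complex conjugation. *)
Lemma rows_unitary u p q : pair_sol G u p q 1 -> pair_sol G u (fun z => - star q z) (star p) 0 ->
  forall z, Im z = 0%R -> (Cmod (p z) * Cmod (p z) + Cmod (q z) * Cmod (q z) = 1)%R.
Proof.
 intros H1 H2 z Hz. set (f := fun z => p z * star p z + q z * star q z - 1). assert (Z : f z = 0).
 { assert (SF : star f = f).
  { apply functional_extensionality. intros w. unfold f, star. rewrite Cminus_conj, Cplus_conj, !Cmult_conj, !Cconj_conj.
   replace (Cconj 1) with (RtoC 1) by (unfold Cconj, RtoC; simpl; f_equal; ring). ring. }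
  assert (L : forall w, G w -> exists l, punctured_limit f G w l).
  { intros w Gw. destruct (ps_lim H1 w Gw) as [l1 Hl1]. destruct (ps_lim H2 w Gw) as [l2 Hl2]. exists (l1 * star p w + (-1) * q w * l2 + (-1)).
   apply (punctured_ext (fun v => glue G u p q v * star p v + (-1) * q v * glue G u (fun z => - star q z) (star p) v + (-1)) f G w _ 1); [lra| |].
   - intros v _ Nv. unfold glue, f. destruct (dec (component_bounded G v)); ring.
   - assert (CY1 : ccont q w) by (apply (hol_cont _ _ _ (ps_Y H1)), ct_sep, Gw).
    assert (CY2 : ccont (star p) w) by (apply (hol_cont _ _ _ (ps_Y H2)), ct_sep, Gw).
    apply punctured_plus; [apply punctured_plus; apply punctured_mult; auto|].
    + apply punctured_cont; auto.
    + apply (punctured_cont (fun v => (-1) * q v)), ccont_mult; [apply ccont_const|auto].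
    + apply (punctured_cont (fun _ => (-1))), ccont_const. }
  apply liouville_contours; auto.
  - apply hol_minus; [|apply hol_const]. apply hol_plus; apply hol_mult.
   + apply (hol_sub _ (fun z => ~ G z)); [tauto|apply (ps_X H1)].
   + apply (hol_sub _ (fun z => ~ Gconj G z)); [tauto|apply (ps_Y H2)].
   + apply (hol_sub _ (fun z => ~ Gconj G z)); [tauto|apply (ps_Y H1)].
   + intros w [N1 N2]. destruct (ps_X H2 w N1) as [l Hl]. exists (- l). apply cder_opp in Hl. revert Hl. apply cder_ext. intros v; ring.
  - rewrite SF. auto.
  - assert (V1 := ps_vanish H1). assert (V2 := ps_vanish H2). assert (Bp : exists R0, forall w, R0 < Cmod w -> Cmod (star p w) <= 2).
   { destruct (vanish_star _ V1 1%R) as [R0 K]; [lra|]. exists R0. intros w Hw. specialize (K w Hw). unfold star in *. rewrite Cminus_conj in K.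
    replace (Cconj 1) with (RtoC 1) in K by (unfold Cconj, RtoC; simpl; f_equal; ring). assert (T := Cmod_tri_inv (Cconj (p (Cconj w))) 1).
    rewrite Cmod_1 in T. lra. }
   assert (Bq : exists R0, forall w, R0 < Cmod w -> Cmod (star (star q) w) <= 1).
   { destruct (vanish_star _ V2 1%R) as [R0 K]; [lra|]. exists R0. intros w Hw. specialize (K w Hw). unfold star in *. rewrite Cminus_conj in K.
    replace (Cconj 0) with (RtoC 0) in K by (unfold Cconj, RtoC; simpl; f_equal; ring). rewrite <- (Cmod_opp).
    replace (- Cconj (Cconj (q (Cconj (Cconj w))))) with (- Cconj (Cconj (q (Cconj (Cconj w)))) - 0) by ring. exact K. }
   destruct Bp as [Rp Bp]. destruct Bq as [Rq Bq]. assert (A1 := vanish_mult_bounded _ _ _ _ V1 Bp). assert (A2 := vanish_mult_bounded _ _ _ _ V2 Bq).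
   assert (A3 := vanish_star _ V1). assert (A4 := vanish_mult_bounded _ (fun _ => (-1)) 1 0 A2).
   apply (vanish_ext (fun w => (p w - 1) * star p w + star (fun z => p z - 1) w + (- star q w - 0) * star (star q) w * (-1)) f 0).
   + intros w _. unfold f. rewrite star_star. unfold star. rewrite Cminus_conj.
    replace (Cconj 1) with (RtoC 1) by (unfold Cconj, RtoC; simpl; f_equal; ring). ring.
   + apply vanish_plus; [apply vanish_plus; auto|]. apply A4. intros w _. rewrite Cmod_R, Rabs_left; lra.
  - intros Gz. apply (ct_up G HG) in Gz. lra.
  - intros Gz. apply (ct_up G HG) in Gz. unfold Im, Cconj in *; simpl in *; lra. }
 unfold f, star in Z. assert (Ez : Cconj z = z).
 { destruct z as [x y]; unfold Im, Cconj in *; simpl in *. rewrite Hz. f_equal. ring. }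
 rewrite Ez in Z. apply (f_equal Re) in Z. rewrite !Cmod_sqr. unfold Re, Im, Cmult, Cplus, Cminus, Copp, Cconj, RtoC in *; simpl in *. lra.
Qed.

(** q and star p are holomorphic on the closed upper half-plane, so the bound on the real line
    spreads by the maximum principle. For p and star q, which jump on [G], it is kept on the real
    line. *)
Lemma row_bounds u p q : pair_sol G u p q 1 -> pair_sol G u (fun z => - star q z) (star p) 0 ->
  (forall z, Im z = 0%R -> Cmod (p z) <= 1 /\ Cmod (- star q z) <= 1) /\
  (forall z, 0 <= Im z -> Cmod (q z) <= 1 /\ Cmod (star p z) <= 1).
Proof.
 intros H1 H2. assert (U := rows_unitary u p q H1 H2). assert (Er : forall z, Im z = 0%R -> Cconj z = z).
 { intros [x y] Hz; unfold Im, Cconj in *; simpl in *. rewrite Hz. f_equal. ring. }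
 assert (B : forall z, Im z = 0%R -> Cmod (p z) <= 1 /\ Cmod (q z) <= 1).
 { intros z Hz. specialize (U z Hz). split; nra. }
 split.
 - intros z Hz. rewrite Cmod_opp. unfold star. rewrite Cconj_mod, Er; auto.
 - split.
  + apply (half_plane_max (fun z => ~ Gconj G z) q 1); try lra.
   * apply ct_openc.
   * apply (ps_Y H1).
   * apply ct_closed_UHP.
   * intros w Hw. apply B, Hw.
   * intros e He. destruct (vanish_star _ (ps_vanish H2) e He) as [R0 K]. exists R0. intros w Hw. specialize (K w Hw). unfold star in K.
    rewrite Cminus_conj, Copp_conj, !Cconj_conj in K. replace (Cconj 0) with (RtoC 0) in K by (unfold Cconj, RtoC; simpl; f_equal; ring).
    replace (- q w - 0) with (- q w) in K by ring. rewrite Cmod_opp in K. lra.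
  + apply (half_plane_max (fun z => ~ Gconj G z) (star p) 1); try lra.
   * apply ct_openc.
   * apply (ps_Y H2).
   * apply ct_closed_UHP.
   * intros w Hw. unfold star. rewrite Cconj_mod, Er; auto. apply B, Hw.
   * intros e He. destruct (vanish_star _ (ps_vanish H1) e He) as [R0 K]. exists R0. intros w Hw. specialize (K w Hw). unfold star in *.
    rewrite Cminus_conj in K. replace (Cconj 1) with (RtoC 1) in K by (unfold Cconj, RtoC; simpl; f_equal; ring).
    assert (T := Cmod_tri_inv (Cconj (p (Cconj w))) 1). rewrite Cmod_1 in T. lra.
Qed.

(* [CY] is the transform of [Y] by a Cauchy kernel carried by [E], [u] that of the constant 1
   and [m] the total mass, i.e. the coefficient of 1/z of [CY] at infinity. *)
Record cauchy_fun (E : C -> Prop) (u Y CY : C -> C) (m : C) : Prop := {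
  cf_C : hol (fun z => ~ E z) CY;
  cf_ext : exists DI, hol UHP DI /\ forall z, UHP z -> ~ E z -> DI z = u z * Y z - CY z;
  cf_inf : vanishes_at_infty (fun z => z * CY z - m)
}.
Arguments cf_C {_ _ _ _ _}.
Arguments cf_ext {_ _ _ _ _}.
Arguments cf_inf {_ _ _ _ _}.

Lemma cf_vanish {E u Y CY m} : cauchy_fun E u Y CY m -> vanishes_at_infty CY.
Proof.
 intros H. assert (V := cf_inf H). destruct (V 1%R) as [R0 K]; [lra|]. apply (vanish_O CY (1 + Cmod m) (Rmax R0 0)). intros z Hz.
 assert (Z1 := Rle_lt_trans _ _ _ (Rmax_l _ _) Hz). assert (Z2 := Rle_lt_trans _ _ _ (Rmax_r _ _) Hz). specialize (K z Z1).
 apply (Rmult_le_reg_r (Cmod z)); auto. unfold Rdiv. rewrite Rmult_assoc, Rinv_l by lra. rewrite <- Cmod_mult, Cmult_comm.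
 assert (T := Cmod_tri_inv (z * CY z) m). lra.
Qed.

Variable E : C -> Prop.
Hypothesis HE : forall z, E z -> interior_of G z.

Lemma E_UHP_far z : G z -> ~ E z.
Proof. intros Gz Ez. destruct (HE z Ez) as [N _]. auto. Qed.

(** Used with - DI = CY - u Y inside, it moves the singularities of the Cauchy transform from [E] to
    [G], where they become a jump. *)
Definition inner_outer (DI CY : C -> C) (z : C) : C :=
  if dec (component_bounded G z) then DI z else CY z.

Lemma hol_inner_outer DI CY : hol UHP DI -> hol (fun z => ~ E z) CY -> hol (fun z => ~ G z) (inner_outer DI CY).
Proof.
 intros HD HC z Hz. destruct (ct_loc G HG z Hz) as (d & Hd & K). destruct (classic (component_bounded G z)) as [B|B].
 - destruct (HD z (ct_bounded_UHP z B)) as [l Hl]. exists l. apply (cder_ext_loc DI _ z l d); auto. intros w Hw. unfold inner_outer.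
  destruct (dec (component_bounded G w)) as [|N]; auto. exfalso. apply N. apply (K w Hw), B.
 - assert (NE : ~ E z) by (intros Ez; apply B, (HE z Ez)). destruct (HC z NE) as [l Hl]. exists l. apply (cder_ext_loc CY _ z l d); auto. intros w Hw.
  unfold inner_outer. destruct (dec (component_bounded G w)) as [N|]; auto. exfalso. apply B. apply (K w Hw), N.
Qed.

Hypothesis E_closed : openC (fun z => ~ E z).

(** X - X0 and the function built by [inner_outer] have the same jump on [G] and vanish at infinity,
    so Liouville's theorem identifies them. *)
Lemma representation u X Y X0 CY m : pair_sol G u X Y X0 -> cauchy_fun E u Y CY m ->
  forall z, exterior_of G z -> ~ Gconj G z -> X z = X0 + CY z.
Proof.
 intros HP HC z [Nz Bz] Ncz. destruct (cf_ext HC) as (DI & HDI & EDI). set (f := fun z => X z - X0 - inner_outer (fun z => - DI z) CY z).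
 assert (HI := hol_inner_outer (fun z => - DI z) CY (hol_opp _ _ HDI) (cf_C HC)). assert (Hf : hol (fun z => ~ G z) f).
 { apply hol_minus; auto. apply hol_minus; [apply (ps_X HP)|apply hol_const]. }
 assert (Z : f z = 0).
 { apply liouville_contours; auto.
  - apply (hol_sub _ (fun z => ~ G z)); [tauto|auto].
  - intros w Gw. destruct (ps_lim HP w Gw) as [l Hl]. exists (l + (- X0 - CY w)). destruct (E_closed w (E_UHP_far w Gw)) as (d & Hd & K).
   apply (punctured_ext (fun v => glue G u X Y v + (- X0 - CY v)) f G w _ d); auto.
   + intros v Hv Nv. unfold f, inner_outer, glue. destruct (dec (component_bounded G v)) as [B|B]; [|ring].
    rewrite EDI; [ring|apply ct_bounded_UHP, B|auto].
   + apply punctured_plus; auto. apply (punctured_cont (fun v => - X0 - CY v)). apply ccont_minus; [apply ccont_const|].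
    apply (hol_cont _ _ _ (cf_C HC)), E_UHP_far, Gw.
  - intros w Gw. exists (star f w). apply punctured_cont. apply (hol_cont (Gconj (fun z => ~ G z))); [apply hol_star, Hf|]. apply ct_sep, Gw.
  - destruct ct_far2 as [R0 HR0]. apply (vanish_ext (fun z => X z - X0 + CY z * (-1)) f R0).
   + intros w Hw. destruct (HR0 w Hw) as [[A1 A2] A3]. unfold f, inner_outer. destruct (dec (component_bounded G w)); [tauto|ring].
   + apply vanish_plus; [apply (ps_vanish HP)|]. apply (vanish_mult_bounded _ _ 1 0); [apply (cf_vanish HC)|]. intros. rewrite Cmod_R, Rabs_left; lra. }
 unfold f, inner_outer in Z. destruct (dec (component_bounded G z)); [tauto|]. replace (X z) with (X z - X0 - CY z + (X0 + CY z)) by ring. rewrite Z.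
 ring.
Qed.

(** Replacing X1 and X2 by their glued versions changes Y1 X2 - X1 Y2 inside [G] by (u2 - u1) Y1 Y2,
    and the transform of this density compensates the change. *)
Lemma bilinear_limit u1 u2 X1 Y1 X10 X2 Y2 X20 CY m DI :
  pair_sol G u1 X1 Y1 X10 -> pair_sol G u2 X2 Y2 X20 ->
  cauchy_fun E (fun z => u1 z - u2 z) (fun z => Y1 z * Y2 z) CY m ->
  (forall z, UHP z -> ~ E z -> DI z = (u1 z - u2 z) * (Y1 z * Y2 z) - CY z) ->
  forall z, G z -> exists l, punctured_limit (fun w => Y1 w * X2 w - X1 w * Y2 w + inner_outer (fun z => - DI z) CY w) G z l.
Proof.
 intros H1 H2 HC EDI z Gz. destruct (ps_lim H1 z Gz) as [l1 Hl1]. destruct (ps_lim H2 z Gz) as [l2 Hl2]. exists (Y1 z * l2 + (-1) * Y2 z * l1 + CY z).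
 destruct (E_closed z (E_UHP_far z Gz)) as (d & Hd & K).
 apply (punctured_ext (fun v => Y1 v * glue G u2 X2 Y2 v + (-1) * Y2 v * glue G u1 X1 Y1 v + CY v) _ G z _ d); auto.
 - intros v Hv Nv. unfold inner_outer, glue. destruct (dec (component_bounded G v)) as [B|B]; [|ring].
  rewrite EDI; [ring|apply ct_bounded_UHP, B|auto].
 - assert (C1 : ccont Y1 z) by (apply (hol_cont _ _ _ (ps_Y H1)), ct_sep, Gz).
  assert (C2 : ccont Y2 z) by (apply (hol_cont _ _ _ (ps_Y H2)), ct_sep, Gz).
  apply punctured_plus; [apply punctured_plus; apply punctured_mult; auto|].
  + apply punctured_cont; auto.
  + apply (punctured_cont (fun v => (-1) * Y2 v)), ccont_mult; [apply ccont_const|auto].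
  + apply punctured_cont, (hol_cont _ _ _ (cf_C HC)), E_UHP_far, Gz.
Qed.

(** The bilinear expression of the second pairs is the [star] of that of the first pairs, so the
    jump on the conjugate curve is compensated by star C2. The sum of all terms is then entire and
    vanishes. *)
Lemma bilinear_representation u1 u2 p1 q1 p2 q2 C1 m1 C2 m2 :
  pair_sol G u1 p1 q1 1 -> pair_sol G u1 (fun z => - star q1 z) (star p1) 0 ->
  pair_sol G u2 p2 q2 1 -> pair_sol G u2 (fun z => - star q2 z) (star p2) 0 ->
  cauchy_fun E (fun z => u1 z - u2 z) (fun z => q1 z * q2 z) C1 m1 ->
  cauchy_fun E (fun z => u1 z - u2 z) (fun z => star p1 z * star p2 z) C2 m2 ->
  exists R0, forall z, R0 < Cmod z -> q1 z * p2 z - p1 z * q2 z = - C1 z - star C2 z.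
Proof.
 intros H1 H1' H2 H2' HC1 HC2. destruct (cf_ext HC1) as (D1 & HD1 & ED1). destruct (cf_ext HC2) as (D2 & HD2 & ED2).
 set (h1 := inner_outer (fun z => - D1 z) C1). set (h2 := inner_outer (fun z => - D2 z) C2).
 assert (Hh1 : hol (fun z => ~ G z) h1) by (apply hol_inner_outer; [apply hol_opp; auto|apply (cf_C HC1)]).
 assert (Hh2 : hol (fun z => ~ G z) h2) by (apply hol_inner_outer; [apply hol_opp; auto|apply (cf_C HC2)]).
 set (f := fun z => q1 z * p2 z - p1 z * q2 z + h1 z + star h2 z). destruct ct_far2 as [R0 HR0]. exists R0. intros z Hz. assert (A : f z = 0).
 { destruct (HR0 z Hz) as [[A1 A2] [A3 A4]]. apply liouville_contours; auto.
  - apply hol_plus; [apply hol_plus|].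
   + apply hol_minus; apply hol_mult; [apply (hol_sub _ (fun z => ~ Gconj G z)); [tauto|apply (ps_Y H1)] |apply (hol_sub _ (fun z => ~ G z)); [tauto|apply (ps_X H2)] |apply (hol_sub _ (fun z => ~ G z)); [tauto|apply (ps_X H1)] |apply (hol_sub _ (fun z => ~ Gconj G z)); [tauto|apply (ps_Y H2)]].
   + apply (hol_sub _ (fun z => ~ G z)); [tauto|auto].
   + apply (hol_sub _ (Gconj (fun z => ~ G z))); [|apply hol_star; auto]. unfold Gconj; tauto.
  - intros w Gw. destruct (bilinear_limit u1 u2 p1 q1 1 p2 q2 1 C1 m1 D1 H1 H2 HC1 ED1 w Gw) as [l Hl]. exists (l + star h2 w).
   apply punctured_plus; auto. apply punctured_cont. apply (hol_cont (Gconj (fun z => ~ G z))); [apply hol_star; auto|apply ct_sep, Gw].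
  - intros w Gw. destruct (bilinear_limit u1 u2 _ _ 0 _ _ 0 C2 m2 D2 H1' H2' HC2 ED2 w Gw) as [l Hl]. exists (l + star h1 w).
   apply (punctured_ext (fun v => star p1 v * - star q2 v - - star q1 v * star p2 v + h2 v + star h1 v) _ G w _ 1); [lra| |].
   + intros v _ _. unfold f, star. rewrite !Cplus_conj, Cminus_conj, !Cmult_conj, !Cconj_conj. ring.
   + apply punctured_plus; auto. apply punctured_cont. apply (hol_cont (Gconj (fun z => ~ G z))); [apply hol_star; auto|apply ct_sep, Gw].
  - assert (V1 := ps_vanish H1). assert (V2 := ps_vanish H2). assert (W1 := vanish_star _ (ps_vanish H1')).
   assert (W2 := vanish_star _ (ps_vanish H2')).
   assert (B : forall p, vanishes_at_infty (fun z => p z - 1) -> exists R0, forall w, R0 < Cmod w -> Cmod ((-1) * p w) <= 2).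
   { intros p V. destruct (V 1%R) as [R1 K]; [lra|]. exists R1. intros w Hw. specialize (K w Hw). assert (T := Cmod_tri_inv (p w) 1).
    rewrite Cmod_1 in T. rewrite Cmod_mult, Cmod_R, (Rabs_left (-1)); lra. }
   assert (Eq : forall q, star (fun z => - star q z - 0) = fun z => - q z).
   { intros q. apply functional_extensionality. intros w. unfold star. rewrite Cminus_conj, Copp_conj, !Cconj_conj.
    replace (Cconj 0) with (RtoC 0) by (unfold Cconj, RtoC; simpl; f_equal; ring). ring. }
   cbv beta in W1, W2. rewrite Eq in W1, W2. destruct (B p1 V1) as [R1 B1]. destruct (B p2 V2) as [R2 B2].
   assert (X1 := vanish_mult_bounded _ _ _ _ W1 B2). assert (X2 := vanish_mult_bounded _ _ _ _ W2 B1).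
   assert (X3 := vanish_mult_bounded _ (fun _ => (-1)) 1 0 X2).
   apply (vanish_ext (fun w => - q1 w * ((-1) * p2 w) + - q2 w * ((-1) * p1 w) * (-1) + C1 w + star C2 w) f R0).
   + intros w Hw. destruct (HR0 w Hw) as [[A1' A2'] [A3' A4']]. unfold f, h1, h2, star, inner_outer. destruct (dec (component_bounded G w)); [tauto|].
    destruct (dec (component_bounded G (Cconj w))); [tauto|]. ring.
   + apply vanish_plus; [apply vanish_plus; [apply vanish_plus; auto|]|].
    * apply X3. intros. rewrite Cmod_R, Rabs_left; lra.
    * apply (cf_vanish HC1).
    * apply vanish_star, (cf_vanish HC2). }
 destruct (HR0 z Hz) as [[A1' A2'] [A3' A4']]. unfold f, h1, h2, inner_outer, star in A. destruct (dec (component_bounded G z)); [tauto|].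
 destruct (dec (component_bounded G (Cconj z))); [tauto|]. unfold star. set (w := q1 z * p2 z - p1 z * q2 z) in *.
 replace w with (w + C1 z + Cconj (C2 (Cconj z)) - C1 z - Cconj (C2 (Cconj z))) by ring. rewrite A. ring.
Qed.

(** Multiplying the bilinear identity by 2 i z and letting z tend to infinity gives psi1 - psi2 = -
    2 i (m1 + conj m2). *)
Theorem potential_difference u1 u2 p1 q1 p2 q2 C1 m1 C2 m2 psi1 psi2 :
  pair_sol G u1 p1 q1 1 -> pair_sol G u1 (fun z => - star q1 z) (star p1) 0 ->
  pair_sol G u2 p2 q2 1 -> pair_sol G u2 (fun z => - star q2 z) (star p2) 0 ->
  cauchy_fun E (fun z => u1 z - u2 z) (fun z => q1 z * q2 z) C1 m1 ->
  cauchy_fun E (fun z => u1 z - u2 z) (fun z => star p1 z * star p2 z) C2 m2 ->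
  vanishes_at_infty (fun z => 2 * Ci * z * q1 z - psi1) ->
  vanishes_at_infty (fun z => 2 * Ci * z * q2 z - psi2) ->
  (Cmod (psi1 - psi2) <= 2 * (Cmod m1 + Cmod m2)).
Proof.
 intros H1 H1' H2 H2' HC1 HC2 L1 L2. destruct (bilinear_representation u1 u2 p1 q1 p2 q2 C1 m1 C2 m2 H1 H1' H2 H2' HC1 HC2) as [R0 HR0].
 assert (V1 := ps_vanish H1). assert (V2 := ps_vanish H2). assert (W1 := cf_inf HC1). assert (W2 := vanish_star _ (cf_inf HC2)).
 apply Rle_plus_epsilon. intros e He. set (M := (Cmod psi1 + Cmod psi2 + 10)%R). pose proof (Cmod_ge_0 psi1) as Q1. pose proof (Cmod_ge_0 psi2) as Q2.
 (* All limits are taken up to [d] at one point z; the resulting errors add up to at most M d. *)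
 set (d := Rmin 1 (e / (4 * M))). assert (Hd : 0 < d) by (apply Rmin_glb_lt; [lra|apply Rdiv_lt_0_compat; unfold M; lra]).
 assert (d1 : d <= 1) by apply Rmin_l. assert (dM : d * (4 * M) <= e).
 { apply Rle_trans with (e / (4 * M) * (4 * M))%R; [apply Rmult_le_compat_r; [unfold M; lra|apply Rmin_r]|right; field; unfold M; lra]. }
 destruct (L1 d Hd) as [Ra Ka]. destruct (L2 d Hd) as [Rb Kb]. destruct (V1 d Hd) as [Rc Kc]. destruct (V2 d Hd) as [Rd Kd].
 destruct (W1 d Hd) as [Re' Ke]. destruct (W2 d Hd) as [Rf Kf].
 set (r := (Rabs R0 + Rabs Ra + Rabs Rb + Rabs Rc + Rabs Rd + Rabs Re' + Rabs Rf + 1)%R). set (z := RtoC r). assert (Pos := Rabs_pos).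
 assert (Le := Rle_abs). assert (Hz : Cmod z = r).
 { unfold z. rewrite Cmod_R, Rabs_pos_eq; auto. unfold r.
  pose proof (Pos R0); pose proof (Pos Ra); pose proof (Pos Rb); pose proof (Pos Rc); pose proof (Pos Rd); pose proof (Pos Re'); pose proof (Pos Rf).
  lra. }
 assert (Big : forall x, Rabs x + 1 <= r -> x < Cmod z) by (intros x Hx; rewrite Hz; specialize (Le x); lra).
 pose proof (Pos R0); pose proof (Pos Ra); pose proof (Pos Rb); pose proof (Pos Rc); pose proof (Pos Rd); pose proof (Pos Re'); pose proof (Pos Rf).
 specialize (HR0 z (Big R0 ltac:(unfold r; lra))). specialize (Ka z (Big Ra ltac:(unfold r; lra))). specialize (Kb z (Big Rb ltac:(unfold r; lra))).
 specialize (Kc z (Big Rc ltac:(unfold r; lra))). specialize (Kd z (Big Rd ltac:(unfold r; lra))). specialize (Ke z (Big Re' ltac:(unfold r; lra))).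
 specialize (Kf z (Big Rf ltac:(unfold r; lra))). unfold star in Kf. rewrite Cminus_conj, Cmult_conj, Cconj_conj in Kf. fold (star C2 z) in Kf.
 set (s1 := 2 * Ci * z * q1 z) in *. set (s2 := 2 * Ci * z * q2 z) in *. assert (Eq : s1 * p2 z - s2 * p1 z = - (2 * Ci) * (z * C1 z + z * star C2 z)).
 { unfold s1, s2. replace (2 * Ci * z * q1 z * p2 z - 2 * Ci * z * q2 z * p1 z) with (2 * Ci * z * (q1 z * p2 z - p1 z * q2 z)) by ring. rewrite HR0.
  ring. }
 replace (psi1 - psi2) with (s1 * p2 z - s2 * p1 z + (- (s1 - psi1) * p2 z + - psi1 * (p2 z - 1) + ((s2 - psi2) * p1 z + psi2 * (p1 z - 1)))) by ring.
 rewrite Eq.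
 replace (- (2 * Ci) * (z * C1 z + z * star C2 z)) with (- (2 * Ci) * (m1 + Cconj m2) + - (2 * Ci) * ((z * C1 z - m1) + (z * star C2 z - Cconj m2))) by ring.
 assert (C2i : forall x, (Cmod (- (2 * Ci) * x) = 2 * Cmod x)%R).
 { intros x. rewrite Cmod_mult, Cmod_opp, Cmod_mult, Cmod_Ci, Cmod_R, Rabs_pos_eq; lra. }
 assert (P1 : Cmod (p1 z) <= 2).
 { assert (T := Cmod_tri_inv (p1 z) 1). rewrite Cmod_1 in T. lra. }
 assert (P2 : Cmod (p2 z) <= 2).
 { assert (T := Cmod_tri_inv (p2 z) 1). rewrite Cmod_1 in T. lra. }
 eapply Rle_trans; [apply Cmod_triangle|].
 assert (T1 : Cmod (- (2 * Ci) * (m1 + Cconj m2) + - (2 * Ci) * ((z * C1 z - m1) + (z * star C2 z - Cconj m2))) <= 2 * (Cmod m1 + Cmod m2) + 4 * d).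
 { eapply Rle_trans; [apply Cmod_triangle|]. rewrite !C2i. assert (A1 := Cmod_triangle m1 (Cconj m2)). rewrite Cconj_mod in A1.
  assert (A2 := Cmod_triangle (z * C1 z - m1) (z * star C2 z - Cconj m2)). lra. }
 assert (T2 : Cmod (- (s1 - psi1) * p2 z + - psi1 * (p2 z - 1) + ((s2 - psi2) * p1 z + psi2 * (p1 z - 1))) <= d * (4 + Cmod psi1 + Cmod psi2)).
 { eapply Rle_trans; [apply Cmod_triangle|]. assert (A1 := Cmod_triangle (- (s1 - psi1) * p2 z) (- psi1 * (p2 z - 1))).
  assert (A2 := Cmod_triangle ((s2 - psi2) * p1 z) (psi2 * (p1 z - 1))). rewrite !Cmod_mult, !Cmod_opp in *.
  assert (B1 : Cmod (s1 - psi1) * Cmod (p2 z) <= d * 2) by (apply Rmult_le_compat; auto using Cmod_ge_0).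
  assert (B2 : Cmod (s2 - psi2) * Cmod (p1 z) <= d * 2) by (apply Rmult_le_compat; auto using Cmod_ge_0). nra. }
 unfold M in dM. nra.
Qed.

End Contour.

(** * Cauchy transforms carried by the nodes and by the chord *)

Fixpoint csum (f : nat -> C) (n : nat) : C :=
  match n with O => 0 | S m => csum f m + f m end.

Lemma csum_ext f g n : (forall i, (i < n)%nat -> f i = g i) -> csum f n = csum g n.
Proof. induction n as [|n IH]; intros H; simpl; auto. rewrite IH, H; auto. Qed.

Lemma csum_minus f g n : csum (fun i => f i - g i) n = csum f n - csum g n.
Proof. induction n as [|n IH]; simpl; [ring|rewrite IH; ring]. Qed.

Lemma csum_mult_r f c n : csum (fun i => f i * c) n = csum f n * c.
Proof. induction n as [|n IH]; simpl; [ring|rewrite IH; ring]. Qed.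

Lemma csum_bound f g n : (forall i, (i < n)%nat -> Cmod (f i) <= g i) -> (Cmod (csum f n) <= rsum g n)%R.
Proof.
 induction n as [|n IH]; intros H; simpl; [rewrite Cmod_0; lra|]. eapply Rle_trans; [apply Cmod_triangle|]. assert (Cmod (f n) <= g n) by auto.
 assert (Cmod (csum f n) <= rsum g n)%R by auto. lra.
Qed.

Lemma sum_n_m_csum (f : nat -> C) n : sum_n_m (G := C_AbelianMonoid) f 1 n = csum (fun i => f (S i)) n.
Proof.
 induction n as [|n IH].
 - auto.
 - rewrite sum_n_Sm by lia. rewrite IH. reflexivity.
Qed.

Lemma hol_csum D f n : (forall i, (i < n)%nat -> hol D (fun z => f i z)) -> hol D (fun z => csum (fun i => f i z) n).
Proof. induction n as [|n IH]; intros H; [exact (hol_const D 0)|]. apply (hol_plus D (fun z => csum (fun i => f i z) n)); auto. Qed.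

Lemma cauchy_fun_minus E u1 u2 Y C1 C2 m1 m2 : cauchy_fun E u1 Y C1 m1 -> cauchy_fun E u2 Y C2 m2 ->
  cauchy_fun E (fun z => u1 z - u2 z) Y (fun z => C1 z - C2 z) (m1 - m2).
Proof.
 intros [A1 (D1 & HD1 & E1) B1] [A2 (D2 & HD2 & E2) B2]. constructor.
 - apply hol_minus; auto.
 - exists (fun z => D1 z - D2 z). split; [apply hol_minus; auto|]. intros z Hz Nz. rewrite E1, E2 by auto. ring.
 - assert (V := vanish_mult_bounded _ (fun _ => RtoC (-1)) 1 0 B2).
  apply (vanish_ext (fun z => z * C1 z - m1 + (z * C2 z - m2) * RtoC (-1)) _ 0); [intros; ring|]. apply vanish_plus; auto. apply V. intros.
  rewrite Cmod_R, Rabs_left; lra.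
Qed.

Lemma removable_quotient D Y l : openC D -> hol D Y -> D l ->
  exists k, hol D k /\ forall z, z <> l -> k z = (Y z - Y l) / (z - l).
Proof.
 intros HD HY Hl. destruct (hol_extension (fun z => (Y z - Y l) / (z - l)) (fun z => z = l) D HD (thin_point l)) as (k & Hk & Ek).
 - intros z Nz. exists (Cmod (z - l)). split.
  + apply Cmod_gt_0. intros E0. apply Nz. replace z with (z - l + l) by ring. rewrite E0; ring.
  + intros w Hw ->. rewrite Cmod_sub_sym in Hw. lra.
 - apply hol_div.
  + apply hol_minus; [apply (hol_sub _ D); [tauto|auto]|apply hol_const].
  + apply hol_minus; [apply hol_id|apply hol_const].
  + intros z [_ N] E0. apply N. replace z with (z - l + l) by ring. rewrite E0; ring.
 - intros z Dz ->. exists (cd Y l). intros e He. destruct (hol_cder D Y l HY Hl (e/2)%R) as (d & Hd & K); [lra|]. exists d; split; auto.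
  intros w Hw Nw. assert (N0 : w - l <> 0) by (intros E0; apply Nw; replace w with (w - l + l) by ring; rewrite E0; ring). specialize (K w Hw).
  replace ((Y w - Y l) / (w - l) - cd Y l) with ((Y w - Y l - cd Y l * (w - l)) / (w - l)) by (field; auto). rewrite Cmod_div by auto.
  apply Cmod_gt_0 in N0. apply (Rmult_lt_reg_r (Cmod (w - l))); auto. unfold Rdiv. rewrite Rmult_assoc, Rinv_l by lra. nra.
 - exists k; auto.
Qed.

Lemma csub_neq (z l : C) : z <> l -> z - l <> 0.
Proof. intros N E0. apply N. replace z with (z - l + l) by ring. rewrite E0; ring. Qed.

Lemma vanish_kernel (l : C) : vanishes_at_infty (fun z => z / (z - l) - 1).
Proof.
 apply (vanish_O _ (2 * Cmod l) (2 * Cmod l)). intros z Hz. pose proof (Cmod_ge_0 l). assert (T := Cmod_tri_inv z l).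
 assert (N : z - l <> 0) by (intros E0; rewrite E0, Cmod_0 in T; lra). replace (z / (z - l) - 1) with (l / (z - l)) by (field; auto).
 rewrite Cmod_div by auto. replace (2 * Cmod l / Cmod z)%R with (Cmod l / (Cmod z / 2))%R by (field; lra). apply Rmult_le_compat_l; auto.
 apply Rinv_le_contravar; lra.
Qed.

(** Here u Y - CY is the sum of the w_i (Y z - Y l_i) / (z - l_i), whose singularities are
    removable. *)
Lemma cauchy_fun_sum (E D : C -> Prop) (w l : nat -> C) (Y : C -> C) n :
  openC D -> (forall z, UHP z -> D z) -> hol D Y ->
  (forall i, (i < n)%nat -> E (l i) /\ UHP (l i)) ->
  cauchy_fun E (fun z => csum (fun i => w i / (z - l i)) n) Y
    (fun z => csum (fun i => w i * Y (l i) / (z - l i)) n) (csum (fun i => w i * Y (l i)) n).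
Proof.
 intros HD HU HY. induction n as [|n IH]; intros Hl.
 - constructor; simpl.
  + apply hol_const.
  + exists (fun _ => 0). split; [apply hol_const|]. intros; ring.
  + apply (vanish_O _ 0 0). intros z Hz. replace (z * 0 - 0) with (RtoC 0) by ring. rewrite Cmod_0. lra.
 - destruct (IH ltac:(intros; apply Hl; lia)) as [A1 (D1 & HD1 & E1) B1]. destruct (Hl n ltac:(lia)) as [En Un].
  assert (NE : forall z, ~ E z -> z <> l n) by (intros z Nz ->; auto). constructor; simpl.
  + apply hol_plus; auto. apply hol_div; [apply hol_const|apply hol_minus; [apply hol_id|apply hol_const]|]. intros z Nz. apply csub_neq, NE, Nz.
  + destruct (removable_quotient D Y (l n) HD HY (HU _ Un)) as (k & Hk & Ek). exists (fun z => D1 z + w n * k z). split.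
   * apply hol_plus; auto. apply hol_mult; [apply hol_const|apply (hol_sub _ D); auto].
   * intros z Uz Nz. rewrite E1, Ek by auto. field. apply csub_neq, NE, Nz.
  + assert (V := vanish_mult_bounded _ (fun _ => w n * Y (l n)) (Cmod (w n * Y (l n))) 0 (vanish_kernel (l n))).
   apply (vanish_ext (fun z => (z * csum (fun i => w i * Y (l i) / (z - l i)) n - csum (fun i => w i * Y (l i)) n) + (z / (z - l n) - 1) * (w n * Y (l n))) _ 0).
   * intros z _. unfold Cdiv. ring.
   * apply vanish_plus; auto. apply V. intros; lra.
Qed.

Lemma eta1_iff a b z : 0 < a -> eta1 a b z <-> (Im z = b /\ - a <= Re z <= a)%R.
Proof.
 unfold eta1, on_segment, segment_path. split.
 - intros (s & Hs & ->). unfold Re, Im, Cplus, Cmult, Cminus, Copp, Cconj, RtoC; simpl. nra.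
 - intros [H1 H2]. exists ((a - Re z) / (2 * a))%R. split.
  + split; [apply Rmult_le_pos; [lra|left; apply Rinv_0_lt_compat; lra]|]. apply (Rmult_le_reg_r (2 * a)); [lra|]. unfold Rdiv.
   rewrite Rmult_assoc, Rinv_l; lra.
  + destruct z as [x y]. unfold Re, Im in *; simpl in *. subst y. unfold Cplus, Cmult, Cminus, Copp, Cconj, RtoC; simpl. f_equal; field; lra.
Qed.

Lemma eta1_closed a b : 0 < a -> openC (fun z => ~ eta1 a b z).
Proof.
 intros Ha z Nz. destruct (rcont_min_dist (fun s => (0, b) + RtoC s * 1) (- a) a z) as (d & Hd & K); [lra|intros s _; apply rcont_affine| |].
 - intros s Hs Es. apply Nz. apply eta1_iff; auto. rewrite <- Es. unfold Re, Im, Cplus, Cmult, RtoC; simpl. split; lra.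
 - exists d; split; auto. intros w Hw Ew. apply eta1_iff in Ew; auto. destruct Ew as [E1 E2]. specialize (K (Re w) E2).
  replace ((0, b) + RtoC (Re w) * 1) with w in K; [lra|]. destruct w as [x y]; unfold Re, Im, Cplus, Cmult, RtoC in *; simpl in *. subst y.
  f_equal; ring.
Qed.

(** The divided difference (Y z - Y l) / (z - l), written as an integral of Y' so that it makes
    sense and is Lipschitz at z = l. *)
Definition quot_kernel (Y : C -> C) (z l : C) : C := CI (fun t => cd Y (l + RtoC t * (z - l))) 0 1.

Lemma quot_kernel_spec D Y z l : openC D -> hol D Y -> (forall t, 0 <= t <= 1 -> D (l + RtoC t * (z - l))%C) ->
  quot_kernel Y z l * (z - l) = Y z - Y l.
Proof.
 intros HD HY HL. unfold quot_kernel. assert (F := FTC_line D Y l (z - l) 0 1 HD HY ltac:(lra) HL). replace (l + 1 * (z - l)) with z in F by ring.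
 replace (l + 0 * (z - l)) with l in F by ring. rewrite <- F. rewrite Cmult_comm, <- CI_scal.
 - apply CI_ext; [lra|]. intros; ring.
 - lra.
 - intros t Ht. apply (rcont_comp (cd Y) (fun t => l + RtoC t * (z - l))); [apply rcont_affine|]. apply (hol_cont D); [apply hol_cd; auto|auto].
Qed.

(** Two Cauchy estimates on discs of radius b / 4: from Im z >= b / 2 down to Im z >= b / 4, and
    from there into the open half-plane. *)
Lemma second_derivative_bound D Y b B : openC D -> (forall z, UHP z -> D z) -> hol D Y -> 0 < b ->
  (forall z, UHP z -> Cmod (Y z) <= B) ->
  forall z, b/2 <= Im z -> Cmod (cd Y z) <= 32 * B / b /\ Cmod (cd (cd Y) z) <= 8 * (32 * B / b) / (b/4).
Proof.
 intros HD HU HY Hb HB. assert (I : forall w z, Im z - Cmod (w - z) <= Im w).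
 { apply Im_close. }
 assert (K : forall z, b/4 <= Im z -> Cmod (cd Y z) <= 32 * B / b).
 { intros z Hz. replace (32 * B / b)%R with (8 * B / (b/4))%R by (field; lra). apply (cauchy_est D); auto; try lra. intros w Hw. specialize (I w z).
  assert (UHP w) by (unfold UHP; lra). auto. }
 split; [apply K; lra|]. apply (cauchy_est D (cd Y)); [lra|apply hol_cd; auto|]. intros w Hw. specialize (I w z).
 split; [apply HU; unfold UHP; lra|apply K; lra].
Qed.

Lemma segment_Im (l z : C) b t : 0 <= t <= 1 -> b <= Im l -> b <= Im z -> b <= Im (l + RtoC t * (z - l))%C.
Proof.
 replace (Im (l + t * (z - l))) with (Im l + t * (Im z - Im l))%R.
 - nra.
 - unfold Im, Cplus, Cmult, Cminus, Copp, RtoC; simpl. ring.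
Qed.

Lemma quot_kernel_lip D Y b B : openC D -> (forall z, UHP z -> D z) -> hol D Y -> 0 < b ->
  (forall z, UHP z -> Cmod (Y z) <= B) ->
  forall z l z' l', b/2 <= Im z -> b/2 <= Im l -> b/2 <= Im z' -> b/2 <= Im l' ->
  (Cmod (quot_kernel Y z l - quot_kernel Y z' l') <= 8 * (32 * B / b) / (b/4) * (Cmod (z - z') + Cmod (l - l'))).
Proof.
 intros HD HU HY Hb HB z l z' l' H1 H2 H3 H4. assert (SB := second_derivative_bound D Y b B HD HU HY Hb HB).
 set (M := (8 * (32 * B / b) / (b/4))%R) in *. assert (HU2 : forall w, b/2 <= Im w -> D w) by (intros w Hw; apply HU; unfold UHP; lra).
 assert (C1 : forall z l, b/2 <= Im z -> b/2 <= Im l -> rcont_on (fun t => cd Y (l + RtoC t * (z - l))) 0 1).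
 { intros u v Hu Hv t Ht. apply (rcont_comp (cd Y) (fun t => v + RtoC t * (u - v))); [apply rcont_affine|]. apply (hol_cont D); [apply hol_cd; auto|].
  apply HU2, segment_Im; auto. }
 assert (M0 : 0 <= M) by (eapply Rle_trans; [apply Cmod_ge_0|apply (SB z H1)]). unfold quot_kernel. rewrite <- CI_minus; auto; [|lra].
 replace (M * (Cmod (z - z') + Cmod (l - l')))%R with ((1 - 0) * (M * (Cmod (z - z') + Cmod (l - l'))))%R by ring. apply CI_bound; [lra| |].
 - intros t Ht. apply rcont_minus; apply C1; auto.
 - intros t Ht. eapply Rle_trans; [apply (mean_value D (cd Y) _ _ M HD (hol_cd D Y HD HY))|].
  + intros s Hs. assert (Q : b/2 <= Im (l' + RtoC t * (z' - l') + RtoC s * (l + RtoC t * (z - l) - (l' + RtoC t * (z' - l'))))%C).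
   { apply segment_Im; auto; apply segment_Im; auto. }
   split; [auto|apply SB, Q].
  + apply Rmult_le_compat_l; auto.
   replace (l + t * (z - l) - (l' + t * (z' - l'))) with (RtoC t * (z - z') + RtoC (1 - t) * (l - l')) by (rewrite RtoC_minus; ring).
   eapply Rle_trans; [apply Cmod_triangle|]. rewrite !Cmod_mult, !Cmod_R, !Rabs_pos_eq by lra.
   pose proof (Cmod_ge_0 (z - z')); pose proof (Cmod_ge_0 (l - l')). nra.
Qed.

Lemma thin_eta1 a b : thin (eta1 a b).
Proof. apply thin_segment. Qed.

Lemma rcont_pt (b s : R) : rcont (fun s => (s, b) : C) s.
Proof. apply rcont_ext with (fun t => (0, b) + RtoC t * 1); [|apply rcont_affine]. intros t. unfold RtoC, Cplus, Cmult; simpl. f_equal; ring. Qed.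

Lemma neq_eta1 a b z s : 0 < a -> ~ eta1 a b z -> - a <= s <= a -> (s, b) <> z.
Proof. intros Ha Nz Hs <-. apply Nz, eta1_iff; auto. Qed.

Lemma cauchy_integral_hol a b (W : R -> C) : 0 < a -> rcont_on W (- a) a ->
  hol (fun z => ~ eta1 a b z) (fun z => CI (fun s => W s / (z - (s, b))) (- a) a).
Proof.
 intros Ha HW z Nz. destruct (CI_kernel_der W (fun s => (s, b)) (- a) a z) as [K _]; auto; try lra.
 - intros s _; apply rcont_pt.
 - intros s Hs. apply (neq_eta1 a); auto.
 - apply cder_opp in K. destruct (eta1_closed a b Ha z Nz) as (d & Hd & Q). refine (ex_intro _ _ (cder_ext_loc _ _ _ _ d Hd _ K)). intros w Hw.
  assert (Cw : rcont_on (fun s => W s / ((s, b) - w)) (- a) a).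
  { intros s Hs. apply rcont_mult; auto. apply rcont_inv; [apply rcont_minus; [apply rcont_pt|apply rcont_const]|]. apply csub_neq, (neq_eta1 a); auto. }
  replace (- CI (fun s => W s / ((s, b) - w)) (- a) a) with ((-1) * CI (fun s => W s / ((s, b) - w)) (- a) a) by ring.
  rewrite <- CI_scal; auto; [|lra]. apply CI_ext; [lra|]. intros s Hs. assert (N1 : (s, b) - w <> 0) by (apply csub_neq, (neq_eta1 a); auto; lra).
  assert (N2 : w - (s, b) <> 0).
  { apply csub_neq. intros E0. apply (neq_eta1 a b w s Ha (Q w Hw)); [lra|auto]. }
  field. auto.
Qed.

Lemma cauchy_fun_integral a b (D : C -> Prop) (W : R -> C) (Y : C -> C) B :
  (0 < a) -> 0 < b -> openC D -> (forall z, UHP z -> D z) -> hol D Y ->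
  (forall z, UHP z -> Cmod (Y z) <= B) -> rcont_on W (- a) a ->
  cauchy_fun (eta1 a b) (fun z => CI (fun s => W s / (z - (s, b))) (- a) a) Y
    (fun z => CI (fun s => W s * Y (s, b) / (z - (s, b))) (- a) a) (CI (fun s => W s * Y (s, b)) (- a) a).
Proof.
 intros Ha Hb HD HU HY HB HW. assert (Ub : forall s, UHP (s, b)) by auto. assert (HWY : rcont_on (fun s => W s * Y (s, b)) (- a) a).
 { intros s Hs. apply rcont_mult; auto. apply (rcont_comp Y (fun s => (s, b))); [apply rcont_pt|]. apply (hol_cont D); auto. }
 assert (CK : forall (V : R -> C) z, rcont_on V (- a) a -> ~ eta1 a b z -> rcont_on (fun s => V s / (z - (s, b))) (- a) a).
 { intros V z HV Nz s Hs. apply rcont_mult; auto. apply rcont_inv.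
  - apply rcont_minus; [apply rcont_const|apply rcont_pt].
  - apply csub_neq. intros E0. apply (neq_eta1 a b z s Ha Nz Hs). auto. }
 constructor.
 - apply cauchy_integral_hol; auto.
 - set (f := fun z => CI (fun s => W s / (z - (s, b))) (- a) a * Y z - CI (fun s => W s * Y (s, b) / (z - (s, b))) (- a) a).
  (* Off the chord u Y - CY is the integral of W against the divided difference, and that integral
     remains continuous on the chord. *)
  set (k := fun z => CI (fun s => W s * quot_kernel Y z (s, b)) (- a) a). assert (LK := quot_kernel_lip D Y b B HD HU HY Hb HB).
  set (M := (8 * (32 * B / b) / (b/4))%R) in *. assert (M0 : 0 <= M).
  { assert (0 <= B) by (eapply Rle_trans; [apply Cmod_ge_0|apply (HB _ (Ub 0%R))]). apply Rmult_le_pos; [|left; apply Rinv_0_lt_compat; lra].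
   apply Rmult_le_pos; [lra|]. apply Rmult_le_pos; [lra|left; apply Rinv_0_lt_compat; lra]. }
  assert (CQ : forall z, b/2 <= Im z -> rcont_on (fun s => W s * quot_kernel Y z (s, b)) (- a) a).
  { intros z Hz s Hs. apply rcont_mult; auto. intros e He. exists (e / (M + 1))%R. split; [apply Rdiv_lt_0_compat; lra|]. intros s' Hs'.
   eapply Rle_lt_trans; [apply LK; auto; unfold Im; simpl; lra|]. rewrite Cmod_sub_diag, Rplus_0_l. replace ((s', b) - (s, b)) with (RtoC (s' - s)).
   2:{ unfold RtoC, Cminus, Cplus, Copp; simpl. f_equal; ring. }
   rewrite Cmod_R. apply Rle_lt_trans with ((M + 1) * Rabs (s' - s))%R; [apply Rmult_le_compat_r; [apply Rabs_pos|lra]|].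
   apply Rlt_le_trans with ((M + 1) * (e / (M + 1)))%R; [nra|right; field; lra]. }
  assert (fk : forall z, b/2 <= Im z -> ~ eta1 a b z -> f z = k z).
  { intros z Hz Nz. unfold f. rewrite (Cmult_comm (CI _ _ _)), <- CI_scal, <- CI_minus; auto; try lra.
   - apply CI_ext; [lra|]. intros s Hs. assert (S := quot_kernel_spec D Y z (s, b) HD HY). assert (N2 : z - (s, b) <> 0).
    { apply csub_neq. intros E0. apply (neq_eta1 a b z s Ha Nz); [lra|auto]. }
    assert (S' : quot_kernel Y z (s, b) * (z - (s, b)) = Y z - Y (s, b)).
    { apply S. intros t Ht. apply HU. unfold UHP. assert (b/2 <= Im ((s, b) + RtoC t * (z - (s, b)))%C); [|lra]. apply segment_Im; auto.
     unfold Im; simpl; lra. }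
    replace (quot_kernel Y z (s, b)) with ((Y z - Y (s, b)) / (z - (s, b))) by (rewrite <- S'; field; auto). field; auto.
   - intros s Hs. apply rcont_scal, CK; auto. }
  destruct (hol_extension f (eta1 a b) UHP) as (DI & HDI & EDI).
  + intros z Hz. exists (Im z). split; auto. intros w Hw. unfold UHP in *. assert (T := Im_close w z). lra.
  + apply thin_eta1.
  + apply eta1_closed; auto.
  + apply hol_minus.
   * apply hol_mult; [|apply (hol_sub _ D); [intros z [U _]; auto|auto]]. apply (hol_sub _ (fun z => ~ eta1 a b z)); [tauto|].
    apply cauchy_integral_hol; auto.
   * apply (hol_sub _ (fun z => ~ eta1 a b z)); [tauto|]. apply (cauchy_integral_hol a b (fun s => W s * Y (s, b))); auto.
  + intros z Uz Ez. exists (k z). apply eta1_iff in Ez; auto. destruct (rcont_bounded W (- a) a) as (MW & HMW & KW); [lra|auto|]. intros e He.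
   set (Q := (2 * a * (MW * M) + 1)%R). assert (HQ : 0 < Q) by (unfold Q; assert (0 <= 2 * a * (MW * M)) by (apply Rmult_le_pos; [lra|nra]); lra).
   exists (Rmin (b/2) (e / Q)). split; [apply Rmin_glb_lt; [lra|apply Rdiv_lt_0_compat; auto]|]. intros w Hw Nw.
   destruct (Rmin_Rgt_l _ _ _ Hw) as [W1 W2]. assert (Iw : b/2 <= Im w).
   { assert (T := Im_close w z). lra. }
   rewrite fk by auto. unfold k. rewrite <- CI_minus; try (apply CQ; lra); try lra. apply Rle_lt_trans with ((a - - a) * (MW * (M * Cmod (w - z))))%R.
   * apply CI_bound; [lra| |].
    -- intros s Hs. apply rcont_minus; apply CQ; lra.
    -- intros s Hs.
     replace (W s * quot_kernel Y w (s, b) - W s * quot_kernel Y z (s, b)) with (W s * (quot_kernel Y w (s, b) - quot_kernel Y z (s, b))) by ring.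
     rewrite Cmod_mult. apply Rmult_le_compat; auto using Cmod_ge_0.
     eapply Rle_trans; [apply LK; auto; try (unfold Im; simpl; lra); unfold Im in *; lra|]. rewrite Cmod_sub_diag. lra.
   * apply Rle_lt_trans with (Q * Cmod (w - z))%R.
    -- unfold Q. pose proof (Cmod_ge_0 (w - z)). nra.
    -- apply Rlt_le_trans with (Q * (e / Q))%R; [nra|right; field; lra].
  + exists DI. split; auto.
 (* The factor z / (z - s) - 1 = s / (z - s) is of order 1 / z uniformly over the chord. *)
 - destruct (rcont_bounded _ (- a) a ltac:(lra) HWY) as (MW & HMW & KW). set (R1 := (a + b)%R).
  assert (Rb : forall s, - a <= s <= a -> Cmod (s, b) <= R1).
  { intros s Hs. eapply Rle_trans; [apply Cmod_le_Re_Im|]. unfold Re, Im, R1; simpl. rewrite (Rabs_pos_eq b) by lra.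
   assert (Rabs s <= a) by (apply Rabs_le; lra). lra. }
  apply (vanish_O _ (2 * a * (MW * (2 * R1))) (2 * R1)). intros z Hz. assert (HR1 : 0 < R1) by (unfold R1; lra). assert (Nz : ~ eta1 a b z).
  { intros Ez. apply eta1_iff in Ez; auto. destruct Ez as [E1 E2]. specialize (Rb _ E2). destruct z as [x y]; simpl in *. subst y. lra. }
  rewrite <- CI_scal; [|lra|auto]. rewrite <- CI_minus; [|lra| |exact HWY].
  2:{ intros s Hs. apply rcont_scal. apply (CK (fun s => W s * Y (s, b))); auto. }
  replace (2 * a * (MW * (2 * R1)) / Cmod z)%R with ((a - - a) * (MW * (R1 / (Cmod z / 2))))%R by (field; lra). apply CI_bound; [lra| |].
  + intros s Hs. apply rcont_minus; [|auto]. apply rcont_scal. apply (CK (fun s => W s * Y (s, b))); auto.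
  + intros s Hs. assert (T := Cmod_tri_inv z (s, b)). specialize (Rb s Hs). assert (N : z - (s, b) <> 0) by (intros E0; rewrite E0, Cmod_0 in T; lra).
   replace (z * (W s * Y (s, b) / (z - (s, b))) - W s * Y (s, b)) with ((W s * Y (s, b)) * ((s, b) / (z - (s, b)))) by (field; auto).
   rewrite Cmod_mult, Cmod_div by auto. apply Rmult_le_compat; auto using Cmod_ge_0.
   * apply Rmult_le_pos; [apply Cmod_ge_0|left; apply Rinv_0_lt_compat; lra].
   * apply Rmult_le_compat; auto using Cmod_ge_0; [left; apply Rinv_0_lt_compat; lra|]. apply Rinv_le_contravar; lra.
Qed.

(** * The slit estimate on the circular arc *)

Definition reflf (r : R) (f : C -> C) (z : C) : C := Cconj (f (RtoC (r * r) / Cconj z)).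

Lemma Cmod_pos (z : C) : z <> 0 -> 0 < Cmod z.
Proof. apply Cmod_gt_0. Qed.

(** Reflection in the circle |z| = r. It preserves the upper half-plane, fixes the circle pointwise
    and exchanges its two sides. *)
Definition refl (r : R) (z : C) : C := RtoC (r * r) / Cconj z.

Lemma Cconj_neq0 (z : C) : z <> 0 -> Cconj z <> 0.
Proof. intros H E. apply H. apply Cmod_eq_0. rewrite <- Cmod_conj, E. apply Cmod_0. Qed.

Lemma Cconj_R x : Cconj (RtoC x) = RtoC x.
Proof. unfold Cconj, RtoC; simpl; f_equal; ring. Qed.

Lemma UHP_neq0 z : UHP z -> z <> 0.
Proof. unfold UHP. intros H E. rewrite E in H. unfold Im, RtoC in H; simpl in H; lra. Qed.

Lemma Cmult_conj_sqr z : z * Cconj z = RtoC (Cmod z * Cmod z).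
Proof. rewrite Cmod_sqr. unfold Cmult, Cconj, RtoC, Re, Im; simpl. f_equal; ring. Qed.

Lemma refl_scal r (z : C) : z <> 0 -> refl r z = RtoC (r * r / (Cmod z * Cmod z)) * z.
Proof.
 intros H. assert (P := Cmod_pos z H). unfold Rdiv. rewrite RtoC_mult, RtoC_inv by nra. unfold refl. rewrite <- Cmult_conj_sqr. field. split; auto.
 apply Cconj_neq0; auto.
Qed.

Lemma refl_mod r (z : C) : 0 < r -> z <> 0 -> Cmod (refl r z) = (r * r / Cmod z)%R.
Proof. intros Hr H. unfold refl. rewrite Cmod_div, Cmod_conj, Cmod_R, Rabs_pos_eq by (try apply Cconj_neq0; auto; nra). reflexivity. Qed.

Lemma refl_Im r (z : C) : z <> 0 -> Im (refl r z) = (r * r / (Cmod z * Cmod z) * Im z)%R.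
Proof. intros H. rewrite refl_scal by auto. unfold Im, Cmult, RtoC; simpl. ring. Qed.

Lemma UHP_refl r z : 0 < r -> UHP z -> UHP (refl r z).
Proof.
 intros Hr H. assert (N := UHP_neq0 z H). assert (P := Cmod_pos z N). unfold UHP. rewrite refl_Im by auto. apply Rmult_lt_0_compat; auto.
 apply Rdiv_lt_0_compat; nra.
Qed.

Lemma refl_axis r z : 0 < r -> Cmod z = r -> refl r z = z.
Proof.
 intros Hr H. assert (N : z <> 0) by (intros E; rewrite E, Cmod_0 in H; lra). rewrite refl_scal, H by auto.
 replace (r * r / (r * r))%R with 1%R by (field; lra). ring.
Qed.

Lemma refl_sub r (z p : C) : Cmod p = r -> z <> 0 -> refl r z - p = p / Cconj z * Cconj (p - z).
Proof. intros H Hz. unfold refl. rewrite <- H, <- Cmult_conj_sqr, Cminus_conj. field. apply Cconj_neq0; auto. Qed.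

Lemma refl_dist r (z p : C) : 0 < r -> Cmod p = r -> z <> 0 -> Cmod (refl r z - p) = (r / Cmod z * Cmod (z - p))%R.
Proof.
 intros Hr H Hz. rewrite (refl_sub r z p) by auto. rewrite Cmod_mult, Cmod_div, !Cmod_conj, H by (apply Cconj_neq0; auto). rewrite (Cmod_sub_sym p z).
 reflexivity.
Qed.

Lemma cder_reflf r f (z : C) : z <> 0 -> (exists l, cder f (refl r z) l) -> exists l, cder (reflf r f) z l.
Proof.
 intros N [l H]. assert (E : Cconj (RtoC (r * r) / z) = refl r z) by (unfold refl; rewrite Cdiv_conj, Cconj_R; auto).
 assert (H2 : cder (fun w => Cconj (f (Cconj w))) (RtoC (r * r) / z) (Cconj l)) by (apply cder_conj; rewrite E; auto).
 destruct (hol_div (fun w => w <> 0) (fun _ => RtoC (r * r)) (fun w => w) (hol_const _ _) (hol_id _) (fun z H => H) z N) as [m Hm].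
 exists (Cconj l * m).
 refine (cder_ext_loc _ _ _ _ (Cmod z) (Cmod_pos z N) _ (cder_comp (fun w => RtoC (r*r) / w) (fun w => Cconj (f (Cconj w))) _ _ _ Hm H2)). intros w Hw.
 rewrite Cdiv_conj, Cconj_R; auto. intros E0. rewrite E0 in Hw. replace (0 - z) with (- z) in Hw by ring. rewrite Cmod_opp in Hw. lra.
Qed.

Lemma Cmod_reflf r f z : Cmod (reflf r f z) = Cmod (f (refl r z)).
Proof. apply Cmod_conj. Qed.

Definition ucont (h : C -> R) (z : C) : Prop :=
  forall e, 0 < e -> exists d, 0 < d /\ forall w, Cmod (w - z) < d -> Rabs (h w - h z) < e.

Lemma ucont_Cmod f z : ccont f z -> ucont (fun w => Cmod (f w)) z.
Proof.
 intros H e He. destruct (H e He) as (d & Hd & K). exists d; split; auto. intros w Hw. specialize (K w Hw). assert (T1 := Cmod_tri_inv (f w) (f z)).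
 assert (T2 := Cmod_tri_inv (f z) (f w)). rewrite (Cmod_sub_sym (f z) (f w)) in T2. apply Rabs_def1; lra.
Qed.

Lemma ucont_max f g z : ucont f z -> ucont g z -> ucont (fun w => Rmax (f w) (g w)) z.
Proof.
 intros Hf Hg e He. destruct (Hf e He) as (d1 & Hd1 & K1). destruct (Hg e He) as (d2 & Hd2 & K2).
 exists (Rmin d1 d2); split; [apply Rmin_glb_lt; auto|]. intros w Hw. specialize (K1 w (proj1 (Rmin_Rgt_l _ _ _ Hw))).
 specialize (K2 w (proj2 (Rmin_Rgt_l _ _ _ Hw))). apply Rabs_def2 in K1. apply Rabs_def2 in K2. unfold Rmax.
 destruct (Rle_dec (f w) (g w)), (Rle_dec (f z) (g z)); apply Rabs_def1; lra.
Qed.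

Lemma ucont_mult f g z : ucont f z -> ucont g z -> ucont (fun w => (f w * g w)%R) z.
Proof.
 intros Hf Hg e He. destruct (mult_eps (f z) (g z) e He) as (e' & He' & K). destruct (Hf e' He') as (d1 & Hd1 & H1).
 destruct (Hg e' He') as (d2 & Hd2 & H2). exists (Rmin d1 d2); split; [apply Rmin_glb_lt; lra|]. intros w Hw. apply Rmin_Rgt_l in Hw.
 specialize (K (f w) (g w)). rewrite <- !RtoC_mult, <- !RtoC_minus, !Cmod_R in K. apply K; [apply H1|apply H2]; apply Hw.
Qed.

(* A stand-in for subharmonicity of [P] at [z0]. *)
Definition touched (D : C -> Prop) (z0 : C) (P : C -> R) : Prop :=
  ucont P z0 /\ exists g, hol D g /\ (forall z, D z -> Cmod (g z) <= P z) /\ P z0 = Cmod (g z0).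

Lemma touched_Cmod D z0 g : hol D g -> D z0 -> touched D z0 (fun z => Cmod (g z)).
Proof. split; [apply ucont_Cmod, (hol_cont D); auto|]. exists g. repeat split; auto. intros; lra. Qed.

Lemma touched_max D z0 P Q : touched D z0 P -> touched D z0 Q -> touched D z0 (fun z => Rmax (P z) (Q z)).
Proof.
 intros [CP (g & Hg & Bg & Eg)] [CQ (h & Hh & Bh & Eh)]. split; [apply ucont_max; auto|].
 destruct (Rle_dec (P z0) (Q z0)) as [L|L]; [exists h; rewrite Rmax_right by auto|exists g; rewrite Rmax_left by lra]; repeat split; auto; intros z Dz; [specialize (Bh z Dz)|specialize (Bg z Dz)]; assert (K1 := Rmax_l (P z) (Q z)); assert (K2 := Rmax_r (P z) (Q z)); lra.
Qed.

Lemma touched_mult D z0 P Q : touched D z0 P -> touched D z0 Q -> touched D z0 (fun z => (P z * Q z)%R).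
Proof.
 intros [CP (g & Hg & Bg & Eg)] [CQ (h & Hh & Bh & Eh)]. split; [apply ucont_mult; auto|]. exists (fun z => g z * h z). split; [apply hol_mult; auto|].
 split; [|rewrite Cmod_mult; congruence]. intros z Dz. rewrite Cmod_mult. apply Rmult_le_compat; auto using Cmod_ge_0.
Qed.

(** The Blaschke factor of the upper half-plane with zero p; its modulus is the pseudohyperbolic
    distance to p. *)
Definition bl (p z : C) : C := (z - p) / (z - Cconj p).

Lemma bl_den p z : UHP p -> 0 <= Im z -> z - Cconj p <> 0.
Proof. unfold UHP. intros Hy Hz E. apply (f_equal Im) in E. unfold Im, Cconj, RtoC, Cminus, Copp, Cplus in *; simpl in *. lra. Qed.

Lemma bl_den_ge p z : UHP p -> 0 <= Im z -> Im p <= Cmod (z - Cconj p).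
Proof. unfold UHP. intros Hy Hz. eapply Rle_trans; [|apply Rabs_Im_le]. rewrite Rabs_pos_eq; unfold Im, Cconj, Cminus, Copp, Cplus in *; simpl in *; lra. Qed.

Lemma bl_le_1 p z : UHP p -> 0 <= Im z -> Cmod (bl p z) <= 1.
Proof.
 intros Hy Hz. assert (N := bl_den p z Hy Hz). assert (P := Cmod_pos _ N). unfold bl. rewrite Cmod_div by auto.
 apply (Rmult_le_reg_r (Cmod (z - Cconj p))); [lra|]. unfold Rdiv. rewrite Rmult_assoc, Rinv_l, Rmult_1_r, Rmult_1_l by lra.
 apply Rsqr_incr_0_var; [|lra]. unfold Rsqr. rewrite !Cmod_sqr. unfold UHP, Re, Im, Cconj, Cminus, Cplus, Copp in *; simpl in *. nra.
Qed.

Lemma bl_hol p : UHP p -> hol (fun z => 0 <= Im z)%R (bl p).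
Proof. intros H. apply hol_div; try (apply hol_minus; [apply hol_id|apply hol_const]). intros z Hz. apply bl_den; auto. Qed.

(** p and its conjugate both lie on the circle, so [refl_dist] scales numerator and denominator by
    the same factor. *)
Lemma bl_refl r p z : 0 < r -> Cmod p = r -> UHP p -> UHP z -> Cmod (bl p (refl r z)) = Cmod (bl p z).
Proof.
 intros Hr H Hp Hz. assert (N := UHP_neq0 z Hz). assert (P := Cmod_pos z N). assert (R1 := UHP_refl r z Hr Hz). unfold UHP in R1, Hz. unfold bl.
 rewrite !Cmod_div by (apply bl_den; auto; lra). rewrite !(refl_dist r) by (auto; rewrite Cmod_conj; auto).
 assert (Q := Cmod_pos _ (bl_den p z Hp ltac:(lra))). field. lra.
Qed.

Fixpoint blist (l : list C) (z : C) : C := match l with nil => 1 | p :: l' => bl p z * blist l' z end.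

Lemma blist_hol l : (forall p, In p l -> UHP p) -> hol (fun z => 0 <= Im z)%R (blist l).
Proof. induction l as [|p l IH]; intros H; [apply hol_const|]. apply hol_mult; [apply bl_hol, H; left; auto|]. apply IH. intros q Hq. apply H; right; auto. Qed.

Lemma blist_le_1 l z : (forall p, In p l -> UHP p) -> 0 <= Im z -> Cmod (blist l z) <= 1.
Proof.
 intros H Hz. induction l as [|p l IH]; simpl; [rewrite Cmod_1; lra|]. rewrite Cmod_mult. assert (A := bl_le_1 p z (H p (or_introl eq_refl)) Hz).
 assert (B := IH (fun q Hq => H q (or_intror Hq))). pose proof (Cmod_ge_0 (bl p z)). nra.
Qed.

Lemma blist_le l p z : (forall p, In p l -> UHP p) -> 0 <= Im z -> In p l -> Cmod (blist l z) <= Cmod (bl p z).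
Proof.
 intros H Hz. induction l as [|q l IH]; simpl; intros I; [tauto|]. rewrite Cmod_mult. assert (A := bl_le_1 q z (H q (or_introl eq_refl)) Hz).
 assert (B := blist_le_1 l z (fun q Hq => H q (or_intror Hq)) Hz). pose proof (Cmod_ge_0 (bl q z)). pose proof (Cmod_ge_0 (blist l z)).
 destruct I as [->|I]; [nra|]. specialize (IH (fun q Hq => H q (or_intror Hq)) I). nra.
Qed.

Definition far (l : list C) (d : R) (z : C) : Prop := forall p, In p l -> d <= Cmod (bl p z).

Lemma far_open l d z0 : (forall p, In p l -> UHP p) -> 0 <= Im z0 -> (forall p, In p l -> d < Cmod (bl p z0)) ->
  exists e, 0 < e /\ forall z, Cmod (z - z0) < e -> far l d z.
Proof.
 intros H Hz. induction l as [|p l IH]; intros F.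
 - exists 1%R. split; [lra|]. intros z _ q [].
 - destruct IH as (e1 & He1 & K1); [intros; apply H; right; auto|intros; apply F; right; auto|]. assert (Q := F p (or_introl eq_refl)).
  assert (CB : ccont (bl p) z0) by (apply (hol_cont _ _ _ (bl_hol p (H p (or_introl eq_refl)))); auto).
  destruct (CB (Cmod (bl p z0) - d)%R) as (e2 & He2 & K2); [lra|]. exists (Rmin e1 e2). split; [apply Rmin_glb_lt; auto|]. intros z Dz q [<-|I].
  + specialize (K2 z (proj2 (Rmin_Rgt_l _ _ _ Dz))). assert (T1 := Cmod_tri_inv (bl p z0) (bl p z)). rewrite Cmod_sub_sym in T1. lra.
  + apply K1; auto. apply (proj1 (Rmin_Rgt_l _ _ _ Dz)).
Qed.

Definition on_arc (r b : R) (z : C) : Prop := (Cmod z = r /\ b <= Im z)%R.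

(* [phi] is the Cauchy integral of [c f / twopii] over the chord, continued through the chord into the region
   under the arc: it is small on the real line and jumps by [c f] across the arc, where [phr] is its outer branch.
   Pseudohyperbolic discs ([far]) about the points of [l], the ends of the arc and the zeros of [c], are removed. *)
Record slit_data (r b eps0 delta Cd rho kappa : R) (l : list C) (f phi phr c : C -> C) : Prop := {
  sd_f : hol UHP f;
  sd_f1 : forall z, UHP z -> (Cmod (f z) <= 1);
  sd_phi : hol (fun z => UHP z /\ ~ on_arc r b z) phi;
  sd_bdry : forall e, 0 < e -> exists d, 0 < d /\
     forall z, UHP z -> ~ on_arc r b z -> Im z < d * (r * r + Cmod z * Cmod z) -> (Cmod (phi z) <= eps0 + e);
  sd_crude : forall z, UHP z -> far l delta z ->
     (~ on_arc r b z -> Cmod (phi z) <= Cd) /\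
     (on_arc r b z -> (Cmod (phr z) <= Cd /\ Cmod (phr z + c z * f z) <= Cd));
  sd_loc : forall z0, on_arc r b z0 -> far l (2 * delta) z0 -> forall z, Cmod (z - z0) < rho ->
     UHP z /\ far l delta z /\ (Cmod z = r -> on_arc r b z) /\
     (exists l, cder phr z l) /\ (exists l, cder c z l) /\ Cmod (c z) <= Cd /\
     (on_arc r b z -> kappa <= Cmod (c z)) /\
     ((r < Cmod z) -> phi z = phr z) /\ ((Cmod z < r) -> phi z = phr z + c z * f z)
}.
Arguments sd_f {_ _ _ _ _ _ _ _ _ _ _ _}.
Arguments sd_f1 {_ _ _ _ _ _ _ _ _ _ _ _}.
Arguments sd_phi {_ _ _ _ _ _ _ _ _ _ _ _}.
Arguments sd_bdry {_ _ _ _ _ _ _ _ _ _ _ _}.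
Arguments sd_crude {_ _ _ _ _ _ _ _ _ _ _ _}.
Arguments sd_loc {_ _ _ _ _ _ _ _ _ _ _ _}.

Section Slit.

Variables (r b eps0 delta Cd rho kappa : R) (l : list C) (f phi phr c : C -> C) (T : nat).
Hypothesis Hr : 0 < b <= r.
Hypothesis Hl : forall p, In p l -> on_arc r b p.
Hypothesis Hdelta : 0 < delta.
Hypothesis Hrho : 0 < rho <= r.
Hypothesis Hkappa : 0 < kappa.
Hypothesis HCd : 1 <= Cd.
Hypothesis Heps : 0 < eps0 <= 1.
Hypothesis HS : slit_data r b eps0 delta Cd rho kappa l f phi phr c.
Hypothesis HT : Cd * Cd * (3 * delta) ^ T <= eps0.

Let phl z := phr z + c z * f z.

(** On the arc, where [phi] has two one-sided values, the larger one is taken. *)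
Definition Pmax (z : C) : R :=
  if dec (on_arc r b z) then Rmax (Cmod (phr z)) (Cmod (phl z)) else Cmod (phi z).

Definition Phi (z : C) : R := Rmax (Pmax z) (Pmax (refl r z)).
Definition Fmax (z : C) : R := Rmax (Rmax (Cmod (f z)) (Cmod (f (refl r z)))) (Phi z).
(** The quantity that obeys a maximum principle. It is O(eps0) where [Phi] is, and near the removed
    points the Blaschke power, with [HT], brings the crude bound Cd^2 down to eps0. *)
Definition Wmax (z : C) : R := (Phi z * Fmax z * Cmod (blist l z) ^ T)%R.
Definition Xdom (z : C) : Prop := UHP z /\ far l delta z.

Lemma arc_UHP z : on_arc r b z -> UHP z.
Proof. unfold on_arc, UHP. lra. Qed.

Lemma l_UHP p : In p l -> UHP p.
Proof. intros; apply arc_UHP, Hl; auto. Qed.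

Lemma arc_refl z : UHP z -> (on_arc r b (refl r z) <-> on_arc r b z).
Proof.
 intros U. assert (N := UHP_neq0 z U). assert (P := Cmod_pos z N). split; intros [A B].
 - rewrite refl_mod in A by (auto; lra). assert (E : Cmod z = r).
  { apply (Rmult_eq_reg_l r); [|lra]. rewrite <- A at 1. unfold Rdiv. rewrite Rmult_assoc, Rinv_l by lra. ring. }
  rewrite refl_axis in B by lra. split; auto.
 - rewrite refl_axis by lra. split; auto.
Qed.

Lemma Xdom_refl z : Xdom z -> Xdom (refl r z).
Proof. intros (A & B). split; [apply UHP_refl; auto; lra|]. intros p Hp. rewrite bl_refl; auto; try lra; [apply Hl; auto|apply l_UHP; auto]. Qed.

Lemma Pmax_nonneg z : 0 <= Pmax z.
Proof. unfold Pmax. destruct (dec (on_arc r b z)); [|apply Cmod_ge_0]. eapply Rle_trans; [apply Cmod_ge_0|apply Rmax_l]. Qed.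

Lemma Phi_nonneg z : 0 <= Phi z.
Proof. eapply Rle_trans; [apply Pmax_nonneg|apply Rmax_l]. Qed.

Lemma Fmax_nonneg z : 0 <= Fmax z.
Proof. eapply Rle_trans; [apply Phi_nonneg|apply Rmax_r]. Qed.

Lemma Pmax_crude z : Xdom z -> Pmax z <= Cd.
Proof.
 intros (A & B). destruct (sd_crude HS z A B) as [K1 K2]. unfold Pmax. destruct (dec (on_arc r b z)); [|auto]. destruct K2; auto. apply Rmax_lub; auto.
Qed.

Lemma Phi_crude z : Xdom z -> Phi z <= Cd.
Proof. intros H. apply Rmax_lub; apply Pmax_crude; auto using Xdom_refl. Qed.

Lemma Fmax_crude z : Xdom z -> Fmax z <= Cd.
Proof.
 intros H. assert (U : UHP z) by apply H. apply Rmax_lub; [apply Rmax_lub|apply Phi_crude; auto].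
 - eapply Rle_trans; [apply (sd_f1 HS); auto|lra].
 - eapply Rle_trans; [apply (sd_f1 HS); apply UHP_refl; auto; lra|lra].
Qed.

Lemma Bpow_bounds z : 0 <= Im z -> 0 <= Cmod (blist l z) ^ T <= 1.
Proof.
 intros H. assert (A := blist_le_1 l z l_UHP H). pose proof (Cmod_ge_0 (blist l z)). split; [apply pow_le; auto|]. rewrite <- (pow1 T).
 apply pow_incr; auto.
Qed.

Lemma Wmax_bounds z : Xdom z -> 0 <= Wmax z <= Cd * Cd.
Proof.
 intros H. assert (U : UHP z) by apply H. unfold UHP in U. assert (A := Bpow_bounds z ltac:(lra)). assert (P := Phi_crude z H).
 assert (F := Fmax_crude z H). pose proof (Phi_nonneg z). pose proof (Fmax_nonneg z). split.
 - repeat apply Rmult_le_pos; lra.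
 - rewrite <- (Rmult_1_r (Cd * Cd)). apply Rmult_le_compat; try lra; [nra|nra].
Qed.

Lemma Phi_small_Wmax z e : Xdom z -> 0 <= e -> Phi z <= eps0 + e -> e <= 1 -> Wmax z <= 4 * eps0 + 4 * e.
Proof.
 intros H He P E1. assert (U : UHP z) by apply H. assert (A := Bpow_bounds z). unfold UHP in U. assert (F : Fmax z <= 2).
 { apply Rmax_lub; [apply Rmax_lub|lra].
  - eapply Rle_trans; [apply (sd_f1 HS); auto|lra].
  - eapply Rle_trans; [apply (sd_f1 HS); apply UHP_refl; auto; lra|lra]. }
 pose proof (Phi_nonneg z). pose proof (Fmax_nonneg z). apply Rle_trans with ((eps0 + e) * 2 * 1)%R; [|lra]. apply Rmult_le_compat; try lra; [nra|nra].
Qed.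

Lemma arc_closed z : ~ on_arc r b z -> exists d, 0 < d /\ forall w, Cmod (w - z) < d -> ~ on_arc r b w.
Proof.
 intros N. destruct (Req_dec (Cmod z) r) as [E|E].
 - assert (L : Im z < b) by (apply Rnot_le_lt; intros L; apply N; split; auto). exists (b - Im z)%R. split; [lra|]. intros w Hw [_ B].
  assert (Q := Im_close w z). lra.
 - exists (Rabs (Cmod z - r)). split; [apply Rabs_pos_lt; lra|]. intros w Hw [B _]. assert (T1 := Cmod_tri_inv w z). assert (T2 := Cmod_tri_inv z w).
  rewrite (Cmod_sub_sym z w) in T2. assert (Q : Rabs (Cmod z - r) <= Cmod (w - z)) by (apply Rabs_le; lra). lra.
Qed.

(** Off the arc each factor of [Wmax] is a maximum of moduli of holomorphic functions, so the
    comparison function touches it without loss. *)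
Lemma local_off_arc z0 : UHP z0 -> ~ on_arc r b z0 -> (forall p, In p l -> delta < Cmod (bl p z0)) ->
  exists s D g, 0 < s /\ (forall u, csq z0 s u -> D u /\ 0 <= Im u) /\ hol D g /\
        (forall e, 0 < e -> exists d, 0 < d /\ forall z, Xdom z -> Cmod (z - z0) < d -> Wmax z <= 1 * Cmod (g z0) + e) /\
        (forall u, bsq z0 s u -> Xdom u /\ Cmod (g u) <= Wmax u).
Proof.
 intros U0 N0 D1. destruct (arc_closed z0 N0) as (d0 & Hd0 & K0).
 destruct (far_open l delta z0 l_UHP) as (d1 & Hd1 & K1); auto; [unfold UHP in U0; lra|]. unfold UHP in U0.
 destruct (pos_min4 d0 (Im z0) d1 1) as (q & Hq & R1 & R2 & R3 & _); [lra..|]. set (D := fun z => (Cmod (z - z0) < q)).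
 assert (DU : forall z, D z -> UHP z /\ ~ on_arc r b z /\ Xdom z).
 { intros z Hz. unfold D in Hz. assert (I : UHP z).
  { assert (Q := Im_close z z0). unfold UHP. lra. }
  split; [auto|]. split; [apply K0; lra|]. split; [auto|]. apply K1. lra. }
 assert (hphi : forall z, D z -> exists l, cder phi z l).
 { intros z Hz. destruct (DU z Hz) as (A & B & _). apply (sd_phi HS). split; auto. }
 assert (hf : forall z, D z -> exists l, cder f z l).
 { intros z Hz. destruct (DU z Hz) as (A & B & _). apply (sd_f HS). auto. }
 assert (hphi' : forall z, D z -> exists l, cder (reflf r phi) z l).
 { intros z Hz. destruct (DU z Hz) as (A & B & _). apply cder_reflf, (sd_phi HS); [apply UHP_neq0; auto|]. split; [apply UHP_refl; auto; lra|].
  rewrite arc_refl; auto. }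
 assert (hf' : forall z, D z -> exists l, cder (reflf r f) z l).
 { intros z Hz. destruct (DU z Hz) as (A & B & _). apply cder_reflf, (sd_f HS); [apply UHP_neq0; auto|]. apply UHP_refl; auto; lra. }
 assert (Dz0 : D z0) by (unfold D; rewrite Cmod_sub_diag; auto). assert (HB : hol D (fun z => Cpow (blist l z) T)).
 { apply hol_pow, (hol_sub _ (fun z => 0 <= Im z)%R); [|apply blist_hol, l_UHP]. intros z Hz. destruct (DU z Hz) as [I _]. unfold UHP in I. lra. }
 set (m := fun z => Rmax (Cmod (phi z)) (Cmod (reflf r phi z))).
 set (H := fun z => (m z * Rmax (Rmax (Cmod (f z)) (Cmod (reflf r f z))) (m z) * Cmod (Cpow (blist l z) T))%R).
 assert (WH : forall z, D z -> Wmax z = H z).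
 { intros z Hz. destruct (DU z Hz) as (A & B & _). unfold Wmax, Fmax, Phi, Pmax, H, m. rewrite !Cmod_reflf, Cmod_Cpow.
  destruct (dec (on_arc r b z)); [tauto|]. destruct (dec (on_arc r b (refl r z))) as [Q|]; [rewrite arc_refl in Q by auto; tauto|reflexivity]. }
 assert (MH : touched D z0 H).
 { apply touched_mult; [apply touched_mult; auto; repeat apply touched_max; auto; apply touched_Cmod; auto|apply (touched_Cmod D z0 (fun z => Cpow (blist l z) T)); auto]. }
 destruct MH as [CH (g & Hg & Bg & Eg)]. exists (q/4)%R, D, g. split; [lra|]. split; [|split; [auto|split]].
 - intros u Hu. apply csq_close in Hu. assert (Du : D u) by (unfold D; lra). split; auto. destruct (DU u Du) as [I _]. unfold UHP in I. lra.
 - intros e He. destruct (CH e He) as (d & Hd & K). exists (Rmin d q). split; [apply Rmin_glb_lt; auto|]. intros z _ Hz.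
  apply Rmin_Rgt_l in Hz as [Z1 Z2]. rewrite WH by auto. specialize (K z Z1). apply Rabs_def2 in K. lra.
 - intros u Hu. assert (Hc := csq_close z0 (q/4) u (proj1 Hu)). assert (Du : D u) by (unfold D; lra). rewrite WH; auto. split; auto. apply DU, Du.
Qed.

(** The factor lost on the arc: 1 + Cd because a branch continued to the wrong side is at most (1 +
    Cd) [Fmax], and 1 + 2 / kappa because on the arc |f| is at most 2 / kappa times the larger
    branch. *)
Definition slit_C1 : R := ((1 + Cd) * (1 + 2 / kappa))%R.

(* Near the slit [phi] is compared with the product of a continuation of [phi] and its reflection:
   one factor is [phi] itself and the other is controlled by [phi] and [f]. *)
Lemma local_on_arc z0 : on_arc r b z0 -> far l (2 * delta) z0 ->
  exists D g, (forall u, csq z0 (rho/16) u -> D u /\ 0 <= Im u) /\ hol D g /\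
        (forall e, 0 < e -> exists d, 0 < d /\ forall z, Xdom z -> Cmod (z - z0) < d -> Wmax z <= slit_C1 * Cmod (g z0) + e) /\
        (forall u, bsq z0 (rho/16) u -> Xdom u /\ Cmod (g u) <= Wmax u).
Proof.
 intros A0 F0. set (D := fun z => (Cmod (z - z0) < rho/2)). assert (HL := sd_loc HS z0 A0 F0).
 assert (HD : forall z, D z -> Cmod (z - z0) < rho) by (intros z Hz; unfold D in Hz; lra).
 assert (DU : forall z, D z -> UHP z) by (intros z Hz; apply HL, HD, Hz).
 assert (DX : forall z, D z -> Xdom z) by (intros z Hz; split; apply HL, HD, Hz). assert (Dr : forall z, D z -> Cmod (refl r z - z0) < rho).
 { intros z Hz. assert (N := UHP_neq0 z (DU z Hz)). assert (P := Cmod_pos z N). destruct A0 as [A0 _]. rewrite refl_dist by (auto; lra).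
  unfold D in Hz. assert (T1 := Cmod_tri_inv z0 z). rewrite (Cmod_sub_sym z0 z) in T1. assert (Q : r / Cmod z <= 2).
  { apply (Rmult_le_reg_r (Cmod z)); auto. unfold Rdiv. rewrite Rmult_assoc, Rinv_l by lra. lra. }
  pose proof (Cmod_ge_0 (z - z0)). nra. }
 assert (Dz0 : D z0) by (unfold D; rewrite Cmod_sub_diag; lra).
 assert (hphr : hol (fun z => (Cmod (z - z0) < rho)) phr) by (intros z Hz; apply HL, Hz). assert (hphl : hol (fun z => (Cmod (z - z0) < rho)) phl).
 { apply hol_plus; auto. apply hol_mult; [intros z Hz; apply HL, Hz|]. intros z Hz. apply (sd_f HS). apply HL, Hz. }
 set (m := fun z => Rmax (Cmod (phr z)) (Cmod (phl z))). assert (Pm : forall z, Cmod (z - z0) < rho -> Pmax z <= m z).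
 { intros z Hz. destruct (HL z Hz) as (U & _ & E0 & _ & _ & _ & _ & E1 & E2). unfold Pmax, m. destruct (dec (on_arc r b z)) as [E|E]; [lra|].
  destruct (Rtotal_order (Cmod z) r) as [L|[L|L]].
  - rewrite (E2 L). apply Rmax_r.
  - tauto.
  - rewrite (E1 L). apply Rmax_l. }
 (* [al] is the branch that is larger at [z0]. Off the circle, exactly one of the points u and refl
    r u lies on the side to which [al] belongs, and there [al] is [phi] itself. *)
 assert (R0 : refl r z0 = z0) by (apply refl_axis; [lra|apply A0]). assert (G : exists al, (al = phr \/ al = phl) /\ Cmod (al z0) = m z0).
 { unfold m. destruct (Rle_dec (Cmod (phr z0)) (Cmod (phl z0))) as [L|L].
  - exists phl. rewrite Rmax_right by auto. auto.
  - exists phr. rewrite Rmax_left by lra. auto. }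
 destruct G as (al & Eal & Mal). assert (hal : hol (fun z => (Cmod (z - z0) < rho)) al) by (destruct Eal as [-> | ->]; auto).
 assert (HB : hol D (blist l)).
 { apply (hol_sub _ (fun z => 0 <= Im z)%R); [|apply blist_hol, l_UHP]. intros z Hz. assert (I := DU z Hz). unfold UHP in I. lra. }
 exists D, (fun z => al z * reflf r al z * Cpow (blist l z) T * / RtoC (1 + Cd)).
 assert (HCd0 : RtoC (1 + Cd) <> 0) by (intros E; apply RtoC_inj in E; lra).
 assert (Mg : forall z, Cmod (al z * reflf r al z * Cpow (blist l z) T * / RtoC (1 + Cd)) = (Cmod (al z) * Cmod (al (refl r z)) * Cmod (blist l z) ^ T / (1 + Cd))%R).
 { intros z. rewrite !Cmod_mult, Cmod_reflf, Cmod_Cpow, Cmod_inv, Cmod_R, Rabs_pos_eq by (auto; lra). reflexivity. }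
 split; [|split; [|split]].
 - intros u Hu. apply csq_close in Hu. assert (Du : D u) by (unfold D; lra). split; auto. assert (I := DU u Du). unfold UHP in I; lra.
 - apply hol_mult; [|apply hol_const]. apply hol_mult; [|apply hol_pow; auto]. apply hol_mult.
  + intros z Hz. auto.
  + intros z Hz. apply cder_reflf; [apply UHP_neq0, DU, Hz|]. auto.
 - set (M := fun z => Rmax (m z) (m (refl r z))).
  set (H := fun z => (M z * Rmax (Rmax (Cmod (f z)) (Cmod (f (refl r z)))) (M z) * Cmod (blist l z) ^ T)%R).
  assert (WH : forall z, D z -> Wmax z <= H z).
  { intros z Hz. assert (I := DU z Hz). unfold UHP in I. assert (PM : Phi z <= M z).
   { apply Rmax_lub; [eapply Rle_trans; [auto|apply Rmax_l]|eapply Rle_trans; [auto|apply Rmax_r]]. }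
   assert (QB := Bpow_bounds z ltac:(lra)). apply Rmult_le_compat_r; [apply QB|]. apply Rmult_le_compat; auto using Phi_nonneg, Fmax_nonneg.
   apply Rle_max_compat_l. exact PM. }
  assert (cal : forall h, hol (fun z => (Cmod (z - z0) < rho)) h -> ucont (fun z => Cmod (h z)) z0 /\ ucont (fun z => Cmod (h (refl r z))) z0).
  { intros h Hh. split.
   - apply ucont_Cmod. apply (hol_cont _ _ _ Hh). auto.
   - assert (Q : ucont (fun z => Cmod (reflf r h z)) z0).
    { apply ucont_Cmod. destruct (cder_reflf r h z0) as [k Hk]; [apply UHP_neq0, DU, Dz0|auto|]. apply (cder_cont _ _ _ Hk). }
    intros e He. destruct (Q e He) as (d & Hd & K). exists d; split; auto. intros w Hw. specialize (K w Hw). rewrite !Cmod_reflf in K. exact K. }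
  assert (hf : hol (fun z => (Cmod (z - z0) < rho)) f) by (intros z Hz; apply (sd_f HS), HL, Hz). destruct (cal _ hphr) as [c1 c2].
  destruct (cal _ hphl) as [c3 c4]. destruct (cal _ hf) as [c5 c6].
  assert (CM : ucont M z0) by (unfold M, m; apply ucont_max; apply (ucont_max _ _ z0); auto). assert (CH : ucont H z0).
  { apply ucont_mult; [apply ucont_mult; auto|].
   - apply ucont_max; auto. apply ucont_max; auto.
   - assert (Q : ucont (fun z => Cmod (Cpow (blist l z) T)) z0) by (apply ucont_Cmod; apply (hol_cont D); auto; apply hol_pow; auto). intros e He.
    destruct (Q e He) as (d & Hd & K). exists d; split; auto. intros w Hw. specialize (K w Hw). rewrite !Cmod_Cpow in K. exact K. }
  assert (H0 : (H z0 <= slit_C1 * Cmod (al z0 * reflf r al z0 * Cpow (blist l z0) T * / RtoC (1 + Cd)))%R).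
  { rewrite Mg, R0, Mal. unfold H. replace (M z0) with (m z0) by (unfold M; rewrite R0; symmetry; apply Rmax_left; lra). rewrite R0.
   rewrite (Rmax_left (Cmod (f z0)) (Cmod (f z0))) by lra. assert (m1 := Rmax_l (Cmod (phr z0)) (Cmod (phl z0))).
   assert (m2 := Rmax_r (Cmod (phr z0)) (Cmod (phl z0))). fold (m z0) in m1, m2.
   (* The jump c f = phl - phr bounds f at [z0] by the two branches. *)
   assert (mp : 0 <= m z0) by (eapply Rle_trans; [apply Cmod_ge_0|apply m1]). assert (KF : kappa * Cmod (f z0) <= 2 * m z0).
   { destruct (HL z0 (HD z0 Dz0)) as (_ & _ & _ & _ & _ & _ & Kc & _). specialize (Kc A0).
    assert (E : c z0 * f z0 = phl z0 - phr z0) by (unfold phl; ring). assert (T1 : Cmod (c z0 * f z0) <= Cmod (phl z0) + Cmod (phr z0)).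
    { rewrite E. eapply Rle_trans; [apply Cmod_triangle|]. rewrite Cmod_opp. lra. }
    rewrite Cmod_mult in T1. nra. }
   assert (QB := Bpow_bounds z0). assert (I := DU z0 Dz0). unfold UHP in I. specialize (QB ltac:(lra)). set (B := (Cmod (blist l z0) ^ T)%R) in *.
   unfold slit_C1. replace ((1 + Cd) * (1 + 2 / kappa) * (m z0 * m z0 * B / (1 + Cd)))%R with (m z0 * ((1 + 2 / kappa) * m z0) * B)%R by (field; lra).
   apply Rmult_le_compat_r; [apply QB|]. apply Rmult_le_compat_l; auto.
   assert (I2 : 0 <= 2 / kappa * m z0) by (apply Rmult_le_pos; auto; left; apply Rdiv_lt_0_compat; lra). apply Rmax_lub; [|lra].
   assert (Cmod (f z0) <= 2 / kappa * m z0); [|lra]. apply (Rmult_le_reg_l kappa); auto.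
   replace (kappa * (2 / kappa * m z0))%R with (2 * m z0)%R by (field; lra). exact KF. }
  intros e He. destruct (CH e He) as (d & Hd & K). exists (Rmin d (rho/2)). split; [apply Rmin_glb_lt; lra|]. intros z _ Hz.
  destruct (Rmin_Rgt_l _ _ _ Hz) as [Z1 Z2]. specialize (K z Z1). apply Rabs_def2 in K. specialize (WH z Z2). lra.
 - intros u Hu. assert (Hc := csq_close z0 (rho/16) u (proj1 Hu)). assert (Du : D u) by (unfold D; lra). split; [auto|]. rewrite Mg.
  assert (U := DU u Du). assert (QB := Bpow_bounds u). unfold UHP in U.
  assert (KEY : Cmod (al u) * Cmod (al (refl r u)) <= (1 + Cd) * (Phi u * Fmax u)).
  { assert (F1 : Cmod (f u) <= Fmax u) by (unfold Fmax; eapply Rle_trans; [|auto]; apply Rmax_l).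
   assert (F2 : Cmod (f (refl r u)) <= Fmax u) by (unfold Fmax; eapply Rle_trans; [|apply Rmax_l]; apply Rmax_r).
   assert (F3 : Phi u <= Fmax u) by (apply Rmax_r). assert (P1 : Pmax u <= Phi u) by (apply Rmax_l).
   assert (P2 : Pmax (refl r u) <= Phi u) by (apply Rmax_r).
   assert (side : forall v, Cmod (v - z0) < rho -> Pmax v <= Phi u -> Cmod (f v) <= Fmax u -> (Cmod v <> r -> ((r < Cmod v) -> Cmod (phr v) <= Phi u /\ Cmod (phl v) <= (1 + Cd) * Fmax u) /\ ((Cmod v < r) -> Cmod (phl v) <= Phi u /\ Cmod (phr v) <= (1 + Cd) * Fmax u))%R).
   { intros v Hv PV FV Nv. destruct (HL v Hv) as (Uv & _ & E0 & _ & _ & Bc & _ & E1 & E2). assert (PE : Pmax v = Cmod (phi v)).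
    { unfold Pmax. destruct (dec (on_arc r b v)) as [[E _]|]; tauto. }
    assert (CF : Cmod (c v * f v) <= Cd * Fmax u).
    { rewrite Cmod_mult. apply Rmult_le_compat; auto using Cmod_ge_0. }
    split; intros L.
    - rewrite (E1 L) in PE. split; [lra|]. eapply Rle_trans; [apply Cmod_triangle|]. lra.
    - rewrite (E2 L) in PE. fold (phl v) in PE. split; [lra|]. replace (phr v) with (phl v - c v * f v) by (unfold phl; ring).
     eapply Rle_trans; [apply Cmod_triangle|]. rewrite Cmod_opp. lra. }
   assert (Nu := UHP_neq0 u (DU u Du)). assert (Pu := Cmod_pos u Nu).
   assert (MR : Cmod (refl r u) = (r * r / Cmod u)%R) by (apply refl_mod; auto; lra).
   assert (MR2 : (Cmod (refl r u) * Cmod u = r * r)%R) by (rewrite MR; field; lra). pose proof (Cmod_ge_0 (al u)).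
   pose proof (Cmod_ge_0 (al (refl r u))). destruct (Rtotal_order (Cmod u) r) as [L|[L|L]].
   - assert (L2 : r < Cmod (refl r u)) by nra. destruct (side u (HD u Du) P1 F1 ltac:(lra)) as [_ S1].
    destruct (side (refl r u) (Dr u Du) P2 F2 ltac:(lra)) as [S2 _]. destruct Eal as [-> | ->].
    + nra.
    + nra.
   - rewrite refl_axis by lra. assert (Aal : Cmod (al u) <= Phi u).
    { destruct (HL u (HD u Du)) as (_ & _ & E0 & _). eapply Rle_trans; [|apply P1]. unfold Pmax.
     destruct (dec (on_arc r b u)) as [|N]; [|exfalso; apply N, E0, L]. destruct Eal as [-> | ->]; [apply Rmax_l|apply Rmax_r]. }
    assert (0 <= Phi u * Fmax u) by nra. nra.
   - assert (L2 : Cmod (refl r u) < r) by nra. destruct (side u (HD u Du) P1 F1 ltac:(lra)) as [S1 _].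
    destruct (side (refl r u) (Dr u Du) P2 F2 ltac:(lra)) as [_ S2]. destruct Eal as [-> | ->].
    + nra.
    + nra. }
  unfold Wmax. set (B := (Cmod (blist l u) ^ T)%R) in *. apply (Rmult_le_reg_r (1 + Cd)); [lra|].
  replace (Cmod (al u) * Cmod (al (refl r u)) * B / (1 + Cd) * (1 + Cd))%R with (Cmod (al u) * Cmod (al (refl r u)) * B)%R by (field; lra). nra.
Qed.

(** Chosen so that K times the squared Cayley gap exceeds ln C1, for the square of half side rho /
    16 about a point with |z0| = r. *)
Definition slit_K : R := ((ln slit_C1 + 1) * ((r + rho + 1) * (r + rho + 1) / (rho / 8)) ^ 2)%R.

Lemma slit_C1_gt : 2 < slit_C1.
Proof. unfold slit_C1. assert (0 < 2 / kappa) by (apply Rdiv_lt_0_compat; lra). nra. Qed.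

Lemma ln_slit_C1 : 0 < ln slit_C1.
Proof. rewrite <- ln_1. apply ln_increasing; [lra|]. assert (H := slit_C1_gt). lra. Qed.

Lemma slit_K_pos : 0 < slit_K.
Proof. assert (H := ln_slit_C1). apply Rmult_lt_0_compat; [lra|]. apply pow_lt. apply Rdiv_lt_0_compat; nra. Qed.

(** Im z / (r^2 + |z|^2) is invariant under the reflection, so this region near the real line and
    infinity is symmetric and both terms of [Phi] are small in it. *)
Lemma Phi_bdry e : 0 < e -> exists d, 0 < d /\
  forall z, UHP z -> ~ on_arc r b z -> Im z < d * (r * r + Cmod z * Cmod z) -> Phi z <= eps0 + e.
Proof.
 intros He. destruct (sd_bdry HS e He) as (d & Hd & K). exists d; split; auto. intros z U N I. assert (Nz := UHP_neq0 z U).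
 assert (P := Cmod_pos z Nz). unfold Phi, Pmax. destruct (dec (on_arc r b z)) as [Q|_]; [tauto|].
 destruct (dec (on_arc r b (refl r z))) as [Q|Nr]; [rewrite arc_refl in Q; tauto|]. apply Rmax_lub; [auto|].
 apply K; auto; [apply UHP_refl; auto; lra|]. rewrite refl_Im, refl_mod by (auto; lra).
 replace (d * (r * r + r * r / Cmod z * (r * r / Cmod z)))%R with (r * r / (Cmod z * Cmod z) * (d * (r * r + Cmod z * Cmod z)))%R by (field; lra).
 apply Rmult_lt_compat_l; auto. apply Rdiv_lt_0_compat; nra.
Qed.

Theorem slit_estimate z : Xdom z -> Wmax z <= 8 * eps0 * exp slit_K.
Proof.
 assert (KP := slit_K_pos).
 assert (small : exists d, 0 < d /\ forall z, Xdom z -> ~ on_arc r b z -> Im z < d * (r * r + Cmod z * Cmod z) -> Wmax z <= 8 * eps0).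
 { destruct (Phi_bdry eps0 ltac:(lra)) as (d & Hd & K). exists d; split; auto. intros u Xu N I.
  eapply Rle_trans; [apply (Phi_small_Wmax u eps0); auto; try lra; apply K; auto; apply Xu|lra]. }
 destruct small as (d & Hd & Sm). apply (master_max_principle Xdom Wmax (8 * eps0) (Cd * Cd) slit_K); auto; try lra.
 - intros u Hu. destruct (Wmax_bounds u Hu). destruct Hu as [Hu _]. unfold UHP in Hu. lra.
 - exists (Rmax r (/ d)). intros u Xu Hu. assert (H1 := Rmax_l r (/ d)). assert (H2 := Rmax_r r (/ d)). apply Sm; auto; [intros [E _]; lra|].
  assert (A := Rabs_Im_le u). assert (A2 := Rle_abs (Im u)). assert (L : 1 < d * Cmod u).
  { apply (Rmult_lt_reg_l (/ d)); [apply Rinv_0_lt_compat; auto|]. rewrite <- Rmult_assoc, Rinv_l by lra. lra. }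
  nra.
 (* Four kinds of limit points: real, close to a removed point, on the arc, and elsewhere in the
    half-plane. *)
 - intros z0 Hz0. destruct (Req_dec (Im z0) 0) as [E|E].
  + left. exists (Rmin b (d * (r * r))). split; [apply Rmin_glb_lt; [lra|apply Rmult_lt_0_compat; nra]|]. intros u Xu Hu.
   destruct (Rmin_Rgt_l _ _ _ Hu) as [U1 U2]. assert (A := Im_close u z0). assert (Wmax u <= 8 * eps0); [|lra]. apply Sm; auto; [intros [_ Q]; lra|].
   nra.
  + assert (U0 : UHP z0) by (unfold UHP; lra). destruct (classic (exists p, In p l /\ Cmod (bl p z0) < 3 * delta)) as [(p & Hp & Hb)|N].
   (* Here the Blaschke power is at most (3 delta)^T, which by [HT] beats the crude bound Cd^2. *)
   * left. assert (CB : ccont (bl p) z0) by (apply (hol_cont _ _ _ (bl_hol p (l_UHP p Hp))); auto).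
    destruct (CB (3 * delta - Cmod (bl p z0))%R) as (d1 & Hd1 & K1); [lra|]. exists d1; split; auto. intros u Xu Hu. specialize (K1 u Hu).
    assert (T1 := Cmod_tri_inv (bl p u) (bl p z0)). assert (I : UHP u) by apply Xu. unfold UHP in I. assert (L1 := blist_le l p u l_UHP ltac:(lra) Hp).
    assert (Phu := Phi_crude u Xu). assert (Fu := Fmax_crude u Xu). pose proof (Phi_nonneg u). pose proof (Fmax_nonneg u).
    assert (Wmax u <= Cd * Cd * (3 * delta) ^ T); [|lra]. apply Rmult_le_compat; [nra|apply pow_le, Cmod_ge_0|nra|]. apply pow_incr.
    split; [apply Cmod_ge_0|lra].
   * assert (F : far l (2 * delta) z0).
    { intros p Hp. apply Rnot_lt_le. intros L. apply N. exists p; split; auto. lra. }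
    right. destruct (classic (on_arc r b z0)) as [A0|N0].
    -- destruct (local_on_arc z0 A0 F) as (D & g & G1 & G2 & G3 & G4). exists (rho/16)%R, (ln slit_C1), D, g. split; [lra|]. split; [auto|].
     split; [auto|]. split; [|split; [auto|]].
     ++ rewrite exp_ln by (assert (H := slit_C1_gt); lra). auto.
     ++ destruct A0 as [A0 _]. rewrite A0. assert (LP := ln_slit_C1). unfold slit_K. set (Q := ((r + rho + 1) * (r + rho + 1) / (rho / 8))%R).
      set (Q2 := (2 * (rho / 16) / ((r + 2 * (rho / 16) + 1) * (r + 2 * (rho / 16) + 1)))%R). assert (QQ : 1 <= Q * Q2).
      { unfold Q, Q2. apply (Rmult_le_reg_r ((r + 2 * (rho / 16) + 1) * (r + 2 * (rho / 16) + 1))); [nra|].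
       replace ((r + rho + 1) * (r + rho + 1) / (rho / 8) * (2 * (rho / 16) / ((r + 2 * (rho / 16) + 1) * (r + 2 * (rho / 16) + 1))) * ((r + 2 * (rho / 16) + 1) * (r + 2 * (rho / 16) + 1)))%R with ((r + rho + 1) * (r + rho + 1))%R by (field; lra).
       nra. }
      assert (QQ2 : 1 <= Q ^ 2 * Q2 ^ 2) by nra. nra.
    -- destruct (local_off_arc z0 U0 N0) as (s & D & g & G0 & G1 & G2 & G3 & G4).
     { intros p Hp. specialize (F p Hp). lra. }
     exists s, 0%R, D, g. rewrite exp_0. split; [auto|]. split; [auto|]. split; [auto|]. split; [auto|]. split; [auto|]. apply Rmult_lt_0_compat; auto.
     apply pow_lt. pose proof (Cmod_ge_0 z0). apply Rdiv_lt_0_compat; nra.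
Qed.

(** On the arc [Phi] is at least kappa |f| / 2 by the jump, and [Fmax] is at least |f|, so [Wmax]
    controls |f|^2. *)
Theorem slit_bound z : on_arc r b z -> far l (2 * delta) z ->
  (Cmod (f z) * Cmod (f z) * Cmod (blist l z) ^ T <= 16 / kappa * exp slit_K * eps0).
Proof.
 intros A F. destruct (sd_loc HS z A F z) as (U & Fz & _ & _ & _ & _ & Kc & _).
 { rewrite Cmod_sub_diag; lra. }
 specialize (Kc A). assert (W := slit_estimate z (conj U Fz)). assert (QB := Bpow_bounds z). unfold UHP in U. specialize (QB ltac:(lra)).
 assert (F1 : Cmod (f z) <= Fmax z) by (unfold Fmax; eapply Rle_trans; [|auto]; apply Rmax_l). assert (P1 : kappa * Cmod (f z) <= 2 * Phi z).
 { assert (P1 : Pmax z <= Phi z) by (apply Rmax_l). unfold Pmax in P1. destruct (dec (on_arc r b z)) as [_|]; [|tauto].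
  assert (m1 := Rmax_l (Cmod (phr z)) (Cmod (phl z))). assert (m2 := Rmax_r (Cmod (phr z)) (Cmod (phl z))).
  assert (E : c z * f z = phl z - phr z) by (unfold phl; ring). assert (T1 : Cmod (c z * f z) <= Cmod (phl z) + Cmod (phr z)).
  { rewrite E. eapply Rle_trans; [apply Cmod_triangle|]. rewrite Cmod_opp. lra. }
  rewrite Cmod_mult in T1. pose proof (Cmod_ge_0 (f z)). nra. }
 pose proof (Cmod_ge_0 (f z)). pose proof (Phi_nonneg z). set (B := (Cmod (blist l z) ^ T)%R) in *. apply (Rmult_le_reg_l (kappa / 2)); [lra|].
 replace (kappa / 2 * (16 / kappa * exp slit_K * eps0))%R with (8 * eps0 * exp slit_K)%R by (field; lra). eapply Rle_trans; [|apply W].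
 replace (kappa / 2 * (Cmod (f z) * Cmod (f z) * B))%R with ((kappa * Cmod (f z) / 2) * Cmod (f z) * B)%R by field.
 apply Rmult_le_compat_r; [apply QB|]. nra.
Qed.

End Slit.

(** * From the arc to the ends of the chord *)

Lemma exp_le x y : x <= y -> exp x <= exp y.
Proof. intros [H| ->]; [left; apply exp_increasing; auto|lra]. Qed.

Lemma complex_sqrt (t : C) : exists w : C, w * w = t /\ 0 <= Im w.
Proof.
 destruct t as [x y]. set (m := Cmod (x, y)). assert (Hm : (m * m = x * x + y * y)%R) by (unfold m; rewrite Cmod_sqr; reflexivity).
 assert (Hx := Rabs_Re_le (x, y)). fold m in Hx. simpl in Hx. assert (X1 := Rle_abs x). assert (X2 := Rle_abs (- x)). rewrite Rabs_Ropp in X2.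
 set (u := sqrt ((m + x) / 2)). set (v := sqrt ((m - x) / 2)). assert (U : (u * u = (m + x) / 2)%R) by (apply sqrt_sqrt; lra).
 assert (V : (v * v = (m - x) / 2)%R) by (apply sqrt_sqrt; lra). assert (Pu : 0 <= u) by apply sqrt_pos.
 assert (Pv : 0 <= v) by apply sqrt_pos. assert (UV : (2 * (u * v) = Rabs y)%R).
 { apply Rsqr_inj; [nra|apply Rabs_pos|]. rewrite <- Rsqr_abs. unfold Rsqr. nra. }
 destruct (Rle_dec 0 y) as [Y|Y].
 - exists (u, v). rewrite Rabs_pos_eq in UV by auto. split; [|auto]. unfold Cmult; simpl. f_equal; lra.
 - exists (- u, v)%R. rewrite Rabs_left in UV by lra. split; [|auto]. unfold Cmult; simpl. f_equal; lra.
Qed.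

(* [v -> i (al + sg v^2)] opens the slit; on the half disc [|v| <= R0] the harmonic function
   [h v = 4 Im v / R0 + Re (v^2) / R0^2] is nonnegative on the diameter and at least 1 on the half circle. *)
Theorem two_constants (al sg R0 L : R) (f : C -> C) : 0 < R0 -> R0 * R0 < al -> (sg = 1 \/ sg = -1)%R -> 0 <= L ->
  hol UHP f -> (forall z, UHP z -> Cmod (f z) <= 1) ->
  (forall s, 0 <= s <= R0 * R0 -> (Cmod (f (Ci * RtoC (al + sg * s))%C) <= exp (- L))%R) ->
  forall xi q, 0 <= q < R0 -> Cmod (xi - Ci * RtoC al) = (q * q)%R -> Cmod (f xi) <= exp (- (L * (1 - 5 * q / R0))).
Proof.
 intros HR Hal Hsg HL Hf B1 Bs xi q Hq Eq. set (psi := fun v : C => Ci * (RtoC al + RtoC sg * (v * v))).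
 set (h := fun v : C => ((4 * Im v * R0 + Re (v * v)) / (R0 * R0))%R).
 (* |g| is |f| at [psi v] times exp (L (1 - h v)): at most 1 on the diameter, where |f| <= exp (-
    L), and on the half circle, where h >= 1. *)
 set (g := fun v => f (psi v) * Cexp (RtoC L * (1 + RtoC (4 / R0) * Ci * v - RtoC (/ (R0 * R0)) * (v * v)))).
 assert (Mg : forall v, Cmod (g v) = (Cmod (f (psi v)) * exp (L * (1 - h v)))%R).
 { intros [x y]. unfold g. rewrite Cmod_mult, Cmod_Cexp. f_equal. f_equal. unfold h, Re, Im, Ci, Cplus, Cminus, Copp, Cmult, RtoC; simpl. field. lra. }
 assert (Upsi : forall v, Cmod v <= R0 -> UHP (psi v)).
 { intros v Hv. unfold UHP. assert (S := Cmod_sqr v). pose proof (Cmod_ge_0 v).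
  replace (Im (psi v)) with (al + sg * (Re v * Re v - Im v * Im v))%R by (unfold psi; destruct v; unfold Re, Im, Ci, Cplus, Cmult, RtoC; simpl; ring).
  nra. }
 set (D := fun v => UHP (psi v)). assert (Hg : hol D g).
 { assert (sq : forall E : C -> Prop, hol E (fun v => v * v)) by (intros E; apply hol_mult; apply hol_id). apply hol_mult.
  - apply (hol_comp D UHP); auto. apply hol_mult; [apply hol_const|]. apply hol_plus; [apply hol_const|]. apply hol_mult; [apply hol_const|auto].
  - apply hol_Cexp, hol_mult; [apply hol_const|]. apply hol_minus; [|apply hol_mult; [apply hol_const|auto]]. apply hol_plus; [apply hol_const|].
   apply hol_mult; [apply hol_const|apply hol_id]. }
 assert (hsq : forall v, (h v * (R0 * R0) = 4 * Im v * R0 + (Re v * Re v - Im v * Im v))%R).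
 { intros [x y]. unfold h, Re, Im, Cmult; simpl. field. lra. }
 set (X := fun v => UHP v /\ Cmod v < R0).
 assert (hX : forall v, 0 <= Im v -> Cmod v <= R0 -> 0 <= h v /\ (Cmod v = R0 -> 1 <= h v)%R).
 { intros v Iv Hv. assert (S := Cmod_sqr v). assert (K := hsq v). assert (PR : 0 < R0 * R0) by nra.
  assert (Y : Im v <= R0) by (eapply Rle_trans; [apply Rle_abs|eapply Rle_trans; [apply Rabs_Im_le|auto]]). nra. }
 assert (E1 : forall v, 0 <= h v -> exp (L * (1 - h v)) <= exp L) by (intros v Hv; apply exp_le; nra).
 assert (MP : forall u, X u -> Cmod (g u) <= 1).
 { apply (max_principle X D g 1 (exp L)); auto; [lra| | |].
  - intros v [Uv Rv]. unfold UHP in Uv. split; [lra|]. rewrite Mg, <- (Rmult_1_l (exp L)).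
   apply Rmult_le_compat; [apply Cmod_ge_0|left; apply exp_pos|apply B1, Upsi; lra|apply E1, hX; lra].
  - exists R0. intros v [_ Rv] Q. lra.
  - intros z0 Hz0. destruct (Rlt_dec R0 (Cmod z0)) as [G|G].
   { left. exists (Cmod z0 - R0)%R. split; [lra|]. intros v [_ Rv] Dv. assert (T := Cmod_tri_inv z0 v). rewrite Cmod_sub_sym in T. lra. }
   apply Rnot_lt_le in G. destruct (hX z0 Hz0 G) as [h0 h1]. destruct (classic (X z0)) as [[U0 G0]|NX].
   + right. unfold UHP in U0. set (s := (Rmin (R0 - Cmod z0) (Im z0) / 4)%R).
    assert (Ps : 0 < Rmin (R0 - Cmod z0) (Im z0)) by (apply Rmin_glb_lt; lra). assert (s1 := Rmin_l (R0 - Cmod z0) (Im z0)).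
    assert (s2 := Rmin_r (R0 - Cmod z0) (Im z0)). exists s. split; [unfold s; lra|]. intros u Hu. apply csq_close in Hu. unfold s in Hu.
    assert (T := Cmod_tri_inv u z0). assert (A := Im_close u z0). split; [apply Upsi; lra|split; [unfold UHP; lra|lra]].
   + left. intros e He. destruct (hol_cont D g z0 Hg (Upsi z0 G) e He) as (d & Hd & K). exists d; split; auto. intros v _ Dv. specialize (K v Dv).
    assert (T := Cmod_tri_inv (g v) (g z0)). assert (Cmod (g z0) <= 1); [|lra]. rewrite Mg. destruct (Req_dec (Im z0) 0) as [I0|I0].
    * apply Rle_trans with (exp (- L) * exp L)%R; [|right; rewrite <- exp_plus, <- exp_0; f_equal; ring].
     apply Rmult_le_compat; [apply Cmod_ge_0|left; apply exp_pos| |auto]. assert (S := Cmod_sqr z0). pose proof (Cmod_ge_0 z0).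
     replace (psi z0) with (Ci * RtoC (al + sg * (Re z0 * Re z0))); [apply Bs; nra|]. unfold psi. destruct z0 as [x y]. simpl in I0. subst.
     unfold Re, Ci, Cplus, Cmult, RtoC; simpl. f_equal; ring.
    * assert (Er : Cmod z0 = R0) by (destruct (Rle_lt_or_eq_dec _ _ G) as [Q|Q]; auto; exfalso; apply NX; split; [unfold UHP; lra|auto]).
     rewrite <- (Rmult_1_r 1). apply Rmult_le_compat; [apply Cmod_ge_0|left; apply exp_pos|auto|].
     apply Rle_trans with (exp 0); [apply exp_le; nra|rewrite exp_0; lra]. }
 (* The root with nonnegative imaginary part is the preimage of [xi] in the closed half disc. *)
 destruct (complex_sqrt ((xi - Ci * RtoC al) / (Ci * RtoC sg))) as (v & Ev & Iv). assert (Nsg : Ci * RtoC sg <> 0).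
 { intros Q. apply (f_equal Cmod) in Q. rewrite Cmod_mult, Cmod_Ci, Cmod_R, Cmod_0 in Q.
  destruct Hsg as [-> | ->]; [rewrite Rabs_pos_eq in Q|rewrite Rabs_left in Q]; lra. }
 assert (Epsi : psi v = xi) by (unfold psi; rewrite Ev, Cmult_plus_distr_l, Cmult_assoc; set (k := Ci * RtoC sg) in *; field; auto).
 assert (Mv : Cmod v = q).
 { apply Rsqr_inj; [apply Cmod_ge_0|lra|]. unfold Rsqr. rewrite <- Cmod_mult, Ev, Cmod_div, Eq, Cmod_mult, Cmod_Ci, Cmod_R by auto.
  destruct Hsg as [-> | ->]; [rewrite Rabs_pos_eq by lra|rewrite Rabs_left by lra]; field. }
 destruct (Req_dec (Im v) 0) as [I0|I0].
 - rewrite <- Epsi. assert (S := Cmod_sqr v). replace (psi v) with (Ci * RtoC (al + sg * (Re v * Re v))).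
  + eapply Rle_trans; [apply Bs; nra|]. apply exp_le. assert (0 <= 5 * q / R0) by (apply Rdiv_le_0_compat; lra). nra.
  + unfold psi. destruct v as [x y]. simpl in I0. subst. unfold Re, Ci, Cplus, Cmult, RtoC; simpl. f_equal; ring.
 - assert (MPv := MP v). rewrite Mg, Epsi in MPv. specialize (MPv ltac:(split; [unfold UHP|]; lra)). assert (hq : h v <= 5 * q / R0).
  { apply (Rmult_le_reg_r (R0 * R0)); [nra|]. rewrite hsq. replace (5 * q / R0 * (R0 * R0))%R with (5 * q * R0)%R by (field; lra).
   assert (S := Cmod_sqr v). assert (Y : Im v <= q) by nra. nra. }
  rewrite exp_Ropp. apply (Rmult_le_reg_r (exp (L * (1 - h v)))); [apply exp_pos|]. eapply Rle_trans; [apply MPv|].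
  rewrite <- exp_Ropp, <- exp_plus, <- exp_0. apply exp_le. nra.
Qed.

(** * Zeros of holomorphic functions along a path *)

Definition cball (p : C) (d : R) (z : C) : Prop := (Cmod (z - p) < d).

Lemma cball_center p d : 0 < d -> cball p d p.
Proof. intros H. unfold cball. rewrite Cmod_sub_diag; auto. Qed.

Definition zero_near (g : C -> C) (p : C) : Prop := exists d, 0 < d /\ forall w, cball p d w -> g w = 0.

(** The k-fold quotient is bounded by M / (3 s / 8)^k on a square about w whose boundary keeps
    distance 3 s / 8 from p. As |w - p| < s / 8, this gives |g w| <= M (1/3)^k for every k. *)
Lemma divided_zero g D p : openC D -> hol D g -> D p ->
  (forall k, exists h, hol D h /\ forall z, D z -> g z = Cpow (z - p) k * h z) -> zero_near g p.
Proof.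
 intros HD Hg Hp H. destruct (open_csq D p HD Hp) as (s & Hs & K). destruct (cont_rect_bounded g (Re p - s) (Im p - s) (2*s) (2*s)) as (M & HM & BM).
 { intros z Hz. apply (hol_cont D); auto. }
 exists (s/8)%R. split; [lra|]. intros w Hw. unfold cball in Hw. apply Cmod_eq_0. assert (In : forall z, csq w (s/2) z -> csq p s z).
 { intros z Hz. assert (A1 := Re_close w p). assert (A2 := Im_close w p). unfold csq, crect in *. lra. }
 assert (Dw : D w) by (apply K, In; unfold csq, crect; lra). assert (Le : forall k, Cmod (g w) <= M * (1/3) ^ k).
 { intros k. destruct (H k) as (h & Hh & Eh). assert (Sk : 0 < (3 * s / 8) ^ k) by (apply pow_lt; lra).
  assert (HB : Cmod (h w) <= M / (3 * s / 8) ^ k).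
  { apply (max_modulus_square D h w (s/2)); auto; [lra|]. intros z Hz. assert (Hz2 := In z (proj1 Hz)). specialize (BM z Hz2).
   rewrite Eh, Cmod_mult, Cmod_Cpow in BM by auto. assert (P := bsq_far w (s/2) z Hz). assert (T1 := Cmod_tri3 z p w).
   rewrite (Cmod_sub_sym p w) in T1. assert (Q : (3 * s / 8) ^ k <= Cmod (z - p) ^ k) by (apply pow_incr; lra).
   apply (Rmult_le_reg_l ((3 * s / 8) ^ k)); auto. replace ((3 * s / 8) ^ k * (M / (3 * s / 8) ^ k))%R with M by (field; lra). nra. }
  rewrite Eh, Cmod_mult, Cmod_Cpow by auto. apply Rle_trans with ((s/8) ^ k * (M / (3 * s / 8) ^ k))%R.
  - apply Rmult_le_compat; auto using Cmod_ge_0; [apply pow_le, Cmod_ge_0|]. apply pow_incr. split; [apply Cmod_ge_0|lra].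
  - replace (s/8)%R with ((3 * s / 8) * (1/3))%R by field. rewrite Rpow_mult_distr. right. field. lra. }
 apply Rle_antisym; [|apply Cmod_ge_0]. apply le_epsilon. intros e He.
 destruct (pow_lt_1_zero (1/3) ltac:(rewrite Rabs_pos_eq; lra) (e / (M + 1))%R) as (k & Hk); [apply Rdiv_lt_0_compat; lra|].
 specialize (Hk k (le_n _)). specialize (Le k). assert (P : 0 < (1/3) ^ k) by (apply pow_lt; lra). rewrite Rabs_pos_eq in Hk by lra.
 assert (Q : M * (1/3)^k <= (M + 1) * (e / (M + 1))) by nra. replace ((M + 1) * (e / (M + 1)))%R with e in Q by (field; lra). lra.
Qed.

(** Dividing by z - p as long as the quotient vanishes at p must come to an end, by
    [divided_zero]. *)
Lemma zero_order g D p : openC D -> hol D g -> D p -> ~ zero_near g p ->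
  exists k h d, 0 < d /\ hol D h /\ (forall z, D z -> g z = Cpow (z - p) k * h z) /\
    (forall z, cball p d z -> D z /\ d <= Cmod (h z)).
Proof.
 intros HD Hg Hp N. assert (Q : exists k h, hol D h /\ (forall z, D z -> g z = Cpow (z - p) k * h z) /\ h p <> 0).
 { apply NNPP. intros NQ. apply N. apply (divided_zero g D); auto. induction k as [|k (h & Hh & Eh)].
  - exists g. split; auto. intros z _. ring.
  - destruct (removable_quotient D h p HD Hh Hp) as (h1 & Hh1 & E1). assert (h p = 0) by (apply NNPP; intros Z; apply NQ; exists k, h; auto).
   exists h1. split; auto. intros z Hz. rewrite Eh by auto. simpl. destruct (classic (z = p)) as [->|Nz]; [rewrite H; ring|]. rewrite E1, H by auto.
   field. apply csub_neq; auto. }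
 destruct Q as (k & h & Hh & Eh & Nh). apply Cmod_gt_0 in Nh. destruct (HD p Hp) as (d1 & Hd1 & K1).
 destruct (hol_cont D h p Hh Hp (Cmod (h p) / 2)%R) as (d2 & Hd2 & K2); [lra|]. exists k, h, (Rmin (Rmin d1 d2) (Cmod (h p) / 2)).
 split; [repeat apply Rmin_glb_lt; lra|]. split; auto. split; auto. intros z Hz. unfold cball in Hz.
 assert (M1 := Rmin_l (Rmin d1 d2) (Cmod (h p) / 2)). assert (M2 := Rmin_r (Rmin d1 d2) (Cmod (h p) / 2)). assert (M3 := Rmin_l d1 d2).
 assert (M4 := Rmin_r d1 d2). split; [apply K1; lra|]. specialize (K2 z ltac:(lra)). assert (T := Cmod_tri_inv (h p) (h z)). rewrite Cmod_sub_sym in T.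
 lra.
Qed.

Lemma zero_isolated g D p : openC D -> hol D g -> D p ->
  zero_near g p \/ exists d, 0 < d /\ forall z, cball p d z -> z <> p -> g z <> 0.
Proof.
 intros HD Hg Hp. destruct (classic (zero_near g p)) as [|N]; [auto|right]. destruct (zero_order g D p HD Hg Hp N) as (k & h & d & Hd & Hh & Eh & Bh).
 exists d; split; auto. intros z Hz Nz E. destruct (Bh z Hz) as [Dz B]. apply (f_equal Cmod) in E.
 rewrite Eh, Cmod_mult, Cmod_Cpow, Cmod_0 in E by auto. assert (P : 0 < Cmod (z - p) ^ k) by (apply pow_lt, Cmod_gt_0, csub_neq; auto). nra.
Qed.

(** Connectedness of the interval, in a form that serves both the identity theorem and the
    finiteness of zeros. *)
Lemma locally_constant_interval (P : R -> Prop) a b : a <= b ->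
  (forall t, a <= t <= b -> exists d, 0 < d /\ forall s s', a <= s <= b -> a <= s' <= b -> Rabs (s - t) < d -> Rabs (s' - t) < d -> P s -> P s') ->
  P a -> P b.
Proof.
 intros Hab L Pa. set (E := fun t => (a <= t <= b) /\ P t). assert (Ea : E a) by (split; [lra|auto]). destruct (completeness E) as (m & U & Lm).
 { exists b. intros t [Ht _]. lra. }
 { exists a; auto. }
 assert (Hm : a <= m <= b) by (split; [apply U; auto|apply Lm; intros t [Ht _]; lra]). destruct (L m Hm) as (d & Hd & K).
 assert (Q : exists t, E t /\ m - d < t).
 { apply NNPP. intros N. assert (m <= m - d); [|lra]. apply Lm. intros t Et. apply Rnot_lt_le. intros Q. apply N. exists t; auto. }
 destruct Q as (t & Et & Lt). assert (Ut := U t Et). destruct Et as [It Pt]. destruct (Rle_dec b (m + d/2)) as [B|B].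
 - apply (K t b); auto; try lra; apply Rabs_def1; lra.
 - assert (Em : E (m + d/2)%R); [|specialize (U _ Em); lra]. split; [lra|]. apply (K t); auto; try lra; apply Rabs_def1; lra.
Qed.

(** The identity theorem along a path: where zeros are isolated, vanishing near [c s] would reduce a
    disc about [c s] to a single point. *)
Lemma zero_near_path g D (c : R -> C) a b : openC D -> hol D g -> a <= b -> rcont_on c a b ->
  (forall t, a <= t <= b -> D (c t)) -> zero_near g (c a) -> zero_near g (c b).
Proof.
 intros HD Hg Hab Hc Dc. apply (locally_constant_interval (fun t => zero_near g (c t)) a b Hab). intros t Ht.
 destruct (zero_isolated g D (c t) HD Hg (Dc t Ht)) as [(d & Hd & K)|(d & Hd & K)].
 - destruct (Hc t Ht (d/2)%R) as (e & He & Ke); [lra|]. exists e; split; auto. intros s s' Hs Hs' _ Ls' _. exists (d/2)%R. split; [lra|]. intros w Hw.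
  apply K. unfold cball in *. specialize (Ke s' Ls'). assert (T := Cmod_tri3 w (c s') (c t)). lra.
 - destruct (Hc t Ht (d/2)%R) as (e & He & Ke); [lra|]. exists e; split; auto. intros s s' Hs Hs' Ls _ (d' & Hd' & K'). specialize (Ke s Ls).
  set (m := Rmin (d/2) d'). assert (Hm : 0 < m) by (apply Rmin_glb_lt; lra). assert (m1 : m <= d/2) by apply Rmin_l.
  assert (m2 : m <= d') by apply Rmin_r. assert (Z : forall w, Cmod (w - c s) < m -> w = c t).
  { intros w Hw. apply NNPP. intros Nw. apply (K w); auto; [unfold cball; assert (T := Cmod_tri3 w (c s) (c t)); lra|]. apply K'. unfold cball. lra. }
  assert (Z1 := Z (c s) ltac:(replace (c s - c s) with (RtoC 0) by ring; rewrite Cmod_0; auto)).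
  assert (M2 : Cmod (c s + RtoC (m/2) - c s) = (m/2)%R) by (replace (c s + RtoC (m/2) - c s) with (RtoC (m/2)) by ring; rewrite Cmod_R, Rabs_pos_eq; lra).
  assert (Z2 := Z (c s + RtoC (m/2)) ltac:(rewrite M2; lra)). rewrite Z2, Z1 in M2. replace (c t - c t) with (RtoC 0) in M2 by ring.
  rewrite Cmod_0 in M2. lra.
Qed.

(** Finiteness of the zeros met up to a parameter propagates, because each point of the path has a
    neighbourhood with at most one zero, its centre. *)
Lemma finite_zeros_path g D (c : R -> C) a b : openC D -> hol D g -> a <= b -> rcont_on c a b ->
  (forall t, a <= t <= b -> D (c t)) -> ~ zero_near g (c b) ->
  exists l, forall t, a <= t <= b -> g (c t) = 0 -> In (c t) l.
Proof.
 intros HD Hg Hab Hc Dc N. assert (NZ : forall t, a <= t <= b -> ~ zero_near g (c t)).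
 { intros t Ht Z. apply N. apply (zero_near_path g D c t b); auto; try lra; intros s Hs; [apply Hc|apply Dc]; lra. }
 apply (locally_constant_interval (fun m => exists l, forall t, a <= t <= m -> g (c t) = 0 -> In (c t) l) a b Hab).
 - intros m Hm. destruct (zero_isolated g D (c m) HD Hg (Dc m Hm)) as [Z|(d & Hd & K)]; [destruct (NZ m Hm Z)|].
  destruct (Hc m Hm d Hd) as (e & He & Ke). exists e; split; auto. intros s s' Hs Hs' Ls Ls' (l & Hl). exists (c m :: l). intros t Ht Zt.
  destruct (Rle_dec t s) as [Q|Q]; [right; apply Hl; auto; lra|left]. apply NNPP. intros Nt. apply (K (c t)); auto. apply Ke. apply Rabs_def2 in Ls.
  apply Rabs_def2 in Ls'. apply Rabs_def1; lra.
 - exists (c a :: nil). left. f_equal. lra.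
Qed.

(** * The chord integral and its continuation through the chord *)

Definition kerint (k g : R -> C) (u v : R) (z : C) : C := CI (fun s => k s / (g s - z)) u v.

Lemma kerint_rcont k g u v z : rcont_on k u v -> rcont_on g u v -> (forall s, u <= s <= v -> g s <> z) ->
  rcont_on (fun s => k s / (g s - z)) u v.
Proof. intros Hk Hg N s Hs. apply rcont_mult; [auto|]. apply rcont_inv; [apply rcont_minus; [auto|apply rcont_const]|]. apply csub_neq; auto. Qed.

Lemma kerint_cont k g u v z : u <= v -> rcont_on k u v -> rcont_on g u v -> (forall s, u <= s <= v -> g s <> z) -> ccont (kerint k g u v) z.
Proof. intros Huv Hk Hg N. destruct (CI_kernel_der k g u v z Huv Hk Hg N) as [A _]. apply (cder_cont _ _ _ A). Qed.

Lemma kerint_bound k g u v z M d : u <= v -> rcont_on k u v -> rcont_on g u v -> 0 < d ->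
  (forall s, u <= s <= v -> Cmod (k s) <= M /\ d <= Cmod (g s - z)) -> Cmod (kerint k g u v z) <= (v - u) * (M / d).
Proof.
 intros Huv Hk Hg Hd H. assert (N : forall s, u <= s <= v -> g s - z <> 0).
 { intros s Hs E. destruct (H s Hs) as [_ Q]. rewrite E, Cmod_0 in Q. lra. }
 apply CI_bound; auto.
 - apply kerint_rcont; auto. intros s Hs E. apply (N s Hs). rewrite E. ring.
 - intros s Hs. destruct (H s Hs) as [A B]. rewrite Cmod_div by auto. apply Rmult_le_compat; auto using Cmod_ge_0.
  + left; apply Rinv_0_lt_compat; lra.
  + apply Rinv_le_contravar; auto.
Qed.

Section Chord.

Variables (a b r M : R) (V : C -> Prop) (F : C -> C).
Hypothesis Ha : 0 < a.
Hypothesis Hb : 0 < b.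
Hypothesis Hr : 0 < r.
Hypothesis Hrr : (r * r = a * a + b * b)%R.
Hypothesis HF : hol V F.

Definition cap (z : C) : Prop := (b <= Im z) /\ Cmod z <= r.

Hypothesis HcapV : forall z, cap z -> V z.
Hypothesis HM : forall z, cap z -> Cmod (F z) <= M.

Lemma capI x y : b <= y -> x * x + y * y <= r * r -> cap (x, y).
Proof. intros H1 H2. split; [exact H1|]. apply Rsqr_incr_0_var; [|lra]. unfold Rsqr. rewrite Cmod_sqr. exact H2. Qed.

Lemma chord_cap s : - a <= s <= a -> cap (s, b).
Proof. intros H. apply capI; nra. Qed.

Definition chint (z : C) : C := CI (fun s => F (s, b) / (z - (s, b))) (- a) a.

Lemma chord_rcont : rcont_on (fun s => F (s, b)) (- a) a.
Proof. intros s Hs. apply (rcont_comp F (fun s => (s, b))); [apply rcont_pt|]. apply (hol_cont V); auto. apply HcapV, chord_cap; auto. Qed.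

Lemma chint_kerint z : ~ eta1 a b z -> chint z = - kerint (fun s => F (s, b)) (fun s => (s, b)) (- a) a z.
Proof.
 intros N. assert (NE := fun s Hs => csub_neq _ _ (neq_eta1 a b z s Ha N Hs)).
 replace (- kerint (fun s => F (s, b)) (fun s => (s, b)) (- a) a z) with ((- (1)) * kerint (fun s => F (s, b)) (fun s => (s, b)) (- a) a z) by ring.
 unfold kerint. rewrite <- CI_scal; [|lra|].
 - apply CI_ext; [lra|]. intros s Hs. assert (N1 := NE s ltac:(lra)).
  assert (N2 : z - (s, b) <> 0) by (intros E; apply N1; replace ((s, b) - z) with (- (z - (s, b))) by ring; rewrite E; ring). field. auto.
 - apply kerint_rcont; [apply chord_rcont|intros s _; apply rcont_pt|intros s Hs; apply (neq_eta1 a); auto].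
Qed.

Lemma chint_hol : hol (fun z => ~ eta1 a b z) chint.
Proof. apply (cauchy_integral_hol a b (fun s => F (s, b))); auto. apply chord_rcont. Qed.

Lemma chint_bound z d : 0 < d -> (forall s, - a <= s <= a -> d <= Cmod (z - (s, b))) -> Cmod (chint z) <= 2 * a * (M / d).
Proof.
 intros Hd H. rewrite chint_kerint.
 - rewrite Cmod_opp. replace (2 * a)%R with (a - - a)%R by ring. apply kerint_bound; try lra; [apply chord_rcont|intros s _; apply rcont_pt|].
  split; [apply HM, chord_cap; auto|]. rewrite Cmod_sub_sym. auto.
 - rewrite eta1_iff by auto. intros [E1 E2]. specialize (H (Re z) E2). replace (Re z, b) with z in H.
  + rewrite Cmod_sub_diag in H. lra.
  + destruct z as [x y]; simpl in *. subst; auto.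
Qed.

(* The chord integral with the piece [s0 - w, s0 + w] of the chord replaced by the other three sides of the square above it. *)
Definition detour (s0 w : R) (z : C) : C :=
  - kerint (fun s => F (s, b)) (fun s => (s, b)) (- a) (s0 - w) z
  - kerint (fun s => F (s, b)) (fun s => (s, b)) (s0 + w) a z
  + (Ci * kerint (fun t => F ((s0 - w + 2 * w)%R, (b + t)%R)) (fun t => ((s0 - w + 2 * w)%R, (b + t)%R)) 0 (2 * w) z
     - kerint (fun t => F ((s0 - w + t)%R, (b + 2 * w)%R)) (fun t => ((s0 - w + t)%R, (b + 2 * w)%R)) 0 (2 * w) z
     - Ci * kerint (fun t => F ((s0 - w)%R, (b + t)%R)) (fun t => ((s0 - w)%R, (b + t)%R)) 0 (2 * w) z).

Section Square.
Variables (s0 w : R).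
Hypothesis Hw : 0 < w.
Hypothesis Hl : - a <= s0 - w.
Hypothesis Hrt : s0 + w <= a.
Hypothesis Hsq : forall z, crect (s0 - w) b (2 * w) (2 * w) z -> Cmod z < r.

Lemma sq_cap z : crect (s0 - w) b (2 * w) (2 * w) z -> cap z.
Proof. split; [unfold crect in H; lra|]. left; auto. Qed.

Lemma sq_cont z : crect (s0 - w) b (2 * w) (2 * w) z -> ccont F z.
Proof. intros H. apply (hol_cont V); auto. apply HcapV, sq_cap, H. Qed.

Lemma detour_RI z : ~ eta1 a b z -> detour s0 w z = chint z + RI (fun l => F l / (l - z)) (s0 - w) b (2 * w) (2 * w).
Proof.
 intros N. rewrite chint_kerint by auto. unfold detour, RI, kerint.
 assert (R := kerint_rcont (fun s => F (s, b)) (fun s => (s, b)) (- a) a z chord_rcont (fun s _ => rcont_pt b s) (fun s Hs => neq_eta1 a b z s Ha N Hs)).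
 rewrite <- (CI_chasles _ (- a) (s0 - w) a) by (auto; lra). rewrite <- (CI_chasles _ (s0 - w) (s0 + w) a) by (try lra; intros s Hs; apply R; lra).
 replace (CI (fun s => F (s, b) / ((s, b) - z)) (s0 - w) (s0 + w)) with (CI (fun t => F ((s0 - w + t)%R, b) / (((s0 - w + t)%R, b) - z)) 0 (2 * w)).
 - ring.
 - assert (S := CI_shift (fun s => F (s, b) / ((s, b) - z)) 0 (2 * w) (s0 - w) ltac:(lra)). replace (0 + (s0 - w))%R with (s0 - w)%R in S by ring.
  replace (2 * w + (s0 - w))%R with (s0 + w)%R in S by ring. rewrite <- S by (intros s Hs; apply R; lra). apply CI_ext; [lra|]. intros t Ht.
  rewrite (Rplus_comm (s0 - w) t). reflexivity.
Qed.

Lemma detour_out z : ~ eta1 a b z -> ~ crect (s0 - w) b (2 * w) (2 * w) z -> detour s0 w z = chint z.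
Proof.
 intros N O. rewrite detour_RI, goursat; auto; try lra; [ring|]. intros l Hl'. assert (NE : l - z <> 0) by (apply csub_neq; intros ->; auto).
 destruct (HF l (HcapV l (sq_cap l Hl'))) as [m Hm].
 apply (cder_div F (fun l => l - z) l m (1 - 0)); [exact Hm|apply cder_minus; [apply cder_id|apply cder_const]|auto].
Qed.

(** The boundary integral of the square now encircles z and contributes twopii F z, which is the
    jump of the chord integral across the chord. *)
Lemma detour_in z : ~ eta1 a b z -> orect (s0 - w) b (2 * w) (2 * w) z -> detour s0 w z = chint z + twopii * F z.
Proof.
 intros N O. rewrite detour_RI by auto. f_equal. apply (cauchy_formula F (fun _ => False)); auto; try lra; [apply thin_empty|intros l; apply sq_cont|].
 intros l Hl' _. apply HF, HcapV, sq_cap, Hl'.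
Qed.

(** The modified path has length 2 a + 4 w <= 6 a and keeps distance d from z; the replaced piece of
    the chord is exempt. *)
Lemma detour_parts z d : 0 < d ->
  (forall s, - a <= s <= a -> (Rabs (s - s0) < w) \/ (d <= Cmod ((s, b) - z))) ->
  (forall l, brect (s0 - w) b (2 * w) (2 * w) l -> (b < Im l) \/ (Rabs (Re l - s0) = w)%R -> d <= Cmod (l - z)) ->
  ccont (detour s0 w) z /\ Cmod (detour s0 w z) <= 6 * a * (M / d).
Proof.
 intros Hd H1 H2. assert (c1 : rcont_on (fun s => F (s, b)) (- a) (s0 - w)) by (intros s Hs; apply chord_rcont; lra).
 assert (c2 : rcont_on (fun s => F (s, b)) (s0 + w) a) by (intros s Hs; apply chord_rcont; lra).
 assert (CR : cont_rect F (s0 - w) b (2 * w) (2 * w)) by (intros l; apply sq_cont).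
 assert (c3 := cont_rect_ver F (s0 - w) b (2*w) (2*w) (s0 - w + 2 * w) ltac:(lra) CR).
 assert (c4 := cont_rect_hor F (s0 - w) b (2*w) (2*w) (b + 2 * w) ltac:(lra) CR).
 assert (c5 := cont_rect_ver F (s0 - w) b (2*w) (2*w) (s0 - w) ltac:(lra) CR).
 assert (g1 : forall u v, rcont_on (fun s => (s, b) : C) u v) by (intros u v s _; apply rcont_pt).
 assert (g3 : rcont_on (fun t => ((s0 - w + 2 * w)%R, (b + t)%R) : C) 0 (2*w)) by (intros s _; apply rcont_ver).
 assert (g4 : rcont_on (fun t => ((s0 - w + t)%R, (b + 2 * w)%R) : C) 0 (2*w)) by (intros s _; apply rcont_hor).
 assert (g5 : rcont_on (fun t => ((s0 - w)%R, (b + t)%R) : C) 0 (2*w)) by (intros s _; apply rcont_ver).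
 assert (A1 : forall s, - a <= s <= s0 - w -> Cmod (F (s, b)) <= M /\ d <= Cmod ((s, b) - z)).
 { split; [apply HM, chord_cap; lra|]. destruct (H1 s ltac:(lra)) as [Q|Q]; auto. apply Rabs_def2 in Q. lra. }
 assert (A2 : forall s, s0 + w <= s <= a -> Cmod (F (s, b)) <= M /\ d <= Cmod ((s, b) - z)).
 { split; [apply HM, chord_cap; lra|]. destruct (H1 s ltac:(lra)) as [Q|Q]; auto. apply Rabs_def2 in Q. lra. }
 assert (A3 : forall t, 0 <= t <= 2 * w -> Cmod (F ((s0 - w + 2 * w)%R, (b + t)%R)) <= M /\ d <= Cmod (((s0 - w + 2 * w)%R, (b + t)%R) - z)).
 { split; [apply HM, sq_cap; unfold crect, Re, Im; simpl; lra|]. apply H2; [unfold brect, crect, Re, Im; simpl; lra|]. right. unfold Re; simpl.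
  replace (s0 - w + 2 * w - s0)%R with w by ring. apply Rabs_pos_eq; lra. }
 assert (A4 : forall t, 0 <= t <= 2 * w -> Cmod (F ((s0 - w + t)%R, (b + 2 * w)%R)) <= M /\ d <= Cmod (((s0 - w + t)%R, (b + 2 * w)%R) - z)).
 { split; [apply HM, sq_cap; unfold crect, Re, Im; simpl; lra|]. apply H2; [unfold brect, crect, Re, Im; simpl; lra|]. unfold Im; simpl. lra. }
 assert (A5 : forall t, 0 <= t <= 2 * w -> Cmod (F ((s0 - w)%R, (b + t)%R)) <= M /\ d <= Cmod (((s0 - w)%R, (b + t)%R) - z)).
 { split; [apply HM, sq_cap; unfold crect, Re, Im; simpl; lra|]. apply H2; [unfold brect, crect, Re, Im; simpl; lra|]. right. unfold Re; simpl.
  replace (s0 - w - s0)%R with (- w)%R by ring. rewrite Rabs_Ropp. apply Rabs_pos_eq; lra. }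
 assert (ne : forall (l : C), d <= Cmod (l - z) -> l <> z).
 { intros l Q ->. rewrite Cmod_sub_diag in Q. lra. }
 split.
 - apply ccont_plus; [apply ccont_minus; [apply ccont_opp|]|apply ccont_minus; [apply ccont_minus|]]; repeat (apply ccont_mult; [apply ccont_const|]); apply kerint_cont; auto; try lra.
  + intros s Hs. apply ne, A1; auto.
  + intros s Hs. apply ne, A2; auto.
  + intros s Hs. apply ne, A3; auto.
  + intros s Hs. apply ne, A4; auto.
  + intros s Hs. apply ne, A5; auto.
 - assert (B1 := kerint_bound _ _ (-a) (s0-w) z M d ltac:(lra) c1 (g1 _ _) Hd A1).
  assert (B2 := kerint_bound _ _ (s0+w) a z M d ltac:(lra) c2 (g1 _ _) Hd A2). assert (B3 := kerint_bound _ _ 0 (2*w) z M d ltac:(lra) c3 g3 Hd A3).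
  assert (B4 := kerint_bound _ _ 0 (2*w) z M d ltac:(lra) c4 g4 Hd A4). assert (B5 := kerint_bound _ _ 0 (2*w) z M d ltac:(lra) c5 g5 Hd A5).
  eapply Rle_trans; [apply Cmod_triangle|]. eapply Rle_trans; [apply Rplus_le_compat; [apply Cmod_triangle|apply Cmod_triangle]|].
  eapply Rle_trans; [apply Rplus_le_compat_l, Rplus_le_compat_r, Cmod_triangle|]. rewrite !Cmod_opp, !Cmod_mult, !Cmod_Ci. assert (0 <= M / d).
  { apply Rdiv_le_0_compat; auto. eapply Rle_trans; [apply Cmod_ge_0|apply (HM (0%R, b))]. apply chord_cap; lra. }
  nra.
Qed.

End Square.
End Chord.

Lemma bl_lip p z w : UHP p -> 0 <= Im z -> 0 <= Im w -> Cmod (bl p z - bl p w) <= 2 / Im p * Cmod (z - w).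
Proof.
 intros Hp Hz Hw. assert (N1 := bl_den p z Hp Hz). assert (N2 := bl_den p w Hp Hw). assert (B1 := bl_den_ge p z Hp Hz).
 assert (B2 := bl_den_ge p w Hp Hw). unfold UHP in Hp.
 assert (E : bl p z - bl p w = (p - Cconj p) * (z - w) / ((z - Cconj p) * (w - Cconj p))) by (unfold bl; field; auto).
 rewrite E, Cmod_div, !Cmod_mult by (apply Cmult_neq_0; auto). assert (E2 : Cmod (p - Cconj p) = (2 * Im p)%R).
 { replace (p - Cconj p) with (RtoC (2 * Im p) * Ci). rewrite Cmod_mult, Cmod_R, Cmod_Ci, Rabs_pos_eq by lra; ring.
  destruct p as [x y]; unfold Im, Cconj, RtoC, Ci, Cminus, Cplus, Copp, Cmult; simpl; f_equal; ring. }
 rewrite E2. pose proof (Cmod_ge_0 (z - w)). apply (Rmult_le_reg_r (Cmod (z - Cconj p) * Cmod (w - Cconj p))); [nra|].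
 apply Rle_trans with (2 / Im p * Cmod (z - w) * (Im p * Im p))%R; [right; field; lra|]. apply Rmult_le_compat_l; [|nra]. apply Rmult_le_pos; auto.
 left; apply Rdiv_lt_0_compat; lra.
Qed.

(** * From the chord integral to the data of the slit estimate *)

Section Cap.

Variables (a b r : R) (U : C -> Prop) (g : C -> C) (l : list C).
Hypothesis Ha : 0 < a.
Hypothesis Hb : 0 < b.
Hypothesis Hr : 0 < r.
Hypothesis Hrr : (r * r = a * a + b * b)%R.
Hypothesis HU : openC U.
Hypothesis HcapU : forall z, cap b r z -> U z.
Hypothesis Hg : hol U g.
Hypothesis Hl : forall p, In p l -> on_arc r b p.
Hypothesis HlA : In ((a, b) : C) l.
Hypothesis HlB : In ((- a, b)%R : C) l.
Hypothesis Hlz : forall z, on_arc r b z -> g z = 0 -> In z l.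

Lemma br : b < r.
Proof. nra. Qed.

Lemma arc_cap z : on_arc r b z -> cap b r z.
Proof. intros [A B]. split; lra. Qed.

Lemma cap_closed z : ~ cap b r z -> exists d, 0 < d /\ forall w, Cmod (w - z) < d -> ~ cap b r w.
Proof.
 intros N. destruct (Rlt_dec (Im z) b) as [L|L].
 - exists (b - Im z)%R. split; [lra|]. intros w Hw [Q _]. assert (I := Im_close w z). lra.
 - assert (Q : r < Cmod z) by (apply Rnot_le_lt; intros Q; apply N; split; lra). exists (Cmod z - r)%R. split; [lra|]. intros w Hw [_ K].
  assert (T1 := Cmod_tri_inv z w). rewrite Cmod_sub_sym in T1. lra.
Qed.

Lemma Cmod_rect z : Cmod z <= r -> crect (- r) (- r) (2 * r) (2 * r) z.
Proof.
 assert (A := Rabs_Re_le z). assert (B := Rabs_Im_le z). unfold crect. assert (A1 := Rle_abs (Re z)). assert (A2 := Rle_abs (- Re z)).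
 assert (B1 := Rle_abs (Im z)). assert (B2 := Rle_abs (- Im z)). rewrite Rabs_Ropp in A2, B2. lra.
Qed.

Lemma sup_cap : exists M, 0 < M /\ forall z, cap b r z -> Cmod (g z) <= M.
Proof.
 destruct (compact_rect_uniform (- r) (- r) (2*r) (2*r) (fun w d => cap b r w -> Cmod (g w) <= / d)) as (d & Hd & K).
 - intros z _. destruct (classic (cap b r z)) as [Q|Q].
  + destruct (hol_cont U g z Hg (HcapU z Q) 1%R) as (d & Hd & K); [lra|]. pose proof (Cmod_ge_0 (g z)). exists (Rmin d (/ (Cmod (g z) + 1))).
   split; [apply Rmin_glb_lt; auto; apply Rinv_0_lt_compat; lra|]. intros w Hw _. specialize (K w (proj1 (Rmin_Rgt_l _ _ _ Hw))).
   assert (T := Cmod_tri_inv (g w) (g z)). apply Rle_trans with (Cmod (g z) + 1)%R; [lra|]. rewrite <- (Rinv_inv (Cmod (g z) + 1)) at 1.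
   apply Rinv_le_contravar; [apply Rmin_glb_lt; auto; apply Rinv_0_lt_compat; lra|apply Rmin_r].
  + destruct (cap_closed z Q) as (d & Hd & K). exists d; split; auto. intros w Hw Cw. destruct (K w Hw Cw).
 - intros w d d' Hd P Cw. eapply Rle_trans; [auto|]. apply Rinv_le_contravar; lra.
 - exists (/ d)%R. split; [apply Rinv_0_lt_compat; auto|]. intros z Cz. apply K; auto. apply Cmod_rect, Cz.
Qed.

(** The lower bound for |g| is uniform because the zeros of g on the arc belong to [l], and [far]
    keeps away from them. *)
Lemma arc_nbhd delta : 0 < delta -> exists d, 0 < d /\ forall w, on_arc r b w ->
  (forall z, Cmod (z - w) < d -> U z /\ Cmod (g z) <= / d) /\ (far l delta w -> d <= Cmod (g w)).
Proof.
 intros Hdl.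
 destruct (compact_rect_uniform (- r) (- r) (2*r) (2*r) (fun w d => on_arc r b w -> (forall z, Cmod (z - w) < d -> U z /\ Cmod (g z) <= / d) /\ (far l delta w -> d <= Cmod (g w)))) as (d & Hd & K).
 - intros p _. destruct (classic (on_arc r b p)) as [Q|Q].
  + assert (Up := HcapU p (arc_cap p Q)). destruct (HU p Up) as (d1 & Hd1 & K1). pose proof (Cmod_ge_0 (g p)).
   assert (far_part : exists d2, 0 < d2 /\ forall w, Cmod (w - p) < d2 -> far l delta w -> d2 <= Cmod (g w)).
   { destruct (classic (g p = 0)) as [Z|Z].
    - assert (I := Hlz p Q Z). assert (UHPp : UHP p) by (unfold UHP; destruct Q; lra).
     assert (CB : ccont (bl p) p) by (apply (hol_cont _ _ _ (bl_hol p UHPp)); unfold UHP in UHPp; lra). destruct (CB delta Hdl) as (d & Hd & K).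
     exists d; split; auto. intros w Hw F. specialize (K w Hw). specialize (F p I).
     replace (bl p p) with (RtoC 0) in K by (unfold bl; field; apply bl_den; unfold UHP in *; lra). replace (bl p w - 0) with (bl p w) in K by ring.
     lra.
    - apply Cmod_gt_0 in Z. destruct (hol_cont U g p Hg Up (Cmod (g p) / 2)%R) as (d & Hd & K); [lra|]. exists (Rmin d (Cmod (g p) / 2)).
     split; [apply Rmin_glb_lt; lra|]. intros w Hw _. specialize (K w (proj1 (Rmin_Rgt_l _ _ _ Hw))). assert (T := Cmod_tri_inv (g p) (g w)).
     rewrite Cmod_sub_sym in T. assert (M := Rmin_r d (Cmod (g p) / 2)). lra. }
   destruct far_part as (d2 & Hd2 & K2). destruct (hol_cont U g p Hg Up 1%R) as (d3 & Hd3 & K3); [lra|].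
   assert (Hi : 0 < / (Cmod (g p) + 1)) by (apply Rinv_0_lt_compat; lra).
   destruct (pos_min4 (d1/2) d2 (d3/2) (/ (Cmod (g p) + 1))) as (d & Hd & D1 & D2 & D3 & D4); [lra..|]. exists d; split; auto. split.
   * intros z Hz. assert (T := Cmod_tri3 z w p). split; [apply K1; lra|]. specialize (K3 z ltac:(lra)). assert (T2 := Cmod_tri_inv (g z) (g p)).
    apply Rle_trans with (Cmod (g p) + 1)%R; [lra|]. rewrite <- (Rinv_inv (Cmod (g p) + 1)) at 1. apply Rinv_le_contravar; auto.
   * intros F. specialize (K2 w ltac:(lra) F). lra.
  + destruct (arc_closed r b p Q) as (d & Hd & K). exists d; split; auto. intros w Hw Aw. destruct (K w Hw Aw).
 - intros w d d' Hd P Aw. destruct (P Aw) as [P1 P2]. split.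
  + intros z Hz. destruct (P1 z ltac:(lra)) as [Uz Bz]. split; auto. eapply Rle_trans; [apply Bz|]. apply Rinv_le_contravar; lra.
  + intros F. specialize (P2 F). lra.
 - exists d; split; auto. intros w Aw. apply K; auto. apply Cmod_rect. destruct Aw; lra.
Qed.

(** At distance d1 from its ends the chord has the arc above it at a height proportional to d1,
    which leaves room for a square of side 2 w. *)
Lemma cap_square d1 : 0 < d1 <= a -> exists w, 0 < w <= d1 / 8 /\ forall s0, - (a - d1) <= s0 <= a - d1 ->
  (- a <= s0 - w) /\ s0 + w <= a /\ forall z, crect (s0 - w) b (2 * w) (2 * w) z -> Cmod z < r.
Proof.
 intros Hd1. set (w := (a * d1 / (8 * (a + b)))%R). assert (W : (w * (8 * (a + b)) = a * d1)%R) by (unfold w; field; lra).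
 assert (Hw : 0 < w) by nra. assert (Hw2 : w <= d1 / 8) by nra. exists w. split; [lra|]. split; [lra|split; [lra|]]. intros z [H1 H2].
 apply Rsqr_incrst_0; [|apply Cmod_ge_0|lra]. unfold Rsqr. rewrite Cmod_sqr. nra.
Qed.

Lemma far_dist delta z : 0 <= delta -> UHP z -> far l delta z -> delta * b <= Cmod (z - (a, b)) /\ delta * b <= Cmod (z - (- a, b)%R).
Proof.
 intros Hd Hz F. assert (Iz : 0 <= Im z) by (unfold UHP in Hz; lra).
 assert (G : forall p, In p l -> UHP p -> Im p = b -> delta * b <= Cmod (z - p)).
 { intros p Hp Up Ep. specialize (F p Hp). assert (N := bl_den p z Up Iz). assert (B := bl_den_ge p z Up Iz). unfold bl in F.
  rewrite Cmod_div in F by auto. apply (Rmult_le_compat_r (Cmod (z - Cconj p))) in F; [|lra]. unfold Rdiv in F.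
  rewrite Rmult_assoc, Rinv_l in F by lra. nra. }
 auto.
Qed.

(** A point of the arc whose height is close to b is close to an end of the chord, and both ends
    belong to [l]. *)
Lemma arc_height delta : 0 < delta -> exists mu, 0 < mu /\ forall z, on_arc r b z -> far l (2 * delta) z -> b + mu <= Im z.
Proof.
 intros Hd. set (mu := (delta * b / (1 + 2 * r / a))%R). assert (P : 0 < 2 * r / a) by (apply Rdiv_lt_0_compat; lra).
 assert (Hmu : 0 < mu) by (apply Rdiv_lt_0_compat; nra). assert (Emu : (mu + mu * (2 * r / a) = delta * b)%R) by (unfold mu; field; split; nra).
 exists mu; split; auto. intros z Az F. assert (Uz : UHP z) by (unfold UHP; destruct Az; lra).
 destruct (far_dist (2 * delta) z ltac:(lra) Uz F) as [FA FB]. destruct Az as [Az Bz]. apply Rnot_lt_le. intros L.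
 assert (S : (Re z * Re z + Im z * Im z = r * r)%R) by (rewrite <- Cmod_sqr, Az; auto). assert (Y : Im z <= r) by nra.
 assert (X : forall x, 0 <= x -> (x * x = Re z * Re z)%R -> 0 <= a - x <= mu * (2 * r / a)).
 { split; [nra|]. apply (Rmult_le_reg_r a); auto. replace (mu * (2 * r / a) * a)%R with (mu * (2 * r))%R by (field; lra). assert (0 <= a - x) by nra.
  nra. }
 destruct (Rle_dec 0 (Re z)) as [R0|R0].
 - specialize (X (Re z) R0 eq_refl). assert (Cmod (z - (a, b)) <= Rabs (Re z - a) + Rabs (Im z - b)) by apply (Cmod_le_Re_Im (z - (a, b))).
  rewrite Rabs_left1, (Rabs_pos_eq (Im z - b)) in H by lra. nra.
 - specialize (X (- Re z)%R ltac:(lra) ltac:(ring)).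
  assert (Cmod (z - (- a, b)%R) <= Rabs (Re z - - a) + Rabs (Im z - b)) by apply (Cmod_le_Re_Im (z - (- a, b)%R)).
  rewrite (Rabs_pos_eq (Re z - - a)), (Rabs_pos_eq (Im z - b)) in H by lra. nra.
Qed.

(** The dichotomy behind the crude bound: away from the chord its integral is estimated directly,
    close to its middle part the detour is used. *)
Lemma chord_split d0 w z : 0 < d0 <= a -> 0 < w <= d0 / 16 ->
  (d0 <= Cmod (z - (a, b))) -> d0 <= Cmod (z - (- a, b)%R) ->
  (forall s, - a <= s <= a -> w / 2 <= Cmod (z - (s, b))) \/ (Rabs (Im z - b) < w / 2 /\ - (a - d0/2) <= Re z <= a - d0/2).
Proof.
 destruct (Rlt_dec (Rabs (Im z - b)) (w/2)) as [L|L].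
 2: { left. intros s Hs. eapply Rle_trans; [|apply (Rabs_Im_le (z - (s, b)))]. change (Im (z - (s, b))) with (Im z - b)%R. lra. }
 assert (A1 := Cmod_le_Re_Im (z - (a, b))). change (Im (z - (a, b))) with (Im z - b)%R in A1. change (Re (z - (a, b))) with (Re z - a)%R in A1.
 assert (A2 := Cmod_le_Re_Im (z - (- a, b)%R)). change (Im (z - (- a, b)%R)) with (Im z - b)%R in A2.
 change (Re (z - (- a, b)%R)) with (Re z - - a)%R in A2. destruct (Rle_dec (Re z) (a - d0/2)) as [R1|R1].
 - destruct (Rle_dec (- (a - d0/2)) (Re z)) as [R2|R2]; [lra|]. left. intros s Hs. eapply Rle_trans; [|apply (Rabs_Re_le (z - (s, b)))].
  change (Re (z - (s, b))) with (Re z - s)%R. destruct (Rle_dec 0 (Re z - - a)) as [S|S]; [rewrite (Rabs_pos_eq (Re z - - a)) in A2 by auto; lra|].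
  rewrite (Rabs_left (Re z - - a)) in A2 by lra. rewrite Rabs_left by lra. lra.
 - left. intros s Hs. eapply Rle_trans; [|apply (Rabs_Re_le (z - (s, b)))]. change (Re (z - (s, b))) with (Re z - s)%R.
  destruct (Rle_dec 0 (Re z - a)) as [S|S]; [rewrite (Rabs_pos_eq (Re z - a)) in A1 by auto; rewrite Rabs_pos_eq by lra; lra|].
  rewrite (Rabs_left (Re z - a)) in A1 by lra. lra.
Qed.

Section Phi.

Variables (M : R) (V : C -> Prop) (F : C -> C).
Hypothesis HF : hol V F.
Hypothesis HcapV : forall z, cap b r z -> V z.
Hypothesis HM : forall z, cap b r z -> Cmod (F z) <= M.

(** Between chord and arc the term twopii F compensates the jump of the chord integral across the
    chord and creates one across the arc. *)
Definition phi0 (z : C) : C :=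
  if dec (b < Im z /\ Cmod z < r) then chint a b F z + twopii * F z else chint a b F z.

Lemma phi0_in z : b < Im z -> Cmod z < r -> phi0 z = chint a b F z + twopii * F z.
Proof. unfold phi0. destruct (dec (b < Im z /\ Cmod z < r)); tauto. Qed.

Lemma phi0_out z : ~ (b < Im z /\ Cmod z < r) -> phi0 z = chint a b F z.
Proof. unfold phi0. destruct (dec (b < Im z /\ Cmod z < r)); tauto. Qed.

Lemma M_pos : 0 <= M.
Proof. eapply Rle_trans; [apply Cmod_ge_0|apply (HM (0%R, b))]. apply (chord_cap a b r); lra. Qed.

Lemma phi0_detour s0 w z : 0 < w -> - a <= s0 - w -> s0 + w <= a ->
  (forall z, crect (s0 - w) b (2 * w) (2 * w) z -> Cmod z < r) -> ~ eta1 a b z ->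
  (s0 - w < Re z < s0 + w) -> Im z < b + 2 * w -> phi0 z = detour a b F s0 w z.
Proof.
 intros Hw H1 H2 Hsq Nz Rz Iz. destruct (Rtotal_order (Im z) b) as [L|[L|L]].
 - rewrite phi0_out by lra. symmetry. apply (detour_out a b r V); auto. unfold crect; lra.
 - exfalso. apply Nz. rewrite eta1_iff by auto. lra.
 - rewrite phi0_in; auto; [|apply Hsq; unfold crect; lra]. symmetry. apply (detour_in a b r V); auto. unfold orect; lra.
Qed.

Lemma phi0_hol : hol (fun z => (UHP z /\ ~ on_arc r b z) /\ ~ eta1 a b z) phi0.
Proof.
 intros z [[Uz Az] Nz]. assert (CH : hol (fun z => ~ eta1 a b z) (chint a b F)) by (apply (chint_hol a b r V); auto). destruct (CH z Nz) as [m Hm].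
 destruct (classic (b <= Im z /\ Cmod z <= r)) as [I|I].
 - assert (I2 : (b < Im z /\ Cmod z < r)).
  { split.
   - destruct (Rle_lt_or_eq_dec _ _ (proj1 I)) as [|E]; auto. exfalso. apply Nz. rewrite eta1_iff by auto. assert (S := Cmod_sqr z).
    assert (Cmod z * Cmod z <= r * r) by (apply Rmult_le_compat; try apply Cmod_ge_0; lra). nra.
   - destruct (Rle_lt_or_eq_dec _ _ (proj2 I)) as [|E]; auto. exfalso. apply Az. split; lra. }
  destruct (HF z (HcapV z I)) as [k Hk]. exists (m + twopii * k).
  refine (cder_ext_loc _ _ _ _ (Rmin (Im z - b) (r - Cmod z)) _ _ (cder_plus _ _ _ _ _ Hm (cder_scal twopii _ _ _ Hk))).
  + apply Rmin_glb_lt; lra.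
  + intros w Hw. symmetry. destruct (Rmin_Rgt_l _ _ _ Hw) as [W1 W2]. assert (T := Cmod_tri_inv w z). assert (Q := Im_close w z). apply phi0_in; lra.
 - destruct (cap_closed z I) as (d & Hd & K). exists m. refine (cder_ext_loc _ _ _ _ d Hd _ Hm). intros w Hw. symmetry. apply phi0_out. intros [I1 I2].
  apply (K w Hw). split; lra.
Qed.

(** Near an interior point of the chord [phi0] agrees with a detour integral, which is continuous
    there, so the chord is removable. *)
Lemma phi_extension : exists phi, hol (fun z => UHP z /\ ~ on_arc r b z) phi /\ forall z, ~ eta1 a b z -> phi z = phi0 z.
Proof.
 apply hol_extension.
 - intros z [Uz Az]. destruct (arc_closed r b z Az) as (d & Hd & K). unfold UHP in *. exists (Rmin d (Im z)). split; [apply Rmin_glb_lt; auto|].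
  intros w Hw. destruct (Rmin_Rgt_l _ _ _ Hw) as [W1 W2]. assert (Q := Im_close w z). split; [lra|auto].
 - apply thin_eta1.
 - intros z Nz. apply (eta1_closed a b Ha z Nz).
 - apply phi0_hol.
 - intros z [Uz Az] Ez. rewrite eta1_iff in Ez by auto. destruct z as [s0 y]. unfold Re, Im in Ez; simpl in Ez. destruct Ez as [-> Es].
  (* The ends of the chord lie on the arc, so the point is interior to the chord. *)
  assert (Es2 : - a < s0 < a).
  { assert (K : (s0 * s0 <> a * a)%R).
   { intros E. apply Az. split; [|unfold Im; simpl; lra]. apply Rsqr_inj; [apply Cmod_ge_0|lra|]. unfold Rsqr. rewrite Cmod_sqr. unfold Re, Im; simpl.
    lra. }
   nra. }
  set (d1 := (a - Rabs s0)%R). assert (Q1 := Rle_abs s0). assert (Q2 := Rle_abs (- s0)). rewrite Rabs_Ropp in Q2.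
  assert (Q3 : Rabs s0 < a) by (apply Rabs_def1; lra). destruct (cap_square d1) as (w & Hw & Kw); [unfold d1; lra|].
  destruct (Kw s0) as (W1 & W2 & W3); [unfold d1; lra|]. exists (detour a b F s0 w (s0, b)).
  destruct (detour_parts a b r M V F) with (s0 := s0) (w := w) (z := (s0, b) : C) (d := w) as [CD _]; auto; try lra.
  { intros s Hs. destruct (Rlt_dec (Rabs (s - s0)) w); [lra|right]. eapply Rle_trans; [|apply Rabs_Re_le].
   change (Re ((s, b) - (s0, b))) with (s - s0)%R. lra. }
  { intros p Hp Q. destruct (Rlt_dec (Rabs (Re p - s0)) w) as [L|L].
   - eapply Rle_trans; [|apply Rabs_Im_le]. change (Im (p - (s0, b))) with (Im p - b)%R. eapply Rle_trans; [|apply Rle_abs].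
    destruct Q as [Q|Q]; [|lra]. apply Rabs_def2 in L. unfold brect in Hp. lra.
   - eapply Rle_trans; [|apply Rabs_Re_le]. change (Re (p - (s0, b))) with (Re p - s0)%R. lra. }
  intros e He. destruct (CD e He) as (d & Hd & K). exists (Rmin d w). split; [apply Rmin_glb_lt; lra|]. intros v Hv Nv.
  destruct (Rmin_Rgt_l _ _ _ Hv) as [V1 V2]. assert (I := Im_close v (s0, b)). assert (I2 := Re_close v (s0, b)). change (Im (s0, b)) with b in I.
  change (Re (s0, b)) with s0 in I2. rewrite (phi0_detour s0 w); auto; try lra.
Qed.

Lemma phi0_crude d0 w : 0 < d0 <= a -> 0 < w <= d0/16 ->
  (forall s0, - (a - d0/2) <= s0 <= a - d0/2 -> - a <= s0 - w /\ s0 + w <= a /\ forall z, crect (s0 - w) b (2 * w) (2 * w) z -> Cmod z < r) ->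
  forall z, d0 <= Cmod (z - (a, b)) -> d0 <= Cmod (z - (- a, b)%R) ->
   (~ eta1 a b z -> Cmod (phi0 z) <= 6 * a * (M / (w/2)) + 2 * PI * M) /\
   (on_arc r b z -> (Cmod (chint a b F z) <= 6 * a * (M / (w/2)) /\ Cmod (chint a b F z + twopii * F z) <= 6 * a * (M / (w/2)) + 2 * PI * M)).
Proof.
 intros Hd Hw Kw z FA FB. assert (PM := M_pos). assert (P2 := PI_ge_2). assert (PQ : 0 <= M / (w/2)) by (apply Rdiv_le_0_compat; lra).
 assert (inF : cap b r z -> Cmod (twopii * F z) <= 2 * PI * M).
 { intros Cz. rewrite Cmod_mult, Cmod_twopii. apply Rmult_le_compat_l; [lra|auto]. }
 assert (0 <= 2 * PI * M) by nra. assert (split0 := chord_split d0 w z Hd Hw FA FB).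
 assert (smallchord : (forall s, - a <= s <= a -> w / 2 <= Cmod (z - (s, b))) -> Cmod (chint a b F z) <= 6 * a * (M / (w/2))).
 { intros D. eapply Rle_trans; [apply (chint_bound a b r M V F) with (d := (w/2)%R); auto; lra|]. nra. }
 split.
 - intros Nz. destruct split0 as [D|[D1 D2]].
  + specialize (smallchord D). unfold phi0. destruct (dec (b < Im z /\ Cmod z < r)) as [[I1 I2]|]; [|lra]. eapply Rle_trans; [apply Cmod_triangle|].
   specialize (inF ltac:(split; lra)). lra.
  + destruct (Kw (Re z) D2) as (W1 & W2 & W3). apply Rabs_def2 in D1. rewrite (phi0_detour (Re z) w); auto; try lra.
   destruct (detour_parts a b r M V F) with (s0 := Re z) (w := w) (z := z) (d := (w/2)%R) as [_ BD]; auto; try lra.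
   { intros s Hs. destruct (Rlt_dec (Rabs (s - Re z)) w); [lra|right]. eapply Rle_trans; [|apply Rabs_Re_le].
    change (Re ((s, b) - z)) with (s - Re z)%R. lra. }
   { intros p Hp Q. destruct (Rlt_dec (Rabs (Re p - Re z)) w) as [L|L].
    - eapply Rle_trans; [|apply Rabs_Im_le]. change (Im (p - z)) with (Im p - Im z)%R. eapply Rle_trans; [|apply Rle_abs]. destruct Q as [Q|Q]; [|lra].
     apply Rabs_def2 in L. unfold brect in Hp. lra.
    - eapply Rle_trans; [|apply Rabs_Re_le]. change (Re (p - z)) with (Re p - Re z)%R. lra. }
 - intros Az. assert (Cz := arc_cap z Az). specialize (inF Cz). destruct split0 as [D|[D1 D2]].
  + specialize (smallchord D). split; [lra|]. eapply Rle_trans; [apply Cmod_triangle|]. lra.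
  + destruct (Kw (Re z) D2) as (W1 & W2 & W3). apply Rabs_def2 in D1. destruct Az as [A1 A2]. assert (Cmod z < r); [|lra]. apply W3. unfold crect. lra.
Qed.

(** Beyond |z| = R0 the integral is at most e by decay. Below that radius it is Lipschitz in the
    height with constant [K], and the height is less than [h]. *)
Lemma chint_bdry eps0 : (forall x : R, Cmod (chint a b F (RtoC x)) <= eps0) -> 0 <= eps0 ->
  forall e, 0 < e -> exists d, 0 < d /\ forall z, UHP z -> Im z < d * (r * r + Cmod z * Cmod z) -> ~ (b < Im z /\ Cmod z < r) /\ ~ eta1 a b z /\ Cmod (chint a b F z) <= eps0 + e.
Proof.
 intros HE He0 e He. assert (PM := M_pos). set (R0 := (r + 1 + 2 * a * M / e)%R). assert (P1 : 0 <= 2 * a * M / e) by (apply Rdiv_le_0_compat; nra).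
 set (K := (2 * a * (M / (b / 2 * (b/2))))%R). assert (PK : 0 <= K) by (unfold K; apply Rmult_le_pos; [lra|apply Rdiv_le_0_compat; nra]).
 set (h := Rmin (b/2) (e / (K + 1))). assert (Hh : 0 < h) by (apply Rmin_glb_lt; [lra|apply Rdiv_lt_0_compat; lra]).
 assert (h1 : h <= b/2) by apply Rmin_l. assert (h2 : h <= e / (K + 1)) by apply Rmin_r. assert (HR : 0 < r * r + R0 * R0) by nra.
 exists (h / (r * r + R0 * R0))%R. split; [apply Rdiv_lt_0_compat; auto|]. intros z Uz Iz. unfold UHP in Uz. destruct (Rle_dec (Cmod z) R0) as [L|L].
 - assert (Ih : Im z < h).
  { eapply Rlt_le_trans; [apply Iz|]. apply Rle_trans with (h / (r * r + R0 * R0) * (r * r + R0 * R0))%R; [|right; field; lra].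
   apply Rmult_le_compat_l; [nra|]. apply Rplus_le_compat_l. apply Rmult_le_compat; auto using Cmod_ge_0. }
  assert (Ne : forall y x, y <= b/2 -> ~ eta1 a b (x, y)) by (intros y x Hy Q; rewrite eta1_iff in Q by auto; unfold Im, Re in Q; simpl in Q; lra).
  split; [lra|]. destruct z as [x y]. unfold Im in *; simpl in *. split; [apply Ne; lra|].
  assert (D : Cmod (chint a b F (x, y) - chint a b F (RtoC x)) <= K * y).
  { assert (N : forall y' s, y' <= b/2 -> b / 2 <= Cmod ((x, y') - (s, b)) /\ (x, y') - (s, b) <> 0).
   { intros y' s Hy. assert (Q : b / 2 <= Cmod ((x, y') - (s, b))).
    - eapply Rle_trans; [|apply Rabs_Im_le]. unfold Im; simpl. rewrite Rabs_left; lra.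
    - split; auto. intros E. rewrite E, Cmod_0 in Q. lra. }
   assert (R1 : forall y', y' <= b/2 -> rcont_on (fun s => F (s, b) / ((x, y') - (s, b))) (- a) a).
   { intros y' Hy s Hs. apply rcont_mult; [apply (chord_rcont a b r V); auto|].
    apply rcont_inv; [apply rcont_minus; [apply rcont_const|apply rcont_pt]|apply N; auto]. }
   unfold chint. rewrite <- CI_minus by (try apply R1; lra).
   replace (K * y)%R with ((a - - a) * (M * y / (b / 2 * (b/2))))%R by (unfold K; field; lra).
   apply CI_bound; [lra|intros s Hs; apply rcont_minus; apply R1; auto; lra|]. intros s Hs. destruct (N y s ltac:(lra)) as [D1 N1].
   destruct (N 0%R s ltac:(lra)) as [D0 N0].
   replace (F (s, b) / ((x, y) - (s, b)) - F (s, b) / (RtoC x - (s, b))) with (F (s, b) * - (RtoC y * Ci) / (((x, y) - (s, b)) * ((x, 0%R) - (s, b)))).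
   - rewrite Cmod_div, !Cmod_mult, Cmod_opp, Cmod_mult, Cmod_R, Cmod_Ci, Rabs_pos_eq, Rmult_1_r by (try apply Cmult_neq_0; auto; lra).
    assert (B := HM _ (chord_cap a b r Hr Hrr s Hs)).
    apply Rmult_le_compat; [apply Rmult_le_pos; [apply Cmod_ge_0|lra]|left; apply Rinv_0_lt_compat; nra|apply Rmult_le_compat_r; lra|].
    apply Rinv_le_contravar; [nra|]. nra.
   - change (RtoC x) with ((x, 0%R) : C).
    replace (RtoC y * Ci) with ((x, y) - (x, 0%R)) by (unfold RtoC, Ci, Cmult, Cminus, Cplus, Copp; simpl; f_equal; ring). field. auto. }
  assert (T := Cmod_tri_inv (chint a b F (x, y)) (chint a b F (RtoC x))). specialize (HE x). assert ((K + 1) * y <= e); [|nra].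
  apply Rle_trans with ((K + 1) * (e / (K + 1)))%R; [nra|right; field; lra].
 - assert (R0r : r + 1 <= R0) by (unfold R0; lra). assert (Dz : forall s, - a <= s <= a -> Cmod z - r <= Cmod (z - (s, b))).
  { intros s Hs. assert (T := Cmod_tri_inv z (s, b)). assert (Q := proj2 (chord_cap a b r Hr Hrr s Hs)). lra. }
  split; [lra|]. split.
  { rewrite eta1_iff by auto. intros [E1 E2]. specialize (Dz (Re z) E2).
   replace (Re z, b) with z in Dz; [|destruct z; unfold Re, Im in *; simpl in *; subst; auto]. rewrite Cmod_sub_diag in Dz. lra. }
  eapply Rle_trans; [apply (chint_bound a b r M V F) with (d := (Cmod z - r)%R); auto; lra|]. assert (2 * a * (M / (Cmod z - r)) <= e); [|lra].
  apply (Rmult_le_reg_r (Cmod z - r)); [lra|]. apply Rle_trans with (e * (2 * a * M / e))%R; [right; field; lra|]. apply Rmult_le_compat_l; [lra|].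
  unfold R0 in L. lra.
Qed.

End Phi.

(** The constants depend on [Ef] and [f] only through e0: [Ef] stands for the exponential of the
    phase, which varies with (x, t), and [f] for an entry of a row, which varies with N too. *)
Theorem slit_exists delta e0 : 0 < delta -> 0 < e0 ->
  exists Cd rho kappa, 1 <= Cd /\ 0 < rho <= r /\ 0 < kappa /\
  forall (Ef f : C -> C) eps0, hol (fun _ => True) Ef -> (forall z, Cmod z <= 2 * r -> e0 <= Cmod (Ef z) <= / e0) ->
    hol UHP f -> (forall z, UHP z -> Cmod (f z) <= 1) -> 0 <= eps0 ->
    (forall x : R, (Cmod (chint a b (fun z => g z * Ef z * f z)%C (RtoC x)) <= eps0)%R) ->
    exists phi phr c, slit_data r b eps0 delta Cd rho kappa l f phi phr c.
Proof.
 intros Hd He0. assert (Hi0 : 0 < / e0) by (apply Rinv_0_lt_compat; auto). destruct sup_cap as (Mg & HMg & BMg). set (M := (Mg * / e0)%R).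
 assert (HM : 0 < M) by (apply Rmult_lt_0_compat; auto). assert (Pdb : 0 < delta * b) by nra.
 destruct (pos_min4 (delta * b / 2) a 1 1) as (d0 & Pd0 & Hd0' & Pa & _); [lra..|]. assert (Hd0 : 0 < d0 <= a) by lra.
 destruct (cap_square (d0/2)) as (w & Hw & Kw); [lra|]. destruct (arc_nbhd delta Hd) as (d & Hdd & Kd).
 destruct (arc_height delta Hd) as (mu & Hmu & Kmu). assert (Hid : 0 < / d) by (apply Rinv_0_lt_compat; auto).
 destruct (pos_min4 r d (mu/2) (delta * b / 4)) as (rho & Hrho & R1 & R2 & R3 & R4); [lra..|]. assert (P2 := PI_ge_2).
 set (C0 := (6 * a * (M / (w/2)) + 2 * PI * M)%R). assert (PC1 : 0 <= 6 * a * (M / (w/2))) by (apply Rmult_le_pos; [lra|apply Rdiv_le_0_compat; lra]).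
 assert (PC2 : 0 <= 2 * PI * M) by nra. assert (PC3 : 0 < 2 * PI * (/ d * / e0)) by (apply Rmult_lt_0_compat; [lra|nra]).
 (* [C0] bounds [phi] and its two branches away from the ends, the last summand bounds c near the
    arc. The lower bound kappa for c is d e0. *)
 set (Cd := (1 + C0 + 2 * PI * (/ d * / e0))%R). exists Cd, rho, (d * e0)%R. split; [unfold Cd, C0; lra|]. split; [lra|]. split; [nra|].
 intros Ef f eps0 HE BE Hf Bf He HB. set (F := fun z => g z * Ef z * f z) in *. set (V := fun z => U z /\ UHP z). assert (HF : hol V F).
 { apply hol_mult; [apply hol_mult|].
  - apply (hol_sub _ U); auto. intros z Hz; apply Hz.
  - apply (hol_sub _ (fun _ => True)); auto.
  - apply (hol_sub _ UHP); auto. intros z Hz; apply Hz. }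
 assert (HcV : forall z, cap b r z -> V z) by (intros z Hz; split; [auto|destruct Hz; unfold UHP; lra]).
 assert (HFM : forall z, cap b r z -> Cmod (F z) <= M).
 { intros z Hz. unfold F. rewrite !Cmod_mult. assert (Q : Cmod z <= 2 * r) by (destruct Hz; lra). destruct (BE z Q) as [_ B2].
  assert (B3 := Bf z (proj2 (HcV z Hz))). unfold M. rewrite <- (Rmult_1_r (Mg * / e0)). apply Rmult_le_compat; auto using Cmod_ge_0.
  - apply Rmult_le_pos; apply Cmod_ge_0.
  - apply Rmult_le_compat; auto using Cmod_ge_0. }
 destruct (phi_extension M V F HF HcV HFM) as (phi & Hphi & Ephi). assert (crude := phi0_crude M V F HF HcV HFM d0 w Hd0 ltac:(lra)).
 assert (Kw2 : forall s0, - (a - d0/2) <= s0 <= a - d0/2 -> - a <= s0 - w /\ s0 + w <= a /\ forall z, crect (s0 - w) b (2 * w) (2 * w) z -> Cmod z < r) by auto.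
 specialize (crude Kw2). exists phi, (chint a b F), (fun z => twopii * (g z * Ef z)). constructor; auto.
 - intros e Hee. destruct (chint_bdry M V F HF HcV HFM eps0 HB He e Hee) as (d1 & Hd1 & K1). exists d1; split; auto. intros z Uz _ Iz.
  destruct (K1 z Uz Iz) as (A1 & A2 & A3). rewrite Ephi, phi0_out; auto.
 - intros z Uz Fz. destruct (far_dist delta z ltac:(lra) Uz Fz) as [FA FB]. split.
  + intros Az. destruct (classic (eta1 a b z)) as [Ez|Ez].
   (* On the chord itself [phi] is compared, by continuity, with its value at a point just below. *)
   * apply Rnot_lt_le. intros L. destruct (hol_cont _ _ _ Hphi (conj Uz Az) (Cmod (phi z) - Cd)%R) as (e & Hee & Ke); [lra|].
    destruct (pos_min4 (e/2) (delta * b / 4) 1 1) as (t & Ht & t1 & t2 & _); [lra..|]. set (v := z - RtoC t * Ci). assert (Dv : Cmod (v - z) = t).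
    { unfold v. replace (z - RtoC t * Ci - z) with (- (RtoC t * Ci)) by ring. rewrite Cmod_opp, Cmod_mult, Cmod_R, Cmod_Ci, Rabs_pos_eq; lra. }
    assert (Nv : ~ eta1 a b v).
    { rewrite eta1_iff in Ez |- * by auto. unfold Im, Cminus, Cplus, Copp, Cmult, RtoC, Ci in *; simpl in *. lra. }
    specialize (Ke v ltac:(lra)). rewrite (Ephi v Nv) in Ke. assert (TA := Cmod_tri3 z v (a, b)). assert (TB := Cmod_tri3 z v (- a, b)%R).
    rewrite (Cmod_sub_sym z v) in TA, TB. destruct (crude v ltac:(lra) ltac:(lra)) as [CR _]. specialize (CR Nv). fold C0 in CR.
    assert (T := Cmod_tri_inv (phi z) (phi0 F v)). rewrite Cmod_sub_sym in T. unfold Cd in *. lra.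
   * rewrite Ephi by auto. destruct (crude z ltac:(lra) ltac:(lra)) as [CR _]. specialize (CR Ez). fold C0 in CR. unfold Cd. lra.
  + intros Az. destruct (crude z ltac:(lra) ltac:(lra)) as [_ CR]. destruct (CR Az) as [C1 C2].
   replace (chint a b F z + twopii * (g z * Ef z) * f z) with (chint a b F z + twopii * F z) by (unfold F; ring). unfold Cd, C0 in *. split; lra.
 - intros z0 A0 F0 z Hz. assert (Hm := Kmu z0 A0 F0). assert (I := Im_close z z0). assert (Iz : b < Im z) by lra.
  assert (Uz : UHP z) by (unfold UHP; lra). assert (Fz : far l delta z).
  { intros p Hp. assert (Up : UHP p) by (destruct (Hl p Hp); unfold UHP; lra). assert (bp : b <= Im p) by apply Hl, Hp.
   assert (L := bl_lip p z0 z Up ltac:(lra) ltac:(lra)). assert (T := Cmod_tri_inv (bl p z0) (bl p z)). specialize (F0 p Hp).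
   assert (Q : 2 / Im p <= 2 / b) by (apply Rmult_le_compat_l; [lra|apply Rinv_le_contravar; lra]). rewrite (Cmod_sub_sym z0 z) in L.
   assert (Q2 : 2 / Im p * Cmod (z - z0) <= 2 / b * (delta * b / 4)).
   { apply Rmult_le_compat; [left; apply Rdiv_lt_0_compat; unfold UHP in Up; lra|lra|auto|lra]. }
   replace (2 / b * (delta * b / 4))%R with (delta / 2)%R in Q2 by (field; lra). lra. }
  assert (NEz : ~ eta1 a b z) by (rewrite eta1_iff by auto; lra). destruct (Kd z0 A0) as [Kd1 _]. destruct (Kd1 z ltac:(lra)) as [UUz Bg].
  assert (Mz : Cmod z <= 2 * r) by (assert (T := Cmod_tri_inv z z0); destruct A0 as [A0 _]; lra). destruct (BE z Mz) as [E1 E2]. split; [auto|].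
  split; [auto|]. split; [intros Q; split; lra|]. split; [apply (chint_hol a b r V); auto|].
  split; [apply (hol_mult U (fun _ => twopii) (fun z => g z * Ef z)); [apply hol_const|apply hol_mult; auto; apply (hol_sub _ (fun _ => True)); auto|auto]|].
  split; [|split; [|split]].
  + rewrite !Cmod_mult, Cmod_twopii. apply Rle_trans with (2 * PI * (/ d * / e0))%R; [|unfold Cd, C0; lra]. apply Rmult_le_compat_l; [lra|]. nra.
  + intros Az. destruct (Kd z Az) as [_ Kd2]. specialize (Kd2 Fz). rewrite !Cmod_mult, Cmod_twopii.
   assert (Q : d * e0 <= Cmod (g z) * Cmod (Ef z)) by nra. assert (0 < d * e0) by nra. nra.
  + intros Q. rewrite Ephi, phi0_out; auto. lra.
  + intros Q. rewrite Ephi, phi0_in; auto. unfold F; ring.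
Qed.

End Cap.

Lemma list_separation (l : list C) (E : C) : exists d, 0 < d /\ forall p, In p l -> p <> E -> d <= Cmod (p - E).
Proof.
 induction l as [|p l (d & Hd & K)]; [exists 1%R; split; [lra|intros q []]|]. destruct (classic (p = E)) as [->|N].
 - exists d; split; auto. intros q [<-|I] Nq; [tauto|auto].
 - exists (Rmin d (Cmod (p - E))). apply csub_neq, Cmod_gt_0 in N. split; [apply Rmin_glb_lt; auto|].
  intros q [<-|I] Nq; [apply Rmin_r|eapply Rle_trans; [apply Rmin_l|auto]].
Qed.

Lemma blist_ge l z m : 0 <= m -> far l m z -> m ^ length l <= Cmod (blist l z).
Proof.
 intros Hm. induction l as [|p l IH]; intros F; simpl; [rewrite Cmod_1; lra|]. rewrite Cmod_mult.
 apply Rmult_le_compat; auto; [apply pow_le; auto|apply F; left; auto|apply IH; intros q Hq; apply F; right; auto].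
Qed.

Lemma exp_pow x n : (exp x ^ n = exp (INR n * x))%R.
Proof. induction n as [|n IH]; [simpl; rewrite Rmult_0_l, exp_0; auto|]. rewrite S_INR. simpl. rewrite IH, <- exp_plus. f_equal. ring. Qed.

(** A conformal map of the upper half-plane onto itself taking the positive imaginary axis to the
    half circle |z| = r; it straightens the arc into the slit of [two_constants]. *)
Definition zmap (r : R) (xi : C) : C := RtoC r * (1 + xi) / (1 - xi).

Lemma zmap_den xi : UHP xi -> 1 - xi <> 0.
Proof. unfold UHP. intros H E. apply (f_equal Im) in E. unfold Im, RtoC, Cminus, Cplus, Copp in *; simpl in *. lra. Qed.

Lemma zmap_sub r xi xi' : UHP xi -> UHP xi' -> zmap r xi - zmap r xi' = RtoC (2 * r) * (xi - xi') / ((1 - xi) * (1 - xi')).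
Proof. intros H H'. unfold zmap. rewrite RtoC_mult. field. split; apply zmap_den; auto. Qed.

Lemma zmap_UHP r xi : 0 < r -> UHP xi -> UHP (zmap r xi).
Proof.
 intros Hr H. assert (N := zmap_den xi H). unfold zmap, UHP.
 replace (RtoC r * (1 + xi) / (1 - xi)) with (RtoC (r / (Cmod (1 - xi) * Cmod (1 - xi))) * ((1 + xi) * Cconj (1 - xi))).
 - assert (ImS : forall k w, Im (RtoC k * w) = (k * Im w)%R) by (intros k [u v]; unfold Im, Cmult, RtoC; simpl; ring). rewrite ImS.
  apply Cmod_gt_0 in N. apply Rmult_lt_0_compat; [apply Rdiv_lt_0_compat; auto; apply Rmult_lt_0_compat; auto|]. destruct xi as [x y]. unfold UHP in *.
  unfold Cmult, Cconj, Cplus, Cminus, Copp, RtoC; simpl in *. lra.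
 - unfold Rdiv. rewrite RtoC_mult, RtoC_inv, <- Cmult_conj_sqr by (apply Cmod_gt_0 in N; nra). field. split; auto. apply Cconj_neq0; auto.
Qed.

Lemma zmap_hol r : hol UHP (zmap r).
Proof.
 apply hol_div; [apply hol_mult; [apply hol_const|apply hol_plus; [apply hol_const|apply hol_id]]|apply hol_minus; [apply hol_const|apply hol_id]|].
 intros z Hz; apply zmap_den; auto.
Qed.

Lemma UHP_Ci y : 0 < y -> UHP (Ci * RtoC y).
Proof. unfold UHP, Ci, RtoC, Cmult, Im; simpl. lra. Qed.

Lemma axis_den y : 0 <= y -> 1 <= Cmod (1 - Ci * RtoC y) <= 1 + y.
Proof.
 split.
 - replace 1%R with (Re (1 - Ci * RtoC y)) at 1 by (unfold Re, Ci, RtoC, Cminus, Cplus, Copp, Cmult; simpl; ring).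
  eapply Rle_trans; [apply Rle_abs|apply Rabs_Re_le].
 - eapply Rle_trans; [apply Cmod_triangle|]. rewrite Cmod_opp, Cmod_1, Cmod_mult, Cmod_Ci, Cmod_R, Rabs_pos_eq by auto. lra.
Qed.

Lemma zmap_axis_dist r y y' : 0 < r -> 0 < y -> 0 < y' ->
  (2 * r / ((1 + y) * (1 + y')) * Rabs (y - y') <= Cmod (zmap r (Ci * RtoC y) - zmap r (Ci * RtoC y')) <= 2 * r * Rabs (y - y'))%R.
Proof.
 intros Hr H H'. rewrite zmap_sub by (apply UHP_Ci; auto). assert (N1 := zmap_den _ (UHP_Ci y H)). assert (N2 := zmap_den _ (UHP_Ci y' H')).
 destruct (axis_den y ltac:(lra)) as [A1 A2]. destruct (axis_den y' ltac:(lra)) as [B1 B2]. rewrite Cmod_div by (apply Cmult_neq_0; auto).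
 rewrite !Cmod_mult, Cmod_R. rewrite (Rabs_pos_eq (2 * r)) by lra.
 replace (Ci * RtoC y - Ci * RtoC y') with (Ci * RtoC (y - y')) by (rewrite RtoC_minus; ring). rewrite Cmod_mult, Cmod_Ci, Cmod_R.
 set (D := (Cmod (1 - Ci * RtoC y) * Cmod (1 - Ci * RtoC y'))%R). assert (D1 : 1 <= D) by (unfold D; nra).
 assert (D2 : D <= (1 + y) * (1 + y')) by (unfold D; apply Rmult_le_compat; lra). pose proof (Rabs_pos (y - y')) as P.
 assert (I1 : / ((1 + y) * (1 + y')) <= / D) by (apply Rinv_le_contravar; lra).
 assert (I2 : / D <= 1) by (rewrite <- Rinv_1; apply Rinv_le_contravar; lra). assert (Q : 0 <= 2 * r * Rabs (y - y')) by nra. split.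
 - nra.
 - nra.
Qed.

(** * The two-constants argument at one end *)

Section End.

Variables (a b r : R) (U : C -> Prop) (g : C -> C) (l : list C).
Hypothesis Ha : 0 < a.
Hypothesis Hb : 0 < b.
Hypothesis Hr : 0 < r.
Hypothesis Hrr : (r * r = a * a + b * b)%R.
Hypothesis HU : openC U.
Hypothesis HcapU : forall z, cap b r z -> U z.
Hypothesis Hg : hol U g.
Hypothesis Hl : forall p, In p l -> on_arc r b p.
Hypothesis HlA : In ((a, b) : C) l.
Hypothesis HlB : In ((- a, b)%R : C) l.
Hypothesis Hlz : forall z, on_arc r b z -> g z = 0 -> In z l.

Variables (y1 sg tau0 : R).
Hypothesis Hy1 : 0 < y1.
Hypothesis Hsg : (sg = 1 \/ sg = -1)%R.
Hypothesis Htau : 0 < tau0.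
Hypothesis Hon : forall t, 0 <= t <= tau0 -> on_arc r b (zmap r (Ci * RtoC (y1 + sg * t))).

(** The Blaschke power weakens the bound on the arc by no more than a multiple of eps0^(- eps):
    [delta] is so small that m0^n >= (3 delta)^eps, while (3 delta)^T is comparable with eps0. *)
Theorem near_end eps e0 : 0 < eps < 1 -> 0 < e0 ->
  exists B r0, 0 < B /\ 0 < r0 /\ forall (Ef f : C -> C) eps0, hol (fun _ => True) Ef ->
    (forall z, Cmod z <= 2 * r -> e0 <= Cmod (Ef z) <= / e0) ->
    hol UHP f -> (forall z, UHP z -> Cmod (f z) <= 1) -> 0 < eps0 <= 1 ->
    (forall x : R, (Cmod (chint a b (fun z => g z * Ef z * f z)%C (RtoC x)) <= eps0)%R) ->
    forall xi, UHP xi -> Cmod (xi - Ci * RtoC y1) < r0 -> Cmod (f (zmap r xi)) <= B * exp ((1/2 - eps) * ln eps0).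
Proof.
 intros Heps He0. set (E := zmap r (Ci * RtoC y1)). destruct (list_separation l E) as (rho1 & Hrho1 & Ksep). set (rho0 := (rho1 / 2)%R).
 assert (Prho : 0 < rho0 / (2 * r)) by (unfold rho0; apply Rdiv_lt_0_compat; lra).
 destruct (pos_min4 tau0 (y1/2) (rho0 / (2 * r)) 1) as (tau1 & Ht1 & t1 & t2 & t3 & _); [lra..|]. apply Rle_div_r in t3; [|lra].
 (* Makes 5 sqrt (2 d) <= eps sqrt (tau1 - d), so that [two_constants] costs a factor 1 - eps in the
    exponent at most. *)
 set (d := (eps * eps * tau1 / 64)%R). assert (Hee : 0 < eps * eps < 1) by nra. assert (Hd : 0 < d) by (unfold d; nra).
 (* [m0] bounds from below the pseudohyperbolic distance from arc points with parameter t >= d to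
    all removed points, the end itself included. *)
 assert (Hd2 : d <= tau1 / 64) by (unfold d; nra). set (m0 := Rmin (1/2) (Rmin rho0 (2 * r / ((1 + 2 * y1) * (1 + y1)) * d) / (2 * r))).
 assert (Pm1 : 0 < 2 * r / ((1 + 2 * y1) * (1 + y1)) * d) by (apply Rmult_lt_0_compat; auto; apply Rdiv_lt_0_compat; nra).
 assert (Hm0 : 0 < m0) by (unfold m0; apply Rmin_glb_lt; [lra|apply Rdiv_lt_0_compat; [apply Rmin_glb_lt; unfold rho0; lra|lra]]).
 assert (m0h : m0 <= 1/2) by apply Rmin_l. assert (m0b : (m0 * (2 * r) <= Rmin rho0 (2 * r / ((1 + 2 * y1) * (1 + y1)) * d))%R).
 { apply Rle_trans with (Rmin rho0 (2 * r / ((1 + 2 * y1) * (1 + y1)) * d) / (2 * r) * (2 * r))%R; [apply Rmult_le_compat_r; [lra|apply Rmin_r]|right; field; lra]. }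
 set (pt := fun t => zmap r (Ci * RtoC (y1 + sg * t))).
 assert (ypos : forall t, 0 <= t <= tau1 -> y1 / 2 <= y1 + sg * t <= 2 * y1) by (intros t Ht; destruct Hsg as [-> | ->]; lra).
 assert (far0 : forall t, d <= t <= tau1 -> far l m0 (pt t)).
 { intros t Ht p Hp. assert (Y := ypos t ltac:(lra)). assert (On := Hon t ltac:(lra)). fold (pt t) in On.
  destruct (zmap_axis_dist r (y1 + sg * t) y1 Hr ltac:(lra) Hy1) as [D1 D2]. fold (pt t) E in D1, D2. assert (At : Rabs (y1 + sg * t - y1) = t).
  { replace (y1 + sg * t - y1)%R with (sg * t)%R by ring. destruct Hsg as [-> | ->]; [rewrite Rabs_pos_eq; lra|rewrite Rabs_left; lra]. }
  rewrite At in D1, D2. assert (dist : m0 * (2 * r) <= Cmod (pt t - p)).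
  { eapply Rle_trans; [apply m0b|]. destruct (classic (p = E)) as [->|N].
   - eapply Rle_trans; [apply Rmin_r|]. eapply Rle_trans; [|apply D1].
    apply Rle_trans with (2 * r / ((1 + 2 * y1) * (1 + y1)) * t)%R; [apply Rmult_le_compat_l; [left; apply Rdiv_lt_0_compat; nra|lra]|].
    apply Rmult_le_compat_r; [lra|]. unfold Rdiv. apply Rmult_le_compat_l; [lra|]. apply Rinv_le_contravar; nra.
   - eapply Rle_trans; [apply Rmin_l|]. specialize (Ksep p Hp N). assert (T := Cmod_tri3 p (pt t) E). rewrite (Cmod_sub_sym p (pt t)) in T.
    assert (2 * r * t <= 2 * r * tau1) by (apply Rmult_le_compat_l; lra). unfold rho0 in *. lra. }
  assert (Ip : UHP p) by (destruct (Hl p Hp); unfold UHP; lra). assert (Iz : 0 <= Im (pt t)) by (destruct On; lra).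
  assert (N := bl_den p (pt t) Ip Iz). unfold bl. rewrite Cmod_div by auto. apply Cmod_gt_0 in N. assert (up : Cmod (pt t - Cconj p) <= 2 * r).
  { unfold Cminus. eapply Rle_trans; [apply Cmod_triangle|]. rewrite Cmod_opp, Cmod_conj. destruct On as [-> _], (Hl p Hp) as [-> _]. lra. }
  apply (Rmult_le_reg_r (Cmod (pt t - Cconj p))); auto. unfold Rdiv. rewrite Rmult_assoc, Rinv_l, Rmult_1_r by lra. eapply Rle_trans; [|apply dist].
  apply Rmult_le_compat_l; lra. }
 set (n := length l). set (lm := (- ln m0)%R). assert (Hlm : 0 < lm).
 { unfold lm. assert (ln m0 < ln 1) by (apply ln_increasing; lra). rewrite ln_1 in H. lra. }
 (* The last term gives n lm <= eps lam; the term lm gives 2 delta <= m0. *)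
 set (lam := (ln 6 + lm + INR n * lm / eps)%R). assert (L6 : 0 < ln 6) by (rewrite <- ln_1; apply ln_increasing; lra).
 assert (Pn : 0 <= INR n * lm / eps) by (apply Rdiv_le_0_compat; [apply Rmult_le_pos; [apply pos_INR|lra]|lra]).
 assert (Hlam : 0 < lam) by (unfold lam; lra). set (delta := (exp (- lam) / 3)%R).
 assert (Hdelta : 0 < delta) by (unfold delta; assert (H := exp_pos (- lam)); lra).
 assert (D3 : (3 * delta = exp (- lam))%R) by (unfold delta; field). assert (dm : 2 * delta <= m0).
 { assert (Q : exp (- lam) <= exp (- lm)) by (apply exp_le; unfold lam; lra). unfold lm in Q. rewrite Ropp_involutive, exp_ln in Q by auto. lra. }
 destruct (slit_exists a b r U g l Ha Hb Hr Hrr HU HcapU Hg Hl HlA HlB Hlz delta e0 Hdelta He0) as (Cd & rho & kappa & HCd & Hrho & Hkappa & Hex).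
 set (KK := (16 / kappa * exp (slit_K r Cd rho kappa))%R).
 assert (HKK : 0 < KK) by (unfold KK; apply Rmult_lt_0_compat; [apply Rdiv_lt_0_compat; lra|apply exp_pos]). set (lC := (2 * ln Cd)%R).
 assert (HlC : 0 <= lC).
 { unfold lC. destruct (Rle_lt_or_eq_dec _ _ HCd) as [Q|<-]; [|rewrite ln_1; lra]. assert (ln 1 < ln Cd) by (apply ln_increasing; lra).
  rewrite ln_1 in H. lra. }
 set (b1 := (Rmax 0 (ln KK) + eps * (lC + lam))%R). assert (Hb1 : 0 <= b1).
 { unfold b1. assert (M := Rmax_l 0 (ln KK)). assert (0 <= eps * (lC + lam)) by (apply Rmult_le_pos; lra). lra. }
 exists (exp (b1 / 2)), d. split; [apply exp_pos|]. split; auto. intros Ef f eps0 HE BE Hf Bf He HB xi Uxi Dxi.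
 destruct (Hex Ef f eps0 HE BE Hf Bf ltac:(lra) HB) as (phi & phr & c & HS). set (le := (- ln eps0)%R). assert (Hle : 0 <= le).
 { unfold le. destruct (Rle_lt_or_eq_dec _ _ (proj2 He)) as [Q| ->]; [|rewrite ln_1; lra]. assert (ln eps0 < ln 1) by (apply ln_increasing; lra).
  rewrite ln_1 in H. lra. }
 (* [T] exceeds (lC + le) / lam by at most 1, which keeps the loss exp (eps T lam) below a constant
    times eps0^(- eps). *)
 destruct (nfloor_ex ((lC + le) / lam)%R) as (T0 & HT0); [apply Rdiv_le_0_compat; lra|]. set (T := S T0). assert (HT1 : lC + le <= INR T * lam).
 { unfold T. rewrite S_INR. apply Rle_trans with ((lC + le) / lam * lam)%R; [right; field; lra|]. apply Rmult_le_compat_r; lra. }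
 assert (HT2 : INR T * lam <= lC + le + lam).
 { unfold T. rewrite S_INR. assert (INR T0 * lam <= (lC + le) / lam * lam) by (apply Rmult_le_compat_r; lra).
  replace ((lC + le) / lam * lam)%R with (lC + le)%R in H by (field; lra). lra. }
 assert (HT : Cd * Cd * (3 * delta) ^ T <= eps0).
 { rewrite D3, exp_pow.
  replace (Cd * Cd)%R with (exp lC) by (unfold lC; replace (2 * ln Cd)%R with (ln Cd + ln Cd)%R by ring; rewrite exp_plus, exp_ln; lra).
  rewrite <- exp_plus. rewrite <- (exp_ln eps0) at 1 by lra. apply exp_le. unfold le in *. lra. }
 set (L := Rmax 0 (((1 - eps) * le - b1) / 2)). assert (L0 : 0 <= L) by apply Rmax_l.
 assert (L1 : ((1 - eps) * le - b1) / 2 <= L) by apply Rmax_r. assert (arcb : forall t, d <= t <= tau1 -> Cmod (f (pt t)) <= exp (- L)).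
 { intros t Ht. assert (On := Hon t ltac:(lra)). fold (pt t) in On. assert (Ft := far0 t Ht).
  assert (Upt : UHP (pt t)) by (destruct On; unfold UHP; lra). unfold L. unfold Rmax.
  destruct (Rle_dec 0 (((1 - eps) * le - b1) / 2)) as [Q|Q]; [|rewrite Ropp_0, exp_0; auto].
  assert (SB := slit_bound r b eps0 delta Cd rho kappa l f phi phr c T).
  assert (br' : b <= r) by (assert (H : b < r) by (apply (br a b r); auto); lra).
  specialize (SB ltac:(lra) Hl Hdelta Hrho Hkappa HCd He HS HT (pt t) On). specialize (SB ltac:(intros p Hp; specialize (Ft p Hp); lra)).
  fold KK in SB. assert (BL : exp (- eps * (INR T * lam)) <= Cmod (blist l (pt t)) ^ T).
  { apply Rle_trans with ((m0 ^ n) ^ T)%R.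
   - rewrite <- (exp_ln m0) by auto. rewrite !exp_pow. apply exp_le. fold n.
    replace (INR T * (INR n * ln m0))%R with (- INR T * (INR n * lm))%R by (unfold lm; ring).
    assert (INR n * lm <= eps * lam); [|assert (H2 := pos_INR T); nra]. unfold lam.
    replace (eps * (ln 6 + lm + INR n * lm / eps))%R with (eps * (ln 6 + lm) + INR n * lm)%R by (field; lra).
    assert (0 <= eps * (ln 6 + lm)) by (apply Rmult_le_pos; lra). lra.
   - apply pow_incr. split; [apply pow_le; lra|]. apply blist_ge; [lra|auto]. }
  assert (SQ : Cmod (f (pt t)) * Cmod (f (pt t)) <= KK * eps0 * exp (eps * (INR T * lam))).
  { pose proof (Cmod_ge_0 (f (pt t))) as P. assert (EP := exp_pos (eps * (INR T * lam))).
   assert (E1 : (exp (- eps * (INR T * lam)) * exp (eps * (INR T * lam)) = 1)%R) by (rewrite <- exp_plus; replace (- eps * (INR T * lam) + eps * (INR T * lam))%R with 0%R by ring; apply exp_0).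
   set (p := (Cmod (f (pt t)) * Cmod (f (pt t)))%R) in *. assert (Pp : 0 <= p) by (unfold p; nra).
   replace p with (p * exp (- eps * (INR T * lam)) * exp (eps * (INR T * lam)))%R by (rewrite Rmult_assoc, E1; ring). apply Rmult_le_compat_r; [lra|].
   eapply Rle_trans; [|apply SB]. apply Rmult_le_compat_l; auto. }
  assert (SQ2 : KK * eps0 * exp (eps * (INR T * lam)) <= exp (- (((1 - eps) * le - b1) / 2)) * exp (- (((1 - eps) * le - b1) / 2))).
  { rewrite <- exp_plus. rewrite <- (exp_ln KK), <- (exp_ln eps0) by lra. rewrite <- !exp_plus. apply exp_le. assert (M := Rmax_r 0 (ln KK)).
   unfold b1. assert (eps * (INR T * lam) <= eps * (lC + le + lam)) by (apply Rmult_le_compat_l; lra). unfold le in *. lra. }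
  apply Rsqr_incr_0_var; [unfold Rsqr; lra|left; apply exp_pos]. }
 (* The slit begins at parameter d, where the bound on the arc is available, and [xi] is within 2 d
    of its tip. *)
 set (al := (y1 + sg * d)%R). set (R0 := sqrt (tau1 - d)). assert (RR : (R0 * R0 = tau1 - d)%R) by (apply sqrt_sqrt; lra).
 assert (HR0 : 0 < R0) by (apply sqrt_lt_R0; lra). assert (Yal := ypos d ltac:(lra)). fold al in Yal.
 assert (Hcomp : hol UHP (fun w => f (zmap r w))) by (apply (hol_comp UHP UHP); auto; [apply zmap_hol|intros z Hz; apply zmap_UHP; auto]).
 assert (TC := two_constants al sg R0 L (fun w => f (zmap r w)) HR0 ltac:(lra) Hsg L0 Hcomp (fun z Hz => Bf _ (zmap_UHP r z Hr Hz))).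
 assert (Bseg : forall s, 0 <= s <= R0 * R0 -> (Cmod (f (zmap r (Ci * RtoC (al + sg * s))%C)) <= exp (- L))%R).
 { intros s Hs. replace (al + sg * s)%R with (y1 + sg * (d + s))%R by (unfold al; ring). apply arcb. lra. }
 assert (T1 : Cmod (xi - Ci * RtoC al) <= 2 * d).
 { assert (T1 := Cmod_tri3 xi (Ci * RtoC y1) (Ci * RtoC al)).
  replace (Ci * RtoC y1 - Ci * RtoC al) with (Ci * RtoC (y1 - al)) in T1 by (rewrite RtoC_minus; ring). rewrite Cmod_mult, Cmod_Ci, Cmod_R in T1.
  assert (Rabs (y1 - al) = d)%R; [|lra]. unfold al. replace (y1 - (y1 + sg * d))%R with (- (sg * d))%R by ring. rewrite Rabs_Ropp.
  destruct Hsg as [-> | ->]; [rewrite Rabs_pos_eq; lra|rewrite Rabs_left; lra]. }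
 set (q := sqrt (Cmod (xi - Ci * RtoC al))). assert (q0 : 0 <= q) by apply sqrt_pos.
 assert (qq : (q * q = Cmod (xi - Ci * RtoC al))%R) by apply sqrt_sqrt, Cmod_ge_0.
 assert (q2 : 5 * q <= eps * R0) by (apply Rsqr_incr_0_var; unfold Rsqr, d in *; nra). eapply Rle_trans; [apply (TC Bseg xi q); [nra|auto]|].
 (* The two losses combine to (1 - eps)^2 / 2 >= 1/2 - eps. *)
 rewrite <- exp_plus. apply exp_le. assert (Q1 : L * (1 - eps) <= L * (1 - 5 * q / R0)).
 { apply Rmult_le_compat_l; auto. assert (5 * q / R0 <= eps); [|lra]. apply Rle_div_l; lra. }
 assert (Q2 : ((1 - eps) * le - b1) / 2 * (1 - eps) <= L * (1 - eps)) by (apply Rmult_le_compat_r; lra).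
 assert (Q3 : 0 <= eps * eps * le) by (apply Rmult_le_pos; lra). assert (Q4 : 0 <= eps * b1) by (apply Rmult_le_pos; lra). fold le in Q3.
 replace (ln eps0) with (- le)%R by (unfold le; ring). nra.
Qed.

End End.

Lemma zmap_axis r y : zmap r (Ci * RtoC y) = ((r * (1 - y * y) / (1 + y * y))%R, (2 * r * y / (1 + y * y))%R).
Proof.
 assert (P : 0 < 1 + y * y) by nra. assert (N : 1 - Ci * RtoC y <> 0).
 { intros E. apply (f_equal Re) in E. unfold Re, Ci, RtoC, Cminus, Cplus, Copp, Cmult in E; simpl in E. lra. }
 set (w := ((r * (1 - y * y) / (1 + y * y))%R, (2 * r * y / (1 + y * y))%R) : C). assert (E : w * (1 - Ci * RtoC y) = RtoC r * (1 + Ci * RtoC y)).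
 { unfold w, Ci, RtoC, Cminus, Cplus, Copp, Cmult; simpl. f_equal; field; lra. }
 unfold zmap. rewrite <- E. field. auto.
Qed.

Lemma arc_point_sqrt a b r z : 0 < a -> 0 < b -> 0 < r -> (r * r = a * a + b * b)%R -> on_arc r b z ->
  (- a <= Re z <= a) /\ z = (Re z, sqrt (r * r - Re z * Re z)).
Proof.
 intros Ha Hb Hr Hrr [A B]. assert (S := Cmod_sqr z). rewrite A in S. split; [nra|]. rewrite S.
 replace (Re z * Re z + Im z * Im z - Re z * Re z)%R with (Im z * Im z)%R by ring. rewrite sqrt_square by lra. destruct z; reflexivity.
Qed.

Lemma rcont_arc a b r : 0 < b -> (r * r = a * a + b * b)%R -> rcont_on (fun t => (t, sqrt (r * r - t * t)) : C) (- a) a.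
Proof.
 intros Hb Hrr s Hs. assert (P : 0 < r * r - s * s) by nra. assert (CX : continuity_pt (fun t => sqrt (r * r - t * t)) s).
 { apply (continuity_pt_comp (fun t => (r * r - t * t)%R) sqrt); [reg|apply continuity_pt_sqrt; lra]. }
 intros e He. destruct (CX (e/2)%R) as (d & Hd & K); [lra|]. exists (Rmin d (e/2)). split; [apply Rmin_glb_lt; lra|]. intros t Ht.
 destruct (Rmin_Rgt_l _ _ _ Ht) as [T1 T2]. eapply Rle_lt_trans; [apply Cmod_le_Re_Im|].
 change (Re ((t, sqrt (r * r - t * t)) - (s, sqrt (r * r - s * s)))) with (t - s)%R.
 change (Im ((t, sqrt (r * r - t * t)) - (s, sqrt (r * r - s * s)))) with (sqrt (r * r - t * t) - sqrt (r * r - s * s))%R.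
 destruct (Req_dec t s) as [->|N].
 - rewrite !Rminus_diag, Rabs_R0. lra.
 - assert (Rabs (sqrt (r * r - t * t) - sqrt (r * r - s * s)) < e/2); [|lra]. apply K. split; [split; [exact I|auto]|exact T1].
Qed.

(** * Zeros on the arc and the estimate at both ends *)

Section Ends.

Variables (a b r : R) (U : C -> Prop) (g : C -> C).
Hypothesis Ha : 0 < a.
Hypothesis Hb : 0 < b.
Hypothesis Hr : 0 < r.
Hypothesis Hrr : (r * r = a * a + b * b)%R.
Hypothesis HU : openC U.
Hypothesis HcapU : forall z, cap b r z -> U z.
Hypothesis Hg : hol U g.
Hypothesis Hg0 : g (0%R, b) <> 0.

(** Otherwise the identity theorem along the chord would make g vanish at its midpoint. *)
Lemma not_zero_near_end sg : (sg = 1 \/ sg = -1)%R -> ~ zero_near g ((sg * a)%R, b).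
Proof.
 intros Hs Z. apply Hg0. assert (ZN : zero_near g ((sg * (- 0))%R, b)).
 { apply (zero_near_path g U (fun t => ((sg * - t)%R, b)) (- a) 0); auto; try lra.
  - intros t _. apply rcont_ext with (fun t => (0%R, b) + RtoC t * RtoC (- sg)); [|apply rcont_affine]. intros u. unfold RtoC, Cplus, Cmult; simpl.
   f_equal; ring.
  - intros t Ht. apply HcapU, (chord_cap a b r); auto. nra.
  - rewrite Ropp_involutive. exact Z. }
 replace (sg * - 0)%R with 0%R in ZN by ring. destruct ZN as (d & Hd & K). apply K, cball_center; auto.
Qed.

(** The arc is a graph over [- a, a], and g does not vanish identically near an end, so it has
    finitely many zeros on the arc. *)
Lemma arc_zeros : exists l, (forall p, In p l -> on_arc r b p) /\ In ((a, b) : C) l /\ In ((- a, b)%R : C) l /\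
  forall z, on_arc r b z -> g z = 0 -> In z l.
Proof.
 assert (Eb : sqrt (r * r - a * a) = b) by (rewrite Hrr; replace (a * a + b * b - a * a)%R with (b * b)%R by ring; apply sqrt_square; lra).
 assert (arcI : forall t, - a <= t <= a -> on_arc r b (t, sqrt (r * r - t * t))).
 { intros t Ht. assert (P : 0 <= r * r - t * t) by nra. split.
  - apply Rsqr_inj; [apply Cmod_ge_0|lra|]. unfold Rsqr. rewrite Cmod_sqr. unfold Re, Im; simpl. rewrite sqrt_sqrt by auto. ring.
  - rewrite <- Eb. apply sqrt_le_1; nra. }
 destruct (finite_zeros_path g U (fun t => (t, sqrt (r * r - t * t))) (- a) a HU Hg ltac:(lra) (rcont_arc a b r Hb Hrr)) as (l & Hl).
 - intros t Ht. apply HcapU. destruct (arcI t Ht). split; lra.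
 - rewrite Eb. replace a with (1 * a)%R by ring. apply not_zero_near_end; auto.
 - set (l' := filter (fun z => if dec (on_arc r b z) then true else false) l). assert (Fl : forall z, In z l' <-> In z l /\ on_arc r b z).
  { intros z. unfold l'. rewrite filter_In. destruct (dec (on_arc r b z)); intuition congruence. }
  exists (((a, b) : C) :: ((- a, b)%R : C) :: l'). split; [|split; [|split]].
  + intros p [<-|[<-|I]]; [| |apply Fl, I].
   * assert (Q := arcI a ltac:(lra)). rewrite Eb in Q. exact Q.
   * assert (Q := arcI (- a)%R ltac:(lra)). replace (- a * - a)%R with (a * a)%R in Q by ring. rewrite Eb in Q. exact Q.
  + left; auto.
  + right; left; auto.
  + intros z Az Zz. right; right. apply Fl. split; auto. destruct (arc_point_sqrt a b r z Ha Hb Hr Hrr Az) as [R1 E]. rewrite E. apply Hl; auto.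
   rewrite <- E; auto.
Qed.

Theorem ends_small eps e0 : 0 < eps < 1 -> 0 < e0 ->
  exists B r0, 0 < B /\ 0 < r0 /\ forall (Ef f : C -> C) eps0, hol (fun _ => True) Ef ->
    (forall z, Cmod z <= 2 * r -> e0 <= Cmod (Ef z) <= / e0) ->
    hol UHP f -> (forall z, UHP z -> Cmod (f z) <= 1) -> 0 < eps0 <= 1 ->
    (forall x : R, (Cmod (chint a b (fun z => g z * Ef z * f z)%C (RtoC x)) <= eps0)%R) ->
    forall z, UHP z -> (Cmod (z - (a, b)) < r0) \/ (Cmod (z - (- a, b)%R) < r0) -> Cmod (f z) <= B * exp ((1/2 - eps) * ln eps0).
Proof.
 (* [yA] and [yB] are the preimages of the two ends under [zmap]: the tangents of half their
    arguments. *)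
 intros Heps He0. destruct arc_zeros as (l & Hl & HlA & HlB & Hlz). assert (ar : a < r) by nra. set (yA := (b / (r + a))%R).
 set (yB := (b / (r - a))%R). assert (YA : (yA * (r + a) = b)%R) by (unfold yA; field; lra).
 assert (YB : (yB * (r - a) = b)%R) by (unfold yB; field; lra). assert (PA : 0 < yA) by nra. assert (PB : 0 < yB) by nra.
 assert (YS : ((yA + yB) * b = 2 * r)%R).
 { nra. }
 (* On the half circle Im >= b means (y - yA) (yB - y) >= 0, since yA yB = 1 and yA + yB = 2 r /
    b. *)
 assert (Lt : yA < yB) by nra. assert (On : forall y, yA <= y <= yB -> on_arc r b (zmap r (Ci * RtoC y))).
 { intros y Hy. rewrite zmap_axis. assert (P : 0 < 1 + y * y) by nra. split.
  - apply Rsqr_inj; [apply Cmod_ge_0|lra|]. unfold Rsqr. rewrite Cmod_sqr. unfold Re, Im; simpl. field. lra.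
  - unfold Im; simpl. apply (Rmult_le_reg_r (1 + y * y)); auto. unfold Rdiv. rewrite Rmult_assoc, Rinv_l by lra.
   assert (0 <= (y - yA) * (yB - y)) by nra. nra. }
 assert (EA : zmap r (Ci * RtoC yA) = (a, b)).
 { rewrite zmap_axis. assert (P : 0 < 1 + yA * yA) by nra.
  f_equal; apply (Rmult_eq_reg_r (1 + yA * yA)); try lra; unfold Rdiv; rewrite Rmult_assoc, Rinv_l, Rmult_1_r by lra.
  - nra.
  - nra. }
 assert (EB : zmap r (Ci * RtoC yB) = (- a, b)%R).
 { rewrite zmap_axis. assert (P : 0 < 1 + yB * yB) by nra. assert (Q : (yB * yB * (r - a) = r + a)%R).
  { nra. }
  f_equal; apply (Rmult_eq_reg_r (1 + yB * yB)); try lra; unfold Rdiv; rewrite Rmult_assoc, Rinv_l, Rmult_1_r by lra; apply (Rmult_eq_reg_l (r - a)); try lra.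
  - nra.
  - nra. }
 destruct (near_end a b r U g l Ha Hb Hr Hrr HU HcapU Hg Hl HlA HlB Hlz yA 1 (yB - yA) PA (or_introl eq_refl) ltac:(lra)) with (eps := eps) (e0 := e0) as (B1 & r1 & HB1 & Hr1 & K1); auto.
 { intros t Ht. apply On. lra. }
 destruct (near_end a b r U g l Ha Hb Hr Hrr HU HcapU Hg Hl HlA HlB Hlz yB (-1) (yB - yA) PB (or_intror eq_refl) ltac:(lra)) with (eps := eps) (e0 := e0) as (B2 & r2 & HB2 & Hr2 & K2); auto.
 { intros t Ht. apply On. lra. }
 (* Near an end the inverse of [zmap] expands distances by the factor 4 r / b^2 at most. *)
 set (r0 := Rmin (b/2) (Rmin r1 r2 * (b * b / (4 * r)))). assert (Pb4 : 0 < b * b / (4 * r)) by (apply Rdiv_lt_0_compat; nra).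
 assert (Hm : 0 < Rmin r1 r2) by (apply Rmin_glb_lt; auto). exists (B1 + B2)%R, r0. split; [lra|]. split; [apply Rmin_glb_lt; [lra|nra]|].
 intros Ef f eps0 HE BE Hf Bf He HB z Uz Dz. assert (R1 : r0 <= b/2) by apply Rmin_l.
 assert (R2 : r0 <= Rmin r1 r2 * (b * b / (4 * r))) by apply Rmin_r.
 assert (inv : forall y E, 0 < y -> zmap r (Ci * RtoC y) = E -> Im E = b -> Cmod (z - E) < r0 -> UHP ((z - RtoC r) / (z + RtoC r)) /\ zmap r ((z - RtoC r) / (z + RtoC r)) = z /\ Cmod ((z - RtoC r) / (z + RtoC r) - Ci * RtoC y) < Rmin r1 r2).
 { intros y E Hy EE IE DE. assert (Uy := UHP_Ci y Hy). assert (N1 := zmap_den _ Uy). assert (UHden : forall v, UHP v -> v + RtoC r <> 0).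
  { intros v Hv Q. apply (f_equal Im) in Q. unfold UHP, Im, Cplus, RtoC in *; simpl in *. lra. }
  assert (Nz := UHden z Uz). assert (UE : UHP E) by (unfold UHP; lra). assert (NE := UHden E UE).
  assert (Rn : RtoC r <> 0) by (intros Q; apply RtoC_inj in Q; lra). assert (Ey : Ci * RtoC y = (E - RtoC r) / (E + RtoC r)).
  { rewrite <- EE in NE |- *. unfold zmap in *. field. split; [exact N1|].
   replace (RtoC r * (1 + Ci * y) + RtoC r * (1 - Ci * y)) with (RtoC r * RtoC 2) by ring. apply Cmult_neq_0; auto. intros Q; apply RtoC_inj in Q; lra. }
  split; [|split].
  - unfold UHP. replace ((z - RtoC r) / (z + RtoC r)) with (RtoC (/ (Cmod (z + RtoC r) * Cmod (z + RtoC r))) * ((z - RtoC r) * Cconj (z + RtoC r))).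
   + assert (ImS : forall k w, Im (RtoC k * w) = (k * Im w)%R) by (intros k [u v]; unfold Im, Cmult, RtoC; simpl; ring). rewrite ImS.
    apply Cmod_gt_0 in Nz. apply Rmult_lt_0_compat; [apply Rinv_0_lt_compat; nra|]. destruct z as [u v]. unfold UHP in Uz. simpl in Uz.
    unfold Im, Cmult, Cconj, Cplus, Cminus, Copp, RtoC; simpl. nra.
   + rewrite RtoC_inv, <- Cmult_conj_sqr by (apply Cmod_gt_0 in Nz; nra). field. split; auto. apply Cconj_neq0; auto.
  - unfold zmap. field. split; auto. replace (z + r - (z - r)) with (RtoC r * RtoC 2) by ring. apply Cmult_neq_0; auto.
   intros Q; apply RtoC_inj in Q; lra.
  - rewrite Ey.
   replace ((z - RtoC r) / (z + RtoC r) - (E - RtoC r) / (E + RtoC r)) with (RtoC (2 * r) * (z - E) / ((z + RtoC r) * (E + RtoC r))) by (rewrite RtoC_mult; field; auto).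
   rewrite Cmod_div by (apply Cmult_neq_0; auto). rewrite !Cmod_mult, Cmod_R, Rabs_pos_eq by lra. assert (I := Im_close z E).
   assert (G1 : b / 2 <= Cmod (z + RtoC r)).
   { eapply Rle_trans; [|apply Rabs_Im_le]. eapply Rle_trans; [|apply Rle_abs].
    replace (Im (z + RtoC r)) with (Im z) by (unfold Im, Cplus, RtoC; simpl; ring). lra. }
   assert (G2 : b <= Cmod (E + RtoC r)).
   { eapply Rle_trans; [|apply Rabs_Im_le]. eapply Rle_trans; [|apply Rle_abs].
    replace (Im (E + RtoC r)) with (Im E) by (unfold Im, Cplus, RtoC; simpl; ring). lra. }
   assert (G3 : b / 2 * b <= Cmod (z + RtoC r) * Cmod (E + RtoC r)) by nra. apply (Rmult_lt_reg_r (Cmod (z + RtoC r) * Cmod (E + RtoC r))); [nra|].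
   unfold Rdiv. rewrite Rmult_assoc, Rinv_l by nra. apply Rlt_le_trans with (2 * r * (Rmin r1 r2 * (b * b / (4 * r))))%R; [nra|].
   replace (2 * r * (Rmin r1 r2 * (b * b / (4 * r))))%R with (Rmin r1 r2 * (b / 2 * b))%R by (field; lra). nra. }
 assert (X := exp_pos ((1/2 - eps) * ln eps0)). destruct Dz as [Dz|Dz].
 - destruct (inv yA _ PA EA eq_refl Dz) as (I1 & I2 & I3). specialize (K1 Ef f eps0 HE BE Hf Bf He HB _ I1 (proj1 (Rmin_Rgt_l _ _ _ I3))).
  rewrite I2 in K1. nra.
 - destruct (inv yB _ PB EB eq_refl Dz) as (I1 & I2 & I3). specialize (K2 Ef f eps0 HE BE Hf Bf He HB _ I1 (proj2 (Rmin_Rgt_l _ _ _ I3))).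
  rewrite I2 in K2. nra.
Qed.

End Ends.

Open Scope R_scope.

(** * Quadrature in the quantile variable *)

Lemma is_derive_nonneg_le (f f' : R -> R) u v : u <= v -> (forall s, u <= s <= v -> is_derive f s (f' s) /\ 0 <= f' s) -> f u <= f v.
Proof.
 intros Huv H. destruct (MVT_gen f u v f') as (c & Hc & E).
 - intros s Hs. rewrite Rmin_left, Rmax_right in Hs by lra. apply H; lra.
 - intros s Hs. rewrite Rmin_left, Rmax_right in Hs by lra. apply continuity_pt_filterlim, (ex_derive_continuous (V := R_NormedModule)). exists (f' s).
  apply H; lra.
 - rewrite Rmin_left, Rmax_right in Hc by lra. destruct (H c Hc). nra.
Qed.

Lemma derive_dominated (f f' h h' : R -> R) u v : u <= v ->
  (forall s, u <= s <= v -> is_derive f s (f' s) /\ is_derive h s (h' s) /\ Rabs (f' s) <= h' s) -> Rabs (f v - f u) <= h v - h u.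
Proof.
 intros Huv H. assert (A : h u - f u <= h v - f v).
 { apply (is_derive_nonneg_le (fun s => h s - f s) (fun s => h' s - f' s)); auto. intros s Hs. destruct (H s Hs) as (A & B & D).
  split; [apply (is_derive_minus (V := R_NormedModule)); auto|]. assert (Q := Rle_abs (f' s)). lra. }
 assert (B : h u + f u <= h v + f v).
 { apply (is_derive_nonneg_le (fun s => h s + f s) (fun s => h' s + f' s)); auto. intros s Hs. destruct (H s Hs) as (B & D & E).
  split; [apply (is_derive_plus (V := R_NormedModule)); auto|]. assert (Q := Rle_abs (- f' s)). rewrite Rabs_Ropp in Q. lra. }
 apply Rabs_le. lra.
Qed.

Section Cell.

Variables (p F q q' : R -> R) (t0 s1 t1 N : R).
Hypothesis Ht : t0 <= s1 <= t1.
Hypothesis HN : 0 < N.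
Hypothesis Hp : forall s, t0 <= s <= t1 -> continuous p s /\ 0 <= p s /\ is_derive F s (p s).
Hypothesis Hq : forall s, t0 <= s <= t1 -> is_derive q s (q' s).
Hypothesis HF0 : F s1 - F t0 = / (2 * N).
Hypothesis HF1 : F t1 - F s1 = / (2 * N).

Lemma cell_int : is_RInt p t0 t1 (/ N).
Proof.
 replace (/ N) with (minus (F t1) (F t0)).
 - apply (is_RInt_derive (V := R_CompleteNormedModule)); intros s Hs; rewrite Rmin_left, Rmax_right in Hs by lra; apply Hp; auto.
 - change (F t1 - F t0 = / N). replace (F t1 - F t0) with ((F t1 - F s1) + (F s1 - F t0)) by ring. rewrite HF0, HF1. field. lra.
Qed.

Lemma q_cont s : t0 <= s <= t1 -> continuous q s.
Proof. intros Hs. apply (ex_derive_continuous (V := R_NormedModule)). exists (q' s). auto. Qed.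

(** [s1] halves the mass of the cell, so p (F - F s1) integrates to 0 and the part of q that is
    linear in F drops out. *)
Lemma cell_weighted (e : R -> R) k M : (forall s, t0 <= s <= t1 -> q s1 - q s = k * (F s1 - F s) + e s /\ Rabs (e s) <= M) ->
  Rabs (q s1 - N * RInt (fun s => p s * q s) t0 t1) <= M.
Proof.
 intros He. assert (I := cell_int). assert (ex : ex_RInt (fun s => p s * q s) t0 t1).
 { apply (ex_RInt_continuous (V := R_CompleteNormedModule)). intros s Hs. rewrite Rmin_left, Rmax_right in Hs by lra.
  apply (continuous_mult (K := R_AbsRing)); [apply Hp; auto|apply q_cont; auto]. }
 assert (I2 := RInt_correct (V := R_CompleteNormedModule) _ _ _ ex). assert (I3 : is_RInt (fun s => p s * (F s - F s1)) t0 t1 0).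
 { replace 0 with (minus ((F t1 - F s1) * (F t1 - F s1) / 2) ((F t0 - F s1) * (F t0 - F s1) / 2)).
  - apply (is_RInt_derive (V := R_CompleteNormedModule) (fun s => (F s - F s1) * (F s - F s1) / 2)); intros s Hs; rewrite Rmin_left, Rmax_right in Hs by lra; destruct (Hp s Hs) as (C1 & P1 & D1).
   + auto_derive; [repeat split; exists (p s); auto|]. replace (Derive (fun x => F x) s) with (p s) by (symmetry; apply is_derive_unique; exact D1).
    field.
   + apply (continuous_mult (K := R_AbsRing)); auto. apply (continuous_minus (V := R_NormedModule)); [|apply continuous_const].
    apply (ex_derive_continuous (V := R_NormedModule)). exists (p s); auto.
  - change ((F t1 - F s1) * (F t1 - F s1) / 2 - (F t0 - F s1) * (F t0 - F s1) / 2 = 0). nra. }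
 set (I0 := RInt (fun s => p s * q s) t0 t1) in *. assert (I4 : is_RInt (fun s => p s * e s) t0 t1 (q s1 * / N - I0)).
 { apply (is_RInt_ext (V := R_NormedModule) (fun s => q s1 * p s - p s * q s + k * (p s * (F s - F s1)))).
  - intros s Hs. rewrite Rmin_left, Rmax_right in Hs by lra. destruct (He s ltac:(lra)) as [E _]. nra.
  - replace (q s1 * / N - I0) with (q s1 * / N - I0 + k * 0) by ring.
   apply (is_RInt_plus (V := R_NormedModule)); [apply (is_RInt_minus (V := R_NormedModule)); auto|]; apply (is_RInt_scal (V := R_NormedModule)); auto. }
 assert (B : Rabs (q s1 * / N - I0) <= M * / N).
 { apply (norm_RInt_le (V := R_NormedModule) (fun s => p s * e s) (fun s => M * p s) t0 t1); auto; [lra| |apply (is_RInt_scal (V := R_NormedModule)); auto].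
  intros s Hs. rewrite Rabs_mult. destruct (Hp s Hs) as (_ & P & _). rewrite (Rabs_pos_eq (p s)) by auto. rewrite Rmult_comm.
  apply Rmult_le_compat_r; auto. apply He; auto. }
 replace (q s1 - N * I0) with (N * (q s1 * / N - I0)) by (field; lra). rewrite Rabs_mult, (Rabs_pos_eq N) by lra.
 apply Rle_trans with (N * (M * / N)); [nra|right; field; lra].
Qed.

Lemma cell_crude D : (forall s, t0 <= s <= t1 -> Rabs (q' s) <= D) -> Rabs (q s1 - N * RInt (fun s => p s * q s) t0 t1) <= D * (t1 - t0).
Proof.
 intros HD. assert (D0 : 0 <= D) by (eapply Rle_trans; [apply Rabs_pos|apply (HD s1); lra]).
 assert (L : forall u v, t0 <= u -> u <= v -> v <= t1 -> Rabs (q v - q u) <= D * v - D * u).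
 { intros u v Hu Huv Hv. apply (derive_dominated q q' (fun s => D * s) (fun _ => D)); auto. split; [apply Hq; lra|]. split; [|apply HD; lra].
  auto_derive; auto; ring. }
 apply (cell_weighted (fun s => q s1 - q s) 0). split; [ring|].
 destruct (Rle_dec s s1) as [Q|Q]; [|rewrite Rabs_minus_sym]; eapply Rle_trans; try (apply L; lra); nra.
Qed.

(* Midpoint rule in the variable [F]: the linear term of [q] as a function of [F] integrates to zero. *)
Lemma cell_refined k D : 0 <= D -> (forall s, t0 <= s <= t1 -> Rabs (q' s - k * p s) <= D * p s) ->
  Rabs (q s1 - N * RInt (fun s => p s * q s) t0 t1) <= D * / (2 * N).
Proof.
 intros D0 HD.
 assert (L : forall u v, t0 <= u -> u <= v -> v <= t1 -> 0 <= F v - F u /\ Rabs ((q v - k * F v) - (q u - k * F u)) <= D * F v - D * F u).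
 { split.
  - assert (F u <= F v); [|lra]. apply (is_derive_nonneg_le F p); auto. split; apply Hp; lra.
  - apply (derive_dominated (fun s => q s - k * F s) (fun s => q' s - k * p s) (fun s => D * F s) (fun s => D * p s)); auto. intros s Hs.
   destruct (Hp s ltac:(lra)) as (_ & _ & D1). split; [apply (is_derive_minus (V := R_NormedModule)); [apply Hq; lra|apply (is_derive_scal); auto]|].
   split; [apply (is_derive_scal); auto|apply HD; lra]. }
 apply (cell_weighted (fun s => (q s1 - k * F s1) - (q s - k * F s)) k). intros s Hs. destruct (Rle_dec s s1) as [Q|Q].
 - destruct (L s s1) as [B1 B2]; try lra. destruct (L t0 s) as [B3 _]; try lra. nra.
 - destruct (L s1 s) as [B1 B2]; try lra. destruct (L s t1) as [B3 _]; try lra. rewrite Rabs_minus_sym. nra.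
Qed.

End Cell.

Lemma rsum_telescope (f : nat -> R) n : rsum (fun i => f (S i) - f i) n = f n - f 0%nat.
Proof. induction n as [|n IH]; simpl; [ring|]. lra. Qed.

Open Scope C_scope.

(** * The midpoint rule along the chord *)

Section Quad.

Variables (a b : R) (rho : C -> C) (W : C -> Prop).
Hypothesis Ha : 0 < a.
Hypothesis HW : openC W.
Hypothesis Hrho : hol W rho.
Hypothesis HcW : forall s, - a <= s <= a -> W (s, b).
Hypothesis Hpos : forall s, - a < s < a -> Im (rho (s, b)) = 0%R /\ 0 < Re (rho (s, b)).
Hypothesis Hint : CI (fun s => rho (s, b)) (- a) a = 1.

Definition dens (s : R) : R := Re (rho (s, b)).
Definition cumul (t : R) : R := RInt dens (- a) t.

Lemma line_eq (s : R) : (s, b) = (0%R, b) + RtoC s * 1.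
Proof. unfold RtoC, Cplus, Cmult; simpl; f_equal; ring. Qed.

Lemma line_derive (G : C -> C) s l : cder G (s, b) l ->
  is_derive (fun s => Re (G (s, b))) s (Re l) /\ is_derive (fun s => Im (G (s, b))) s (Im l).
Proof.
 rewrite line_eq. intros H. destruct (cder_comp_line G (0%R, b) 1 s l H) as [A B]. rewrite Cmult_1_r in A, B. split.
 - apply (is_derive_ext (V := R_NormedModule) (fun s => Re (G ((0%R, b) + RtoC s * 1)))); auto. intros t. rewrite <- line_eq. reflexivity.
 - apply (is_derive_ext (V := R_NormedModule) (fun s => Im (G ((0%R, b) + RtoC s * 1)))); auto. intros t. rewrite <- line_eq. reflexivity.
Qed.

Lemma rho_rcont s : W (s, b) -> rcont (fun s => rho (s, b)) s.
Proof. intros H. apply (rcont_comp rho (fun s => (s, b))); [apply rcont_pt|]. apply (hol_cont W); auto. Qed.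

Lemma dens_cont s : W (s, b) -> continuous dens s.
Proof. intros H. apply (rcont_Re (fun s => rho (s, b))), rho_rcont, H. Qed.

(** Carries realness and nonnegativity of the density from the open chord to its ends. *)
Lemma closed_interval_limit (f : R -> R) (P : R -> Prop) s : (forall x, (forall e, 0 < e -> exists y, P y /\ Rabs (y - x) < e) -> P x) ->
  continuous f s -> - a <= s <= a -> (forall t, - a < t < a -> P (f t)) -> P (f s).
Proof.
 intros HP Hf Hs H. apply HP. intros e He. assert (K := proj1 (filterlim_locally (U := R_UniformSpace) f (f s)) Hf (mkposreal e He)).
 destruct K as [d Hd]. set (h := Rmin (d / 2) a). assert (Ph : 0 < h) by (apply Rmin_glb_lt; auto; assert (Q := cond_pos d); lra).
 assert (h1 : h <= d/2) by apply Rmin_l. assert (h2 : h <= a) by apply Rmin_r. assert (Ex : exists t, - a < t < a /\ Rabs (t - s) < d).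
 { destruct (Rle_dec s 0) as [Q|Q]; [exists (s + h/2)%R|exists (s - h/2)%R]; split; try lra; apply Rabs_def1; lra. }
 destruct Ex as (t & Ht & Dt). exists (f t). split; [auto|]. apply (Hd t Dt).
Qed.

Lemma dens_closed s : - a <= s <= a -> Im (rho (s, b)) = 0%R /\ 0 <= dens s.
Proof.
 intros Hs. assert (Ws := HcW s Hs). split.
 - apply (closed_interval_limit (fun s => Im (rho (s, b))) (fun x => x = 0%R)); auto.
  + intros x Hx. apply NNPP. intros N. destruct (Hx (Rabs x) (Rabs_pos_lt x N)) as (y & -> & Q). rewrite Rminus_0_l, Rabs_Ropp in Q. lra.
  + apply (rcont_Im (fun s => rho (s, b))), rho_rcont, Ws.
  + intros t Ht. apply Hpos, Ht.
 - apply (closed_interval_limit dens (fun x => 0 <= x)%R); auto; [|apply dens_cont; auto|intros t Ht; left; apply Hpos, Ht]. intros x Hx.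
  apply Rnot_lt_le. intros N. destruct (Hx (- x)%R) as (y & Py & Q); [lra|]. apply Rabs_def2 in Q. lra.
Qed.

Lemma dens_rho s : - a <= s <= a -> rho (s, b) = RtoC (dens s).
Proof. intros Hs. destruct (dens_closed s Hs) as [E _]. unfold dens. destruct (rho (s, b)) as [x y]; simpl in *; subst; auto. Qed.

Lemma dens_ex u v : - a <= u <= a -> - a <= v <= a -> ex_RInt dens u v.
Proof.
 intros Hu Hv. apply (ex_RInt_continuous (V := R_CompleteNormedModule)). intros s Hs. apply dens_cont, HcW. unfold Rmin, Rmax in Hs.
 destruct (Rle_dec u v); lra.
Qed.

Lemma cumul_derive s : - a <= s <= a -> is_derive cumul s (dens s).
Proof.
 intros Hs. apply (is_derive_RInt (V := R_CompleteNormedModule) dens cumul (- a) s); [|apply dens_cont, HcW, Hs].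
 (* The density continues a little beyond the ends of the chord, so the derivative is two-sided at -
    a and a as well. *)
 destruct (HW (s, b) (HcW s Hs)) as (d & Hd & K). exists (mkposreal d Hd). intros t Ht. apply (RInt_correct (V := R_CompleteNormedModule)).
 apply (ex_RInt_Chasles (V := R_NormedModule) _ _ s); [apply dens_ex; lra|]. apply (ex_RInt_continuous (V := R_CompleteNormedModule)). intros u Hu.
 apply dens_cont, K. replace ((u, b) - (s, b)) with (RtoC (u - s)) by (unfold RtoC, Cminus, Cplus, Copp; simpl; f_equal; ring). rewrite Cmod_R.
 apply Rle_lt_trans with (Rabs (t - s)); auto. unfold Rmin, Rmax in Hu. destruct (Rle_dec s t); [rewrite !Rabs_pos_eq; lra|rewrite !Rabs_left1; lra].
Qed.

Lemma cumul_CI t : - a <= t <= a -> CI (fun s => rho (s, b)) (- a) t = RtoC (cumul t).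
Proof.
 intros Ht. apply is_CI_Re_Im.
 - apply (RInt_correct (V := R_CompleteNormedModule) dens), dens_ex; lra.
 - apply (is_RInt_ext (V := R_NormedModule) (fun _ => 0%R)).
  + intros s Hs. rewrite Rmin_left, Rmax_right in Hs by lra. symmetry. apply dens_closed. lra.
  + assert (Q := is_RInt_const (V := R_NormedModule) (- a)%R t 0%R). rewrite Rmult_0_r in Q. exact Q.
Qed.

Lemma cumul_ends : cumul (- a) = 0%R /\ cumul a = 1%R.
Proof. split; [apply (RInt_point (V := R_CompleteNormedModule))|]. apply RtoC_inj. rewrite <- cumul_CI by lra. exact Hint. Qed.

Lemma cumul_mono u v : - a <= u -> u <= v -> v <= a -> cumul u <= cumul v.
Proof. intros. apply (is_derive_nonneg_le cumul dens); auto. split; [apply cumul_derive; lra|apply dens_closed; lra]. Qed.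

(** The extreme points are prescribed, so that the cells fill the chord exactly. *)
Lemma quantile_points n : (0 < n)%nat -> exists t : nat -> R, t 0%nat = (- a)%R /\ t n = a /\
  forall j, (j <= n)%nat -> - a <= t j <= a /\ cumul (t j) = (INR j / INR n)%R.
Proof.
 intros Hn. destruct cumul_ends as [E0 E1]. assert (Pn : 0 < INR n) by (apply lt_0_INR; auto).
 assert (Ex : forall j, exists t, (j = 0%nat -> t = (- a)%R) /\ (j = n -> t = a) /\ ((j <= n)%nat -> - a <= t <= a /\ cumul t = (INR j / INR n)%R)).
 { intros j. destruct (Nat.eq_dec j 0) as [->|N0].
  { exists (- a)%R. split; [auto|split; [intros E; lia|]]. simpl. lra. }
  destruct (Nat.eq_dec j n) as [->|N1].
  { exists a. split; [intros E; lia|split; [auto|]]. rewrite E1. split; [lra|field; lra]. }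
  destruct (Nat.le_gt_cases j n) as [Q|Q]; [|exists 0%R; repeat split; intros; lia]. assert (B : 0 < INR j / INR n < 1).
  { split; [apply Rdiv_lt_0_compat; auto; apply lt_0_INR; lia|]. apply (Rmult_lt_reg_r (INR n)); auto. unfold Rdiv. rewrite Rmult_assoc, Rinv_l by lra.
   assert (R1 := lt_INR j n ltac:(lia)). lra. }
  destruct (IVT_interv (fun s => cumul s - INR j / INR n)%R (- a) a) as (t & Ht & Et); try lra.
  - intros s Hs. apply continuity_pt_minus; [|apply continuity_pt_const; intros x y; auto].
   apply continuity_pt_filterlim, (ex_derive_continuous (V := R_NormedModule)). exists (dens s). apply cumul_derive; lra.
  - exists t. repeat split; try lia; try lra. }
 exists (fun j => epsilon (inhabits 0%R) (fun t => (j = 0%nat -> t = (- a)%R) /\ (j = n -> t = a) /\ ((j <= n)%nat -> - a <= t <= a /\ cumul t = (INR j / INR n)%R))).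
 assert (K := fun j => epsilon_spec (inhabits 0%R) _ (Ex j)). split; [apply (K 0%nat); auto|]. split; [apply (K n); auto|]. intros j Hj.
 apply (K j), Hj.
Qed.

Lemma cell_pieces (f : R -> C) t n : (forall i, (i < n)%nat -> t i <= t (S i)) -> (forall i, (i <= n)%nat -> - a <= t i <= a) -> rcont_on f (- a) a ->
  csum (fun i => CI f (t i) (t (S i))) n = CI f (t 0%nat) (t n).
Proof.
 intros Ht B Hf. induction n as [|n IH]; simpl; [symmetry; apply CI_zero_len|]. rewrite IH by auto. apply CI_chasles; auto.
 - assert (Q : forall k, (k <= n)%nat -> (t 0%nat <= t k)%R); [|auto]. induction k; intros Hk; [lra|]. specialize (IHk ltac:(lia)).
  specialize (Ht k ltac:(lia)). lra.
 - intros s Hs. apply Hf. destruct (B 0%nat ltac:(lia)), (B (S n) ltac:(lia)). lra.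
Qed.

Section Rule.

Variables (n : nat) (sj : nat -> R) (V : C -> Prop) (G : C -> C).
Hypothesis Hn : (0 < n)%nat.
Hypothesis Hsj : forall i, (i < n)%nat -> - a <= sj i <= a /\ cumul (sj i) = ((2 * INR i + 1) / (2 * INR n))%R.
Hypothesis HV : openC V.
Hypothesis HG : hol V G.
Hypothesis HcV : forall s, - a <= s <= a -> V (s, b).

Definition quad_error : C := csum (fun i => G (sj i, b)) n - RtoC (INR n) * CI (fun s => rho (s, b) * G (s, b)) (- a) a.

Lemma G_derive s : - a <= s <= a ->
  is_derive (fun s => Re (G (s, b))) s (Re (cd G (s, b))) /\ is_derive (fun s => Im (G (s, b))) s (Im (cd G (s, b))).
Proof. intros Hs. apply line_derive, (hol_cder V); auto. Qed.

(** Cell errors are measured by increments of a function [E] of the position, whose sum telescopes;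
    the factor 2 adds real and imaginary parts. *)
Lemma quad_cells (E : R -> R) :
  (forall t0 s1 t1, - a <= t0 -> t0 <= s1 <= t1 -> t1 <= a -> (cumul s1 - cumul t0 = / (2 * INR n))%R -> (cumul t1 - cumul s1 = / (2 * INR n))%R ->
    (forall s, t0 <= s <= t1 -> continuous dens s /\ 0 <= dens s /\ is_derive cumul s (dens s))%R ->
    (Rabs (Re (G (s1, b)) - INR n * RInt (fun s => dens s * Re (G (s, b))) t0 t1) <= E t1 - E t0)%R /\
    (Rabs (Im (G (s1, b)) - INR n * RInt (fun s => dens s * Im (G (s, b))) t0 t1) <= E t1 - E t0)%R) ->
  (Cmod quad_error <= 2 * (E a - E (- a)))%R.
Proof.
 intros HE. destruct (quantile_points n Hn) as (t & T0 & Tn & Ht). assert (Pn : 0 < INR n) by (apply lt_0_INR; auto).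
 assert (Rc : rcont_on (fun s => rho (s, b) * G (s, b)) (- a) a).
 { intros s Hs. apply rcont_mult; [apply rho_rcont, HcW, Hs|]. apply (rcont_comp G (fun s => (s, b))); [apply rcont_pt|]. apply (hol_cont V); auto. }
 assert (rev : forall u v, - a <= u <= a -> - a <= v <= a -> cumul u < cumul v -> u < v).
 { intros u v Hu Hv L. apply Rnot_le_lt. intros Q. assert (M := cumul_mono v u ltac:(lra) Q ltac:(lra)). lra. }
 assert (ord : forall i, (i < n)%nat -> t i < sj i < t (S i) /\ (cumul (sj i) - cumul (t i) = / (2 * INR n))%R /\ (cumul (t (S i)) - cumul (sj i) = / (2 * INR n))%R).
 { intros i Hi. destruct (Ht i ltac:(lia)) as [B1 E1]. destruct (Ht (S i) ltac:(lia)) as [B2 E2]. destruct (Hsj i Hi) as [B3 E3]. rewrite S_INR in E2.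
  assert (P : 0 < / (2 * INR n)) by (apply Rinv_0_lt_compat; lra).
  assert (Q1 : (cumul (sj i) - cumul (t i) = / (2 * INR n))%R) by (rewrite E1, E3; field; lra).
  assert (Q2 : (cumul (t (S i)) - cumul (sj i) = / (2 * INR n))%R) by (rewrite E2, E3; field; lra). repeat split; auto; apply rev; lra. }
 unfold quad_error. rewrite <- T0, <- Tn at 1.
 rewrite <- (cell_pieces _ t n); [|intros i Hi; destruct (ord i Hi); lra|intros i Hi; apply Ht; auto|auto].
 rewrite Cmult_comm, <- csum_mult_r, <- csum_minus. eapply Rle_trans; [apply (csum_bound _ (fun i => 2 * (E (t (S i)) - E (t i)))%R)|].
 - intros i Hi. destruct (ord i Hi) as (O1 & O2 & O3). destruct (Ht i ltac:(lia)) as [B1 _]. destruct (Ht (S i) ltac:(lia)) as [B2 _].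
  destruct (HE (t i) (sj i) (t (S i))) as [H1 H2]; try lra.
  { split; [apply dens_cont, HcW; lra|split; [apply dens_closed; lra|apply cumul_derive; lra]]. }
  assert (CE : CI (fun s => rho (s, b) * G (s, b)) (t i) (t (S i)) = (RInt (fun s => (dens s * Re (G (s, b)))%R) (t i) (t (S i)), RInt (fun s => (dens s * Im (G (s, b)))%R) (t i) (t (S i)))).
  { rewrite CI_pair; [|lra|intros s Hs; apply Rc; lra].
   f_equal; apply (RInt_ext (V := R_CompleteNormedModule)); intros s Hs; rewrite Rmin_left, Rmax_right in Hs by lra; rewrite dens_rho by lra; destruct (G (s, b)) as [x y]; simpl; ring. }
  rewrite CE. eapply Rle_trans; [apply Cmod_le_Re_Im|].
  replace (Re (G (sj i, b) - (RInt (fun s => (dens s * Re (G (s, b)))%R) (t i) (t (S i)), RInt (fun s => (dens s * Im (G (s, b)))%R) (t i) (t (S i))) * RtoC (INR n))) with (Re (G (sj i, b)) - INR n * RInt (fun s => dens s * Re (G (s, b))) (t i) (t (S i)))%R by (unfold Re, Cminus, Cplus, Copp, Cmult, RtoC; simpl; ring).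
  replace (Im (G (sj i, b) - (RInt (fun s => (dens s * Re (G (s, b)))%R) (t i) (t (S i)), RInt (fun s => (dens s * Im (G (s, b)))%R) (t i) (t (S i))) * RtoC (INR n))) with (Im (G (sj i, b)) - INR n * RInt (fun s => dens s * Im (G (s, b))) (t i) (t (S i)))%R by (unfold Im, Cminus, Cplus, Copp, Cmult, RtoC; simpl; ring).
  lra.
 - rewrite rsum_scal, (rsum_telescope (fun i => E (t i))), T0, Tn. lra.
Qed.

Lemma Re_Im_le z D : Cmod z <= D -> (Rabs (Re z) <= D /\ Rabs (Im z) <= D).
Proof. assert (A := Rabs_Re_le z). assert (B := Rabs_Im_le z). split; lra. Qed.

(** A bound that does not decay in n but is uniform. It compares the sum over the nodes with the
    integral in the a priori estimate on the real line. *)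
Theorem quad_crude D : (forall s, - a <= s <= a -> Cmod (cd G (s, b)) <= D) -> Cmod quad_error <= 4 * a * D.
Proof.
 intros HD. assert (Pn : 0 < INR n) by (apply lt_0_INR; auto). eapply Rle_trans; [apply (quad_cells (fun t => D * t)%R)|lra].
 intros t0 s1 t1 A1 A2 A3 E1 E2 Hp. replace (D * t1 - D * t0)%R with (D * (t1 - t0))%R by ring.
 split; [apply (cell_crude dens cumul (fun s => Re (G (s, b))) (fun s => Re (cd G (s, b))))|apply (cell_crude dens cumul (fun s => Im (G (s, b))) (fun s => Im (cd G (s, b))))]; auto; intros s Hs; try (apply G_derive; lra); apply Re_Im_le, HD; lra.
Qed.

(* Cells reaching within [eta] of an end of the chord lie within [2 eta] of it and are treated crudely. *)
Theorem quad_refined eta A B : 0 < eta -> 4 * eta <= 2 * a -> 0 <= A -> 0 <= B ->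
  (/ INR n < cumul (- a + 2 * eta) - cumul (- a + eta))%R -> (/ INR n < cumul (a - eta) - cumul (a - 2 * eta))%R ->
  (forall s, - a <= s <= a -> (s <= - a + 2 * eta \/ a - 2 * eta <= s) -> Cmod (cd G (s, b)) <= B) ->
  (forall s s', - a + eta <= s <= a - eta -> - a + eta <= s' <= a - eta ->
     (Cmod (cd G (s, b) / rho (s, b) - cd G (s', b) / rho (s', b)) <= A * Rabs (s - s'))) ->
  (Cmod quad_error <= 2 * a * A / INR n + 8 * B * eta).
Proof.
 intros He He2 HA HB M1 M2 Bad Good. assert (Pn : 0 < INR n) by (apply lt_0_INR; auto).
 assert (PA : 0 <= A * / (2 * INR n)) by (apply Rmult_le_pos; auto; left; apply Rinv_0_lt_compat; lra).
 (* The linear term carries the refined bound; the other two grow only within 2 eta of an end and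
    carry the crude one. *)
 set (E := fun t => (A * / (2 * INR n) * t + B * (Rmin (t + a) (2 * eta) + Rmax 0 (t - (a - 2 * eta))))%R). eapply Rle_trans; [apply (quad_cells E)|].
 - intros t0 s1 t1 A1 A2 A3 E1 E2 Hp. assert (Em : 0 <= Rmin (t1 + a) (2 * eta) - Rmin (t0 + a) (2 * eta)).
  { unfold Rmin. destruct (Rle_dec (t1 + a) (2 * eta)), (Rle_dec (t0 + a) (2 * eta)); lra. }
  assert (Ex : 0 <= Rmax 0 (t1 - (a - 2 * eta)) - Rmax 0 (t0 - (a - 2 * eta))).
  { unfold Rmax. destruct (Rle_dec 0 (t1 - (a - 2 * eta))), (Rle_dec 0 (t0 - (a - 2 * eta))); lra. }
  assert (total : (cumul t1 - cumul t0 = / INR n)%R) by (replace (/ INR n)%R with (/ (2 * INR n) + / (2 * INR n))%R by (field; lra); lra).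
  assert (crude : (forall s, t0 <= s <= t1 -> Cmod (cd G (s, b)) <= B) -> (Rabs (Re (G (s1, b)) - INR n * RInt (fun s => dens s * Re (G (s, b))) t0 t1) <= B * (t1 - t0))%R /\ (Rabs (Im (G (s1, b)) - INR n * RInt (fun s => dens s * Im (G (s, b))) t0 t1) <= B * (t1 - t0))%R).
  { intros HD.
   split; [apply (cell_crude dens cumul (fun s => Re (G (s, b))) (fun s => Re (cd G (s, b))))|apply (cell_crude dens cumul (fun s => Im (G (s, b))) (fun s => Im (cd G (s, b))))]; auto; intros s Hs; try (apply G_derive; lra); apply Re_Im_le, HD; lra. }
  assert (lin : 0 <= A * / (2 * INR n) * (t1 - t0)) by nra.
  assert (EE : (E t1 - E t0 = A * / (2 * INR n) * (t1 - t0) + B * (Rmin (t1 + a) (2 * eta) - Rmin (t0 + a) (2 * eta)) + B * (Rmax 0 (t1 - (a - 2 * eta)) - Rmax 0 (t0 - (a - 2 * eta))))%R) by (unfold E; ring).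
  assert (B1 := Rmult_le_pos _ _ HB Em). assert (B2 := Rmult_le_pos _ _ HB Ex). destruct (Rlt_dec t0 (- a + eta)) as [L|L].
  (* By [M1] the piece from - a + eta to - a + 2 eta has more mass than a whole cell. *)
  + assert (U : t1 <= - a + 2 * eta).
   { apply Rnot_lt_le. intros Q. assert (C1 := cumul_mono t0 (- a + eta) ltac:(lra) ltac:(lra) ltac:(lra)).
    assert (C2 := cumul_mono (- a + 2 * eta) t1 ltac:(lra) ltac:(lra) ltac:(lra)). lra. }
   destruct crude as [X1 X2]; [intros s Hs; apply Bad; lra|]. rewrite (Rmin_left (t1 + a)), (Rmin_left (t0 + a)) in EE by lra. split; lra.
  + destruct (Rlt_dec (a - eta) t1) as [L2|L2].
   * assert (U : a - 2 * eta <= t0).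
    { apply Rnot_lt_le. intros Q. assert (C1 := cumul_mono t0 (a - 2 * eta) ltac:(lra) ltac:(lra) ltac:(lra)).
     assert (C2 := cumul_mono (a - eta) t1 ltac:(lra) ltac:(lra) ltac:(lra)). lra. }
    destruct crude as [X1 X2]; [intros s Hs; apply Bad; lra|].
    rewrite (Rmax_right 0 (t1 - (a - 2 * eta))), (Rmax_right 0 (t0 - (a - 2 * eta))) in EE by lra. split; lra.
   (* The derivative of G with respect to the quantile variable, taken at the node. *)
   * set (k := cd G (s1, b) / rho (s1, b)).
    assert (key : forall s, t0 <= s <= t1 -> Rabs (Re (cd G (s, b)) - Re k * dens s) <= A * (t1 - t0) * dens s /\ Rabs (Im (cd G (s, b)) - Im k * dens s) <= A * (t1 - t0) * dens s).
    { intros s Hs. specialize (Good s s1 ltac:(lra) ltac:(lra)). assert (Dp : 0 < dens s) by (apply Hpos; lra).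
     rewrite (dens_rho s) in Good by lra. assert (N : RtoC (dens s) <> 0) by (intros Q; apply RtoC_inj in Q; lra).
     assert (Z : Cmod (cd G (s, b) - k * RtoC (dens s)) <= A * (t1 - t0) * dens s).
     { replace (cd G (s, b) - k * RtoC (dens s)) with ((cd G (s, b) / RtoC (dens s) - k) * RtoC (dens s)) by (field; auto).
      rewrite Cmod_mult, Cmod_R, (Rabs_pos_eq (dens s)) by lra. apply Rmult_le_compat_r; [lra|]. eapply Rle_trans; [apply Good|].
      apply Rmult_le_compat_l; auto. apply Rabs_le; lra. }
     assert (ZR := Re_Im_le _ _ Z).
     replace (Re (cd G (s, b) - k * RtoC (dens s))) with (Re (cd G (s, b)) - Re k * dens s)%R in ZR by (unfold Re, Cminus, Cplus, Copp, Cmult, RtoC; simpl; ring).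
     replace (Im (cd G (s, b) - k * RtoC (dens s))) with (Im (cd G (s, b)) - Im k * dens s)%R in ZR by (unfold Im, Cminus, Cplus, Copp, Cmult, RtoC; simpl; ring).
     exact ZR. }
    assert (DA : 0 <= A * (t1 - t0)) by nra.
    assert (X1 : (Rabs (Re (G (s1, b)) - INR n * RInt (fun s => dens s * Re (G (s, b))) t0 t1) <= A * (t1 - t0) * / (2 * INR n))%R).
    { apply (cell_refined dens cumul (fun s => Re (G (s, b))) (fun s => Re (cd G (s, b)))) with (k := Re k); auto; intros s Hs; [apply G_derive; lra|apply key; auto]. }
    assert (X2 : (Rabs (Im (G (s1, b)) - INR n * RInt (fun s => dens s * Im (G (s, b))) t0 t1) <= A * (t1 - t0) * / (2 * INR n))%R).
    { apply (cell_refined dens cumul (fun s => Im (G (s, b))) (fun s => Im (cd G (s, b)))) with (k := Im k); auto; intros s Hs; [apply G_derive; lra|apply key; auto]. }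
    split; lra.
 - unfold E. rewrite (Rmin_right (a + a)), (Rmin_left (- a + a)), (Rmax_right 0 (a - (a - 2 * eta))), (Rmax_left 0 (- a - (a - 2 * eta))) by lra.
  right. field. lra.
Qed.

End Rule.

End Quad.

Lemma cd2_bound V G z0 d Q : openC V -> hol V G -> 0 < d -> (forall w, Cmod (w - z0) < 2 * d -> V w /\ Cmod (G w) <= Q) ->
  (Cmod (cd G z0) <= 8 * Q / d) /\ Cmod (cd (cd G) z0) <= 64 * Q / (d * d).
Proof.
 intros HV HG Hd H. assert (C1 : forall z, Cmod (z - z0) < d -> Cmod (cd G z) <= 8 * Q / d).
 { intros z Hz. apply (cauchy_est V G z d Q Hd HG). intros w Hw. apply H. assert (T := Cmod_tri3 w z z0). lra. }
 split; [apply C1; rewrite Cmod_sub_diag; auto|]. replace (64 * Q / (d * d))%R with (8 * (8 * Q / d) / d)%R by (field; lra).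
 apply (cauchy_est V); auto; [apply hol_cd; auto|]. split; [apply H; lra|auto].
Qed.

(** The quotient rule is obtained by differentiating (F / g) g = F. *)
Lemma quotient_derivative_bound V F g z A B D R0 : openC V -> hol V F -> hol V g -> V z -> 0 < R0 -> R0 <= Cmod (g z) <= D ->
  (Cmod (F z) <= A) -> Cmod (cd F z) <= B -> Cmod (cd g z) <= D ->
  (Cmod (cd (fun w => F w / g w)%C z) <= (B * D + A * D) / (R0 * R0))%R.
Proof.
 intros HV HF Hg Vz HR Bg BF BF' Bg'. assert (N : g z <> 0) by (intros E; rewrite E, Cmod_0 in Bg; lra).
 destruct (hol_cont V g z Hg Vz (Cmod (g z))) as (d & Hd & K); [lra|]. set (k := fun w => F w / g w).
 assert (Ck : exists m, cder k z m) by (apply (cder_div F g z _ _ (hol_cder V F z HF Vz) (hol_cder V g z Hg Vz) N)).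
 assert (P := cder_mult _ _ _ _ _ (cd_spec k z Ck) (hol_cder V g z Hg Vz)). assert (E : cder F z (cd k z * g z + k z * cd g z)).
 { refine (cder_ext_loc _ _ _ _ d Hd _ P). intros w Hw. unfold k. assert (Ng : g w <> 0).
  { intros Q. specialize (K w Hw). rewrite Q in K. replace (0 - g z) with (- g z) in K by ring. rewrite Cmod_opp in K. lra. }
  field; auto. }
 apply cd_unique in E. assert (E2 : cd k z = (cd F z * g z - F z * cd g z) / (g z * g z)) by (rewrite E; unfold k; field; auto).
 rewrite E2, Cmod_div, Cmod_mult by (apply Cmult_neq_0; auto). pose proof (Cmod_ge_0 (cd F z)). pose proof (Cmod_ge_0 (F z)).
 apply Rmult_le_compat; [apply Cmod_ge_0|left; apply Rinv_0_lt_compat; nra| |apply Rinv_le_contravar; nra]. eapply Rle_trans; [apply Cmod_triangle|].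
 rewrite Cmod_opp, !Cmod_mult. nra.
Qed.

(** * The quadrature error for products of row entries *)

Section Main.

Variables (a b r : R) (U : C -> Prop) (rho h : C -> C).
Hypothesis Ha : 0 < a.
Hypothesis Hb : 0 < b.
Hypothesis Hr : 0 < r.
Hypothesis Hrr : (r * r = a * a + b * b)%R.
Hypothesis HU : openC U.
Hypothesis HcapU : forall z, cap b r z -> U z.
Hypothesis Hrho : hol U rho.
Hypothesis Hh : hol U h.
Hypothesis Hpos : forall s, - a < s < a -> Im (rho (s, b)) = 0%R /\ 0 < Re (rho (s, b)).
Hypothesis Hint : CI (fun s => rho (s, b)) (- a) a = 1.
Hypothesis Hh0 : h (0%R, b) <> 0.

Lemma chord_U s : - a <= s <= a -> U (s, b).
Proof. intros Hs. apply HcapU, (chord_cap a b r); auto. Qed.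

(** One width of neighbourhood for the whole chord. The condition d <= r0 / 4 keeps the discs about
    points close to an end inside the range of [ends_small]. *)
Lemma tube r0 : 0 < r0 -> exists d M, 0 < d <= r0 / 4 /\ 1 <= M /\ forall s z, - a <= s <= a -> Cmod (z - (s, b)) < 2 * d ->
  U z /\ b / 2 <= Im z /\ Cmod z <= 2 * r /\ Cmod (h z) <= M /\ Cmod (rho z) <= M.
Proof.
 intros Hr0.
 destruct (compact_rect_uniform (- a) b (2 * a) 0 (fun w d => forall z, Cmod (z - w) < 2 * d -> U z /\ Cmod (h z) <= / d /\ Cmod (rho z) <= / d)) as (d & Hd & K).
 - intros p Hp. assert (Up : U p).
  { replace p with ((Re p, b) : C); [apply chord_U; unfold crect in Hp; lra|]. destruct p as [x y]. unfold crect, Re, Im in *; simpl in *.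
   f_equal; lra. }
  destruct (HU p Up) as (d1 & Hd1 & K1). destruct (hol_cont U h p Hh Up 1%R) as (d2 & Hd2 & K2); [lra|].
  destruct (hol_cont U rho p Hrho Up 1%R) as (d3 & Hd3 & K3); [lra|]. set (m := (Cmod (h p) + Cmod (rho p) + 1)%R). pose proof (Cmod_ge_0 (h p)).
  pose proof (Cmod_ge_0 (rho p)). assert (Pm : 0 < / m) by (apply Rinv_0_lt_compat; unfold m; lra).
  destruct (pos_min4 (d1/3) (d2/3) (d3/3) (/ m)) as (d & Hd & D1 & D2 & D3 & D4); [lra..|].
  assert (MD : m <= / d) by (rewrite <- (Rinv_inv m); apply Rinv_le_contravar; auto). exists d; split; auto. intros w Hw z Hz.
  assert (T := Cmod_tri3 z w p). specialize (K2 z ltac:(lra)). specialize (K3 z ltac:(lra)). assert (T2 := Cmod_tri_inv (h z) (h p)).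
  assert (T3 := Cmod_tri_inv (rho z) (rho p)). split; [apply K1; lra|]. unfold m in MD. split; lra.
 - intros w d d' Hd P z Hz. destruct (P z ltac:(lra)) as (P1 & P2 & P3). assert (Q : / d <= / d') by (apply Rinv_le_contravar; lra).
  repeat split; auto; lra.
 - destruct (pos_min4 d (b/4) (r/4) (r0/4)) as (d0 & Hd0 & D1 & D2 & D3 & D4); [lra..|]. exists d0, (Rmax 1 (/ d)). split; [lra|].
  split; [apply Rmax_l|]. intros s z Hs Hz. assert (Cr : crect (- a) b (2 * a) 0 (s, b)) by (unfold crect, Re, Im; simpl; lra).
  destruct (K (s, b) Cr z ltac:(lra)) as (K1 & K2 & K3). assert (MM := Rmax_r 1 (/ d)). assert (I := Im_close z (s, b)).
  change (Im (s, b)) with b in I. assert (T := Cmod_tri_inv z (s, b)). assert (Q := proj2 (chord_cap a b r Hr Hrr s Hs)). repeat split; auto; lra.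
Qed.

(** [rho] is nonzero inside the chord, so it vanishes to finite order at each end; k is the larger
    of the two orders. *)
Lemma dens_lower : exists k kap, 0 < kap <= 1 /\ forall eta s, 0 < eta <= 1 -> - a + eta <= s <= a - eta -> kap * eta ^ k <= dens b rho s.
Proof.
 assert (R0 : rho (0%R, b) <> 0) by (intros E; destruct (Hpos 0%R ltac:(lra)) as [_ Q]; rewrite E in Q; unfold Re, RtoC in Q; simpl in Q; lra).
 assert (N1 := not_zero_near_end a b r U rho Ha Hr Hrr HU HcapU Hrho R0 1 (or_introl eq_refl)).
 assert (N2 := not_zero_near_end a b r U rho Ha Hr Hrr HU HcapU Hrho R0 (-1) (or_intror eq_refl)). replace (1 * a)%R with a in N1 by ring.
 replace (-1 * a)%R with (- a)%R in N2 by ring. destruct (zero_order rho U _ HU Hrho (chord_U a ltac:(lra)) N1) as (k1 & h1 & d1 & Hd1 & _ & E1 & B1).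
 destruct (zero_order rho U _ HU Hrho (chord_U (- a)%R ltac:(lra)) N2) as (k2 & h2 & d2 & Hd2 & _ & E2 & B2).
 destruct (pos_min4 d1 d2 a 1) as (dm & Pdm & m1 & m2 & m3 & _); [lra..|].
 destruct (rcont_min_dist (fun s => rho (s, b)) (- a + dm/2) (a - dm/2) 0) as (c0 & Hc0 & K0); [lra| | |].
 - intros s Hs. apply (rcont_comp rho (fun s => (s, b))); [apply rcont_pt|]. apply (hol_cont U); auto. apply chord_U; lra.
 - intros s Hs E. destruct (Hpos s ltac:(lra)) as [_ Q]. rewrite E in Q. unfold Re, RtoC in Q; simpl in Q; lra.
 - destruct (pos_min4 d1 d2 c0 1) as (kap & Pk & q1 & q2 & q3 & q4); [lra..|]. exists (Nat.max k1 k2), kap. split; [lra|]. intros eta s He Hs.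
  assert (dR : Cmod (rho (s, b)) = dens b rho s).
  { destruct (Hpos s ltac:(lra)) as [I P]. unfold dens.
   replace (rho (s, b)) with (RtoC (Re (rho (s, b)))) at 1; [rewrite Cmod_R; apply Rabs_pos_eq; lra|].
   destruct (rho (s, b)) as [x y]; simpl in *; subst; auto. }
  rewrite <- dR. assert (pw : forall k x, (k <= Nat.max k1 k2)%nat -> eta <= x -> eta ^ Nat.max k1 k2 <= x ^ k).
  { intros k x Hk Hx. apply Rle_trans with (eta ^ k)%R; [|apply pow_incr; lra]. replace (Nat.max k1 k2) with (k + (Nat.max k1 k2 - k))%nat by lia.
   rewrite pow_add. rewrite <- (Rmult_1_r (eta ^ k)) at 2. apply Rmult_le_compat_l; [apply pow_le; lra|]. rewrite <- (pow1 (Nat.max k1 k2 - k)).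
   apply pow_incr; lra. }
  assert (P0 : 0 < eta ^ Nat.max k1 k2) by (apply pow_lt; lra).
  destruct (Rlt_dec (a - dm/2) s) as [L1|L1]; [|destruct (Rlt_dec s (- a + dm/2)) as [L2|L2]].
  + assert (M : Cmod ((s, b) - (a, b)) = (a - s)%R).
   { replace ((s, b) - (a, b)) with (RtoC (s - a)) by (unfold RtoC, Cminus, Cplus, Copp; simpl; f_equal; ring). rewrite Cmod_R, Rabs_left; lra. }
   destruct (B1 (s, b)) as [Us Bs]; [unfold cball; lra|]. rewrite E1, Cmod_mult, Cmod_Cpow, Rmult_comm by auto. apply Rmult_le_compat; try lra.
   apply pw; [lia|lra].
  + assert (M : Cmod ((s, b) - (- a, b)%R) = (s + a)%R).
   { replace ((s, b) - (- a, b)%R) with (RtoC (s + a)) by (unfold RtoC, Cminus, Cplus, Copp; simpl; f_equal; ring). rewrite Cmod_R, Rabs_pos_eq; lra. }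
   destruct (B2 (s, b)) as [Us Bs]; [unfold cball; lra|]. rewrite E2, Cmod_mult, Cmod_Cpow, Rmult_comm by auto. apply Rmult_le_compat; try lra.
   apply pw; [lia|lra].
  + specialize (K0 s ltac:(lra)). replace (rho (s, b) - 0) with (rho (s, b)) in K0 by ring. assert (Q := pw 0%nat eta ltac:(lia) ltac:(lra)). nra.
Qed.

(** What the entries of both problems have in common, so that an entry of one may be multiplied by
    an entry of the other. *)
Definition small_fun (Ef f : C -> C) (eps0 : R) : Prop :=
  hol UHP f /\ (forall z, UHP z -> Cmod (f z) <= 1) /\
  forall x : R, (Cmod (chint a b (fun z => h z * rho z * Ef z * f z)%C (RtoC x)) <= eps0)%R.

Definition quantiles (n : nat) (sj : nat -> R) : Prop := forall i, (i < n)%nat -> - a <= sj i <= a /\ cumul a b rho (sj i) = ((2 * INR i + 1) / (2 * INR n))%R.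

Theorem quadrature_estimate e0 M0 : 0 < e0 -> 1 <= M0 -> exists N0 Cq, forall n sj Ef f1 f2, (N0 < n)%nat -> quantiles n sj ->
  hol (fun _ => True) Ef -> (forall z, Cmod z <= 2 * r -> e0 <= Cmod (Ef z) <= / e0) ->
  small_fun Ef f1 (M0 / INR n) -> small_fun Ef f2 (M0 / INR n) ->
  (Cmod (quad_error a b rho n sj (fun z => h z * Ef z * (f1 z * f2 z))%C) <= Cq / INR n)%R.
Proof.
 intros He0 HM0. assert (Hi0 : 0 < / e0) by (apply Rinv_0_lt_compat; auto). destruct dens_lower as (k & kap & Hkap & Klow).
 (* Small enough for two purposes: 2 eps (k + 1) < 1/4 makes kap eta^(k + 1) exceed 1 / n, and 4 eps
    k <= 1 - 2 eps makes qn <= eta^(2 k). *)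
 assert (Pk := pos_INR k). set (eps := (/ (8 * (INR k + 2)))%R). assert (Heps : (eps * (8 * (INR k + 2)) = 1)%R) by (unfold eps; field; lra).
 assert (Heps0 : 0 < eps) by (apply Rinv_0_lt_compat; lra). assert (Hek : 0 <= eps * INR k) by (apply Rmult_le_pos; lra).
 destruct (ends_small a b r U (fun z => h z * rho z)) with (eps := eps) (e0 := e0) as (B & r0 & HB & Hr0 & Ends); auto; [apply hol_mult; auto| |lra|].
 { apply Cmult_neq_0; auto. intros E. destruct (Hpos 0%R ltac:(lra)) as [_ Q]. rewrite E in Q. unfold Re, RtoC in Q; simpl in Q; lra. }
 destruct (tube r0 Hr0) as (d & M & Hd & HM & Tube). destruct (pos_min4 (r0/2) 1 1 1) as (r1 & Pr1 & r11 & r12 & _); [lra..|].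
 set (Qm := (M * / e0)%R). assert (PQm : 0 < Qm) by (apply Rmult_lt_0_compat; lra). set (Q1 := (Qm * ((B * M0) * (B * M0)))%R).
 assert (PBM : 0 < B * M0) by (apply Rmult_lt_0_compat; lra).
 assert (PQ1 : 0 < Q1) by (unfold Q1; apply Rmult_lt_0_compat; [auto|apply Rmult_lt_0_compat; auto]). set (D := (8 * M / d + M)%R).
 assert (PMd : 0 < 8 * M / d) by (apply Rdiv_lt_0_compat; lra). assert (PD : 0 < D) by (unfold D; lra).
 set (K3 := (64 / (d * d) * D + 8 / d * D)%R). assert (Pdd : 0 < 64 / (d * d)) by (apply Rdiv_lt_0_compat; nra).
 assert (P8d : 0 < 8 / d) by (apply Rdiv_lt_0_compat; lra).
 assert (PK3 : 0 < K3) by (unfold K3; assert (H1 := Rmult_lt_0_compat _ _ Pdd PD); assert (H2 := Rmult_lt_0_compat _ _ P8d PD); lra).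
 set (Rm := (kap * r1 ^ k)%R). assert (PRm : 0 < Rm) by (apply Rmult_lt_0_compat; [lra|apply pow_lt; auto]). set (A1 := (K3 * Q1 / (kap * kap))%R).
 set (A2 := (K3 * Qm / (Rm * Rm))%R). assert (PA1 : 0 < A1) by (apply Rdiv_lt_0_compat; apply Rmult_lt_0_compat; lra).
 assert (PA2 : 0 < A2) by (apply Rdiv_lt_0_compat; apply Rmult_lt_0_compat; lra).
 destruct (pos_min4 (r1/2) (a/2) 1 1) as (c & Pc & c1 & c2 & _); [lra..|]. set (L0 := (Rabs (ln c) / (2 * eps) + 2 * Rabs (ln kap) + 1)%R).
 assert (PL1 : 0 <= Rabs (ln c) / (2 * eps)) by (apply Rdiv_le_0_compat; [apply Rabs_pos|lra]). assert (PL2 := Rabs_pos (ln kap)).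
 (* Beyond exp L0 both eta <= c and the mass inequality hold; beyond M0 the ratio M0 / n is at most
    1, as [ends_small] requires. *)
 destruct (nfloor_ex (exp L0 + M0)) as (m & Hm); [assert (H := exp_pos L0); lra|]. exists (S m), (2 * a * (A1 + A2) + 8 * (8 * Q1 / d))%R.
 intros n sj Ef f1 f2 Hn Hsj HE BE [H1 [F1 S1]] [H2 [F2 S2]].
 assert (Hn1 : exp L0 + M0 <= INR n) by (apply (lt_INR (S m) n) in Hn; rewrite S_INR in Hn; lra). assert (EP := exp_pos L0).
 assert (Pn : 0 < INR n) by lra. set (LN := ln (INR n)). assert (ELN : exp LN = INR n) by (apply exp_ln; auto).
 (* eta = n^(- 2 eps) and, below, qn = n^(- 1 + 2 eps): near the ends the product of two entries is
    of size qn, and qn eta = 1 / n. *)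
 assert (HLN : L0 <= LN) by (rewrite <- (ln_exp L0); apply ln_le; lra). set (eta := exp (- (2 * eps * LN))).
 assert (Peta : 0 < eta) by apply exp_pos. assert (Heta : eta <= c).
 { rewrite <- (exp_ln c) by auto. apply exp_le. assert (Q := Rle_abs (- ln c)). rewrite Rabs_Ropp in Q. assert (Rabs (ln c) <= 2 * eps * LN); [|lra].
  apply Rle_trans with (2 * eps * (Rabs (ln c) / (2 * eps)))%R; [right; field; lra|]. apply Rmult_le_compat_l; unfold L0 in HLN; lra. }
 assert (eta1 : eta <= 1) by lra.
 assert (etak : forall j, (eta ^ j = exp (- (2 * eps * INR j * LN)))%R) by (intros j; unfold eta; rewrite exp_pow; f_equal; ring).
 set (qn := exp (- ((1 - 2 * eps) * LN))). assert (Pqn : 0 < qn) by apply exp_pos.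
 assert (qeta : (qn * eta = / INR n)%R) by (unfold qn, eta; rewrite <- exp_plus, <- ELN, <- exp_Ropp; f_equal; ring).
 assert (eps01 : 0 < M0 / INR n <= 1).
 { split; [apply Rdiv_lt_0_compat; lra|]. apply (Rmult_le_reg_r (INR n)); auto. unfold Rdiv. rewrite Rmult_assoc, Rinv_l; lra. }
 assert (fsmall : forall f, small_fun Ef f (M0 / INR n) -> forall z, UHP z -> (Cmod (z - (a, b)) < r0) \/ (Cmod (z - (- a, b)%R) < r0) -> Cmod (f z) <= B * M0 * exp (- ((1/2 - eps) * LN))).
 { intros f (Hf1 & Hf2 & Hf3) z Uz Dz. eapply Rle_trans; [apply (Ends Ef f (M0 / INR n)%R HE BE Hf1 Hf2 eps01 Hf3 z Uz Dz)|]. rewrite Rmult_assoc.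
  apply Rmult_le_compat_l; [lra|].
  assert (EL : ln (M0 / INR n) = (ln M0 - LN)%R) by (unfold Rdiv; rewrite ln_mult, ln_Rinv; [reflexivity|lra|lra|apply Rinv_0_lt_compat; lra]).
  rewrite EL. rewrite <- (exp_ln M0) at 2 by lra. rewrite <- exp_plus. apply exp_le.
  assert (LM : 0 <= ln M0) by (rewrite <- ln_1; apply ln_le; lra). assert (0 <= eps * ln M0) by (apply Rmult_le_pos; lra). lra. }
 set (V := fun z => U z /\ UHP z). assert (HV : openC V).
 { intros z [Uz Iz]. destruct (HU z Uz) as (e & Hee & Ke). unfold UHP in Iz. exists (Rmin e (Im z)). split; [apply Rmin_glb_lt; auto|]. intros v Hv.
  destruct (Rmin_Rgt_l _ _ _ Hv) as [V1 V2]. assert (I := Im_close v z). split; [auto|unfold UHP; lra]. }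
 assert (VU : forall z, V z -> U z) by (intros z Hz; apply Hz). assert (VH : forall z, V z -> UHP z) by (intros z Hz; apply Hz).
 set (G := fun z => h z * Ef z * (f1 z * f2 z)). assert (HG : hol V G).
 { unfold G. apply hol_mult; apply hol_mult; [apply (hol_sub V U)|apply (hol_sub V (fun _ => True))|apply (hol_sub V UHP)|apply (hol_sub V UHP)]; auto. }
 assert (cV : forall s, - a <= s <= a -> V (s, b)) by (intros s Hs; split; [apply chord_U; auto|unfold UHP, Im; simpl; auto]).
 assert (tubeV : forall s z, - a <= s <= a -> Cmod (z - (s, b)) < 2 * d -> V z).
 { intros s z Hs Hz. destruct (Tube s z Hs Hz) as (T1 & T2 & _). split; [auto|unfold UHP; lra]. }
 assert (Gall : forall s z, - a <= s <= a -> Cmod (z - (s, b)) < 2 * d -> Cmod (G z) <= Qm * (Cmod (f1 z) * Cmod (f2 z))).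
 { intros s z Hs Hz. destruct (Tube s z Hs Hz) as (T1 & T2 & T3 & T4 & T5). unfold G, Qm. rewrite !Cmod_mult. destruct (BE z T3) as [_ E2].
  apply Rmult_le_compat_r; [apply Rmult_le_pos; apply Cmod_ge_0|]. apply Rmult_le_compat; auto using Cmod_ge_0. }
 assert (Gmid : forall s, - a <= s <= a -> Cmod (cd G (s, b)) <= 8 * Qm / d /\ Cmod (cd (cd G) (s, b)) <= 64 * Qm / (d * d)).
 { intros s Hs. apply (cd2_bound V); auto; [lra|]. intros w Hw. split; [apply (tubeV s); auto|]. eapply Rle_trans; [apply (Gall s w Hs Hw)|].
  assert (Uw := VH w (tubeV s w Hs Hw)). rewrite <- (Rmult_1_r Qm) at 2. apply Rmult_le_compat_l; [lra|]. specialize (F1 w Uw). specialize (F2 w Uw).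
  pose proof (Cmod_ge_0 (f1 w)). pose proof (Cmod_ge_0 (f2 w)). nra. }
 assert (Gnear : forall s, - a <= s <= a -> (s <= - a + r1 \/ a - r1 <= s) -> Cmod (cd G (s, b)) <= 8 * (Q1 * qn) / d /\ Cmod (cd (cd G) (s, b)) <= 64 * (Q1 * qn) / (d * d)).
 { intros s Hs Ns. apply (cd2_bound V); auto; [lra|]. intros w Hw. split; [apply (tubeV s); auto|]. eapply Rle_trans; [apply (Gall s w Hs Hw)|].
  assert (Uw := VH w (tubeV s w Hs Hw)). assert (near : (Cmod (w - (a, b)) < r0) \/ (Cmod (w - (- a, b)%R) < r0)).
  { destruct Ns as [Ns|Ns]; [right; assert (T := Cmod_tri3 w (s, b) (- a, b)%R)|left; assert (T := Cmod_tri3 w (s, b) (a, b))].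
   - replace ((s, b) - (- a, b)%R) with (RtoC (s + a)) in T by (unfold RtoC, Cminus, Cplus, Copp; simpl; f_equal; ring).
    rewrite Cmod_R, Rabs_pos_eq in T by lra. lra.
   - replace ((s, b) - (a, b)) with (RtoC (s - a)) in T by (unfold RtoC, Cminus, Cplus, Copp; simpl; f_equal; ring).
    rewrite Cmod_R, Rabs_left1 in T by lra. lra. }
  assert (X1 := fsmall f1 (conj H1 (conj F1 S1)) w Uw near). assert (X2 := fsmall f2 (conj H2 (conj F2 S2)) w Uw near). unfold Q1. rewrite Rmult_assoc.
  apply Rmult_le_compat_l; [lra|].
  replace (B * M0 * (B * M0) * qn)%R with ((B * M0 * exp (- ((1/2 - eps) * LN))) * (B * M0 * exp (- ((1/2 - eps) * LN))))%R.
  - apply Rmult_le_compat; auto using Cmod_ge_0.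
  - unfold qn. replace (- ((1 - 2 * eps) * LN))%R with (- ((1 / 2 - eps) * LN) + - ((1 / 2 - eps) * LN))%R by field. rewrite exp_plus. ring. }
 assert (rhoB : forall s, - a <= s <= a -> Cmod (rho (s, b)) <= D /\ Cmod (cd rho (s, b)) <= D).
 { intros s Hs. split.
  - destruct (Tube s (s, b) Hs) as (_ & _ & _ & _ & T5); [|unfold D; lra]. rewrite Cmod_sub_diag. lra.
  - eapply Rle_trans; [apply (cauchy_est U rho (s, b) d M)|unfold D; lra]; auto; [lra|]. intros w Hw.
   destruct (Tube s w Hs ltac:(lra)) as (T1 & _ & _ & _ & T5). auto. }
 assert (dR : forall s, - a < s < a -> 0 < dens b rho s /\ Cmod (rho (s, b)) = dens b rho s).
 { intros s Hs. destruct (Hpos s Hs) as [I P]. split; [exact P|]. unfold dens.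
  replace (rho (s, b)) with (RtoC (Re (rho (s, b)))) at 1; [rewrite Cmod_R; apply Rabs_pos_eq; lra|].
  destruct (rho (s, b)) as [x y]; unfold RtoC; simpl in *; subst; auto. }
 (* On an interval of length eta at distance eta from the ends the density is at least kap eta^k, so
    a cell of mass 1 / n cannot cover it. *)
 assert (mass : forall u, - a + eta <= u -> u + eta <= a - eta -> (/ INR n < cumul a b rho (u + eta) - cumul a b rho u)%R).
 { intros u Hu1 Hu2. assert (Q : (cumul a b rho u - kap * eta ^ k * u <= cumul a b rho (u + eta) - kap * eta ^ k * (u + eta))%R).
  { apply (is_derive_nonneg_le (fun s => cumul a b rho s - kap * eta ^ k * s)%R (fun s => dens b rho s - kap * eta ^ k)%R); [lra|]. intros s Hs. split.
   - apply (is_derive_minus (V := R_NormedModule)); [apply (cumul_derive a b rho U); auto using chord_U; lra|]. auto_derive; auto; ring.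
   - assert (Q := Klow eta s ltac:(lra) ltac:(lra)). lra. }
  assert (Q2 : / INR n < kap * eta ^ k * eta); [|lra]. rewrite Rmult_assoc, etak. unfold eta at 1. rewrite <- exp_plus.
  rewrite <- (exp_ln kap) by lra. rewrite <- exp_plus, <- ELN, <- exp_Ropp. apply exp_increasing. assert (Q3 := Rle_abs (- ln kap)).
  rewrite Rabs_Ropp in Q3. assert (E8 : 2 * eps * INR k * LN + 2 * eps * LN <= LN / 4).
  { replace (2 * eps * INR k * LN + 2 * eps * LN)%R with ((2 * (eps * INR k) + 2 * eps) * LN)%R by ring. replace (LN / 4)%R with (/ 4 * LN)%R by field.
   apply Rmult_le_compat_r; [unfold L0 in HLN; lra|]. lra. }
  unfold L0 in HLN. lra. }
 assert (QR : forall Q Q' s, - a + eta <= s <= a - eta -> 0 < Q' -> Q' <= dens b rho s -> 0 <= Q -> Cmod (cd G (s, b)) <= 8 * Q / d -> Cmod (cd (cd G) (s, b)) <= 64 * Q / (d * d) -> (Cmod (cd (fun w => cd G w / rho w)%C (s, b)) <= K3 * Q / (Q' * Q'))%R).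
 { intros Q Q' s Hs HQ' HQd HQ G1 G2. destruct (dR s ltac:(lra)) as [P1 P2]. destruct (rhoB s ltac:(lra)) as [RB1 RB2].
  replace (K3 * Q / (Q' * Q'))%R with ((64 * Q / (d * d) * D + 8 * Q / d * D) / (Q' * Q'))%R by (unfold K3; field; lra).
  apply (quotient_derivative_bound V); auto; [apply hol_cd; auto|apply (hol_sub V U); auto|apply cV; lra|lra]. }
 rewrite Rdiv_plus_distr.
 eapply Rle_trans; [apply (quad_refined a b rho U Ha HU Hrho chord_U Hpos Hint n sj V G) with (eta := eta) (A := (A1 + A2)%R) (B := (8 * (Q1 * qn) / d)%R)|]; auto; try lra.
 - lia.
 - left. apply Rdiv_lt_0_compat; [|lra]. apply Rmult_lt_0_compat; [lra|apply Rmult_lt_0_compat; auto].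
 - replace (- a + 2 * eta)%R with (- a + eta + eta)%R by ring. apply mass; lra.
 - replace (a - eta)%R with (a - 2 * eta + eta)%R at 1 by ring. apply mass; lra.
 - intros s Hs Ns. apply Gnear; auto. lra.
 - intros s s' Hs Hs'.
  replace (Rabs (s - s')) with (Cmod ((s, b) - (s', b))) by (replace ((s, b) - (s', b)) with (RtoC (s - s')) by (unfold RtoC, Cminus, Cplus, Copp; simpl; f_equal; ring); apply Cmod_R).
  apply (mean_value (fun z => V z /\ rho z <> 0) (fun w => cd G w / rho w)).
  + intros z [Vz Nz]. destruct (HV z Vz) as (e1 & He1 & K1).
   destruct (hol_cont U rho z Hrho (VU z Vz) (Cmod (rho z))) as (e2 & He2 & K2); [apply Cmod_gt_0; auto|]. exists (Rmin e1 e2).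
   split; [apply Rmin_glb_lt; auto|]. intros w Hw. split; [apply K1, (proj1 (Rmin_Rgt_l _ _ _ Hw))|]. intros E.
   specialize (K2 w (proj2 (Rmin_Rgt_l _ _ _ Hw))). rewrite E in K2. replace (0 - rho z) with (- rho z) in K2 by ring. rewrite Cmod_opp in K2. lra.
  + apply hol_div; [apply (hol_sub _ V); [tauto|apply hol_cd; auto]|apply (hol_sub _ U); auto; intros z [Vz _]; auto|intros z [_ Nz]; auto].
  + intros t Ht.
   replace ((s', b) + RtoC t * ((s, b) - (s', b))) with ((s' + t * (s - s'))%R, b) by (unfold RtoC, Cplus, Cminus, Copp, Cmult; simpl; f_equal; ring).
   assert (I : - a + eta <= s' + t * (s - s') <= a - eta) by nra. set (v := (s' + t * (s - s'))%R) in *. destruct (dR v ltac:(lra)) as [P1 P2].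
   split; [split; [apply cV; lra|intros E; rewrite E, Cmod_0 in P2; lra]|]. destruct (classic (v <= - a + r1 \/ a - r1 <= v)) as [Nv|Nv].
   * destruct (Gnear v ltac:(lra) Nv) as [G1 G2]. apply Rle_trans with A1; [|lra].
    eapply Rle_trans; [apply (QR (Q1 * qn) (kap * eta ^ k) v I)%R; [apply Rmult_lt_0_compat; [lra|apply pow_lt; auto]|apply Klow; lra|left; apply Rmult_lt_0_compat; auto|auto|auto]|].
    (* The smallness of the product of entries pays for the division by the square of the
       density. *)
    -- assert (X : qn <= eta ^ k * eta ^ k).
     { rewrite !etak. unfold qn. rewrite <- exp_plus. apply exp_le. assert (LN0 : 0 <= LN) by (unfold L0 in HLN; lra).
      assert ((4 * (eps * INR k)) * LN <= (1 - 2 * eps) * LN) by (apply Rmult_le_compat_r; lra). lra. }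
     assert (Ek : 0 < eta ^ k) by (apply pow_lt; auto). unfold A1.
     replace (K3 * Q1 / (kap * kap))%R with (K3 * Q1 * (eta ^ k * eta ^ k) / (kap * eta ^ k * (kap * eta ^ k)))%R by (field; lra). unfold Rdiv.
     apply Rmult_le_compat_r; [left; apply Rinv_0_lt_compat; apply Rmult_lt_0_compat; apply Rmult_lt_0_compat; lra|]. rewrite Rmult_assoc.
     apply Rmult_le_compat_l; [lra|]. apply Rmult_le_compat_l; lra.
   (* At distance r1 from the ends the density is at least the constant [Rm], and the bound 1 for
      the entries suffices. *)
   * destruct (Gmid v ltac:(lra)) as [G1 G2]. apply Rle_trans with A2; [|lra]. apply (QR Qm Rm v I); [auto|apply Klow; lra|lra|auto|auto].
 - right. replace (8 * (8 * (Q1 * qn) / d) * eta)%R with (8 * (8 * Q1 / d) * (qn * eta))%R by (field; lra). rewrite qeta. reflexivity.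
Qed.

End Main.

(** * The condensate *)

Lemma holomorphic_hol D f : holomorphic_on D f -> hol D f.
Proof. intros H z Hz. destruct (H z Hz) as [l Hl]. exists l. apply is_derive_cder, Hl. Qed.

Lemma csum_conj f n : Cconj (csum f n) = csum (fun i => Cconj (f i)) n.
Proof. induction n as [|n IH]; simpl; [apply Cconj_R|]. rewrite Cplus_conj, IH. reflexivity. Qed.

Lemma Cinv_conj_all (z : C) : Cconj (/ z) = / Cconj z.
Proof. destruct z as [x y]. unfold Cinv, Cconj; simpl. replace (- y * (- y * 1))%R with (y * (y * 1))%R by ring. f_equal. lra. Qed.

Lemma CI_conj f u v : u <= v -> rcont_on f u v -> CI (fun s => Cconj (f s)) u v = Cconj (CI f u v).
Proof.
 intros Huv H. rewrite (CI_pair f) by auto. apply is_CI_Re_Im.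
 - apply (RInt_correct (V := R_CompleteNormedModule) (fun s => Re (f s))), (ex_RInt_continuous (V := R_CompleteNormedModule)). intros s Hs.
  rewrite Rmin_left, Rmax_right in Hs by auto. apply rcont_Re, H; auto.
 - apply (is_RInt_opp (V := R_NormedModule) (fun s => Im (f s))).
  apply (RInt_correct (V := R_CompleteNormedModule)), (ex_RInt_continuous (V := R_CompleteNormedModule)). intros s Hs.
  rewrite Rmin_left, Rmax_right in Hs by auto. apply rcont_Im, H; auto.
Qed.

Lemma CI_flip f a : 0 <= a -> rcont_on f (- a) a -> CI (fun s => f (- s)%R) (- a) a = CI f (- a) a.
Proof.
 intros Ha H. apply CI_unique. assert (K : is_RInt (V := C_R_NormedModule) f (- - a) (- a) (opp (CI f (- a) a))).
 { rewrite Ropp_involutive. apply (is_RInt_swap (V := C_R_NormedModule)). apply CI_is; auto; lra. }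
 apply (is_RInt_comp_opp (V := C_R_NormedModule)) in K. apply (is_RInt_opp (V := C_R_NormedModule)) in K.
 change (is_RInt (V := C_R_NormedModule) (fun y => - - f (- y)%R) (- a) a (- - CI f (- a) a)) in K.
 replace (- - CI f (- a) a) with (CI f (- a) a) in K by ring. revert K. apply is_RInt_ext. intros s _. change (- - f (- s)%R = f (- s)%R :> C). ring.
Qed.

Lemma compact_plane_bounded (K : R * R -> Prop) : compact_set (T := prod_UniformSpace R_UniformSpace R_UniformSpace) K ->
  exists T0, 1 <= T0 /\ forall x t, K (x, t) -> (Rabs x <= T0 /\ Rabs t <= T0).
Proof.
 intros HK. destruct (HK nat (fun n p => Rabs (fst p) < INR n /\ Rabs (snd p) < INR n)%R) as (l & Hl).
 - intros n [x t] [Hx Ht]. simpl in *. destruct (pos_min4 (INR n - Rabs x) (INR n - Rabs t) 1 1) as (e & He & M1 & M2 & _); [lra..|].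
  exists (mkposreal e He). intros [x' t'] [B1 B2]. simpl in *. change (Rabs (x' - x) < e) in B1. change (Rabs (t' - t) < e) in B2.
  assert (T1 := Rabs_triang_inv x' x). assert (T2 := Rabs_triang_inv t' t). lra.
 - intros [x t] _. simpl. destruct (nfloor_ex (Rabs x + Rabs t)) as (n & Hn); [assert (P1 := Rabs_pos x); assert (P2 := Rabs_pos t); lra|].
  exists (S n). rewrite S_INR. assert (P1 := Rabs_pos x); assert (P2 := Rabs_pos t). lra.
 - exists (1 + fold_right (fun n s => INR n + s)%R 0%R l)%R.
  assert (Q : forall n, In n l -> (INR n <= fold_right (fun n s => INR n + s)%R 0%R l)%R /\ (0 <= fold_right (fun n s => INR n + s)%R 0%R l)%R).
  { clear. induction l as [|m l IH]; intros n; [intros []|]. simpl. assert (P : (0 <= fold_right (fun n s => INR n + s)%R 0%R l)%R).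
   { clear. induction l as [|m l IH]; simpl; [lra|]. assert (Q := pos_INR m). lra. }
   assert (Pm := pos_INR m). intros [->|I]; [lra|]. destruct (IH n I). lra. }
  assert (P : (0 <= fold_right (fun n s => INR n + s)%R 0%R l)%R) by (clear; induction l as [|m l IH]; simpl; [lra|assert (Q := pos_INR m); lra]).
  split; [lra|]. intros x t Kx. destruct (Hl (x, t) Kx) as (n & In' & B1 & B2). simpl in *. destruct (Q n In'). lra.
Qed.

Definition phase (x t : R) (z : C) : C := Cexp (2 * Ci * theta z x t).

Lemma phase_hol x t : hol (fun _ => True) (phase x t).
Proof. apply hol_Cexp, hol_mult; [apply hol_const|]. apply hol_plus; apply hol_mult; try apply hol_const; [apply hol_id|apply hol_mult; apply hol_id]. Qed.

Lemma phase_bounds r T0 x t z : 0 < r -> Rabs x <= T0 -> Rabs t <= T0 -> Cmod z <= 2 * r ->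
  (exp (- (2 * (2 * r * T0 + 4 * r * r * T0))) <= Cmod (phase x t z) <= / exp (- (2 * (2 * r * T0 + 4 * r * r * T0)))).
Proof.
 intros Hr Hx Ht Hz. unfold phase. rewrite Cmod_Cexp, exp_Ropp, Rinv_inv, <- exp_Ropp.
 assert (B : Cmod (2 * Ci * theta z x t) <= 2 * (2 * r * T0 + 4 * r * r * T0)).
 { rewrite !Cmod_mult, Cmod_R, Cmod_Ci, (Rabs_pos_eq 2), Rmult_1_r by lra. apply Rmult_le_compat_l; [lra|]. eapply Rle_trans; [apply Cmod_triangle|].
  rewrite !Cmod_mult, !Cmod_R. pose proof (Cmod_ge_0 z). assert (P2 := Rabs_pos t). apply Rplus_le_compat; [nra|]. apply Rmult_le_compat; auto; [nra|].
  nra. }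
 assert (A := Rabs_Re_le (2 * Ci * theta z x t)). assert (A1 := Rle_abs (Re (2 * Ci * theta z x t))).
 assert (A2 := Rle_abs (- Re (2 * Ci * theta z x t))). rewrite Rabs_Ropp in A2. split; apply exp_le; lra.
Qed.

Lemma phase_conj x t z : Cexp (- (2 * Ci * theta (Cconj z) x t)) = Cconj (phase x t z).
Proof. unfold phase. rewrite <- Cexp_conj. f_equal. unfold Ci, Cconj, Cmult, Cplus, Copp, RtoC; simpl. f_equal; ring. Qed.

Lemma RHP_solution_ext G1 G2 J1 J2 J1' J2' A : (forall z, G1 z -> J1 z = J1' z) -> (forall z, G2 z -> J2 z = J2' z) ->
  RHP_solution G1 G2 J1 J2 A -> RHP_solution G1 G2 J1' J2' A.
Proof.
 intros E1 E2 (H1 & H2 & H3 & H4). split; [auto|]. split; [auto|]. split; intros z Gz.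
 - rewrite <- E1 by auto. apply H3, Gz.
 - rewrite <- E2 by auto. apply H4, Gz.
Qed.

Lemma potential_vanish G q A (psi : C) : contour G -> (forall z, ~ G z -> ~ Gconj G z -> q z = entry (A z) 0 1) ->
  filterlim (fun z : C => 2 * Ci * z * entry (A z) 0 1) C_infty (locally (T := C_UniformSpace) psi) ->
  vanishes_at_infty (fun z => 2 * Ci * z * q z - psi).
Proof.
 intros HG Eq HL e He. destruct (ct_far2 G HG) as (R0 & HR0). assert (L : locally (T := C_UniformSpace) psi (fun w => (Cmod (w - psi)%C < e))).
 { exact (proj2 (locally_C psi (fun w => (Cmod (w - psi)%C < e))) (ex_intro _ e (conj He (fun w Hw => Hw)))). }
 destruct (HL _ L) as (R1 & HR1). exists (Rmax R0 R1). intros z Hz. assert (Z0 := Rle_lt_trans _ _ _ (Rmax_l R0 R1) Hz).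
 assert (Z1 := Rle_lt_trans _ _ _ (Rmax_r R0 R1) Hz). destruct (HR0 z Z0) as [[N1 _] [N2 _]]. rewrite Eq by auto. left. auto.
Qed.

(** * The two Riemann-Hilbert problems of the condensate *)

Section Final.

Variables (a b : R) (U : C -> Prop) (rho h : C -> C) (lambda c : nat -> nat -> C) (gamma1 : R -> C).
Hypothesis H : condensate_data a b U rho h lambda c gamma1.

Let r := Cmod (vertexA a b).
Let G := curve_image gamma1.
Let Ha := cd_a _ _ _ _ _ _ _ _ H.
Let Hb := cd_b _ _ _ _ _ _ _ _ H.

Lemma f_Hrr : (r * r = a * a + b * b)%R.
Proof. unfold r. rewrite Cmod_sqr. reflexivity. Qed.

Lemma f_Hr : 0 < r.
Proof. assert (P := Cmod_ge_0 (vertexA a b)). assert (E := f_Hrr). fold r in P. nra. Qed.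

Lemma f_HU : openC U.
Proof. apply open_openC, (cd_U_open _ _ _ _ _ _ _ _ H). Qed.

Lemma f_cap z : cap b r z -> U z.
Proof. apply (cd_U_nbhd _ _ _ _ _ _ _ _ H). Qed.

Lemma f_rho : hol U rho.
Proof. apply holomorphic_hol, (cd_rho_an _ _ _ _ _ _ _ _ H). Qed.

Lemma f_h : hol U h.
Proof. apply holomorphic_hol, (cd_h_an _ _ _ _ _ _ _ _ H). Qed.

Lemma f_int : CI (fun s => rho (s, b)) (- a) a = 1.
Proof. exact (cd_rho_int _ _ _ _ _ _ _ _ H). Qed.

Lemma f_chordU s : - a <= s <= a -> U (s, b).
Proof. intros Hs. apply f_cap, (chord_cap a b r f_Hr f_Hrr s Hs). Qed.

Lemma f_eta s : - a <= s <= a -> eta1 a b (s, b).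
Proof. intros Hs. apply eta1_iff; auto. Qed.

Lemma f_h0 : h (0%R, b) <> 0.
Proof. apply (cd_h_nz _ _ _ _ _ _ _ _ H). left. apply f_eta. lra. Qed.

Lemma f_contour : contour G.
Proof. apply curve_contour; [apply (cd_gamma_curve _ _ _ _ _ _ _ _ H)|apply (cd_gamma_upper _ _ _ _ _ _ _ _ H)]. Qed.

Lemma f_inside z : eta1 a b z -> interior_of G z.
Proof. apply (cd_gamma_encircles _ _ _ _ _ _ _ _ H). Qed.

Lemma f_off z : G z -> ~ eta1 a b z.
Proof. intros Gz E. apply (f_inside z E), Gz. Qed.

(** Nodes are counted from 0 and eigenvalues from 1, whence 2 i + 1 instead of 2 j - 1 in
    [quantiles]. *)
Definition nodes (N i : nat) : R := Re (lambda N (S i)).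

Lemma f_nodes N i : (i < N)%nat -> lambda N (S i) = (nodes N i, b) /\ - a <= nodes N i <= a.
Proof.
 intros Hi. destruct (cd_lambda_seg _ _ _ _ _ _ _ _ H N (S i) ltac:(lia)) as [E I]. rewrite eta1_iff in E by auto. split; [|apply E]. unfold nodes.
 rewrite <- I. destruct (lambda N (S i)); reflexivity.
Qed.

Lemma f_quantiles N : quantiles a b rho N (nodes N).
Proof.
 intros i Hi. destruct (f_nodes N i Hi) as [E B]. assert (Q := cd_lambda_quantile _ _ _ _ _ _ _ _ H N (S i) ltac:(lia)).
 change (CI (fun s => rho (s, b)) (- a) (nodes N i) = RtoC ((2 * INR (S i) - 1) / (2 * INR N))) in Q.
 rewrite (cumul_CI a b rho U) in Q; [|auto|apply f_rho|apply f_chordU|apply (cd_rho_pos _ _ _ _ _ _ _ _ H)|auto]. apply RtoC_inj in Q.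
 rewrite Q, S_INR. lra.
Qed.

Definition uN (N : nat) (x t : R) (z : C) : C := csum (fun i => h (nodes N i, b) * phase x t (nodes N i, b) / (z - (nodes N i, b))) N.
(** The chord is run through from left to right with the kernel 1 / (z - s). Relative to the
    integral over eta1 both the orientation and the sign of the kernel are reversed, and the two
    changes cancel. *)
Definition uS (N : nat) (x t : R) (z : C) : C := CI (fun s => RtoC (INR N) * (h (s, b) * rho (s, b) * phase x t (s, b)) / (z - (s, b))) (- a) a.

Lemma JN1_uN N x t : JN1 lambda c N x t = fun z => lower_unipotent (uN N x t z).
Proof.
 apply functional_extensionality. intros z. unfold JN1. f_equal. rewrite sum_n_m_csum. apply csum_ext. intros i Hi. destruct (f_nodes N i Hi) as [E _].
 rewrite (cd_c _ _ _ _ _ _ _ _ H) by lia. rewrite E. unfold phase, Cdiv. ring.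
Qed.

Lemma JN2_uN N x t : JN2 lambda c N x t = fun z => upper_unipotent (- Cconj (uN N x t (Cconj z))).
Proof.
 apply functional_extensionality. intros z. unfold JN2. f_equal. f_equal. rewrite sum_n_m_csum. unfold uN. rewrite csum_conj. apply csum_ext.
 intros i Hi. destruct (f_nodes N i Hi) as [E _]. rewrite (cd_c _ _ _ _ _ _ _ _ H) by lia. rewrite phase_conj, E. unfold Cdiv.
 rewrite !Cmult_conj, Cinv_conj_all, Cminus_conj, Cconj_conj. ring.
Qed.

Lemma weight_rcont x t : rcont_on (fun s => h (s, b) * rho (s, b) * phase x t (s, b)) (- a) a.
Proof.
 intros s Hs. apply (rcont_comp (fun z => h z * rho z * phase x t z) (fun s => (s, b))); [apply rcont_pt|].
 apply (hol_cont U); [|apply f_chordU; auto].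
 apply hol_mult; [apply hol_mult; [apply f_h|apply f_rho]|apply (hol_sub _ (fun _ => True)); [auto|apply phase_hol]].
Qed.

Lemma kernel_rcont x t z : ~ eta1 a b z -> rcont_on (fun s => h (s, b) * rho (s, b) * phase x t (s, b) / ((s, b) - z)) (- a) a.
Proof.
 intros N.
 apply (kerint_rcont (fun s => h (s, b) * rho (s, b) * phase x t (s, b)) (fun s => (s, b))); [apply weight_rcont|intros s _; apply rcont_pt|].
 intros s Hs. apply (neq_eta1 a); auto.
Qed.

Lemma uS_kernel N x t z : ~ eta1 a b z -> uS N x t z = - (INR N * CI (fun s => h (s, b) * rho (s, b) * phase x t (s, b) / ((s, b) - z)) (- a) a).
Proof.
 intros Nz.
 replace (- (INR N * CI (fun s => h (s, b) * rho (s, b) * phase x t (s, b) / ((s, b) - z)) (- a) a)) with ((- INR N) * CI (fun s => h (s, b) * rho (s, b) * phase x t (s, b) / ((s, b) - z)) (- a) a) by ring.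
 rewrite <- CI_scal; [|lra|apply kernel_rcont; auto]. apply CI_ext; [lra|]. intros s Hs.
 assert (N1 : (s, b) - z <> 0) by (apply csub_neq, (neq_eta1 a); auto; lra). replace (z - (s, b)) with (- ((s, b) - z)) by ring. field. auto.
Qed.

Lemma JSG1_uS N x t z : G z -> JSG1 a b rho h N x t z = lower_unipotent (uS N x t z).
Proof.
 intros Gz. assert (Nz := f_off z Gz). unfold JSG1. f_equal. rewrite uS_kernel by auto.
 replace (- (INR N * CI (fun s => h (s, b) * rho (s, b) * phase x t (s, b) / ((s, b) - z)) (- a) a)) with (INR N * (- CI (fun s => h (s, b) * rho (s, b) * phase x t (s, b) / ((s, b) - z)) (- a) a)) by ring.
 f_equal. set (k := fun s : R => h (s, b) * rho (s, b) * phase x t (s, b) / ((s, b) - z)).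
 assert (Ck : rcont_on k (- a) a) by (apply kernel_rcont; auto). rewrite <- (CI_flip k) by (auto; lra).
 assert (Ck2 : rcont_on (fun s => k (- s)%R) (- a) a).
 { intros s Hs e He. destruct (Ck (- s)%R ltac:(lra) e He) as (d & Hd & K). exists d; split; auto. intros v Hv. apply K.
  replace (- v - - s)%R with (- (v - s))%R by ring. rewrite Rabs_Ropp. auto. }
 assert (L := CI_lin (fun s => - k (- s)%R) (2 * a) (- a) 0 1 ltac:(lra) ltac:(lra)). replace (2 * a * 0 + - a)%R with (- a)%R in L by ring.
 replace (2 * a * 1 + - a)%R with a in L by ring. assert (L2 := L (fun s Hs => rcont_opp _ _ (Ck2 s Hs))).
 replace (- CI (fun s => k (- s)%R) (- a) a) with (CI (fun s => - k (- s)%R) (- a) a).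
 - rewrite <- L2. apply CI_ext; [lra|]. intros s Hs. unfold k.
  replace (segment_path (vertexA a b) (- Cconj (vertexA a b)) s) with ((- (2 * a * s + - a))%R, b) by (apply injective_projections; unfold segment_path, vertexA; simpl; ring).
  replace (- Cconj (vertexA a b) - vertexA a b) with (- RtoC (2 * a)) by (apply injective_projections; unfold vertexA; simpl; ring). unfold phase.
  ring.
 - replace (- CI (fun s => k (- s)%R) (- a) a) with (- (1) * CI (fun s => k (- s)%R) (- a) a) by ring. rewrite <- CI_scal by (auto; lra).
  apply CI_ext; [lra|]. intros s _. ring.
Qed.

(** eta2 is the conjugate of the chord, run through from left to right, and h and rho are symmetric,
    so the entry is the conjugate of a chord integral at conj z. *)
Lemma JSG2_uS N x t z : Gconj G z -> JSG2 a b rho h N x t z = upper_unipotent (- Cconj (uS N x t (Cconj z))).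
Proof.
 intros Gz. assert (Nz := f_off _ Gz). unfold JSG2. f_equal. rewrite uS_kernel by auto. rewrite Copp_conj, Cmult_conj, Cconj_R.
 replace (- - (INR N * Cconj (CI (fun s => h (s, b) * rho (s, b) * phase x t (s, b) / ((s, b) - Cconj z)) (- a) a))) with (INR N * Cconj (CI (fun s => h (s, b) * rho (s, b) * phase x t (s, b) / ((s, b) - Cconj z)) (- a) a)) by ring.
 f_equal. assert (Ck := kernel_rcont x t (Cconj z) Nz). rewrite <- CI_conj by (auto; lra).
 set (k := fun s : R => Cconj (h (s, b) * rho (s, b) * phase x t (s, b) / ((s, b) - Cconj z))).
 assert (L := CI_lin k (2 * a) (- a) 0 1 ltac:(lra) ltac:(lra)). replace (2 * a * 0 + - a)%R with (- a)%R in L by ring.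
 replace (2 * a * 1 + - a)%R with a in L by ring. rewrite <- L.
 - apply CI_ext; [lra|]. intros s Hs. unfold k. set (v := (2 * a * s + - a)%R). assert (Uv : U (v, b)) by (apply f_chordU; unfold v; nra).
  replace (segment_path (- vertexA a b) (Cconj (vertexA a b)) s) with (Cconj (v, b)) by (apply injective_projections; unfold v, segment_path, vertexA; simpl; ring).
  replace (Cconj (vertexA a b) - - vertexA a b) with (RtoC (2 * a)) by (apply injective_projections; unfold vertexA; simpl; ring).
  rewrite (cd_h_conj _ _ _ _ _ _ _ _ H), (cd_rho_conj _ _ _ _ _ _ _ _ H), phase_conj by auto. unfold Cdiv.
  rewrite !Cmult_conj, Cinv_conj_all, Cminus_conj, Cconj_conj. ring.
 - intros s Hs e He. destruct (Ck s Hs e He) as (d & Hd & K). exists d; split; auto. intros v Hv. unfold k. rewrite <- Cminus_conj, Cmod_conj. auto.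
Qed.

Lemma uN_hol N x t : hol (fun z => ~ eta1 a b z) (uN N x t).
Proof.
 apply hol_csum. intros i Hi. apply hol_div; [apply hol_const|apply hol_minus; [apply hol_id|apply hol_const]|]. intros z Nz. apply csub_neq. intros E.
 apply Nz. rewrite E. apply f_eta, f_nodes, Hi.
Qed.

Lemma uS_hol N x t : hol (fun z => ~ eta1 a b z) (uS N x t).
Proof.
 apply (cauchy_integral_hol a b (fun s => RtoC (INR N) * (h (s, b) * rho (s, b) * phase x t (s, b)))); auto. intros s Hs.
 apply rcont_scal, weight_rcont, Hs.
Qed.

Lemma real_exterior (x : R) : exterior_of G (RtoC x) /\ ~ Gconj G (RtoC x).
Proof. split; [apply (ct_low G f_contour)|apply (ct_closed_UHP G f_contour)]; simpl; lra. Qed.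

Lemma off_conj_UHP z : UHP z -> ~ Gconj G z.
Proof. unfold UHP. intros Hz. apply (ct_closed_UHP G f_contour). lra. Qed.

Lemma cauchy_uN N x t Y : hol (fun z => ~ Gconj G z) Y -> cauchy_fun (eta1 a b) (uN N x t) Y
  (fun z => csum (fun i => h (nodes N i, b) * phase x t (nodes N i, b) * Y (nodes N i, b) / (z - (nodes N i, b))) N)
  (csum (fun i => h (nodes N i, b) * phase x t (nodes N i, b) * Y (nodes N i, b)) N).
Proof.
 intros HY.
 apply (cauchy_fun_sum (eta1 a b) (fun z => ~ Gconj G z) (fun i => h (nodes N i, b) * phase x t (nodes N i, b)) (fun i => (nodes N i, b))); auto.
 - apply (ct_openc G f_contour).
 - apply off_conj_UHP.
 - intros i Hi. split; [apply f_eta, f_nodes, Hi|auto].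
Qed.

Lemma cauchy_uS N x t Y : hol (fun z => ~ Gconj G z) Y -> (forall z, UHP z -> Cmod (Y z) <= 1) -> cauchy_fun (eta1 a b) (uS N x t) Y
  (fun z => CI (fun s => RtoC (INR N) * (h (s, b) * rho (s, b) * phase x t (s, b)) * Y (s, b) / (z - (s, b))) (- a) a)
  (CI (fun s => RtoC (INR N) * (h (s, b) * rho (s, b) * phase x t (s, b)) * Y (s, b)) (- a) a).
Proof.
 intros HY B. apply (cauchy_fun_integral a b (fun z => ~ Gconj G z) (fun s => RtoC (INR N) * (h (s, b) * rho (s, b) * phase x t (s, b))) Y 1); auto.
 - apply (ct_openc G f_contour).
 - apply off_conj_UHP.
 - intros s Hs. apply rcont_scal, weight_rcont, Hs.
Qed.

Lemma chord_weight_rcont x t Y z : hol UHP Y -> ~ eta1 a b z -> rcont_on (fun s => h (s, b) * rho (s, b) * phase x t (s, b) * Y (s, b) / (z - (s, b))) (- a) a.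
Proof.
 intros HY Nz s Hs. apply rcont_mult; [apply rcont_mult; [apply weight_rcont; auto|]|].
 - apply (rcont_comp Y (fun s => (s, b))); [apply rcont_pt|]. apply (hol_cont UHP); auto.
 - apply rcont_inv; [apply rcont_minus; [apply rcont_const|apply rcont_pt]|]. intros E. apply (neq_eta1 a b z s Ha Nz Hs).
  assert (Q : forall p, z - p = 0 -> p = z) by (intros p Ep; replace p with (z - (z - p)) by ring; rewrite Ep; ring). apply Q, E.
Qed.

Lemma chint_scal N x t Y z : hol UHP Y -> ~ eta1 a b z ->
  CI (fun s => RtoC (INR N) * (h (s, b) * rho (s, b) * phase x t (s, b)) * Y (s, b) / (z - (s, b))) (- a) a = RtoC (INR N) * chint a b (fun z => h z * rho z * phase x t z * Y z) z.
Proof. intros HY Nz. unfold chint. rewrite <- CI_scal; [|lra|apply chord_weight_rcont; auto]. apply CI_ext; [lra|]. intros s _. unfold Cdiv. ring. Qed.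

Lemma real_off_eta (x : R) : ~ eta1 a b (RtoC x).
Proof. rewrite eta1_iff by auto. intros [E _]. unfold Im, RtoC in E; simpl in E. lra. Qed.

(** The real line lies outside both curves, where CY = X - X0 by [representation]. *)
Lemma X_real_bound X Y X0 u CY m (x : R) : Cmod X0 <= 1 -> pair_sol G u X Y X0 -> (forall z, Im z = 0%R -> Cmod (X z) <= 1) -> cauchy_fun (eta1 a b) u Y CY m -> Cmod (CY (RtoC x)) <= 2.
Proof.
 intros HX0 HP HX HC. destruct (real_exterior x) as [E1 E2].
 assert (Q := representation G f_contour (eta1 a b) f_inside (eta1_closed a b Ha) u X Y X0 CY m HP HC (RtoC x) E1 E2).
 replace (CY (RtoC x)) with (X (RtoC x) - X0) by (rewrite Q; ring). eapply Rle_trans; [apply Cmod_triangle|]. rewrite Cmod_opp.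
 assert (B := HX (RtoC x) eq_refl). lra.
Qed.

(** In the continuous problem N times the chord integral is the transform CY itself, bounded by 2.
    In the discrete one it differs from CY by a midpoint error, bounded by [quad_crude] because the
    kernel at a real point is smooth near the chord; M0 adds the two bounds. *)
Lemma pair_small N x t X Y X0 M0 d M e0 : (0 < N)%nat -> 0 < e0 -> 0 < d -> 1 <= M ->
  (forall s z, - a <= s <= a -> Cmod (z - (s, b)) < 2 * d -> U z /\ b / 2 <= Im z /\ Cmod z <= 2 * r /\ Cmod (h z) <= M /\ Cmod (rho z) <= M) ->
  (forall z, Cmod z <= 2 * r -> e0 <= Cmod (phase x t z) <= / e0) -> (M0 = 2 + 4 * a * (8 * (M * / e0 * / (b / 2)) / d))%R ->
  (Cmod X0 <= 1) -> (pair_sol G (uN N x t) X Y X0 \/ pair_sol G (uS N x t) X Y X0) -> (forall z, Im z = 0%R -> Cmod (X z) <= 1) -> (forall z, UHP z -> Cmod (Y z) <= 1) ->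
  small_fun a b rho h (phase x t) Y (M0 / INR N).
Proof.
 intros HN He0 Hd HM Tube BE EM HX0 HP HX HY. assert (PN : 0 < INR N) by (apply lt_0_INR; auto).
 assert (HYG : hol (fun z => ~ Gconj G z) Y) by (destruct HP as [HP|HP]; apply (ps_Y HP)).
 assert (HYU : hol UHP Y) by (apply (hol_sub _ _ _ off_conj_UHP HYG)). assert (Hi0 : 0 < / e0) by (apply Rinv_0_lt_compat; auto).
 assert (Hib : 0 < / (b/2)) by (apply Rinv_0_lt_compat; lra). set (Q := (M * / e0 * / (b / 2))%R) in *.
 assert (PQ : 0 < Q) by (unfold Q; apply Rmult_lt_0_compat; [nra|auto]).
 assert (PM : 0 <= 4 * a * (8 * Q / d)) by (apply Rmult_le_pos; [lra|apply Rdiv_le_0_compat; lra]). split; [auto|split; [auto|]]. intros y.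
 assert (key : (Cmod (RtoC (INR N) * chint a b (fun z => h z * rho z * phase x t z * Y z) (RtoC y))%C <= M0)%R).
 { destruct HP as [HP|HP].
  - assert (C1 := cauchy_uN N x t Y HYG). assert (XB := X_real_bound X Y X0 _ _ _ y HX0 HP HX C1). set (V := fun z => U z /\ UHP z).
   set (G0 := fun z => h z * phase x t z * Y z / (RtoC y - z)).
   assert (ny : forall z, UHP z -> RtoC y - z <> 0) by (intros z Hz E; apply (f_equal Im) in E; unfold UHP, Im, RtoC, Cminus, Cplus, Copp in *; simpl in *; lra).
   assert (HG0 : hol V G0).
   { apply hol_div; [apply hol_mult; [apply hol_mult|]|apply hol_minus; [apply hol_const|apply hol_id]|intros z Hz; apply ny, Hz].
    - apply (hol_sub V U); [intros z Hz; apply Hz|apply f_h].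
    - apply (hol_sub V (fun _ => True)); [auto|apply phase_hol].
    - apply (hol_sub V UHP); [intros z Hz; apply Hz|auto]. }
   assert (QC := quad_crude a b rho U Ha f_HU f_rho f_chordU (cd_rho_pos _ _ _ _ _ _ _ _ H) f_int N (nodes N) V G0 HN (f_quantiles N) HG0).
   specialize (QC ltac:(intros s Hs; split; [apply f_chordU; auto|auto]) (8 * Q / d)%R).
   assert (QB : Cmod (quad_error a b rho N (nodes N) G0) <= 4 * a * (8 * Q / d)).
   { apply QC. intros s Hs. apply (cauchy_est V); auto. intros w Hw. destruct (Tube s w Hs ltac:(lra)) as (T1 & T2 & T3 & T4 & T5).
    assert (Uw : UHP w) by (unfold UHP; lra). split; [split; auto|]. unfold G0. rewrite Cmod_div, !Cmod_mult by auto.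
    assert (I := Rabs_Im_le (RtoC y - w)). assert (I2 := Rle_abs (- Im (RtoC y - w))). rewrite Rabs_Ropp in I2.
    replace (- Im (RtoC y - w))%R with (Im w) in I2 by (unfold Im, RtoC, Cminus, Cplus, Copp; simpl; ring). destruct (BE w T3) as [_ E2].
    apply Rmult_le_compat.
    - apply Rmult_le_pos; [apply Rmult_le_pos|]; apply Cmod_ge_0.
    - left. apply Rinv_0_lt_compat. lra.
    - rewrite <- (Rmult_1_r (M * / e0)). apply Rmult_le_compat; auto using Cmod_ge_0; [apply Rmult_le_pos; apply Cmod_ge_0|].
     apply Rmult_le_compat; auto using Cmod_ge_0.
    - apply Rinv_le_contravar; lra. }
   assert (EQ : RtoC (INR N) * chint a b (fun z => h z * rho z * phase x t z * Y z) (RtoC y) = csum (fun i => h (nodes N i, b) * phase x t (nodes N i, b) * Y (nodes N i, b) / (RtoC y - (nodes N i, b))) N - quad_error a b rho N (nodes N) G0).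
   { unfold quad_error, chint.
    rewrite (CI_ext (fun s => rho (s, b) * G0 (s, b)) (fun s => h (s, b) * rho (s, b) * phase x t (s, b) * Y (s, b) / (RtoC y - (s, b)))); [unfold G0; ring|lra|].
    intros s _. unfold G0, Cdiv. ring. }
   rewrite EQ. refine (Rle_trans _ _ _ (Cmod_triangle _ (- quad_error a b rho N (nodes N) G0)) _). rewrite Cmod_opp. lra.
  - assert (C1 := cauchy_uS N x t Y HYG HY). assert (XB := X_real_bound X Y X0 _ _ _ y HX0 HP HX C1). cbv beta in XB.
   rewrite chint_scal in XB; auto; [lra|apply real_off_eta]. }
 rewrite Cmod_mult, Cmod_R, Rabs_pos_eq in key by lra. apply (Rmult_le_reg_l (INR N)); auto. replace (INR N * (M0 / INR N))%R with M0 by (field; lra).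
 exact key.
Qed.

(** The discrete and the continuous transform have the same kernel, and the difference of their
    masses is a midpoint error: here quadrature enters [potential_difference]. *)
Lemma cauchy_difference N x t Y : hol (fun z => ~ Gconj G z) Y -> (forall z, UHP z -> Cmod (Y z) <= 1) ->
  exists CY, cauchy_fun (eta1 a b) (fun z => uN N x t z - uS N x t z) Y CY (quad_error a b rho N (nodes N) (fun z => h z * phase x t z * Y z)).
Proof.
 intros HY B. eexists.
 replace (quad_error a b rho N (nodes N) (fun z => h z * phase x t z * Y z)) with (csum (fun i => h (nodes N i, b) * phase x t (nodes N i, b) * Y (nodes N i, b)) N - CI (fun s => RtoC (INR N) * (h (s, b) * rho (s, b) * phase x t (s, b)) * Y (s, b)) (- a) a).
 - apply cauchy_fun_minus; [apply cauchy_uN; auto|apply cauchy_uS; auto].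
 - unfold quad_error. f_equal. assert (HYU : hol UHP Y) by (apply (hol_sub _ _ _ off_conj_UHP HY)). rewrite <- CI_scal; [|lra|].
  + apply CI_ext; [lra|]. intros s _. ring.
  + intros s Hs. apply rcont_ext with (fun s => h (s, b) * rho (s, b) * phase x t (s, b) * Y (s, b)); [intros v; ring|].
   apply rcont_mult; [apply weight_rcont; auto|]. apply (rcont_comp Y (fun s => (s, b))); [apply rcont_pt|]. apply (hol_cont UHP); auto.
Qed.

Lemma final_estimate T0 : 1 <= T0 -> exists (N0 : nat) (c0 : R), forall (N : nat) (x t : R), (N0 < N)%nat -> (Rabs x <= T0 /\ Rabs t <= T0) ->
  forall psiN psiSG, is_psiN lambda c gamma1 N x t psiN -> is_psiSG a b rho h gamma1 N x t psiSG -> Cmod (psiN - psiSG)%C <= c0 / INR N.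
Proof.
 assert (Hr := f_Hr). set (e0 := exp (- (2 * (2 * r * T0 + 4 * r * r * T0)))). assert (He0 : 0 < e0) by apply exp_pos.
 destruct (tube a b r U rho h Hb Hr f_Hrr f_HU f_cap f_rho f_h 1 ltac:(lra)) as (d & M & Hd & HM & Tube).
 set (M0 := (2 + 4 * a * (8 * (M * / e0 * / (b / 2)) / d))%R). assert (HM0 : 1 <= M0).
 { assert (0 <= 4 * a * (8 * (M * / e0 * / (b / 2)) / d)); [|unfold M0; lra]. apply Rmult_le_pos; [lra|]. apply Rdiv_le_0_compat; [|lra].
  assert (0 < / e0) by (apply Rinv_0_lt_compat; auto). assert (0 < / (b/2)) by (apply Rinv_0_lt_compat; lra). apply Rmult_le_pos; [lra|].
  apply Rmult_le_pos; [nra|lra]. }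
 destruct (quadrature_estimate a b r U rho h Ha Hb Hr f_Hrr f_HU f_cap f_rho f_h (cd_rho_pos _ _ _ _ _ _ _ _ H) f_int f_h0 e0 M0 He0 HM0) as (N0 & Cq & HQ).
 exists N0, (4 * Cq)%R. intros N x t HN [Hx Ht] psiN psiSG (AN & RN & LN) (AS & RS & LS). rewrite conj_curve_image in RN, RS.
 rewrite JN1_uN, JN2_uN in RN.
 (* The jump entry is given by [uS] on the curves, where alone the jump condition is imposed. *)
 assert (RS' := RHP_solution_ext _ _ _ _ (fun z => lower_unipotent (uS N x t z)) (fun z => upper_unipotent (- Cconj (uS N x t (Cconj z)))) AS (JSG1_uS N x t) (JSG2_uS N x t) RS).
 assert (PN : (0 < N)%nat) by lia.
 destruct (rhp_pairs G (uN N x t) (fun z => - Cconj (uN N x t (Cconj z))) AN f_contour) as (p1 & q1 & P1 & P1' & E1); auto.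
 { intros z Gz. apply (hol_cont _ _ _ (uN_hol N x t)), f_off, Gz. }
 { intros z. rewrite Cconj_conj. auto. }
 destruct (rhp_pairs G (uS N x t) (fun z => - Cconj (uS N x t (Cconj z))) AS f_contour) as (p2 & q2 & P2 & P2' & E2); auto.
 { intros z Gz. apply (hol_cont _ _ _ (uS_hol N x t)), f_off, Gz. }
 { intros z. rewrite Cconj_conj. auto. }
 destruct (row_bounds G f_contour _ _ _ P1 P1') as [BR1 BU1]. destruct (row_bounds G f_contour _ _ _ P2 P2') as [BR2 BU2].
 assert (u1 : forall z, UHP z -> (Cmod (q1 z) <= 1 /\ Cmod (star p1 z) <= 1)) by (intros z Hz; apply BU1; unfold UHP in Hz; lra).
 assert (u2 : forall z, UHP z -> (Cmod (q2 z) <= 1 /\ Cmod (star p2 z) <= 1)) by (intros z Hz; apply BU2; unfold UHP in Hz; lra).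
 assert (BE := fun z => phase_bounds r T0 x t z Hr Hx Ht).
 assert (Tube' : forall s z, - a <= s <= a -> Cmod (z - (s, b)) < 2 * d -> U z /\ b / 2 <= Im z /\ Cmod z <= 2 * r /\ Cmod (h z) <= M /\ Cmod (rho z) <= M) by auto.
 assert (c1 : Cmod 1 <= 1) by (rewrite Cmod_1; lra). assert (c0 : Cmod 0 <= 1) by (rewrite Cmod_0; lra).
 (* Both pairs of both problems satisfy [small_fun] with the same M0. *)
 assert (PS := fun X Y X0 => pair_small N x t X Y X0 M0 d M e0 PN He0 (proj1 Hd) HM Tube' BE eq_refl).
 assert (S1 := PS p1 q1 1 c1 (or_introl P1) (fun z Hz => proj1 (BR1 z Hz)) (fun z Hz => proj1 (u1 z Hz))).
 assert (S1' := PS _ (star p1) 0 c0 (or_introl P1') (fun z Hz => proj2 (BR1 z Hz)) (fun z Hz => proj2 (u1 z Hz))).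
 assert (S2 := PS p2 q2 1 c1 (or_intror P2) (fun z Hz => proj1 (BR2 z Hz)) (fun z Hz => proj1 (u2 z Hz))).
 assert (S2' := PS _ (star p2) 0 c0 (or_intror P2') (fun z Hz => proj2 (BR2 z Hz)) (fun z Hz => proj2 (u2 z Hz))).
 assert (prod1 : forall f g : C -> C, (forall z, UHP z -> Cmod (f z) <= 1) -> (forall z, UHP z -> Cmod (g z) <= 1) -> forall z, UHP z -> Cmod (f z * g z) <= 1).
 { intros f g Hf Hg z Hz. rewrite Cmod_mult, <- (Rmult_1_r 1). apply Rmult_le_compat; auto using Cmod_ge_0. }
 destruct (cauchy_difference N x t (fun z => q1 z * q2 z)) as (CY1 & K1).
 { apply hol_mult; [apply (ps_Y P1)|apply (ps_Y P2)]. }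
 { apply prod1; [apply S1|apply S2]. }
 destruct (cauchy_difference N x t (fun z => star p1 z * star p2 z)) as (CY2 & K2).
 { apply hol_mult; [apply (ps_Y P1')|apply (ps_Y P2')]. }
 { apply prod1; [apply S1'|apply S2']. }
 assert (V1 := potential_vanish G q1 AN psiN f_contour E1 LN). assert (V2 := potential_vanish G q2 AS psiSG f_contour E2 LS).
 assert (PD := potential_difference G f_contour (eta1 a b) f_inside (eta1_closed a b Ha) _ _ p1 q1 p2 q2 _ _ _ _ psiN psiSG P1 P1' P2 P2' K1 K2 V1 V2).
 assert (Q1 := HQ N (nodes N) (phase x t) q1 q2 HN (f_quantiles N) (phase_hol x t) BE S1 S2).
 assert (Q2 := HQ N (nodes N) (phase x t) (star p1) (star p2) HN (f_quantiles N) (phase_hol x t) BE S1' S2'). lra.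
Qed.

End Final.

Theorem corollary2p10 :
  forall (a b : R) (U : C -> Prop) (rho h : C -> C)
    (lambda c : nat -> nat -> C) (gamma1 : R -> C),
  condensate_data a b U rho h lambda c gamma1 ->
  forall K : R * R -> Prop,
  compact_set (T := prod_UniformSpace R_UniformSpace R_UniformSpace) K ->
  exists (N0 : nat) (c0 : R),
    forall (N : nat) (x t : R), (N0 < N)%nat -> K (x, t) ->
    forall psiN psiSG : C,
      is_psiN lambda c gamma1 N x t psiN ->
      is_psiSG a b rho h gamma1 N x t psiSG ->
      (Cmod (psiN - psiSG)%C <= c0 / INR N)%R.
Proof.
 (* The compact set enters through a common bound for |x| and |t|, on which the bounds for the phase
    depend. *)
 intros a b U rho h lambda c gamma1 H K HK. destruct (compact_plane_bounded K HK) as (T0 & HT0 & BT).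
 destruct (final_estimate a b U rho h lambda c gamma1 H T0 HT0) as (N0 & c0 & E). exists N0, c0. intros N x t HN Kx. apply E; auto.
Qed.
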